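(* Let $m\ge 1$ be an integer, let $p_1,\ldots,p_m>0$ be real numbers, and let $$\Omega_1=\Big\{z\in\mathbb{C}^m:\ \sum_{j=1}^m |z_j|^{2p_j}<1\Big\}.$$ Let $0<p<\infty$. Then the Bergman module on $\Omega_1$ is $p$-essentially normal if and only if $$p>\begin{cases}\frac12, & m=1,\\ \max\{m,\ p_j(m-1): j=1,\ldots,m\}, & m>1.\end{cases}$$
   Context: A bounded operator $T$ on a Hilbert space is (Schatten) $p$-summable, $0<p<\infty$, if $(TT^* )^{p/2}$ is trace class; equivalently, if its sequence of singular values belongs to $\ell^p$. For a bounded domain $\Omega\subseteq\mathbb{C}^d$, the Bergman space $L^2_a(\Omega)$ is the Hilbert space of holomorphic functions on $\Omega$ that are square-integrable with respect to Lebesgue measure. The Bergman module is $L^2_a(\Omega)$ with polynomials acting by multiplication. For a coordinate function $z_j$, $M_{z_j}:L^2_a(\Omega)\to L^2_a(\Omega)$ denotes multiplication by $z_j$. The Bergman module on $\Omega$ is called $p$-essentially normal if all commutators $[M_{z_j},M_{z_k}^*]=M_{z_j}M_{z_k}^*-M_{z_k}^*M_{z_j}$, $j,k=1,\ldots,d$, are $p$-summable. *)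

(* Defs.v *)
From HB Require Import structures.
From mathcomp Require Import all_boot all_order all_algebra.
From mathcomp Require Import complex.
From mathcomp Require Import all_classical all_reals all_analysis.

Set Implicit Arguments.
Unset Strict Implicit.
Unset Printing Implicit Defensive.
Import Order.TTheory GRing.Theory Num.Theory.
Import numFieldNormedType.Exports.
Local Open Scope classical_set_scope.
Local Open Scope ring_scope.
Local Open Scope complex_scope.

Section sigma_finite_product.
Context d1 d2 (T1 : measurableType d1) (T2 : measurableType d2) (R : realType).
Variables (m1 : {sigma_finite_measure set T1 -> \bar R})
  (m2 : {sigma_finite_measure set T2 -> \bar R}).

(* An alias: the canonical [{sigma_finite_measure ...}] structure on [_ \x _]
   that the library exports is the one for products of subprobabilities. *)
Definition sfprod : set (T1 * T2) -> \bar R := (m1 \x m2)%E.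

HB.instance Definition _ := Measure.copy sfprod (m1 \x m2)%E.

Let sfprod_sigma_finite : sigma_finite setT sfprod.
Proof.
have /sigma_finiteP[F [TF ndF Foo]] := sigma_finiteT m1.
have /sigma_finiteP[G [TG ndG Goo]] := sigma_finiteT m2.
exists (fun n => F n `*` G n).
  rewrite -setXTT TF TG predeqE => -[x y]; split.
    move=> [/= [n _ Fnx] [k _ Gky]]; exists (maxn n k) => //; split.
    - by move: x Fnx; exact/subsetPset/ndF/leq_maxl.
    - by move: y Gky; exact/subsetPset/ndG/leq_maxr.
  by move=> [n _ []/= ? ?]; split; exists n.
move=> k; have [? ?] := Foo k; have [? ?] := Goo k.
split; first exact: measurableX.
by rewrite /sfprod product_measure1E// lte_mul_pinfty// ge0_fin_numE.
Qed.

HB.instance Definition _ := Measure_isSigmaFinite.Build _ _ _ sfprod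
  sfprod_sigma_finite.

End sigma_finite_product.

Section tuple_measure.
Context d (T : measurableType d) (R : realType).

Definition tcons n (x : T * n.-tuple T) : n.+1.-tuple T :=
  [the n.+1.-tuple T of x.1 :: x.2].
Definition tuncons n (x : n.+1.-tuple T) : T * n.-tuple T :=
  (thead x, [tuple of behead x]).

Lemma tconsK n : cancel (@tcons n) (@tuncons n).
Proof. by case=> x t; congr pair => //; apply/val_inj. Qed.

Lemma measurable_tcons n : measurable_fun [set: T * n.-tuple T] (@tcons n).
Proof. exact: (@measurable_cons _ _ _ T fst n snd). Qed.

Lemma measurable_tuncons n :
  measurable_fun [set: n.+1.-tuple T] (@tuncons n).
Proof.
by apply: measurable_fun_pair; [exact: measurable_tnth|exact: measurable_behead].
Qed.

Section tuple_measureS.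
Variables (n : nat) (mu : {sigma_finite_measure set T -> \bar R})
  (nu : {sigma_finite_measure set (n.-tuple T) -> \bar R}).

Definition tuple_measureS : set (n.+1.-tuple T) -> \bar R :=
  pushforward (sfprod mu nu) (@tcons n).

Let tuple_measureS0 : tuple_measureS set0 = 0%E.
Proof. by rewrite /tuple_measureS /pushforward preimage_set0 measure0. Qed.

Let tuple_measureS_ge0 A : (0 <= tuple_measureS A)%E.
Proof. by rewrite /tuple_measureS /pushforward; apply: measure_ge0. Qed.

Let tuple_measureS_sigma_additive : semi_sigma_additive tuple_measureS.
Proof.
exact: (@measure_semi_sigma_additive _ _ _
  (measure_function_pushforward__canonical__measure_function_Measure
    (sfprod mu nu) (@measurable_tcons n))).
Qed.

HB.instance Definition _ := isMeasure.Build _ _ _ tuple_measureS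
  tuple_measureS0 tuple_measureS_ge0 tuple_measureS_sigma_additive.

Let tuple_measureS_sigma_finite : sigma_finite setT tuple_measureS.
Proof.
have [F FT Ffin] := sigma_finiteT [the {sigma_finite_measure set _ -> \bar R} of sfprod mu nu].
exists (fun i => @tuncons n @^-1` F i).
  by rewrite -preimage_bigcup -FT preimage_setT.
move=> i; have [mF Foo] := Ffin i; split.
  by rewrite -[X in measurable X]setTI; exact: measurable_tuncons.
rewrite /tuple_measureS /pushforward -comp_preimage.
by rewrite (_ : _ \o _ = id) //; apply/funext => x; exact: tconsK.
Qed.

HB.instance Definition _ := Measure_isSigmaFinite.Build _ _ _ tuple_measureS
  tuple_measureS_sigma_finite.

End tuple_measureS.

(* The n-fold product measure of mu. *)
Fixpoint tuple_measure (mu : {sigma_finite_measure set T -> \bar R}) n :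
    {sigma_finite_measure set (n.-tuple T) -> \bar R} :=
  if n is k.+1 then [the {sigma_finite_measure set _ -> \bar R} of
                      tuple_measureS mu (tuple_measure mu k)]
  else [the {sigma_finite_measure set _ -> \bar R} of \d_[tuple]].

End tuple_measure.

(* [R[i]] packaged as a [numFieldType], so that the topological and normed
   structures on ['rV[R[i]]_m] and [R[i]^o] can be inferred. *)
Definition Cplx (R : realType) : numClosedFieldType := R[i].

(* A Hilbert space is given as a subspace H of an ambient vector space V
   together with an inner product ip (linear in its first argument); operators
   on it are maps V -> V, of which only the restriction to H is relevant. *)
Section operators.
Context (R : realType) (V : lmodType (Cplx R)).
Variables (H : set V) (ip : V -> V -> Cplx R).
Local Notation C := (Cplx R).

Definition hnorm (f : V) : R := Num.sqrt (complex.Re (ip f f)).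

Definition bounded_operator (T : V -> V) : Prop :=
  [/\ (forall f, H f -> H (T f)),
      (forall (c : C) f g, H f -> H g -> T (c *: f + g) = c *: T f + T g) &
      exists M : R, forall f, H f -> hnorm (T f) <= M * hnorm f].

(* T^*; it is total, and 0 where no such vector exists, which by the Riesz
   representation theorem does not occur for bounded T and g in H. *)
Definition adjoint (T : V -> V) (g : V) : V :=
  xget 0 [set h | H h /\ forall f, H f -> ip (T f) g = ip f h].

Definition commutator (S T : V -> V) (f : V) : V := S (T f) - T (S f).

Definition orthonormal_basis (I : choiceType) (e : I -> V) : Prop :=
  [/\ (forall i, H (e i)),
      (forall i j, ip (e i) (e j) = (i == j)%:R) &
      (forall f, H f -> forall eps : R, 0 < eps ->
        exists (r : seq I) (c : I -> C),
          hnorm (f - \sum_(i <- r) c i *: e i) < eps)].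

(* s lists the singular values of T, i.e. the square roots of the eigenvalues
   of T T^*, with multiplicities, 0 included.  The list is indexed by an
   orthonormal eigenbasis rather than by nat in decreasing order; neither the
   order nor the zeros affect membership in l^p.  Such a list exists as soon
   as T T^* is compact. *)
Definition singular_values (I : choiceType) (s : I -> R) (T : V -> V) : Prop :=
  (forall i, 0 <= s i) /\
  exists2 e : I -> V, orthonormal_basis e &
    forall i, T (adjoint T (e i)) = ((s i ^+ 2)%:C : C) *: e i.

Definition summable_operator (p : R) (T : V -> V) : Prop :=
  bounded_operator T /\
  exists (I : choiceType) (s : I -> R),
    singular_values s T /\ (\esum_(i in [set: I]) (s i `^ p)%:E < +oo)%E.

End operators.

Section bergman.
Context (R : realType) (m : nat).
Local Notation C := (Cplx R).
Local Notation plane := (measurableTypeR R * measurableTypeR R)%type.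

(* C^m is identified with (R^2)^m, on which the measure theory takes place. *)
Definition Cpoint (x : m.-tuple plane) : 'rV[C]_m :=
  \row_j (((tnth x j).1 : R) +i* ((tnth x j).2 : R)).

Definition lebesgue_Cm : {sigma_finite_measure set (m.-tuple plane) -> \bar R} :=
  tuple_measure [the {sigma_finite_measure set plane -> \bar R} of
    sfprod (@lebesgue_measure R) (@lebesgue_measure R)] m.

Definition Cintegral (D : set (m.-tuple plane)) (h : m.-tuple plane -> C) : C :=
  (\int[lebesgue_Cm]_(x in D) complex.Re (h x)) +i*
  (\int[lebesgue_Cm]_(x in D) complex.Im (h x)).

(* Functions on Omega are extended by 0 outside Omega.  Differentiability is
   Frechet differentiability over C, i.e. holomorphy on an open Omega. *)
Definition bergman_space (Omega : set 'rV[C]_m) : set ('rV[C]_m -> C^o) :=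
  [set f : 'rV[C]_m -> C^o | [/\ (forall z, Omega z -> differentiable f z),
               (forall z, ~ Omega z -> f z = 0) &
               lebesgue_Cm.-integrable (Cpoint @^-1` Omega)
                 (fun x => (ComplexField.Normc.normc (f (Cpoint x) : C) ^+ 2)%:E)]].

Definition bergman_ip (Omega : set 'rV[C]_m) (f g : 'rV[C]_m -> C^o) : C :=
  Cintegral (Cpoint @^-1` Omega)
    (fun x => (f (Cpoint x) : C) * Num.conj (g (Cpoint x) : C)).

Definition coord_mul (j : 'I_m) (f : 'rV[C]_m -> C^o) : 'rV[C]_m -> C^o :=
  fun z => z 0 j * f z.

Definition essentially_normal (p : R) (Omega : set 'rV[C]_m) : Prop :=
  let H := bergman_space Omega in
  let ip := bergman_ip Omega in
  forall j k : 'I_m,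
    summable_operator H ip p
      (commutator (coord_mul j) (adjoint H ip (coord_mul k))).

Definition ellipsoid (a : 'I_m -> R) : set 'rV[C]_m :=
  [set z : 'rV[C]_m | \sum_(j < m) ComplexField.Normc.normc (z 0 j) `^ (2 * a j) < 1].

End bergman.

(* Main.v *)
(* The monomials z^al are orthogonal with dense span, because averaging over
   rotations of one coordinate isolates homogeneous parts.  With n_j = al_j + 1,
   b_j = 1/p_j and T = sum_j n_j b_j, a Beta integral gives
     ||z^al||^2 = const^m * prod_j (Gamma (n_j b_j + 1) / n_j) / Gamma (T + 1).
   Hence M_j is a weighted shift on an orthonormal basis, and [M_j, M_k^*] maps
   basis vectors to multiples of distinct basis vectors.  The multiples are its
   singular values; logarithmic convexity of Gamma bounds them by
   C n_j^(b_j - 1) T^(- b_j) for j = k and by C / T otherwise.  The p-th powers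
   of these bounds are dominated by prod_j n_j^(-(1 + d)) for some d > 0 exactly
   in the stated range (for m = 1 the diagonal entry is 1/(n (n + 1))).
   Conversely, dyadic boxes where all n_j are comparable to N contribute
   N^(m - p), and those of the face n_j = 1 contribute N^(m - 1 - p b_j), which
   forces p > m and p > p_j (m - 1). *)

Require Import Defs.
From HB Require Import structures.
From mathcomp Require Import all_boot all_order all_algebra.
From mathcomp Require Import complex ring lra.
From mathcomp Require Import all_classical all_reals all_analysis.
From mathcomp Require Import measurable_realfun zify.
Set Implicit Arguments.
Unset Strict Implicit.
Unset Printing Implicit Defensive.
Import Order.TTheory GRing.Theory Num.Theory.
Import numFieldNormedType.Exports.
Local Open Scope classical_set_scope.
Local Open Scope ring_scope.
Local Open Scope complex_scope.

(** * Measure-preserving maps *)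

Section measure_preserving.
Local Open Scope ereal_scope.

(** The eigenvalues of the diagonal commutators are differences of nearly equal weights, so bounds
    for G(T+b)/G(T), with G(s) = Gamma(s+1), are not enough. Factoring out one weight leaves a
    difference of two second ratios G(T+b)G(T-b)/G(T)^2 = 1 + O(1/T), whose first-order term, of
    size b^2/T, decides the rate. An inequality for such a ratio at T is reduced by the functional
    equation to a one-step inequality along T, T+1, T+2, ... and the limit 1 at infinity. Cauchy's
    theorem is used for circles only: in the coordinate log z an annulus is a strip with a period,
    and Goursat's bisection applies to rectangles as high as this period. Averages over rotations
    are finite averages over roots of unity. These are finite combinations of unitary operators and
    stay in the Bergman space; their limits are pointwise, with norms controlled by Fatou's lemma.
    Summability speaks of some eigenbasis, indexed by any set; for the converse it is compared with
    the monomial basis by Parseval and Bessel. Lower bounds concern the diagonal commutators, which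
    force the whole condition. *)

Definition measure_pres d (T : measurableType d) (R : realType)
    (mu : {measure set T -> \bar R}) (f : T -> T) :=
  measurable_fun setT f /\ forall A, measurable A -> mu (f @^-1` A) = mu A.

Definition pushm d1 d2 (T1 : measurableType d1) (T2 : measurableType d2)
    (R : realType) (mu : {measure set T1 -> \bar R}) (f : T1 -> T2)
    (mf : measurable_fun setT f) : {measure set T2 -> \bar R} :=
  measure_function_pushforward__canonical__measure_function_Measure mu mf.

Context d (T : measurableType d) (R : realType).
Variable mu : {measure set T -> \bar R}.

Lemma measure_pres_id : measure_pres mu id.
Proof. by split. Qed.

Lemma measure_pres_comp f g : measure_pres mu f -> measure_pres mu g -> measure_pres mu (f \o g).
Proof.
move=> [mf Ef] [mg Eg]; split; first exact: measurableT_comp.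
move=> A mA; rewrite comp_preimage Eg ?Ef//.
by rewrite -[X in measurable X]setTI; exact: mf.
Qed.

Lemma measure_pres_integral (D : set T) f (g : T -> \bar R) : measure_pres mu f ->
  measurable D -> measurable_fun D g -> (forall x, D x -> 0 <= g x) ->
  \int[mu]_(x in f @^-1` D) g (f x) = \int[mu]_(x in D) g x.
Proof.
move=> [mf Ef] mD mg g0.
rewrite -(ge0_integral_pushforward mf)//; last by move=> x /set_mem; exact: g0.
rewrite (@eq_measure_integral _ _ _ _ mu (pushm mu mf))//.
by move=> A mA _; exact: Ef.
Qed.

End measure_preserving.

(** * Lebesgue measure on the line and on the plane *)

Section line.
Context (R : realType).
Local Notation L := (measurableTypeR R).
Local Notation leb := (@lebesgue_measure R).

Lemma measurable_add_cst (c : R) : measurable_fun setT (fun x : L => (x + c)%R : L).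
Proof. by apply: measurable_funD. Qed.

Lemma measurable_mul_cst (c : R) : measurable_fun setT (fun x : L => (c * x)%R : L).
Proof. by apply: measurable_funM. Qed.

(** Lebesgue measure is determined by its values on half-open intervals, so invariance is only
    checked there. *)
Lemma lebesgue_translate (c : R) : measure_pres leb (fun x : L => (x + c)%R : L).
Proof.
split; first exact: measurable_add_cst.
move=> A mA; apply/esym/(@lebesgue_measure_unique R (pushm leb (measurable_add_cst c))) => //.
move=> X /ocitvP[->|[[a b] /= ab ->]]; first by rewrite !measure0.
rewrite /pushforward.
rewrite (_ : _ @^-1` _ = `](a - c)%R, (b - c)%R]%classic).
  rewrite !lebesgue_measure_itv/= !lte_fin ltrD2r ab -!EFinB.
  by congr (_%:E); lra.
by apply/seteqP; split => x /=; rewrite !in_itv/=; lra.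
Qed.

Lemma lebesgue_scale (k : {posnum R}) (A : set L) : measurable A ->
  (k%:num%:E * leb ((fun x : L => (k%:num * x)%R : L) @^-1` A) = leb A)%E.
Proof.
move=> mA.
apply/esym/(@lebesgue_measure_unique R
  (mscale (k%:num)%:nng (pushm leb (measurable_mul_cst k%:num)))) => //.
move=> X /ocitvP[->|[[a b] /= ab ->]]; first by rewrite !measure0.
rewrite /mscale/= /pushforward.
rewrite (_ : _ @^-1` _ = `](a / k%:num)%R, (b / k%:num)%R]%classic).
  rewrite !lebesgue_measure_itv/= !lte_fin ltr_pM2r// ab -!EFinB -EFinM.
  by congr (_%:E); field.
by apply/seteqP; split => x /=; rewrite !in_itv/= ltr_pdivrMr// ler_pdivlMr// ![(x * _)%R]mulrC.
Qed.

End line.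

Section product.
Local Open Scope ereal_scope.
Context d1 d2 (T1 : measurableType d1) (T2 : measurableType d2) (R : realType).
Variables (m1 : {sigma_finite_measure set T1 -> \bar R})
  (m2 : {sigma_finite_measure set T2 -> \bar R}).

Lemma measure_pres_prod f g : measure_pres m1 f -> measure_pres m2 g ->
  measure_pres (sfprod m1 m2) (fun x => (f x.1, g x.2)).
Proof.
move=> [mf Ef] [mg Eg].
have mfg : measurable_fun setT (fun x : T1 * T2 => (f x.1, g x.2)).
  by apply: measurable_fun_pair; apply: measurableT_comp.
split => // A mA.
apply/esym; have := @product_measure_unique _ _ _ _ _ m1 m2 (pushm (sfprod m1 m2) mfg).
apply => // X Y mX mY; rewrite /= /pushforward.
rewrite (_ : _ @^-1` _ = (f @^-1` X) `*` (g @^-1` Y)); last first.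
  by apply/seteqP; split.
rewrite [LHS]product_measure1E.
- by rewrite Ef// Eg.
- by rewrite -[X in measurable X]setTI; exact: mf.
- by rewrite -[X in measurable X]setTI; exact: mg.
Qed.

(** Allows sections in the other order of integration, as the shear along the first coordinate
    requires. *)
Lemma sfprod2E (A : set (T1 * T2)) : measurable A ->
  sfprod m1 m2 A = (m1 \x^ m2) A.
Proof. by move=> mA; apply: product_measure_unique => //= ? ? ? ?; rewrite product_measure2E. Qed.

End product.

Section plane.
Local Open Scope ereal_scope.
Context (R : realType).
Local Notation L := (measurableTypeR R).
Local Notation leb := (@lebesgue_measure R).
Local Notation leb2 := (sfprod leb leb).
Local Notation plane := (L * L)%type.

(** By Fubini: the section at height y is translated by the constant c * y. *)
Lemma measure_pres_shear1 (c : R) :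
  measure_pres leb2 (fun x : plane => ((x.1 + c * x.2)%R : L, x.2)).
Proof.
set f := (fun x : plane => _).
have mf : measurable_fun setT f.
  apply: measurable_fun_pair => //.
  apply: measurable_funD => //; apply: measurable_funM => //.
split => // A mA.
have mfA : measurable (f @^-1` A) by rewrite -[X in measurable X]setTI; exact: mf.
rewrite -[LHS]/(sfprod leb leb (f @^-1` A)) -[RHS]/(sfprod leb leb A).
rewrite !sfprod2E// /product_measure2; apply: eq_integral => y _ /=.
have [_ E] := lebesgue_translate (c * y).
rewrite -(E (ysection A y)); last exact: measurable_ysection.
by congr (leb _); apply/seteqP; split => x /=; rewrite /ysection/= !inE.
Qed.

Lemma measure_pres_shear2 (c : R) :
  measure_pres leb2 (fun x : plane => (x.1, (x.2 + c * x.1)%R : L)).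
Proof.
set f := (fun x : plane => _).
have mf : measurable_fun setT f.
  apply: measurable_fun_pair => //.
  apply: measurable_funD => //; apply: measurable_funM => //.
split => // A mA.
have mfA : measurable (f @^-1` A) by rewrite -[X in measurable X]setTI; exact: mf.
rewrite -[LHS]/((leb \x leb) (f @^-1` A)) -[RHS]/((leb \x leb) A).
rewrite /product_measure1; apply: eq_integral => y _ /=.
have [_ E] := lebesgue_translate (c * y).
rewrite -(E (xsection A y)); last exact: measurable_xsection.
by congr (leb _); apply/seteqP; split => x /=; rewrite /xsection/= !inE.
Qed.

Definition rot (u v : R) (x : plane) : plane :=
  ((u * x.1 - v * x.2)%R, (v * x.1 + u * x.2)%R).

Lemma measure_pres_eq (f g : plane -> plane) : f =1 g -> measure_pres leb2 f -> measure_pres leb2 g.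
Proof. by move=> /funext ->. Qed.

(* A rotation other than the half-turn is a product of three shears. *)
Lemma measure_pres_rot_shear (u v : R) : (u != -1)%R -> (u ^+ 2 + v ^+ 2 = 1)%R ->
  measure_pres leb2 (rot u v).
Proof.
move=> u1 uv.
have u10 : (1 + u != 0)%R by rewrite addrC -(opprK 1%R) subr_eq0.
(* With u = cos s and v = sin s this is tan(s/2); the shears by -t, v, -t compose to the
   rotation. *)
pose t := (v / (1 + u))%R.
have tv : (t * v = 1 - u)%R.
  rewrite /t mulrAC; apply: (mulIf u10); rewrite divfK//.
  by rewrite -expr2; lra.
have tu : (t * (1 + u) = v)%R by rewrite /t divfK.
apply: measure_pres_eq; last first.
  apply: (measure_pres_comp (measure_pres_shear1 (- t))).
  exact: (measure_pres_comp (measure_pres_shear2 v) (measure_pres_shear1 (- t))).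
move=> [x y]; rewrite /rot/=; congr pair.
  transitivity ((1 - t * v) * x - (t * (1 + u) + (1 - u - t * v) * t) * y)%R.
    by ring.
  by rewrite tu tv; ring.
transitivity (v * x + (1 - t * v) * y)%R; first by ring.
by rewrite tv; ring.
Qed.

Lemma measure_pres_rot (u v : R) : (u ^+ 2 + v ^+ 2 = 1)%R -> measure_pres leb2 (rot u v).
Proof.
have [->|u1 uv] := eqVneq u (-1)%R; last exact: measure_pres_rot_shear.
rewrite sqrrN expr1n => h.
have /eqP : (v ^+ 2 = 0)%R by lra.
rewrite sqrf_eq0 => /eqP ->.
(* The half-turn is the square of the quarter-turn, which the shears do reach. *)
have H01 : measure_pres leb2 (rot 0 1).
  by apply: measure_pres_rot_shear; [rewrite eq_sym oppr_eq0 oner_eq0|rewrite expr0n expr1n add0r].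
apply: measure_pres_eq (measure_pres_comp H01 H01) => -[x y]; rewrite /rot/=.
by congr pair; ring.
Qed.

Lemma measure_pres_translate2 (a b : R) :
  measure_pres leb2 (fun x : plane => ((x.1 + a)%R : L, (x.2 + b)%R : L)).
Proof. exact: (measure_pres_prod (lebesgue_translate a) (lebesgue_translate b)). Qed.

Definition sqn (x : plane) : R := (x.1 ^+ 2 + x.2 ^+ 2)%R.

Lemma sqn_ge0 x : (0 <= sqn x)%R.
Proof. by rewrite addr_ge0 ?sqr_ge0. Qed.

Lemma measurable_sqn : measurable_fun setT (sqn : plane -> L).
Proof. by apply: measurable_funD; apply: measurable_funX. Qed.

Lemma plane_scale (k : {posnum R}) (A : set plane) : measurable A ->
  (k%:num ^+ 2)%:E * leb2 ((fun x : plane => ((k%:num * x.1)%R : L, (k%:num * x.2)%R : L)) @^-1` A)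
  = leb2 A.
Proof.
move=> mA; set f := (fun x : plane => _).
have mf : measurable_fun setT f.
  by apply: measurable_fun_pair; apply: measurable_funM.
apply/esym.
have /(_ _ _ mA) := @product_measure_unique _ _ _ _ _ leb leb
  (mscale (NngNum (sqr_ge0 k%:num)) (pushm leb2 mf)).
apply => X Y mX mY; rewrite /= /mscale/= /pushforward.
rewrite (_ : _ @^-1` _ = ((fun x : L => (k%:num * x)%R : L) @^-1` X) `*`
   ((fun x : L => (k%:num * x)%R : L) @^-1` Y)); last by apply/seteqP; split.
have mp (Z : set L) : measurable Z -> measurable ((fun x : L => (k%:num * x)%R : L) @^-1` Z).
  by move=> mZ; rewrite -[X in measurable X]setTI; exact: measurable_mul_cst.
rewrite [X in _ * X](product_measure1E _ _ (mp _ mX) (mp _ mY)).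
rewrite -(lebesgue_scale k mX) -(lebesgue_scale k mY) expr2 EFinM.
by rewrite -!muleA; congr (_ * _); rewrite muleCA.
Qed.

(** The parameter is the squared radius, so that areas are linear in it. *)
Definition disc (r : R) : set plane := [set x | (sqn x <= r)%R].

Lemma measurable_disc r : measurable (disc r).
Proof.
rewrite (_ : disc r = (sqn : plane -> L) @^-1` `]-oo, r]).
  by rewrite -[X in measurable X]setTI; apply: measurable_sqn.
by apply/seteqP; split => x /=; rewrite in_itv/=.
Qed.

(** The area of the unit disc, kept abstract: it cancels in every ratio of weights. *)
Definition discA : R := fine (leb2 (disc 1)).

Lemma discAE : leb2 (disc 1) = discA%:E.
Proof.
rewrite /discA fineK// ge0_fin_numE//.
apply: (@le_lt_trans _ _ (leb2 (`[(-1)%R, 1%R]%classic `*` `[(-1)%R, 1%R]%classic))).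
  apply: le_measure; rewrite ?inE; [exact: measurable_disc| exact: measurableX|].
  move=> [x y]; rewrite /disc/sqn/= !in_itv/=; nra.
rewrite [ltLHS]product_measure1E//.
by rewrite /= lebesgue_measure_itv/= ifT ?lte_fin ?ltry//; lra.
Qed.

Lemma discA_gt0 : (0 < discA)%R.
Proof.
rewrite -lte_fin -discAE.
apply: (@lt_le_trans _ _ (leb2 (`[0%R, (1/2)%R]%classic `*` `[0%R, (1/2)%R]%classic))).
  rewrite [ltRHS]product_measure1E//.
  rewrite /= lebesgue_measure_itv/= ifT ?lte_fin; last lra.
  lra.
apply: le_measure; rewrite ?inE; [exact: measurableX|exact: measurable_disc|].
by move=> [x y]; rewrite /disc/sqn/= !in_itv/=; nra.
Qed.

(** Scaling gives r > 0; for r = 0 the disc lies in discs of arbitrarily small area, and for r < 0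
    it is empty. *)
Lemma leb2_disc (r : R) : leb2 (disc r) = (discA * Num.max r 0)%:E.
Proof.
have pos (s : R) : (0 < s)%R -> leb2 (disc s) = (discA * s)%:E.
  move=> s0; pose k := Num.sqrt s; have k0 : (0 < k)%R by rewrite sqrtr_gt0.
  rewrite -(plane_scale (PosNum k0) (measurable_disc _))/=.
  rewrite (_ : _ @^-1` _ = disc 1).
    by rewrite discAE sqr_sqrtr ?ltW// -EFinM mulrC.
  have ks : (k ^+ 2 = s)%R by rewrite sqr_sqrtr// ltW.
  apply/seteqP; split => -[x y] /=; rewrite /disc /sqn/= !exprMn ks -mulrDr.
    by rewrite -[X in (_ <= X -> _)%R]mulr1 ler_pM2l.
  by rewrite -[X in (_ -> _ <= X)%R]mulr1 ler_pM2l.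
have [r0|] := ltP 0%R r; first by rewrite pos.
rewrite le_eqVlt => /orP[/eqP ->|r0]; last first.
  rewrite mulr0 (_ : disc r = set0) ?measure0//.
  apply/seteqP; split => // x; rewrite /disc/= => h.
  by have := sqn_ge0 x; lra.
rewrite mulr0; apply/eqP; rewrite eq_le measure_ge0 andbT.
apply/lee_addgt0Pr => e e0; rewrite add0e.
have := pos _ (divr_gt0 e0 discA_gt0); rewrite mulrCA mulfV ?gt_eqF ?discA_gt0// mulr1 => <-.
apply: le_measure; rewrite ?inE; [exact: measurable_disc|exact: measurable_disc|].
by move=> x; rewrite /disc/= => /le_trans; apply; rewrite divr_ge0 ?ltW ?discA_gt0.
Qed.

(** Integration in polar coordinates with the variable |z|^2: up to the factor [discA], the image of
    planar measure under |z|^2 is Lebesgue measure on the half-line. *)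
Lemma leb2_sqn (A : set L) : measurable A -> A `<=` `[0%R, +oo[ ->
  leb2 (sqn @^-1` A) = discA%:E * leb A.
Proof.
move=> mA A0.
have c0 := discA_gt0.
have mr : measurable (`]-oo, 0%R[%classic : set L) by [].
(* The image measure is completed by a multiple of Lebesgue measure on the negative axis, so that
   uniqueness of Lebesgue measure on the whole line applies. *)
pose nu : {measure set L -> \bar R} := measure_add (pushm leb2 measurable_sqn)
  (mscale (NngNum (ltW c0)) (mrestr leb mr)).
have nuE (X : set L) :
    nu X = leb2 (sqn @^-1` X) + discA%:E * leb (X `&` `]-oo, 0%R[%classic).
  exact: measure_addE.
have ci0 : (0 <= discA^-1)%R by rewrite invr_ge0 ltW.
have := @lebesgue_measure_unique R (mscale (NngNum ci0) nu).
move=> /(_ _ _ mA) ->.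
  rewrite /mscale/= muleA -EFinM mulfV ?gt_eqF// mul1e.
  rewrite nuE (_ : A `&` _ = set0) ?measure0 ?mule0 ?adde0//.
  apply/seteqP; split => // x [/A0/=]; rewrite !in_itv/=; lra.
move=> X /ocitvP[->|[[a b] /= ab ->]]; first by rewrite !measure0.
rewrite /mscale/= nuE.
have -> : sqn @^-1` `]a, b] = disc b `\` disc a.
  apply/seteqP; split => x /=; rewrite /disc/= in_itv/=.
    by move=> /andP[h ->]; split => //; lra.
  by move=> [-> /negP]; rewrite -ltNge => ->.
rewrite measureD; last 3 first.
- exact: measurable_disc.
- exact: measurable_disc.
- by rewrite [ltLHS]leb2_disc ltry.
rewrite setIidr; last by move=> x; rewrite /disc/=; lra.
rewrite [X in X - _]leb2_disc [X in _ - X]leb2_disc.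
have [b0|b0] := ltP b 0%R.
  have -> : `]a, b] `&` `]-oo, 0%R[ = `]a, b]%classic.
    by apply/seteqP; split => x /=; rewrite !in_itv/=; lra.
  rewrite !lebesgue_measure_itv/= lte_fin ab max_r; last lra.
  rewrite -?EFinB -?EFinM -?EFinD -?EFinM.
  by congr (_%:E); field; rewrite gt_eqF.
have -> : `]a, b] `&` `]-oo, 0%R[ = `]a, 0%R[%classic.
  by apply/seteqP; split => x /=; rewrite !in_itv/=; lra.
rewrite !lebesgue_measure_itv/= !lte_fin ab.
case: ifPn => a0.
  rewrite max_r ?ltW// -?EFinB -?EFinM -?EFinD -?EFinM.
  by congr (_%:E); field; rewrite gt_eqF.
rewrite -leNgt in a0.
rewrite max_l// mule0 adde0 -?EFinB -?EFinM.
by congr (_%:E); field; rewrite gt_eqF.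
Qed.

Lemma integral_sqn (g : R -> \bar R) : measurable_fun setT (g : L -> \bar R) ->
  (forall x, 0 <= g x) ->
  \int[leb2]_x g (sqn x) = discA%:E * \int[leb]_(x in `[0%R, +oo[) g x.
Proof.
move=> mg g0; have c0 := discA_gt0.
have -> : \int[leb2]_x g (sqn x) = \int[leb2]_(x in sqn @^-1` `[0%R, +oo[) (g \o sqn) x.
  congr (integral _ _ _); apply/seteqP; split => x //= _.
  by rewrite in_itv/= sqn_ge0.
rewrite -(@ge0_integral_pushforward _ _ _ _ _ _ measurable_sqn)//; last exact: measurable_funTS.
have -> := @eq_measure_integral _ L R (`[0%R, +oo[%classic : set R) (mscale (NngNum (ltW c0)) leb) (pushm leb2 measurable_sqn).
  by rewrite ge0_integral_mscale//; exact: measurable_funTS.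
by move=> A mA AS; rewrite /=/mscale/= -leb2_sqn.
Qed.

End plane.

(** * Product measures on tuples *)

Section tuples.
Local Open Scope ereal_scope.
Context d (T : measurableType d) (R : realType).
Variable mu : {sigma_finite_measure set T -> \bar R}.

Lemma ge0_integral_tupleS n (f : n.+1.-tuple T -> \bar R) :
  measurable_fun setT f -> (forall x, 0 <= f x) ->
  \int[tuple_measure mu n.+1]_x f x =
  \int[mu]_x \int[tuple_measure mu n]_y f (tcons (x, y)).
Proof.
move=> mf f0.
have mc := @measurable_tcons _ T n.
have E := @ge0_integral_pushforward _ _ _ _ R _ mc (sfprod mu (tuple_measure mu n)) setT f measurableT mf (fun x _ => f0 x).
transitivity (\int[sfprod mu (tuple_measure mu n)]_x (f \o @tcons _ T n) x).
  by rewrite preimage_setT in E; rewrite -E.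
rewrite -[LHS]/(\int[mu \x (tuple_measure mu n)]_x (f \o @tcons _ T n) x).
rewrite fubini_tonelli1//.
- by apply: measurableT_comp.
- by move=> x; exact: f0.
Qed.

Lemma integral_tuple0 (f : 0.-tuple T -> \bar R) : measurable_fun setT f ->
  \int[tuple_measure mu 0]_x f x = f [tuple].
Proof. by move=> mf; rewrite integral_dirac// diracT mul1e. Qed.

Definition tmap n (F : 'I_n -> T -> T) (x : n.-tuple T) : n.-tuple T :=
  [tuple F i (tnth x i) | i < n].

Lemma measurable_tmap n (F : 'I_n -> T -> T) :
  (forall i, measurable_fun setT (F i)) -> measurable_fun setT (tmap F).
Proof.
move=> mF; apply/measurable_fun_tnthP => i.
rewrite (_ : _ \o _ = F i \o (fun x : n.-tuple T => tnth x i)).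
  by apply: measurableT_comp => //; exact: measurable_tnth.
by apply/funext => x /=; rewrite tnth_mktuple.
Qed.

Lemma measure_pres_tmap n (F : 'I_n -> T -> T) :
  (forall i, measure_pres mu (F i)) -> measure_pres (tuple_measure mu n) (tmap F).
Proof.
elim: n F => [|n IH] F hF.
  split; first by apply: measurable_tmap => -[].
  move=> A mA; rewrite (_ : tmap F @^-1` A = A)//.
  by apply/seteqP; split => x /=; rewrite (tuple0 (tmap F x)) (tuple0 x).
split; first by apply: measurable_tmap => i; exact: (hF i).1.
move=> A mA.
pose F' (i : 'I_n) := F (lift ord0 i).
have [mF' EF'] := measure_pres_prod (hF ord0) (IH F' (fun i => hF (lift ord0 i))).
have mcA : measurable (@tcons _ T n @^-1` A).
  by rewrite -[X in measurable X]setTI; exact: measurable_tcons.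
rewrite -[RHS]/(sfprod mu (tuple_measure mu n) (@tcons _ T n @^-1` A)).
rewrite -[LHS]/(sfprod mu (tuple_measure mu n) (@tcons _ T n @^-1` (tmap F @^-1` A))).
rewrite -[RHS](EF' _ mcA); congr (_ _).
apply/seteqP; suff E x : tcons (F ord0 x.1, tmap F' x.2) = tmap F (tcons x).
  by split => x /=; rewrite E.
apply: eq_from_tnth => i; rewrite tnth_mktuple.
have [j ->|->] := unliftP ord0 i; last by rewrite !tnth0.
by rewrite !tnthS tnth_mktuple.
Qed.

End tuples.

(** * The function [Pi s = Gamma (s + 1)] *)

Section gamma.
Context (R : realType).
Local Notation L := (measurableTypeR R).
Local Notation leb := (@lebesgue_measure R).
Implicit Types (s t u : R).

(** Extended by zero to the negative axis, so that integrals run over the whole line, where Tonelli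
    and translations apply directly. *)
Definition powR_pos (s : R) (x : R) : R := if 0 <= x then x `^ s else 0.

Lemma powR_pos_ge0 s x : 0 <= powR_pos s x.
Proof. by rewrite /powR_pos; case: ifP => // _; exact: powR_ge0. Qed.

Lemma measurable_powR_pos s : measurable_fun setT (powR_pos s : L -> L).
Proof.
by apply: measurable_fun_ifT => //; exact: measurable_fun_ler.
Qed.

Lemma integral_itv_if (i : interval R) (f : R -> \bar R) :
  (\int[leb]_(x in [set` i]) f x = \int[leb]_x (if x \in i then f x else 0))%E.
Proof.
rewrite integral_mkcond; apply: eq_integral => x _; rewrite patchE.
by case: ifPn; [rewrite inE/= => ->|move/negP; rewrite inE/= => /negP/negbTE ->].
Qed.

Lemma continuous_powR_gt0 s x : 0 < x -> {for x, continuous (fun y : R => y `^ s)}.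
Proof.
move=> x0; apply: differentiable_continuous; apply/derivable1_diffP.
by apply: derivable_powR; rewrite in_itv/= x0.
Qed.

Lemma cvg_at_right0_powR s : 0 <= s -> (fun y : R => y `^ s) x @[x --> 0^'+] --> (0:R) `^ s.
Proof.
rewrite le_eqVlt => /predU1P[<-|s0].
  by rewrite powRr0; under eq_fun do rewrite powRr0; exact: cvg_cst.
by rewrite powR0 ?gt_eqF//; exact: powR_cvg0.
Qed.

Lemma integral_powR s u : 0 <= s -> 0 <= u ->
  (\int[leb]_(x in `[0%R, u]) (x `^ s)%:E = (u `^ (s + 1) / (s + 1))%:E)%E.
Proof.
move=> s0; have s1 : 0 < s + 1 by lra.
rewrite le_eqVlt => /predU1P[<-|u0].
  by rewrite set_itv1 integral_set1 powR0 ?mul0r// gt_eqF.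
have H := @continuous_FTC2 _ (fun x => x `^ s) (fun x => x `^ (s + 1) / (s + 1)) 0 u u0.
rewrite H.
- by rewrite powR0 ?gt_eqF// mul0r sube0.
- apply/continuous_within_itvP => //; split.
  + by move=> x; rewrite in_itv/= => /andP[x0 _]; exact: continuous_powR_gt0.
  + exact: cvg_at_right0_powR.
  + by apply/cvg_at_left_filter; exact: continuous_powR_gt0.
- split.
  + move=> x; rewrite in_itv/= => /andP[x0 _].
    apply: derivableM => //; apply: derivable_powR; by rewrite in_itv/= x0.
  + apply: cvgM; last exact: cvg_cst.
    by apply: cvg_at_right0_powR; lra.
  + apply: cvgM; last exact: cvg_cst.
    by apply/cvg_at_left_filter; exact: continuous_powR_gt0.
- move=> x; rewrite in_itv/= => /andP[x0 _].
  rewrite derive1Mr; last by apply: derivable_powR; rewrite in_itv/= x0.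
  rewrite powR_derive1 ?in_itv/= ?x0// addrK mulrAC mulfV ?mul1r// gt_eqF//.
Qed.

Lemma integral_expRN u :
  (\int[leb]_(x in `[u, +oo[) (expR (- x))%:E = (expR (- u))%:E)%E.
Proof.
have c : continuous (fun x : R => expR (- x)).
  move=> x; apply: continuous_comp; last exact: continuous_expR.
  by apply: (@continuousN _ R^o); exact: cvg_id.
rewrite (@ge0_continuous_FTC2y _ _ (fun x => - expR (- x)) _ 0)//.
- by rewrite EFinN oppeK add0e.
- by apply: continuous_subspaceT => x; exact: c.
- by rewrite -oppr0; apply: cvgN; exact: cvgr_expR.
- by apply: cvgN; apply/cvg_at_right_filter; exact: c.
- move=> x _; rewrite derive1N// derive1_comp// derive1N// derive1_id mulrN1 opprK.
  by rewrite derive1E; have /funeqP -> := @derive_expR R.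
Qed.

Definition Pie (s : R) : \bar R := (\int[leb]_x (powR_pos s x * expR (- x))%:E)%E.
Definition Pi (s : R) : R := fine (Pie s).

Lemma Pie_ge0 s : (0 <= Pie s)%E.
Proof. by apply: integral_ge0 => x _; rewrite lee_fin mulr_ge0 ?powR_pos_ge0 ?expR_ge0. Qed.

Lemma measurable_expRN : measurable_fun setT (fun x : L => expR (- x) : L).
Proof. by apply: measurableT_comp => //; exact: measurable_expR. Qed.

Lemma integral_powR_pos (s : R) (p : pred R) u : 0 <= s -> 0 <= u ->
  (forall x, 0 <= x -> p x = (x <= u)) ->
  (\int[leb]_x (if p x then powR_pos s x else 0)%:E = (u `^ (s + 1) / (s + 1))%:E)%E.
Proof.
move=> s0 u0 hp; rewrite -integral_powR// [RHS]integral_itv_if/=.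
apply: eq_integral => x _; rewrite in_itv/= /powR_pos.
case: (lerP 0 x) => x0; last by rewrite if_same.
by rewrite hp//; case: ifP.
Qed.

Lemma measurable_comp_fst (f : R -> R) : measurable_fun setT (f : L -> L) ->
  measurable_fun setT (fun z : L * L => f z.1 : L).
Proof. by move=> mf; apply: (measurableT_comp mf). Qed.

Lemma measurable_comp_snd (f : R -> R) : measurable_fun setT (f : L -> L) ->
  measurable_fun setT (fun z : L * L => f z.2 : L).
Proof. by move=> mf; apply: (measurableT_comp mf). Qed.

Lemma measurable_pow (a : R) : measurable_fun setT (fun x : L => x `^ a : L).
Proof. exact: measurable_powR. Qed.

(** Writing exp(-x^a) as the integral of e^(-y) over y >= x^a and exchanging the integrals leaves
    the integral of x^s over [0, y^(1/a)]; this does the work of the substitution y = x^a. *)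
Lemma integral_expR_pow (s a : R) : 0 <= s -> 0 < a ->
  (\int[leb]_x (powR_pos s x * expR (- (x `^ a)))%:E =
   ((s + 1)^-1)%:E * Pie ((s + 1) / a))%E.
Proof.
move=> s0 a0; have s1 : 0 < s + 1 by lra.
have ai0 : 0 <= a^-1 by rewrite invr_ge0 ltW.
pose h (z : L * L) : \bar R := (if z.1 `^ a <= z.2 then powR_pos s z.1 * expR (- z.2) else 0)%:E.
have mh : measurable_fun setT h.
  apply/measurable_EFinP; apply: measurable_fun_ifT => //.
    apply: measurable_fun_ler => //.
    exact: (measurable_comp_fst (measurable_pow a)).
  apply: measurable_funM; first exact: (measurable_comp_fst (measurable_powR_pos s)).
  exact: (measurable_comp_snd measurable_expRN).
have h0 z : (0 <= h z)%E.
  by rewrite lee_fin; case: ifP => // _; rewrite mulr_ge0 ?powR_pos_ge0 ?expR_ge0.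
transitivity (\int[leb]_x \int[leb]_y h (x, y))%E.
  apply: eq_integral => x _; rewrite EFinM -integral_expRN -ge0_integralZl//=.
  - rewrite [LHS]integral_itv_if; apply: eq_integral => y _.
    by rewrite in_itv/= andbT /h/=; case: ifP.
  - by apply/measurable_EFinP/measurable_funTS; exact: measurable_expRN.
  - by rewrite lee_fin powR_pos_ge0.
rewrite fubini_tonelli//.
rewrite -ge0_integralZl//=; last 3 first.
- apply/measurable_EFinP; apply: measurable_funM; [exact: measurable_powR_pos|exact: measurable_expRN].
- by move=> x _; rewrite lee_fin mulr_ge0 ?powR_pos_ge0 ?expR_ge0.
- by rewrite lee_fin invr_ge0 ltW.
apply: eq_integral => y _; rewrite /h/=.
have [y0|y0] := ltP y 0.
  rewrite /powR_pos leNgt y0/= mul0r mule0 integral0_eq// => x _.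
  by rewrite ifF//; apply/negbTE; rewrite -ltNge (lt_le_trans y0)// powR_ge0.
transitivity (\int[leb]_x ((expR (- y))%:E * (if x `^ a <= y then powR_pos s x else 0)%:E))%E.
  by apply: eq_integral => x _; rewrite -EFinM; case: ifP; rewrite ?mulr0// mulrC.
rewrite ge0_integralZl//=; last 2 first.
- apply/measurable_EFinP; apply: measurable_fun_ifT => //.
    by apply: measurable_fun_ler => //; exact: measurable_pow.
  exact: measurable_powR_pos.
- by move=> x _; rewrite lee_fin; case: ifP => // _; exact: powR_pos_ge0.
rewrite (@integral_powR_pos s (fun x => x `^ a <= y) (y `^ a^-1)) ?powR_ge0//; last first.
  move=> x x0; apply/idP/idP => h1.
    rewrite -[leLHS]powRr1// -(mulfV (lt0r_neq0 a0)) powRrM.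
    by apply: ge0_ler_powR; rewrite ?nnegrE ?powR_ge0.
  rewrite -[leRHS]powRr1// -(mulVf (lt0r_neq0 a0)) powRrM.
  by apply: ge0_ler_powR => //; rewrite ?nnegrE ?powR_ge0// ltW.
rewrite -!EFinM /powR_pos y0 -powRrM [a^-1 * _]mulrC; congr (_%:E); ring.
Qed.

(** The case a = 1 of [integral_expR_pow], in place of an integration by parts. *)
Lemma Pie_rec s : 0 <= s -> (Pie (s + 1) = (s + 1)%:E * Pie s)%E.
Proof.
move=> s0; have s1 : s + 1 != 0 by rewrite gt_eqF//; lra.
have := integral_expR_pow s0 ltr01; rewrite divr1.
have -> : (\int[leb]_x (powR_pos s x * expR (- (x `^ 1)))%:E = Pie s)%E.
  apply: eq_integral => x _; congr (_%:E); rewrite /powR_pos.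
  by case: ifP => x0; rewrite ?mul0r// powRr1.
by move=> ->; rewrite muleA -EFinM mulfV// mul1e.
Qed.

Lemma Pie0 : Pie 0 = 1%E.
Proof.
rewrite -[RHS]/(1%:E) -expR0 -[in RHS]oppr0 -integral_expRN [RHS]integral_itv_if/=.
apply: eq_integral => x _; rewrite in_itv/= andbT /powR_pos.
by case: ifP => x0; rewrite ?mul0r// powRr0 mul1r.
Qed.

Lemma Pie_nat n : Pie n%:R = (n`!%:R)%:E.
Proof.
elim: n => [|n IH]; first exact: Pie0.
by rewrite -natr1 Pie_rec// IH natr1 -EFinM -natrM -factS.
Qed.

(** For s <= n, x^s is at most 1 + x^n, so the integral is dominated by [Pie 0] plus [Pie n%:R],
    both factorials. *)
Lemma Pie_fin s : 0 <= s -> Pie s \is a fin_num.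
Proof.
move=> s0; rewrite ge0_fin_numE ?Pie_ge0//.
have [n sn] : exists n : nat, s <= n%:R.
  by exists (Num.truncn s).+1; apply/ltW/truncnS_gt.
have m t : measurable_fun setT (fun x : L => (powR_pos t x * expR (- x))%:E).
  by apply/measurable_EFinP; apply: measurable_funM; [exact: measurable_powR_pos|exact: measurable_expRN].
have g t (x : L) : (0 <= (powR_pos t x * expR (- x))%:E)%E.
  by rewrite lee_fin mulr_ge0 ?powR_pos_ge0 ?expR_ge0.
apply: (@le_lt_trans _ _ (Pie 0 + Pie n%:R)%E); last by rewrite Pie0 Pie_nat ltry.
rewrite -ge0_integralD//; try by move=> x _; exact: g.
apply: ge0_le_integral => //.
- by apply: emeasurable_funD.
- move=> x _; rewrite -EFinD lee_fin -mulrDl ler_wpM2r ?expR_ge0// /powR_pos.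
  case: ifP => x0; last by rewrite addr0.
  rewrite powRr0; have [x1|x1] := leP x 1.
    rewrite -[leLHS]addr0 lerD ?powR_ge0//.
    move: x0; rewrite le_eqVlt => /predU1P[<-|x0].
      by have [->|?] := eqVneq s 0; rewrite ?powRr0// powR0.
    by rewrite -[leRHS](powRr0 x); apply: ger_powR; rewrite ?x0.
  by rewrite -[leLHS]add0r lerD// ler_powR// ltW.
Qed.

Lemma PiE s : 0 <= s -> Pie s = (Pi s)%:E.
Proof. by move=> s0; rewrite /Pi fineK// Pie_fin. Qed.

Lemma Pi_rec s : 0 <= s -> Pi (s + 1) = (s + 1) * Pi s.
Proof. by move=> s0; rewrite /Pi Pie_rec// fineM// Pie_fin. Qed.

Lemma Pi_gt0 s : 0 <= s -> 0 < Pi s.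
Proof.
move=> s0; rewrite -lte_fin -PiE//.
apply: (@lt_le_trans _ _ (\int[leb]_(x in `[1%R, 2%R]) (cst (expR (- 2))%:E) x)%E).
  rewrite integral_cst//= lebesgue_measure_itv/= lte_fin ltr1n -EFinB -EFinM lte_fin.
  by rewrite mulr_gt0 ?expR_gt0//; lra.
rewrite integral_itv_if; apply: ge0_le_integral => //.
- by move=> x _; case: ifP => // _; rewrite lee_fin expR_ge0.
- by apply: measurable_fun_ifT => //; under eq_fun do rewrite in_itv/=; apply: measurable_and; exact: measurable_fun_ler.
- by apply/measurable_EFinP; apply: measurable_funM; [exact: measurable_powR_pos|exact: measurable_expRN].
- move=> x _; case: ifPn; last by rewrite lee_fin mulr_ge0 ?powR_pos_ge0 ?expR_ge0.
  rewrite in_itv/= => /andP[x1 x2]; rewrite lee_fin /powR_pos ifT; last lra.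
  apply: (@le_trans _ _ (1 * expR (- x))).
    by rewrite mul1r ler_expR lerN2.
  rewrite ler_wpM2r ?expR_ge0// -[leLHS](powRr0 x).
  by apply: ler_powR.
Qed.

End gamma.

(** * Logarithmic convexity of Gamma *)

Section gamma_log_convex.
Context (R : realType).
Local Notation L := (measurableTypeR R).
Implicit Types (s t u b T : R).
Local Notation Pi := (@Pi R).

Lemma expR_convex (l p q : R) : 0 <= l <= 1 ->
  expR ((1 - l) * p + l * q) <= (1 - l) * expR p + l * expR q.
Proof.
move=> /andP[l0 l1]; set z := _ + _.
have e (x : R) : expR z * (1 + (x - z)) <= expR x.
  have -> : expR x = expR z * expR (x - z) by rewrite -expRD addrC subrK.
  rewrite ler_wpM2l ?expR_ge0//.
  exact: expR_ge1Dx.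
have := e p; have := e q; rewrite /z; set E := expR _ => hq hp.
apply: (@le_trans _ _ ((1 - l) * (E * (1 + (p - z))) + l * (E * (1 + (q - z))))).
  rewrite [leRHS](_ : _ = E) // /z; ring.
by rewrite lerD// ler_wpM2l// subr_ge0.
Qed.

(** Young's inequality for x^s / A and x^u / B, where K = A^(1-l) B^l. Taking the values of [Pi] for
    A and B and integrating against e^(-x) gives Hoelder's inequality for Gamma. *)
Lemma powR_pos_young (l s u A B x : R) : 0 < s -> 0 < u -> 0 <= l <= 1 ->
  0 < A -> 0 < B -> forall K, K = expR ((1 - l) * ln A + l * ln B) ->
  powR_pos ((1 - l) * s + l * u) x <=
  K * (1 - l) / A * powR_pos s x + K * l / B * powR_pos u x.
Proof.
move=> s0 u0 /[dup] hl /andP[l0 l1] A0 B0 K KE; pose m := (1 - l) * s + l * u; rewrite -/m.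
have K0 : 0 < K by rewrite KE expR_gt0.
have m0 : 0 < m.
  have [e|ln0] := eqVneq l 0; first by rewrite /m e subr0 mul1r mul0r addr0.
  have {}l0 : 0 < l by rewrite lt_neqAle eq_sym ln0.
  by rewrite /m ltr_wpDl ?mulr_ge0 ?mulr_gt0// ?subr_ge0// ltW.
rewrite /powR_pos; case: ifP => x0; last by rewrite !mulr0 addr0.
move: x0; rewrite le_eqVlt => /predU1P[<-|x0].
  by rewrite !powR0 ?gt_eqF// !mulr0 addr0.
have pE t : x `^ t = expR (t * ln x) by rewrite /powR gt_eqF.
have h := @expR_convex l (s * ln x - ln A) (u * ln x - ln B) hl.
have e1 : expR (s * ln x - ln A) = x `^ s / A by rewrite expRD expRN lnK ?posrE// pE.
have e2 : expR (u * ln x - ln B) = x `^ u / B by rewrite expRD expRN lnK ?posrE// pE.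
rewrite e1 e2 in h.
have e3 : x `^ m = K * expR ((1 - l) * (s * ln x - ln A) + l * (u * ln x - ln B)).
  by rewrite KE -expRD pE; congr expR; rewrite /m; ring.
rewrite e3; apply: (@le_trans _ _ (K * ((1 - l) * (x `^ s / A) + l * (x `^ u / B)))).
  by rewrite ler_pM2l.
rewrite (_ : K * _ = K * (1 - l) / A * x `^ s + K * l / B * x `^ u)//; ring.
Qed.

Lemma ln_Pi_convex (l s u : R) : 0 < s -> 0 < u -> 0 <= l <= 1 ->
  ln (Pi ((1 - l) * s + l * u)) <= (1 - l) * ln (Pi s) + l * ln (Pi u).
Proof.
move=> s0 u0 /[dup] hl /andP[l0 l1].
have m0 : 0 <= (1 - l) * s + l * u.
  by rewrite addr_ge0// mulr_ge0 ?subr_ge0 ?(ltW s0) ?(ltW u0).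
have mP t : measurable_fun setT (fun x : L => (powR_pos t x * expR (- x))%:E).
  by apply/measurable_EFinP; apply: measurable_funM; [exact: measurable_powR_pos|exact: measurable_expRN].
have gP t (x : L) : (0 <= (powR_pos t x * expR (- x))%:E)%E.
  by rewrite lee_fin mulr_ge0 ?powR_pos_ge0 ?expR_ge0.
have := PiE (ltW s0); have := PiE (ltW u0); have := PiE m0.
have := Pi_gt0 (ltW s0); have := Pi_gt0 (ltW u0); have := Pi_gt0 m0.
move: (Pi s) (Pi u) (Pi _) => A B M M0 B0 A0 ME BE AE.
pose K := expR ((1 - l) * ln A + l * ln B).
have K0 : 0 < K := expR_gt0 _.
suff h : M <= K by rewrite -[leRHS]expRK ler_ln ?posrE ?expR_gt0.
rewrite -lee_fin -ME.
have ca : 0 <= K * (1 - l) / A by apply: divr_ge0 (ltW A0); apply: mulr_ge0 (ltW K0) _; lra.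
have cb : 0 <= K * l / B by apply: divr_ge0 (ltW B0); apply: mulr_ge0 (ltW K0) _.
apply: (@le_trans _ _ ((K * (1 - l) / A)%:E * Pie s + (K * l / B)%:E * Pie u)%E); last first.
  rewrite AE BE -!EFinM -EFinD lee_fin !divfK ?gt_eqF// -mulrDr.
  by rewrite subrK mulr1.
rewrite -!ge0_integralZl// -ge0_integralD//; last 4 first.
- by move=> x _; rewrite mule_ge0.
- by apply: emeasurable_funM => //; exact: measurable_cst.
- by move=> x _; rewrite mule_ge0.
- by apply: emeasurable_funM => //; exact: measurable_cst.
apply: ge0_le_integral => //.
  by apply: emeasurable_funD; apply: emeasurable_funM => //; exact: measurable_cst.
move=> x _; rewrite -!EFinM -EFinD lee_fin !mulrA -mulrDl ler_wpM2r ?expR_ge0//.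
exact: powR_pos_young.
Qed.

End gamma_log_convex.

(* The asymptotics below only use the functional equation and logarithmic
   convexity of [Pi s = Gamma (s + 1)]. *)
Section log_convex.
Context (R : realType) (G : R -> R).
Hypothesis G_gt0 : forall s, 0 <= s -> 0 < G s.
Hypothesis G_rec : forall s, 0 <= s -> G (s + 1) = (s + 1) * G s.
Hypothesis G_convex : forall l s u : R, 0 < s -> 0 < u -> 0 <= l <= 1 ->
  ln (G ((1 - l) * s + l * u)) <= (1 - l) * ln (G s) + l * ln (G u).
Implicit Types (s t u b T : R).

(** For Gamma this grows like T^b. *)
Definition Qr b T := G (T + b) / G T.
(** The second multiplicative difference of G, equal to [Qr b T / Qr b (T - b)]; it decreases to 1
    and exceeds it by about b^2 / T. *)
Definition Ur b T := G (T + b) * G (T - b) / G T ^+ 2.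

Lemma ln_G_rec T : 0 <= T -> ln (G (T + 1)) = ln (T + 1) + ln (G T).
Proof. by move=> T0; rewrite G_rec// lnM ?posrE ?G_gt0//; lra. Qed.

Lemma Qr_gt0 b T : 0 <= T -> 0 < b -> 0 < Qr b T.
Proof. by move=> T0 b0; rewrite divr_gt0// G_gt0//; lra. Qed.

(** Convexity at T < T + b < T + b + 1; the functional equation reduces the right end to T + b. *)
Lemma Qr_ub b T : 0 < T -> 0 < b -> Qr b T <= (T + b + 1) `^ b.
Proof.
move=> T0 b0.
have b1 : 0 < b + 1 by lra.
have l01 : 0 <= b / (b + 1) <= 1.
  by rewrite divr_ge0 ?(ltW b0) ?(ltW b1)//= ler_pdivrMr//; lra.
have h := @G_convex (b / (b + 1)) T (T + b + 1) T0 ltac:(lra) l01.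
rewrite (_ : _ + _ * (T + b + 1) = T + b) in h; last by field; rewrite gt_eqF.
rewrite ln_G_rec in h; last lra.
set x := ln (G (T + b)) in h; set y := ln (G T) in h; set z := ln _ in h.
have {}h : x <= y + b * z.
  have e : (b + 1) * ((1 - b / (b + 1)) * y + b / (b + 1) * (z + x)) = y + b * (z + x).
    by field; rewrite gt_eqF.
  by move: h; rewrite -(ler_pM2l b1) e; lra.
rewrite /powR gt_eqF; last lra.
rewrite -[leLHS]lnK ?posrE; last by rewrite Qr_gt0 ?(ltW T0).
rewrite ler_expR ln_div ?posrE ?G_gt0//; try lra.
by rewrite -/x -/y -/z; lra.
Qed.

(** Convexity at T - 1 < T < T + b; the functional equation reduces the left end to T. *)
Lemma Qr_lb b T : 1 < T -> 0 < b -> T `^ b <= Qr b T.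
Proof.
move=> T1 b0.
have b1 : 0 < b + 1 by lra.
have l01 : 0 <= 1 / (b + 1) <= 1.
  by rewrite divr_ge0 ?ler01 ?(ltW b1)//= ler_pdivrMr//; lra.
have h := @G_convex (1 / (b + 1)) (T - 1) (T + b) ltac:(lra) ltac:(lra) l01.
rewrite (_ : _ + _ * (T + b) = T) in h; last by field; rewrite gt_eqF.
have E : ln (G T) = ln T + ln (G (T - 1)).
  have T0 : 0 <= T - 1 by lra.
  by have := ln_G_rec T0; rewrite subrK.
set x := ln (G (T + b)) in h; set y := ln (G T) in h E; set z := ln (G (T - 1)) in h E.
have {}h : y + b * ln T <= x.
  have e : (b + 1) * ((1 - 1 / (b + 1)) * z + 1 / (b + 1) * x) = b * z + x.
    by field; rewrite gt_eqF.
  by move: h; rewrite -(ler_pM2l b1) e E; lra.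
rewrite /powR gt_eqF; last lra.
rewrite -[leRHS]lnK ?posrE ?Qr_gt0//; last lra.
rewrite ler_expR ln_div ?posrE ?G_gt0//; try lra.
by rewrite -/x -/y; lra.
Qed.

Lemma Ur_gt0 b T : 0 < b -> b <= T -> 0 < Ur b T.
Proof. by move=> b0 bT; rewrite divr_gt0 ?exprn_gt0 ?mulr_gt0// G_gt0//; lra. Qed.

Lemma UrE b T : 0 < b -> b <= T -> Ur b T = Qr b T / Qr b (T - b).
Proof.
move=> b0 bT; rewrite /Ur /Qr subrK.
have p1 : G T != 0 by rewrite gt_eqF// G_gt0//; lra.
have p2 : G (T - b) != 0 by rewrite gt_eqF// G_gt0//; lra.
by field; rewrite p1 p2.
Qed.

Lemma Ur_ge1 b T : 0 < b -> b < T -> 1 <= Ur b T.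
Proof.
move=> b0 bT.
have h := @G_convex (1/2) (T - b) (T + b) ltac:(lra) ltac:(lra) ltac:(lra).
rewrite (_ : _ + _ * (T + b) = T) in h; last by field.
have p1 : 0 < G (T + b) by apply: G_gt0; lra.
have p2 : 0 < G (T - b) by apply: G_gt0; lra.
have p3 : 0 < G T by apply: G_gt0; lra.
rewrite /Ur ler_pdivlMr ?exprn_gt0// mul1r.
rewrite -ler_ln ?posrE ?mulr_gt0 ?exprn_gt0// lnM ?posrE// lnXn//.
lra.
Qed.

(** The explicit factor turns comparisons of [Ur] with rational functions of T into one-step
    inequalities along T, T + 1, ... *)
Lemma Ur_rec b T : 0 < b -> b <= T ->
  Ur b (T + 1) = Ur b T * (1 - b ^+ 2 / (T + 1) ^+ 2).
Proof.
move=> b0 bT; rewrite /Ur.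
rewrite (_ : T + 1 + b = T + b + 1); last ring.
rewrite (_ : T + 1 - b = T - b + 1); last ring.
rewrite !G_rec; try lra.
have p1 : G T != 0 by rewrite gt_eqF// G_gt0//; lra.
have p2 : T + 1 != 0 by rewrite gt_eqF//; lra.
by field; rewrite p1 p2.
Qed.

(** A rough bound whose purpose is the limit 1 at infinity. *)
Lemma Ur_ub0 b T : 0 < b -> b + 1 < T -> Ur b T <= expR (b * (1 + 2 * b) / (T - b)).
Proof.
move=> b0 bT; rewrite UrE//; last lra.
have h1 := @Qr_ub b T ltac:(lra) b0.
have h2 := @Qr_lb b (T - b) ltac:(lra) b0.
have q0 : 0 < (T - b) `^ b by rewrite powR_gt0; lra.
apply: (@le_trans _ _ ((T + b + 1) `^ b / (T - b) `^ b)).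
  rewrite ler_pM//.
  - by rewrite ltW// Qr_gt0//; lra.
  - by rewrite invr_ge0 ltW// Qr_gt0//; lra.
  - by rewrite lef_pV2// ?posrE ?Qr_gt0//; lra.
have Tb : 0 < T - b by lra.
rewrite /powR !gt_eqF; try lra.
rewrite -expRN -expRD ler_expR -mulrN -mulrDr -mulrA ler_pM2l//.
rewrite -ln_div ?posrE//; last lra.
have -> : (T + b + 1) / (T - b) = 1 + (1 + 2 * b) / (T - b) by field; rewrite gt_eqF.
apply: (le_trans (le_ln1Dx _)) => //.
by rewrite (@lt_trans _ _ 0)// ?divr_gt0//; lra.
Qed.

(** The comparison principle behind the bounds on [Ur]: f k is the quotient of the two sides at T +
    k, it decreases in k, and its limit is at least 1. *)
Lemma antitone_lim1 (f : nat -> R) : (forall k, f k.+1 <= f k) ->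
  (forall e, 0 < e -> exists k, 1 - e <= f k) -> 1 <= f 0%N.
Proof.
move=> fd fl; apply/ler_addgt0Pr => e e0.
have [k hk] := fl e e0.
have : f k <= f 0%N by elim: k {hk} => // k; apply: le_trans.
lra.
Qed.

Lemma exists_large (T M : R) : exists k : nat, M <= T + k%:R.
Proof.
exists (Num.truncn (`|M - T|)).+1.
have := truncnS_gt `|M - T|; have := ler_norm (M - T); lra.
Qed.

Lemma Ur_lb b T : 0 < b -> b < T -> 1 + b ^+ 2 / (T + 1) <= Ur b T.
Proof.
move=> b0 bT.
pose f (k : nat) := Ur b (T + k%:R) / (1 + b ^+ 2 / (T + k%:R + 1)).
have b2 : 0 < b ^+ 2 by rewrite exprn_gt0.
have w0 (t : R) : 0 < t -> 0 < 1 + b ^+ 2 / t by move=> t0; rewrite addr_gt0 ?divr_gt0.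
suff : 1 <= f 0%N by rewrite /f addr0 ler_pdivlMr ?mul1r// w0; lra.
apply: antitone_lim1 => [k|e e0].
  have k0 : (0:R) <= k%:R by [].
  rewrite /f ler_pdivrMr; last by rewrite w0//; lra.
  rewrite mulrAC ler_pdivlMr; last by rewrite w0//; lra.
  rewrite -natr1 addrA (@Ur_rec b (T + k%:R) b0); last lra.
  rewrite -mulrA ler_pM2l ?Ur_gt0//; last lra.
  set t := T + k%:R + 1; have t0 : 0 < t by rewrite /t; lra.
  have t1 : 0 < t + 1 by lra.
  rewrite -subr_ge0.
  have -> : 1 + b ^+ 2 / (t + 1) - (1 - b ^+ 2 / t ^+ 2) * (1 + b ^+ 2 / t) =
    b ^+ 2 / (t ^+ 2 * (t + 1)) + b ^+ 2 * b ^+ 2 / (t ^+ 3).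
    by field; rewrite !gt_eqF.
  by rewrite addr_ge0// divr_ge0 ?mulr_ge0 ?exprn_ge0 ?ltW.
have [k hk] := exists_large T (b ^+ 2 / e).
exists k; rewrite /f ler_pdivlMr; last by rewrite w0//; have : (0:R) <= k%:R by []; lra.
have k0 : (0:R) <= k%:R by [].
apply: le_trans (@Ur_ge1 b (T + k%:R) b0 ltac:(lra)).
set t := T + k%:R in hk *; have t0 : 0 < t by rewrite /t; lra.
have : b ^+ 2 / (t + 1) <= e.
  rewrite ler_pdivrMr; last lra.
  by move: hk; rewrite ler_pdivrMr//; nra.
have : 0 < b ^+ 2 / (t + 1) by rewrite divr_gt0//; lra.
nra.
Qed.

Lemma Ur_cvg1 b T e : 0 < b -> b < T -> 0 < e ->
  exists K : nat, forall k, (K <= k)%N -> Ur b (T + k%:R) <= 1 + e.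
Proof.
move=> b0 bT e0.
pose c := b * (1 + 2 * b).
have c0 : 0 < c by rewrite mulr_gt0//; lra.
have l0 : 0 < ln (1 + e) by apply: ln_gt0; lra.
have [K hK] := exists_large T (c / ln (1 + e) + b + 1 + 1).
have cl : 0 < c / ln (1 + e) by rewrite divr_gt0.
exists K => k Kk.
have hk : K%:R <= k%:R :> R by rewrite ler_nat.
apply: le_trans (@Ur_ub0 b (T + k%:R) b0 ltac:(lra)) _.
rewrite -[leRHS]lnK ?posrE; last lra.
rewrite ler_expR ler_pdivrMr; last lra.
have : c / ln (1 + e) <= T + k%:R - b by lra.
by rewrite ler_pdivrMr// [leRHS]mulrC.
Qed.

(** The factor 1 - b^2 / t^2 of [Ur_rec] increases with t, so the quotient of the values along T + k
    and S + k decreases, to the limit 1. *)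
Lemma Ur_antitone b T S : 0 < b -> b < T -> T <= S -> Ur b S <= Ur b T.
Proof.
move=> b0 bT TS.
pose f (k : nat) := Ur b (T + k%:R) / Ur b (S + k%:R).
have b2 : 0 < b ^+ 2 by rewrite exprn_gt0.
have k0 (k : nat) : (0:R) <= k%:R by [].
suff : 1 <= f 0%N by rewrite /f !addr0 ler_pdivlMr ?mul1r// Ur_gt0//; lra.
apply: antitone_lim1 => [k|e e0].
  have := k0 k => kk.
  have US : 0 < Ur b (S + k%:R) by rewrite Ur_gt0//; lra.
  have UT : 0 < Ur b (T + k%:R) by rewrite Ur_gt0//; lra.
  have US1 : 0 < Ur b (S + k.+1%:R) by rewrite Ur_gt0// -natr1; lra.
  rewrite /f ler_pdivrMr// [leRHS]mulrAC ler_pdivlMr//.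
  have bTk : b <= T + k%:R by lra.
  have bSk : b <= S + k%:R by lra.
  rewrite -natr1 !addrA (Ur_rec b0 bTk) (Ur_rec b0 bSk).
  rewrite mulrAC [leRHS]mulrA ler_pM2l ?(mulr_gt0 UT US)//.
  set t := T + k%:R + 1; set s := S + k%:R + 1.
  rewrite lerD2l lerN2 ler_pM2l//.
  have t0 : 0 < t by rewrite /t; lra.
  have s0 : 0 < s by rewrite /s; lra.
  rewrite lef_pV2 ?posrE ?exprn_gt0// lerXn2r ?nnegrE ?(ltW t0) ?(ltW s0)//.
  by rewrite /t /s; lra.
have [K hK] := Ur_cvg1 b0 (lt_le_trans bT TS) e0.
exists K; have hKK := hK K (leqnn _).
have U1 := @Ur_ge1 b (T + K%:R) b0 ltac:(have := k0 K; lra).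
have U2 := @Ur_ge1 b (S + K%:R) b0 ltac:(have := k0 K; lra).
rewrite /f ler_pdivlMr; last lra.
nra.
Qed.

Lemma Ur_ub b T : 0 < b -> 2 + 4 * b ^+ 2 + b <= T ->
  Ur b T <= 1 + 2 * b ^+ 2 / (T + 1).
Proof.
move=> b0 bT.
have b2 : 0 < b ^+ 2 by rewrite exprn_gt0.
pose f (k : nat) := (1 + 2 * b ^+ 2 / (T + k%:R + 1)) / Ur b (T + k%:R).
have k0 (k : nat) : (0:R) <= k%:R by [].
have w0 (t : R) : 0 < t -> 0 < 1 + 2 * b ^+ 2 / t.
  by move=> t0; rewrite addr_gt0 ?divr_gt0 ?mulr_gt0.
suff : 1 <= f 0%N by rewrite /f addr0 ler_pdivlMr ?mul1r// Ur_gt0//; lra.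
apply: antitone_lim1 => [k|e e0].
  have kk := k0 k.
  have U0 : 0 < Ur b (T + k%:R) by rewrite Ur_gt0//; lra.
  have U1 : 0 < Ur b (T + k.+1%:R) by rewrite Ur_gt0// -natr1; lra.
  have bTk : b <= T + k%:R by lra.
  rewrite /f ler_pdivrMr// [leRHS]mulrAC ler_pdivlMr//.
  rewrite -[k.+1%:R]natr1 !addrA (Ur_rec b0 bTk).
  rewrite [leRHS]mulrCA [leLHS]mulrC ler_pM2l//.
  set t := T + k%:R + 1; have t0 : 0 < t by rewrite /t; lra.
  have t1 : 0 < t + 1 by lra.
  rewrite -subr_ge0.
  have -> : (1 + 2 * b ^+ 2 / t) * (1 - b ^+ 2 / t ^+ 2) - (1 + 2 * b ^+ 2 / (t + 1)) =
    b ^+ 2 * (2 * t ^+ 2 - (t + 1) * (t + 2 * b ^+ 2)) / (t ^+ 3 * (t + 1)).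
    by field; rewrite !gt_eqF.
  rewrite divr_ge0 ?mulr_ge0 ?exprn_ge0 ?(ltW t0) ?(ltW t1) ?(ltW b0)//.
  (* This makes (t + 1)(t + 2 b^2) at most 2 t^2, which is the origin of the threshold on T. *)
  have : 2 + 4 * b ^+ 2 <= t by rewrite /t; lra.
  by move: b2; set c := b ^+ 2 => c0 tc; nra.
have [K hK] := Ur_cvg1 b0 (T := T) ltac:(lra) e0.
exists K; have hKK := hK K (leqnn _).
have U1 := @Ur_ge1 b (T + K%:R) b0 ltac:(have := k0 K; lra).
rewrite /f ler_pdivlMr; last lra.
have : 0 < 2 * b ^+ 2 / (T + K%:R + 1) by rewrite divr_gt0 ?mulr_gt0//; have := k0 K; lra.
nra.
Qed.

End log_convex.

(** * Integrals of monomials over ellipsoids *)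

Section beta.
Context (R : realType).
Local Notation L := (measurableTypeR R).
Local Notation leb := (@lebesgue_measure R).

Lemma integral_scale (k : R) (g : R -> \bar R) : 0 < k ->
  measurable_fun setT (g : L -> \bar R) -> (forall x, 0 <= g x)%E ->
  (\int[leb]_x g x = k%:E * \int[leb]_x g (k * x)%R)%E.
Proof.
move=> k0 mg g0.
have mk := measurable_mul_cst k.
have -> : (\int[leb]_x g (k * x)%R = \int[pushm leb mk]_x g x)%E.
  by rewrite (@ge0_integral_pushforward _ _ _ _ _ _ mk).
rewrite -(@ge0_integral_mscale _ _ _ (pushm leb mk) setT measurableT (NngNum (ltW k0)))//.
apply: eq_measure_integral => A mA _; rewrite /= /mscale/=.
by have := lebesgue_scale (PosNum k0) mA; rewrite /= => ->.
Qed.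

Lemma integral_translate (c : R) (g : R -> \bar R) :
  measurable_fun setT (g : L -> \bar R) -> (forall x, 0 <= g x)%E ->
  (\int[leb]_x g (x + c)%R = \int[leb]_x g x)%E.
Proof.
move=> mg g0.
by have := measure_pres_integral (lebesgue_translate c) measurableT mg (fun x _ => g0 x).
Qed.

(** Truncated strictly, also for T = 0, to match the strict inequality defining the ellipsoid. *)
Definition psi (T w : R) : R := if 0 < w then w `^ T else 0.

Lemma psi_ge0 T w : 0 <= psi T w.
Proof. by rewrite /psi; case: ifP => // _; exact: powR_ge0. Qed.

Lemma measurable_psi T : measurable_fun setT (psi T : L -> L).
Proof. by apply: measurable_fun_ifT => //; exact: measurable_fun_ltr. Qed.

Lemma integral_psi T : (\int[leb]_x (psi T x * expR (- x))%:E = Pie T)%E.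
Proof.
have mf : measurable_fun setT (fun x : L => (x `^ T * expR (- x))%:E).
  by apply/measurable_EFinP; apply: measurable_funM; [exact: measurable_pow|exact: measurable_expRN].
transitivity (\int[leb]_(x in `]0%R, +oo[) (x `^ T * expR (- x))%:E)%E.
  rewrite [RHS]integral_itv_if; apply: eq_integral => x _.
  by rewrite in_itv/= andbT /psi; case: ifP; rewrite ?mul0r.
rewrite integral_itv_obnd_cbnd; last exact: measurable_funTS.
rewrite [LHS]integral_itv_if; apply: eq_integral => x _.
by rewrite in_itv/= andbT /powR_pos; case: ifP; rewrite ?mul0r.
Qed.

Lemma powR_pos_psi_scale n (a T k y s : R) : 0 < k -> 0 < y -> k `^ a = y ->
  powR_pos n%:R (k * s) * psi T (y - (k * s) `^ a) =
  k ^+ n * y `^ T * (powR_pos n%:R s * psi T (1 - s `^ a)).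
Proof.
move=> k0 y0 ky; rewrite /powR_pos pmulr_rge0//.
case E: (0 <= s); last by rewrite [LHS]mul0r [X in _ = _ * X]mul0r [RHS]mulr0.
have s0 : 0 <= s by rewrite E.
have -> : (k * s) `^ n%:R = k ^+ n * s `^ n%:R.
  by rewrite powRM ?(ltW k0)// powR_mulrn ?(ltW k0).
have -> : y - (k * s) `^ a = y * (1 - s `^ a).
  by rewrite powRM ?(ltW k0)// ky; ring.
rewrite /psi pmulr_rgt0//; case: ifP => h; last by rewrite !mulr0.
by rewrite powRM ?(ltW y0)// ?(ltW h)//; ring.
Qed.

Variables (n : nat) (a T : R).
Hypotheses (a0 : 0 < a) (T0 : 0 <= T).
Let t : R := n.+1%:R / a.

Definition bet (y : R) : \bar R := (\int[leb]_s (powR_pos n%:R s * psi T (y - s `^ a))%:E)%E.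

Let t0 : 0 < t. Proof. by rewrite divr_gt0. Qed.

Let ge0 y s : (0 <= (powR_pos n%:R s * psi T (y - s `^ a))%:E)%E.
Proof. by rewrite lee_fin mulr_ge0 ?powR_pos_ge0 ?psi_ge0. Qed.

Let mb y : measurable_fun setT (fun s : L => (powR_pos n%:R s * psi T (y - s `^ a))%:E).
Proof.
apply/measurable_EFinP; apply: measurable_funM; first exact: measurable_powR_pos.
apply: (measurableT_comp (measurable_psi T)).
by apply: measurable_funB => //; exact: measurable_pow.
Qed.

Lemma bet_le0 y : y <= 0 -> bet y = 0%E.
Proof.
move=> y0; apply: integral0_eq => s _; rewrite /psi ifF ?mulr0//.
by apply/negbTE; rewrite -leNgt; have := powR_ge0 s a; lra.
Qed.

(** Homogeneity, by the scaling s -> k s with k = y^(1/a). *)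
Lemma bet_scale y : 0 < y -> bet y = ((y `^ (t + T))%:E * bet 1)%E.
Proof.
move=> y0; pose k := y `^ a^-1; have k0 : 0 < k by rewrite powR_gt0.
rewrite {1}/bet (@integral_scale k _ k0 (mb y) (ge0 y)) /bet.
have -> : y `^ (t + T) = k * (k ^+ n * y `^ T).
  rewrite powRD; last by apply/implyP => _; rewrite gt_eqF.
  rewrite mulrA -exprS; congr (_ * _).
  by rewrite -powR_mulrn ?(ltW k0)// /k -powRrM mulrC.
rewrite [(k * _)%:E]EFinM -muleA; congr (_ * _)%E.
rewrite -ge0_integralZl//; last by rewrite lee_fin mulr_ge0 ?exprn_ge0 ?powR_ge0 ?(ltW k0).
apply: eq_integral => s _; rewrite -EFinM; congr (_%:E).
apply: powR_pos_psi_scale => //.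
by rewrite /k -powRrM mulVf ?gt_eqF// powRr1// ltW.
Qed.

(** The integral of [bet y] against e^(-y) is computed twice: homogeneity yields
    [bet 1 * Pie (t + T)], while Tonelli and the translation y -> y + s^a separate the variables. *)
Lemma bet_laplace : (bet 1 * Pie (t + T) =
  (n.+1%:R^-1)%:E * Pie t * Pie T)%E.
Proof.
pose h (z : L * L) : \bar R := (powR_pos n%:R z.1 * psi T (z.2 - z.1 `^ a) * expR (- z.2))%:E.
have mh : measurable_fun setT h.
  apply/measurable_EFinP; apply: measurable_funM.
    apply: measurable_funM; first exact: (measurable_comp_fst (measurable_powR_pos n%:R)).
    apply: (measurableT_comp (measurable_psi T)).
    apply: measurable_funB; first exact: measurable_snd.
    exact: (measurable_comp_fst (measurable_pow a)).
  exact: (measurableT_comp (@measurable_expRN R) measurable_snd).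
have h0 z : (0 <= h z)%E.
  by rewrite lee_fin !mulr_ge0 ?powR_pos_ge0 ?expR_ge0 ?psi_ge0.
have H1 : (\int[leb]_y \int[leb]_x h (x, y) = bet 1 * Pie (t + T))%E.
  have b0 : (0 <= bet 1)%E by apply: integral_ge0 => s _; exact: ge0.
  rewrite -integral_psi -ge0_integralZl//; last 2 first.
  - by apply/measurable_EFinP; apply: measurable_funM; [exact: measurable_psi|exact: measurable_expRN].
  - by move=> x _; rewrite lee_fin mulr_ge0 ?psi_ge0 ?expR_ge0.
  apply: eq_integral => y _.
  transitivity (bet y * (expR (- y))%:E)%E.
    by rewrite -ge0_integralZr//=.
  rewrite [in RHS]/psi; case: ifPn => y0.
    by rewrite bet_scale// -muleA muleCA EFinM.
  by rewrite bet_le0 ?mul0r ?mule0 ?mul0e// leNgt.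
have H2 : (\int[leb]_x \int[leb]_y h (x, y) =
    (n.+1%:R^-1)%:E * Pie t * Pie T)%E.
  have e1 : (n%:R + 1 = n.+1%:R :> R) by rewrite natr1.
  rewrite -e1 (_ : t = (n%:R + 1) / a); last by rewrite e1.
  have K := @integral_expR_pow R n%:R a (ler0n _ _) a0.
  rewrite -K -ge0_integralZr//; last 3 first.
  - apply/measurable_EFinP; apply: measurable_funM; first exact: measurable_powR_pos.
    exact: (measurableT_comp (@measurable_expRN R) (measurable_pow a)).
  - by move=> x _; rewrite lee_fin mulr_ge0 ?powR_pos_ge0 ?expR_ge0.
  - exact: Pie_ge0.
  apply: eq_integral => x _; rewrite /h/= -integral_psi.
  have mg : measurable_fun setT (fun y : L => (powR_pos n%:R x * (psi T (y - x `^ a) * expR (- y)))%:E).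
    apply/measurable_EFinP; apply: measurable_funM => //.
    apply: measurable_funM; last exact: measurable_expRN.
    apply: (measurableT_comp (measurable_psi T)).
    by apply: measurable_funB.
  under eq_integral do rewrite -mulrA.
  rewrite -[LHS](integral_translate (x `^ a))//; last first.
    by move=> y; rewrite lee_fin !mulr_ge0 ?powR_pos_ge0 ?expR_ge0 ?psi_ge0.
  rewrite -ge0_integralZl//; last 3 first.
  - by apply/measurable_EFinP; apply: measurable_funM; [exact: measurable_psi|exact: measurable_expRN].
  - by move=> y _; rewrite lee_fin mulr_ge0 ?psi_ge0 ?expR_ge0.
  - by rewrite lee_fin mulr_ge0 ?powR_pos_ge0 ?expR_ge0.
  apply: eq_integral => y _; rewrite -EFinM addrK opprD expRD; congr (_%:E); ring.
by rewrite -H1 -H2 fubini_tonelli.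
Qed.

Lemma betE y : bet y =
  (Pi t / n.+1%:R * Pi T / Pi (t + T) * psi (t + T) y)%:E.
Proof.
have tT : 0 <= t + T by rewrite addr_ge0// ltW.
rewrite /psi; case: ifPn => y0; last by rewrite bet_le0 ?mulr0// leNgt.
rewrite bet_scale//.
have := bet_laplace; rewrite !PiE ?(ltW t0)// -!EFinM => h.
have P0 := Pi_gt0 tT.
have -> : bet 1 = (Pi t / n.+1%:R * Pi T / Pi (t + T))%:E.
  rewrite [RHS](_ : _ = (n.+1%:R^-1 * Pi t * Pi T)%:E * ((Pi (t + T))^-1)%:E)%E.
    by rewrite -h -muleA -EFinM mulfV ?gt_eqF// mule1.
  by rewrite -EFinM; congr (_%:E); ring.
by rewrite -EFinM mulrC.
Qed.

End beta.

Section omega.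
Context (R : realType).
Local Notation L := (measurableTypeR R).
Local Notation leb := (@lebesgue_measure R).
Local Notation leb2 := (sfprod leb leb).

Definition tdeg n (a : 'I_n -> R) (al : 'I_n -> nat) : R := \sum_(i < n) (al i).+1%:R / a i.

Lemma tdeg_ge0 n (a : 'I_n -> R) al : (forall i, 0 < a i) -> 0 <= tdeg a al.
Proof. by move=> a0; apply: sumr_ge0 => i _; rewrite divr_ge0// ltW. Qed.

(* [||z^al||^2] in the Bergman space of the ellipsoid; the values of [Pi] at
   partial degrees cancel between successive one-variable Beta integrals. *)
Definition mono_weight n (a : 'I_n -> R) (al : 'I_n -> nat) : R :=
  \prod_(i < n) (discA R * (Pi ((al i).+1%:R / a i) / (al i).+1%:R)) / Pi (tdeg a al).

(** The level [y] is variable for the sake of induction: fixing one coordinate lowers it. *)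
Definition monof n (a : 'I_n -> R) (al : 'I_n -> nat) (y : R) (x : n.-tuple (L * L)) : R :=
  if \sum_(i < n) sqn (tnth x i) `^ a i < y then \prod_(i < n) sqn (tnth x i) ^+ al i else 0.

Lemma monof_ge0 n (a : 'I_n -> R) al y x : 0 <= monof a al y x.
Proof. by rewrite /monof; case: ifP => // _; apply: prodr_ge0 => i _; rewrite exprn_ge0 ?sqn_ge0. Qed.

Lemma measurable_sqn_tnth n (i : 'I_n) : measurable_fun setT (fun x : n.-tuple (L * L) => sqn (tnth x i) : L).
Proof.
by apply: (measurableT_comp (@measurable_sqn R)); exact: measurable_tnth.
Qed.

Lemma measurable_monof n (a : 'I_n -> R) al y : measurable_fun setT (monof a al y : _ -> L).
Proof.
apply: measurable_fun_ifT => //.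
  apply: measurable_fun_ltr => //; apply: measurable_sum => i.
  exact: (measurableT_comp (measurable_pow (a i)) (measurable_sqn_tnth i)).
apply: measurable_prod => i _; apply: measurable_funX; exact: measurable_sqn_tnth.
Qed.

(** Induction on the number of variables: integrating out all but the first coordinate gives a power
    of the remaining level, and the first one contributes [bet] in the variable |z|^2. *)
Lemma integral_monof n (a : 'I_n -> R) al y : (forall i, 0 < a i) ->
  (\int[tuple_measure leb2 n]_x (monof a al y x)%:E =
   (mono_weight a al * psi (tdeg a al) y)%:E)%E.
Proof.
elim: n a al y => [|n IH] a al y a0.
  rewrite integral_tuple0; last by apply/measurable_EFinP; exact: measurable_monof.
  rewrite /monof /mono_weight /tdeg !big_ord0 /psi powRr0 /Pi Pie0/= invr1 mulr1.
  by case: ifP; rewrite ?mulr0 ?mul1r.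
rewrite ge0_integral_tupleS; last 2 first.
- by apply/measurable_EFinP; exact: measurable_monof.
- by move=> x; rewrite lee_fin monof_ge0.
pose a' (i : 'I_n) := a (lift ord0 i); pose al' (i : 'I_n) := al (lift ord0 i).
have a'0 i : 0 < a' i by exact: a0.
have T0 : 0 <= tdeg a' al' by exact: tdeg_ge0.
pose g (s : R) : \bar R := (mono_weight a' al' * (powR_pos (al ord0)%:R s * psi (tdeg a' al') (y - s `^ a ord0)))%:E.
have w0 : (0 <= mono_weight a' al').
  rewrite divr_ge0//; last by rewrite ltW// Pi_gt0.
  apply: prodr_ge0 => i _; rewrite mulr_ge0 ?ltW ?discA_gt0// divr_gt0// Pi_gt0//.
  by rewrite divr_ge0// ltW.
transitivity (\int[leb2]_x g (sqn x))%E.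
  apply: eq_integral => x _; rewrite /g.
  transitivity (\int[tuple_measure leb2 n]_z ((sqn x ^+ al ord0)%:E * (monof a' al' (y - sqn x `^ a ord0) z)%:E))%E.
    apply: eq_integral => z _; rewrite -EFinM; congr (_%:E).
    rewrite /monof !big_ord_recl !tnth0.
    under eq_bigr do rewrite tnthS.
    under [in X in if _ then _ * X else _]eq_bigr do rewrite tnthS.
    rewrite ltrBrDl /a' /al' /=; case: ifP => h //; by rewrite mulr0.
  rewrite ge0_integralZl//; last 3 first.
  - by apply/measurable_EFinP; exact: measurable_monof.
  - by move=> z _; rewrite lee_fin monof_ge0.
  - by rewrite lee_fin exprn_ge0 ?sqn_ge0.
  rewrite IH// -!EFinM /powR_pos sqn_ge0 powR_mulrn ?sqn_ge0//; congr (_%:E); ring.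
rewrite integral_sqn; last 2 first.
- apply/measurable_EFinP; apply: measurable_funM; first exact: measurable_cst.
  apply: measurable_funM; first exact: measurable_powR_pos.
  apply: (measurableT_comp (measurable_psi _)).
  by apply: measurable_funB => //; exact: measurable_pow.
- by move=> s; rewrite lee_fin mulr_ge0// mulr_ge0 ?powR_pos_ge0 ?psi_ge0.
have -> : (\int[leb]_(x in `[0%R, +oo[) g x = \int[leb]_x g x)%E.
  rewrite integral_itv_if; apply: eq_integral => s _; rewrite in_itv/= andbT.
  by case: ifPn => // s0; rewrite /g /powR_pos (negbTE s0) mul0r mulr0.
rewrite /g; under eq_integral do rewrite EFinM.
rewrite ge0_integralZl//; last 2 first.
- apply/measurable_EFinP; apply: measurable_funM; first exact: measurable_powR_pos.
  apply: (measurableT_comp (measurable_psi _)).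
  by apply: measurable_funB => //; exact: measurable_pow.
- by move=> s _; rewrite lee_fin mulr_ge0 ?powR_pos_ge0 ?psi_ge0.
rewrite -/(bet _ _ _ _) betE//.
have e : tdeg a al = (al ord0).+1%:R / a ord0 + tdeg a' al' by rewrite /tdeg big_ord_recl.
rewrite -!EFinM -e; congr (_%:E).
rewrite /mono_weight big_ord_recl -/(tdeg _ _) -/(a' _).
have P1 := Pi_gt0 T0; have P2 := Pi_gt0 (tdeg_ge0 al a0).
rewrite -/a' -/al'.
set P := \prod_(i < n) _; rewrite -[X in _ = _ * X / _ * _]/P.
move: P P1 P2 (Pi (_ / _)) (psi _ _) (discA R) => P.
move: (Pi _) (Pi _) => p1 p2 h1 h2 p3 q c.
by field; rewrite !gt_eqF.
Qed.

End omega.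

(** * Goursat's lemma and the Taylor expansion *)

Section segment_integral.
Context (R : realType).
Local Notation leb := (@lebesgue_measure R).

Definition Int (f : R -> R) (a b : R) : R := (\int[leb]_(x in `[a, b]) f x)%R.

Definition cont_on (a b : R) (f : R -> R) :=
  forall x, a <= x <= b -> {for x, continuous f}.

Lemma cont_on_integrable f a b : cont_on a b f ->
  leb.-integrable `[a, b] (EFin \o f).
Proof.
move=> cf; apply: continuous_compact_integrable; first exact: segment_compact.
apply: continuous_in_subspaceT => x; rewrite inE/= in_itv/=; exact: cf.
Qed.

Lemma Int_split f a b c : a <= b -> b <= c -> cont_on a c f ->
  Int f a c = Int f a b + Int f b c.
Proof.
move=> ab bc cf; apply/eqP; rewrite addrC -subr_eq; apply/eqP.
rewrite /Int Rintegral_itvB ?bnd_simp//; last exact: cont_on_integrable.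
apply: Rintegral_itv_obnd_cbnd.
apply: (@integrableS _ _ _ leb `[b, c]%classic `]b, c]%classic) => //.
  by apply: subset_itvr; rewrite bnd_simp.
by apply: cont_on_integrable => x xbc; apply: cf; lra.
Qed.

Lemma IntB f g a b : cont_on a b f -> cont_on a b g ->
  Int (fun x => f x - g x) a b = Int f a b - Int g a b.
Proof. by move=> cf cg; apply: RintegralB => //; exact: cont_on_integrable. Qed.

Lemma IntD f g a b : cont_on a b f -> cont_on a b g ->
  Int (fun x => f x + g x) a b = Int f a b + Int g a b.
Proof. by move=> cf cg; apply: RintegralD => //; exact: cont_on_integrable. Qed.

Lemma IntZ (k : R) f a b : cont_on a b f ->
  Int (fun x => k * f x) a b = k * Int f a b.
Proof. by move=> cf; apply: RintegralZl => //; exact: cont_on_integrable. Qed.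

Lemma Int_cst (c a b : R) : a <= b -> Int (fun=> c) a b = c * (b - a).
Proof.
move=> ab; rewrite /Int Rintegral_cst//= lebesgue_measure_itv/= lte_fin.
by move: ab; rewrite le_eqVlt => /predU1P[->|->]//=; rewrite ltxx subrr.
Qed.

Lemma le_Int f g a b : cont_on a b f -> cont_on a b g ->
  (forall x, a <= x <= b -> f x <= g x) -> Int f a b <= Int g a b.
Proof.
move=> cf cg fg; apply: le_Rintegral => //; exact: cont_on_integrable.
Qed.

Lemma Int_approx f (c e a b : R) : a <= b -> cont_on a b f ->
  (forall x, a <= x <= b -> `|f x - c| <= e) ->
  `|Int f a b - c * (b - a)| <= e * (b - a).
Proof.
move=> ab cf h.
have cc (r : R) : cont_on a b (fun=> r) by move=> x _; exact: cst_continuous.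
have h1 : Int (fun=> c - e) a b <= Int f a b.
  by apply: le_Int => // x /h; rewrite ler_norml; lra.
have h2 : Int f a b <= Int (fun=> c + e) a b.
  by apply: le_Int => // x /h; rewrite ler_norml; lra.
by move: h1 h2; rewrite !Int_cst// ler_norml; nra.
Qed.

Lemma eq_Int f g a b : (forall x, a <= x <= b -> f x = g x) -> Int f a b = Int g a b.
Proof.
by move=> h; apply: eq_Rintegral => x; rewrite inE/= in_itv/=; exact: h.
Qed.

End segment_integral.

(** * Goursat's lemma for rectangles in a vertical strip *)

Section goursat.
Context (R : realType).
Variables (u v : R -> R -> R) (X1 X2 : R).

(* [u + i v] is complex differentiable at [x + i y], with derivative [p + i q]. *)
Definition cr_at (x y : R) := exists p q : R, forall e, 0 < e ->
  exists2 d, 0 < d & forall s t, `|s| < d -> `|t| < d ->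
    `|u (x + s) (y + t) - u x y - (p * s - q * t)| <= e * (`|s| + `|t|) /\
    `|v (x + s) (y + t) - v x y - (q * s + p * t)| <= e * (`|s| + `|t|).

Hypothesis cr : forall x y, X1 < x < X2 -> cr_at x y.

Lemma lin_cont (f : R -> R) (x m : R) : (forall e, 0 < e ->
  exists2 d, 0 < d & forall s, `|s| < d -> `|f (x + s) - f x - m * s| <= e * `|s|) ->
  {for x, continuous f}.
Proof.
move=> h; apply/cvgrPdist_le => e e0.
have [d d0 hd] := h 1 ltr01.
have M0 : 0 < 1 + `|m| by have := normr_ge0 m; lra.
apply/nbhs_ballP; exists (Num.min d (e / (1 + `|m|))).
  by rewrite /= lt_min d0 divr_gt0.
move=> y; rewrite /ball/= distrC lt_min => /andP[h1 h2].
have := hd _ h1; rewrite (_ : x + (y - x) = y) ?mul1r => [h3|]; last ring.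
rewrite distrC (_ : f y - f x = (f y - f x - m * (y - x)) + m * (y - x)); last ring.
apply: le_trans (ler_normD _ _) _; rewrite normrM.
apply: (@le_trans _ _ ((1 + `|m|) * `|y - x|)).
  by rewrite mulrDl mul1r lerD.
by rewrite mulrC -ler_pdivlMr// ltW.
Qed.

Let cux y x : X1 < x < X2 -> {for x, continuous (fun x => u x y)}.
Proof.
move=> /cr h; have [p [q hpq]] := h y.
apply: (@lin_cont _ _ p) => e e0; have [d d0 hd] := hpq e e0.
exists d => // s sd; have [] := hd s 0 sd; first by rewrite normr0.
by rewrite addr0 normr0 mulr0 subr0 addr0.
Qed.

Let cvy y x : X1 < x < X2 -> {for y, continuous (fun y => v x y)}.
Proof.
move=> /cr h; have [p [q hpq]] := h y.
apply: (@lin_cont _ _ p) => e e0; have [d d0 hd] := hpq e e0.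
exists d => // s sd; have [] := hd 0 s; rewrite ?normr0//.
by rewrite addr0 !mulr0 !add0r.
Qed.

(* The real part of the contour integral of [u + i v] along a rectangle. *)
Definition circ (x h y k : R) : R :=
  Int (fun s => u s y) x (x + h) - Int (fun s => u s (y + k)) x (x + h)
  - Int (fun t => v (x + h) t) y (y + k) + Int (fun t => v x t) y (y + k).

Let cu x h y : X1 < x -> x + h < X2 -> cont_on x (x + h) (fun s => u s y).
Proof. by move=> x1 x2 s hs; apply: cux; lra. Qed.

Let cv x y k : X1 < x < X2 -> cont_on y (y + k) (fun t => v x t).
Proof. by move=> x1 s hs; apply: cvy. Qed.

Lemma circ_quarter x h y k : X1 < x -> x + h < X2 -> 0 <= h -> 0 <= k ->
  circ x h y k = circ x (h / 2) y (k / 2) + circ (x + h / 2) (h / 2) y (k / 2)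
  + circ x (h / 2) (y + k / 2) (k / 2) + circ (x + h / 2) (h / 2) (y + k / 2) (k / 2).
Proof.
move=> x1 x2 h0 k0; rewrite /circ.
have e1 : x + h / 2 + h / 2 = x + h by field.
have e2 : y + k / 2 + k / 2 = y + k by field.
rewrite !e1 !e2.
have su z : Int (fun s => u s z) x (x + h) =
    Int (fun s => u s z) x (x + h / 2) + Int (fun s => u s z) (x + h / 2) (x + h).
  by apply: Int_split; [lra|lra|exact: cu].
have sv z : X1 < z < X2 -> Int (fun s => v z s) y (y + k) =
    Int (fun s => v z s) y (y + k / 2) + Int (fun s => v z s) (y + k / 2) (y + k).
  by move=> hz; apply: Int_split; [lra|lra|exact: cv].
rewrite !su (sv (x + h)); last lra.
rewrite (sv x); last lra.
ring.
Qed.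

(** The affine part of u + i v has vanishing contour integral; only the remainder is left, which is
    small compared with the squared size of the rectangle. *)
Lemma circ_small x y : X1 < x < X2 -> forall e, 0 < e ->
  exists2 d, 0 < d & forall x0 h y0 k, X1 < x0 -> x0 + h < X2 ->
    0 <= h < d -> 0 <= k < d -> x0 <= x <= x0 + h -> y0 <= y <= y0 + k ->
    `|circ x0 h y0 k| <= 2 * e * (h + k) ^+ 2.
Proof.
move=> hx e e0; have [p [q hpq]] := cr y hx; have [d d0 hd] := hpq e e0.
exists d => // x0 h y0 k X1x0 x0hX2 /andP[h0 hd'] /andP[k0 kd'] xx yy.
have ee (a b : R) : `|a| <= h -> `|b| <= k -> e * (`|a| + `|b|) <= e * (h + k).
  by move=> ah bk; rewrite ler_pM2l// lerD.
have nrm (a c : R) : - c <= a <= c -> `|a| <= c by rewrite ler_norml.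
have main (s t : R) : x0 <= s <= x0 + h -> y0 <= t <= y0 + k ->
    `|u s t - u x y - (p * (s - x) - q * (t - y))| <= e * (h + k) /\
    `|v s t - v x y - (q * (s - x) + p * (t - y))| <= e * (h + k).
  move=> hs ht.
  have sh : `|s - x| <= h by apply: nrm; lra.
  have tk : `|t - y| <= k by apply: nrm; lra.
  have := hd (s - x) (t - y) (le_lt_trans sh hd') (le_lt_trans tk kd').
  rewrite ![_ + (_ - _)]addrC !subrK => -[a1 a2].
  by split; [apply: le_trans a1 _|apply: le_trans a2 _]; exact: ee.
have Hu : `|Int (fun s => u s y0 - u s (y0 + k)) x0 (x0 + h) - q * k * (x0 + h - x0)|
    <= 2 * (e * (h + k)) * (x0 + h - x0).
  apply: Int_approx; first lra.
    move=> s hs; apply: continuousB; apply: cux; lra.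
  move=> s hs.
  have [a1 _] := main s y0 hs ltac:(lra).
  have [a2 _] := main s (y0 + k) hs ltac:(lra).
  move: a1 a2; rewrite !ler_norml => a1 a2; lra.
have Hv : `|Int (fun t => v (x0 + h) t - v x0 t) y0 (y0 + k) - q * h * (y0 + k - y0)|
    <= 2 * (e * (h + k)) * (y0 + k - y0).
  apply: Int_approx; first lra.
    move=> s hs; apply: continuousB; apply: cvy; lra.
  move=> s hs.
  have [_ a1] := main x0 s ltac:(lra) hs.
  have [_ a2] := main (x0 + h) s ltac:(lra) hs.
  move: a1 a2; rewrite !ler_norml => a1 a2; lra.
rewrite IntB in Hu; [|exact: cu|exact: cu].
rewrite IntB in Hv; [|by apply: cv; lra|by apply: cv; lra].
rewrite /circ; move: Hu Hv; rewrite !ler_norml expr2 => /andP[b1 b2] /andP[b3 b4].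
apply/andP; split; lra.
Qed.

Section bisection.
Variables (x0 h y0 k eta : R).
Hypotheses (hX1 : X1 < x0) (hX2 : x0 + h < X2) (h0 : 0 < h) (k0 : 0 < k) (eta0 : 0 < eta).
Hypothesis big : eta * (h * k) <= `|circ x0 h y0 k|.

Let w n : R := (2 ^+ n)^-1.
Let w0 n : 0 < w n. Proof. by rewrite invr_gt0 exprn_gt0. Qed.
Let wS n : w n.+1 = w n / 2. Proof. by rewrite /w exprS invfM mulrC. Qed.

(** The rectangle with corner z and sides h / 2^n, k / 2^n still has an integral of at least eta
    times its area. *)
Let P n (z : R * R) := [/\ x0 <= z.1, z.1 + h * w n <= x0 + h &
  eta * (h * w n * (k * w n)) <= `|circ z.1 (h * w n) z.2 (k * w n)|].

Let N n (z z' : R * R) := [/\ z.1 <= z'.1, z'.1 + h * w n.+1 <= z.1 + h * w n,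
  z.2 <= z'.2, z'.2 + k * w n.+1 <= z.2 + k * w n & P n.+1 z'].

(** If all four quarters fell below eta times their area, the whole rectangle would too. *)
Let next n z : P n z -> exists z', N n z z'.
Proof.
case=> p1 p2 p3.
have hw := mulr_gt0 h0 (w0 n.+1); have kw := mulr_gt0 k0 (w0 n.+1).
have eh : h * w n = h * w n.+1 + h * w n.+1 by rewrite wS; field.
have ek : k * w n = k * w n.+1 + k * w n.+1 by rewrite wS; field.
have eh2 : h * w n / 2 = h * w n.+1 by rewrite wS mulrA.
have ek2 : k * w n / 2 = k * w n.+1 by rewrite wS mulrA.
have Q : X1 < z.1 -> z.1 + h * w n < X2 -> 0 <= h * w n -> 0 <= k * w n -> _ :=
  @circ_quarter z.1 (h * w n) z.2 (k * w n).
have {}Q := Q (lt_le_trans hX1 p1) (le_lt_trans p2 hX2)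
  (ltW (mulr_gt0 h0 (w0 n))) (ltW (mulr_gt0 k0 (w0 n))).
rewrite eh2 ek2 in Q.
set A := h * w n.+1 in eh eh2 hw Q *; set B := k * w n.+1 in ek ek2 kw Q *.
have ab : (A + A) * (B + B) = A * B + A * B + A * B + A * B by ring.
rewrite eh ek ab in p3; rewrite eh in p2.
have AB : 0 < eta * (A * B) by rewrite !mulr_gt0.
have tri : `|circ z.1 (A + A) z.2 (B + B)| <= `|circ z.1 A z.2 B| +
   `|circ (z.1 + A) A z.2 B| + `|circ z.1 A (z.2 + B) B| + `|circ (z.1 + A) A (z.2 + B) B|.
  rewrite -eh -ek Q; do 2 (apply: le_trans (ler_normD _ _) _; rewrite lerD2r).
  exact: ler_normD.
have fin a b : z.1 <= a -> a + A <= z.1 + (A + A) -> z.2 <= b -> b + B <= z.2 + (B + B) ->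
    eta * (A * B) <= `|circ a A b B| -> exists z', N n z z'.
  move=> a1 a2 b1 b2 c; exists (a, b); split; rewrite /= ?eh ?ek//.
  split => //=; first exact: le_trans p1 a1.
  exact: le_trans a2 p2.
have eqA : z.1 + A + A <= z.1 + (A + A) by rewrite addrA.
have eqB : z.2 + B + B <= z.2 + (B + B) by rewrite addrA.
have leA : z.1 <= z.1 + A by rewrite lerDl ltW.
have leB : z.2 <= z.2 + B by rewrite lerDl ltW.
have leA2 : z.1 + A <= z.1 + (A + A) by rewrite lerD2l lerDl ltW.
have leB2 : z.2 + B <= z.2 + (B + B) by rewrite lerD2l lerDl ltW.
have [c1|c1] := leP (eta * (A * B)) `|circ z.1 A z.2 B|; first exact: fin c1.
have [c2|c2] := leP (eta * (A * B)) `|circ (z.1 + A) A z.2 B|; first exact: fin c2.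
have [c3|c3] := leP (eta * (A * B)) `|circ z.1 A (z.2 + B) B|; first exact: fin c3.
have [c4|c4] := leP (eta * (A * B)) `|circ (z.1 + A) A (z.2 + B) B|; first exact: fin c4.
exfalso; lra.
Qed.

Let sq := fix sq n : R * R := if n is n'.+1 then xget (sq n') [set z' | N n' (sq n') z'] else (x0, y0).

Let sqP n : P n (sq n).
Proof.
elim: n => [|n IH].
  by split; rewrite /= /w ?expr0 ?invr1 ?mulr1.
have [z hz] := next IH.
by have /= [] : [set z' | N n (sq n) z'] (sq n.+1) by apply: xgetPex; exists z.
Qed.

Let sqN n : N n (sq n) (sq n.+1).
Proof.
have [z hz] := next (sqP n).
by have /= : [set z' | N n (sq n) z'] (sq n.+1) by apply: xgetPex; exists z.
Qed.

Lemma nested_point (a l : nat -> R) : (forall n, a n <= a n.+1) ->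
  (forall n, a n.+1 + l n.+1 <= a n + l n) -> (forall n, 0 <= l n) ->
  exists c, forall n, a n <= c <= a n + l n.
Proof.
move=> a1 a2 l0.
have am n m : (n <= m)%N -> a n <= a m.
  elim: m => [|m IH]; first by rewrite leqn0 => /eqP ->.
  rewrite leq_eqVlt => /predU1P[->//|/IH] h'; exact: le_trans h' _.
have bm n m : (n <= m)%N -> a m + l m <= a n + l n.
  elim: m => [|m IH]; first by rewrite leqn0 => /eqP ->.
  rewrite leq_eqVlt => /predU1P[->//|/IH] h'; exact: le_trans (a2 _) h'.
have ab n m : a n <= a m + l m.
  apply: (@le_trans _ _ (a (maxn n m))); first by apply: am; exact: leq_maxl.
  apply: (@le_trans _ _ (a (maxn n m) + l (maxn n m))); first by rewrite lerDl.
  by apply: bm; exact: leq_maxr.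
pose S := range a; exists (sup S) => n; apply/andP; split.
  by apply: ub_le_sup; [exists (a 0%N + l 0%N) => _ [m _ <-]; exact: ab|exists n].
by apply: ge_sup; [exists (a 0%N), 0%N|move=> _ [m _ <-]; exact: ab].
Qed.

Lemma bisection_absurd : False.
Proof.
have [x hx] := @nested_point (fun n => (sq n).1) (fun n => h * w n)
  (fun n => let: And5 a _ _ _ _ := sqN n in a) (fun n => let: And5 _ a _ _ _ := sqN n in a)
  (fun n => ltW (mulr_gt0 h0 (w0 n))).
have [y hy] := @nested_point (fun n => (sq n).2) (fun n => k * w n)
  (fun n => let: And5 _ _ a _ _ := sqN n in a) (fun n => let: And5 _ _ _ a _ := sqN n in a)
  (fun n => ltW (mulr_gt0 k0 (w0 n))).
have hx0 := hx 0%N; rewrite /= /w expr0 invr1 mulr1 in hx0.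
have hk : 0 < (h + k) ^+ 2 by rewrite exprn_gt0// addr_gt0.
(* With this e the local bound of [circ_small] is half of the lower bound kept along the
   bisection. *)
pose e := eta * (h * k) / (4 * (h + k) ^+ 2).
have e0 : 0 < e by rewrite divr_gt0// mulr_gt0// mulr_gt0.
have [hx1 hx2] := andP hx0.
have hxX : X1 < x < X2 by rewrite (lt_le_trans hX1 hx1) (le_lt_trans hx2 hX2).
have [d d0 hd] := @circ_small x y hxX e e0.
have [n hn] : exists n, w n * (h + k) < d.
  have [n hn] : exists n : nat, (h + k) / d < n%:R.
    by exists (Num.truncn ((h + k) / d)).+1; exact: truncnS_gt.
  exists n; rewrite /w mulrC ltr_pdivrMr ?exprn_gt0//.
  rewrite ltr_pdivrMr// in hn; apply: (lt_le_trans hn); rewrite mulrC ler_pM2l//.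
  by rewrite -natrX ler_nat ltnW// ltn_expl.
have [p1 p2 p3] := sqP n.
have wn := w0 n.
have hw : 0 < h * w n by rewrite mulr_gt0.
have kw : 0 < k * w n by rewrite mulr_gt0.
have := hd _ _ _ _ _ _ _ _ (hx n) (hy n) => hh.
have hh1 : `|circ (sq n).1 (h * w n) (sq n).2 (k * w n)| <= 2 * e * (h * w n + k * w n) ^+ 2.
  have hk1 : w n * (h + k) = h * w n + k * w n by ring.
  rewrite hk1 in hn.
  apply: hh.
  - exact: lt_le_trans hX1 p1.
  - exact: le_lt_trans p2 hX2.
  - by rewrite (ltW hw)/=; apply: le_lt_trans hn; rewrite lerDl ltW.
  - by rewrite (ltW kw)/=; apply: le_lt_trans hn; rewrite lerDr ltW.
have := le_trans p3 hh1.
have -> : 2 * e * (h * w n + k * w n) ^+ 2 = eta * (h * w n * (k * w n)) / 2.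
  by rewrite /e; field; rewrite gt_eqF// addr_gt0.
have : 0 < eta * (h * w n * (k * w n)) by rewrite !mulr_gt0.
lra.
Qed.

End bisection.

Lemma circ0 x h y k : X1 < x -> x + h < X2 -> 0 < h -> 0 < k -> circ x h y k = 0.
Proof.
move=> x1 x2 h0 k0; apply/eqP; rewrite -normr_le0 leNgt; apply/negP => c0.
have hk : 0 < h * k by rewrite mulr_gt0.
apply: (@bisection_absurd x h y k (`|circ x h y k| / (h * k))) => //.
  by rewrite divr_gt0.
by rewrite divfK// gt_eqF.
Qed.

(** For a rectangle whose height is the period the horizontal sides cancel, so the vertical ones
    agree. With u + i v = f(e^(x+iy)) the latter are integrals of f over circles. *)
Lemma periodic_mean (k : R) : 0 < k -> (forall x, u x (0 + k) = u x 0) ->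
  {in `]X1, X2[ &, forall x x', Int (v x) 0 k = Int (v x') 0 k}.
Proof.
move=> k0 per.
have H x x' : X1 < x -> x < x' -> x' < X2 -> Int (v x) 0 k = Int (v x') 0 k.
  move=> x1 xx' x2; have := @circ0 x (x' - x) 0 k x1 ltac:(lra) ltac:(lra) k0.
  rewrite /circ (_ : x + (x' - x) = x') ?add0r => [c|]; last ring.
  have E : Int (fun s : R => u s k) x x' = Int (fun s : R => u s 0) x x'.
    by apply: eq_Int => s _; have := per s; rewrite add0r.
  by move: c; rewrite E; lra.
move=> x x'; rewrite !in_itv/= => /andP[a1 a2] /andP[b1 b2].
by have [xx'|xx'|->//] := ltgtP x x'; [apply: H|apply/esym/H].
Qed.

End goursat.

(** * Complex modulus, continuity and differentiability in real-valued estimates *)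

Section complex_toolkit.
Context (R : realType).
Local Notation C := (Cplx R).
Implicit Types (z w : C) (x y : R).

Definition nc (z : C) : R := ComplexField.Normc.normc z.
Definition re (z : C) : R := complex.Re z.
Definition im (z : C) : R := complex.Im z.
Definition mkc (x y : R) : C := x +i* y.
Definition ofR (x : R) : C := x%:C.

Lemma ncM z w : nc (z * w) = nc z * nc w. Proof. exact: ComplexField.Normc.normcM. Qed.
Lemma ncV z : nc z^-1 = (nc z)^-1. Proof. exact: ComplexField.Normc.normcV. Qed.
Lemma nc0 : nc 0 = 0. Proof. exact: ComplexField.Normc.normc0. Qed.
Lemma nc1 : nc 1 = 1. Proof. exact: ComplexField.Normc.normc1. Qed.
Lemma ncN z : nc (- z) = nc z. Proof. exact: normcN. Qed.
Lemma ncD z w : nc (z + w) <= nc z + nc w. Proof. exact: le_normcD. Qed.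
Lemma nc_ge0 z : 0 <= nc z. Proof. by case: z => a b; exact: sqrtr_ge0. Qed.
Lemma ncB z w : nc (z - w) <= nc z + nc w. Proof. by rewrite -[nc w]ncN; exact: ncD. Qed.
Lemma nc_sub z w : nc (z - w) = nc (w - z). Proof. by rewrite -ncN opprB. Qed.
Lemma nc_eq0 z : (nc z == 0) = (z == 0).
Proof.
by apply/eqP/eqP => [/ComplexField.Normc.eq0_normc|->]; rewrite ?nc0.
Qed.
Lemma nc_gt0 z : (0 < nc z) = (z != 0).
Proof. by rewrite lt_neqAle nc_ge0 andbT eq_sym nc_eq0. Qed.
Lemma ncX z n : nc (z ^+ n) = nc z ^+ n.
Proof. by elim: n => [|n IH]; rewrite ?expr0 ?nc1// !exprS ncM IH. Qed.

Lemma sqr_nc z : nc z ^+ 2 = re z ^+ 2 + im z ^+ 2.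
Proof. by case: z => a b; rewrite /nc /= sqr_sqrtr// addr_ge0 ?sqr_ge0. Qed.

Lemma nc_mkc x y : nc (mkc x y) = Num.sqrt (x ^+ 2 + y ^+ 2). Proof. by []. Qed.

Lemma nc_ofR x : nc (ofR x) = `|x|.
Proof. by rewrite /nc /= expr0n addr0 sqrtr_sqr. Qed.

Lemma abs_re_le z : `|re z| <= nc z.
Proof.
case: z => a b; rewrite /re /nc /= -sqrtr_sqr ler_sqrt ?addr_ge0 ?sqr_ge0//.
by rewrite lerDl sqr_ge0.
Qed.

Lemma abs_im_le z : `|im z| <= nc z.
Proof.
case: z => a b; rewrite /im /nc /= -sqrtr_sqr ler_sqrt ?addr_ge0 ?sqr_ge0//.
by rewrite lerDr sqr_ge0.
Qed.

Lemma nc_le_abs z : nc z <= `|re z| + `|im z|.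
Proof.
rewrite -(ler_pXn2r (n := 2)) ?nnegrE ?nc_ge0 ?addr_ge0//.
rewrite sqr_nc -(real_normK (num_real (re z))) -(real_normK (num_real (im z))).
have : 0 <= `|re z| * `|im z| by rewrite mulr_ge0.
by rewrite sqrrD => h; rewrite lerD2r lerDl mulr2n addr_ge0.
Qed.

Lemma reD z w : re (z + w) = re z + re w. Proof. by case: z w => ? ? []. Qed.
Lemma imD z w : im (z + w) = im z + im w. Proof. by case: z w => ? ? []. Qed.
Lemma reN z : re (- z) = - re z. Proof. by case: z. Qed.
Lemma imN z : im (- z) = - im z. Proof. by case: z. Qed.
Lemma reB z w : re (z - w) = re z - re w. Proof. by rewrite reD reN. Qed.
Lemma imB z w : im (z - w) = im z - im w. Proof. by rewrite imD imN. Qed.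
Lemma reM z w : re (z * w) = re z * re w - im z * im w. Proof. by case: z w => ? ? []. Qed.
Lemma imM z w : im (z * w) = re z * im w + im z * re w. Proof. by case: z w => ? ? []. Qed.
Lemma complex_eq z w : re z = re w -> im z = im w -> z = w.
Proof. by case: z w => ? ? [? ?] /= -> ->. Qed.
Lemma reZ x z : re (ofR x * z) = x * re z.
Proof. by rewrite reM /= mul0r subr0. Qed.
Lemma imZ x z : im (ofR x * z) = x * im z.
Proof. by rewrite imM /= mul0r addr0. Qed.

Lemma ncB_ge z w : nc z - nc w <= nc (z - w).
Proof. by rewrite lerBlDr -{1}(subrK w z); exact: ncD. Qed.

Lemma nc_sum (I : Type) (r : seq I) (P : pred I) (F : I -> C) :
  nc (\sum_(i <- r | P i) F i) <= \sum_(i <- r | P i) nc (F i).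
Proof.
apply: (big_ind2 (fun z x => nc z <= x)) => [|z1 x1 z2 x2 h1 h2|//].
  by rewrite nc0.
exact: le_trans (ncD _ _) (lerD h1 h2).
Qed.

Definition cdiff (f : C -> C) (z : C) := exists D : C, forall e : R, 0 < e ->
  exists2 d : R, 0 < d & forall w, nc w < d -> nc (f (z + w) - f z - D * w) <= e * nc w.

Definition ccont (f : C -> C) (z : C) := forall e : R, 0 < e ->
  exists2 d : R, 0 < d & forall w, nc (w - z) < d -> nc (f w - f z) <= e.

Lemma cdiff_cont f z : cdiff f z -> ccont f z.
Proof.
move=> [D hD] e e0; have [d d0 hd] := hD 1 ltr01.
have M0 : 0 < 1 + nc D by have := nc_ge0 D; lra.
exists (Num.min d (e / (1 + nc D))); first by rewrite lt_min d0 divr_gt0.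
move=> w; rewrite lt_min => /andP[h1 h2].
have := hd _ h1; rewrite [z + _]addrC subrK mul1r => h3.
have -> : f w - f z = (f w - f z - D * (w - z)) + D * (w - z) by rewrite subrK.
apply: le_trans (ncD _ _) _; rewrite ncM.
apply: (@le_trans _ _ ((1 + nc D) * nc (w - z))); first by rewrite mulrDl mul1r lerD2r.
by rewrite mulrC -ler_pdivlMr// ltW.
Qed.

Lemma cdiff_cst c z : cdiff (fun=> c) z.
Proof.
exists 0 => e e0; exists 1 => // w _.
by rewrite subrr mul0r subr0 nc0 mulr_ge0 ?nc_ge0// ltW.
Qed.

Lemma cdiff_id z : cdiff id z.
Proof.
exists 1 => e e0; exists 1 => // w _.
by rewrite mul1r [z + w]addrC addrK subrr nc0 mulr_ge0 ?nc_ge0// ltW.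
Qed.

Lemma cdiffD f g z : cdiff f z -> cdiff g z -> cdiff (fun w => f w + g w) z.
Proof.
move=> [D hD] [E hE]; exists (D + E) => e e0.
have e2 : 0 < e / 2 by lra.
have [d d0 hd] := hD _ e2; have [d' d0' hd'] := hE _ e2.
exists (Num.min d d'); first by rewrite lt_min d0.
move=> w; rewrite lt_min => /andP[/hd h1 /hd' h2].
have -> : f (z + w) + g (z + w) - (f z + g z) - (D + E) * w =
  (f (z + w) - f z - D * w) + (g (z + w) - g z - E * w) by ring.
apply: le_trans (ncD _ _) _; lra.
Qed.

Lemma cdiffM f g z : cdiff f z -> cdiff g z -> cdiff (fun w => f w * g w) z.
Proof.
move=> cf cg; have cc := cdiff_cont cg.
case: cf => D hD; case: cg => E hE; exists (D * g z + f z * E) => e e0.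
have K0 : 0 < nc (g z) + nc D + nc (f z) + 2.
  by have := nc_ge0 D; have := nc_ge0 (g z); have := nc_ge0 (f z); lra.
set K := _ + 2 in K0.
pose e1 := Num.min 1 (e / (2 * K)).
have e10 : 0 < e1 by rewrite lt_min ltr01 divr_gt0// mulr_gt0.
have [d d0 hd] := hD _ e10; have [d' d0' hd'] := hE _ e10; have [d2 d20 hd2] := cc _ e10.
exists (Num.min d (Num.min d' d2)); first by rewrite !lt_min d0 d0'.
move=> w; rewrite !lt_min => /and3P[/hd h1 /hd' h2 w2].
have {hd2}h3 : nc (g (z + w) - g z) <= e1 by apply: hd2; rewrite addrC addKr.
have -> : f (z + w) * g (z + w) - f z * g z - (D * g z + f z * E) * w =
  (f (z + w) - f z - D * w) * g (z + w) + D * w * (g (z + w) - g z)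
  + f z * (g (z + w) - g z - E * w) by ring.
have e11 : e1 <= 1 by rewrite ge_min lexx.
have e1K : e1 * (2 * K) <= e by rewrite -ler_pdivlMr ?mulr_gt0// ge_min lexx orbT.
have gb : nc (g (z + w)) <= nc (g z) + 1.
  rewrite -[g (z + w)](subrK (g z)) addrC; apply: le_trans (ncD _ _) _.
  by rewrite lerD2l (le_trans h3).
apply: le_trans (ncD _ _) _; apply: le_trans (lerD (ncD _ _) (lexx _)) _.
rewrite !ncM.
have w0 := nc_ge0 w; have D0 := nc_ge0 D; have F0 := nc_ge0 (f z); have G0 := nc_ge0 (g z).
apply: (@le_trans _ _ (e1 * nc w * (nc (g z) + 1) + nc D * nc w * e1 + nc (f z) * (e1 * nc w))).
  rewrite !lerD//.
  - by rewrite ler_pM ?nc_ge0.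
  - by rewrite ler_wpM2l// mulr_ge0.
  - by rewrite ler_wpM2l.
have -> : e1 * nc w * (nc (g z) + 1) + nc D * nc w * e1 + nc (f z) * (e1 * nc w) =
   e1 * (K - 1) * nc w by rewrite /K; ring.
rewrite ler_wpM2r//; apply: le_trans e1K.
by rewrite ler_wpM2l ?(ltW e10)//; lra.
Qed.

Lemma cdiffV z : z != 0 -> cdiff GRing.inv z.
Proof.
move=> z0; exists (- z ^- 2) => e e0.
have nz : 0 < nc z by rewrite nc_gt0.
exists (Num.min (nc z / 2) (e * nc z ^+ 3 / 2)).
  by rewrite lt_min !divr_gt0// mulr_gt0// exprn_gt0.
move=> w; rewrite lt_min => /andP[h1 h2].
have zw : nc z / 2 <= nc (z + w).
  have := ncB_ge z (- w); rewrite opprK ncN; lra.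
have zw0 : z + w != 0 by rewrite -nc_gt0; lra.
have -> : (z + w)^-1 - z^-1 - - z ^- 2 * w = w ^+ 2 * (z ^- 2 * (z + w)^-1).
  by field; rewrite zw0 z0.
have -> : nc (w ^+ 2 * (z ^- 2 * (z + w)^-1)) =
    nc w * (nc w * ((nc z ^+ 2)^-1 * (nc (z + w))^-1)).
  have w2 : nc (w ^+ 2) = nc w * nc w by rewrite ncX expr2.
  have zi : nc (z ^- 2) = (nc z ^+ 2)^-1 by rewrite ncV ncX.
  have zwi := ncV (z + w).
  by rewrite (ncM (w ^+ 2)) w2 (ncM (z ^- 2)) zi zwi -(mulrA (nc w)).
rewrite [leRHS]mulrC ler_wpM2l ?nc_ge0//.
apply: (@le_trans _ _ (nc w * ((nc z ^+ 2)^-1 * (nc z / 2)^-1))).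
  rewrite ler_wpM2l ?nc_ge0// ler_wpM2l ?invr_ge0 ?exprn_ge0 ?nc_ge0//.
  by rewrite lef_pV2 ?posrE//; lra.
rewrite (_ : nc w * _ = nc w / (nc z ^+ 3 / 2)); last by field; rewrite gt_eqF.
by rewrite ler_pdivrMr ?divr_gt0 ?exprn_gt0//; lra.
Qed.

Lemma cdiff_ext f g z : f =1 g -> cdiff f z -> cdiff g z.
Proof. by move=> /funext ->. Qed.

Lemma cdiff_near f g z r : 0 < r -> (forall w, nc w < r -> f (z + w) = g (z + w)) ->
  cdiff f z -> cdiff g z.
Proof.
move=> r0 fg [D hD]; exists D => e e0; have [d d0 hd] := hD e e0.
exists (Num.min d r); first by rewrite lt_min d0.
move=> w; rewrite lt_min => /andP[wd wr].
rewrite -fg//; have := fg 0; rewrite addr0 nc0 => <-//; exact: hd.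
Qed.

End complex_toolkit.

(** * Circle means in logarithmic polar coordinates *)

Section polar.
Context (R : realType).
Local Notation C := (Cplx R).

Definition cis (r y : R) : C := mkc (r * cos y) (r * sin y).

Lemma nc_cis r y : nc (cis r y) = `|r|.
Proof. by rewrite nc_mkc !exprMn -mulrDr cos2Dsin2 mulr1 sqrtr_sqr. Qed.

Lemma cisM r y s t : cis r y * cis s t = cis (r * s) (y + t).
Proof.
apply: complex_eq; rewrite ?reM ?imM /= ?cosD ?sinD; ring.
Qed.

Lemma cis2pi r y : cis r (y + pi *+ 2) = cis r y.
Proof. by rewrite /cis cosD2pi sinD2pi. Qed.

Lemma derive_lin (f : R -> R) (x m : R) : is_derive x 1 f m -> forall e, 0 < e ->
  exists2 d, 0 < d & forall h, `|h| < d -> `|f (x + h) - f x - m * h| <= e * `|h|.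
Proof.
move=> [df <-] e e0.
have /cvgrPdist_le /(_ _ e0) := df.
rewrite near_withinE => /nbhs_ballP[d /= d0 hd]; exists d => // h hh.
have [->|h0] := eqVneq h 0.
  by rewrite addr0 subrr mulr0 subr0 normr0 mulr0.
have : ball (0:R) d h by rewrite /ball/= sub0r normrN.
move=> /hd /(_ h0).
rewrite -/('D_1 f x) [h *: 1]mulr1 [_ *: _]/(_ * _) [h + x]addrC.
set D := 'D_1 f x => H.
have -> : f (x + h) - f x - D * h = - (h * (D - h^-1 * (f (x + h) - f x))).
  by field.
by rewrite normrN normrM mulrC ler_wpM2r.
Qed.

Lemma exp_lin (e : R) : 0 < e -> exists2 d, 0 < d & forall s t, `|s| < d -> `|t| < d ->
  nc (cis (expR s) t - 1 - mkc s t) <= e * (`|s| + `|t|).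
Proof.
(* The error terms below add up to at most 3a|s| + 5a|t|, hence the divisor 5. *)
move=> e0; have [a [e40 a1 ae]] : exists a : R, [/\ 0 < a, a <= 1 & a <= e / 5].
  exists (Num.min 1 (e / 5)); split.
  - by rewrite lt_min ltr01 divr_gt0.
  - by rewrite ge_min lexx.
  - by rewrite ge_min lexx orbT.
have [d1 d10 h1] := derive_lin (is_derive_expR 0) e40.
have [d2 d20 h2] := derive_lin (is_derive_cos 0) e40.
have [d3 d30 h3] := derive_lin (is_derive_sin 0) e40.
exists (Num.min (Num.min d1 d2) (Num.min d3 a)).
  by rewrite !lt_min d10 d20 d30.
move=> s t; rewrite !lt_min => /andP[/andP[s1 _] /andP[_ sa]] /andP[/andP[_ t2] /andP[t3 ta]].
have := h1 _ s1; have := h2 _ t2; have := h3 _ t3.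
rewrite !add0r sin0 cos0 expR0 !oppr0 !mul0r !oppr0 !addr0 !mul1r => {}h3 {}h2 {}h1.
apply: le_trans (nc_le_abs _) _.
rewrite !reB !imB /= subr0.
have c1 := cos_max t.
have -> : expR s * cos t - 1 - s = (expR s - 1 - s) * cos t + (1 + s) * (cos t - 1) by ring.
have -> : expR s * sin t - t = (expR s - 1 - s) * sin t + s * sin t + (sin t - t) by ring.
have s0 := normr_ge0 s; have t0 := normr_ge0 t.
have st : `|sin t| <= 2 * `|t|.
  have -> : sin t = (sin t - t) + t by ring.
  apply: le_trans (ler_normD _ _) _; nra.
have A1 : `|(expR s - 1 - s) * cos t| <= a * `|s|.
  by rewrite normrM -[leRHS]mulr1 ler_pM.
have A2 : `|(1 + s) * (cos t - 1)| <= 2 * (a * `|t|).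
  rewrite normrM ler_pM//; apply: le_trans (ler_normD _ _) _; rewrite normr1; lra.
have A3 : `|(expR s - 1 - s) * sin t| <= (a * `|s|) * 2.
  rewrite normrM ler_pM//; nra.
have A4 : `|s * sin t| <= a * (2 * `|t|).
  by rewrite normrM ler_pM// ltW.
apply: (@le_trans _ _ (5 * a * (`|s| + `|t|))).
  have := ler_normD ((expR s - 1 - s) * cos t) ((1 + s) * (cos t - 1)).
  have := ler_normD ((expR s - 1 - s) * sin t + s * sin t) (sin t - t).
  have := ler_normD ((expR s - 1 - s) * sin t) (s * sin t).
  have : 0 <= a * `|s| by rewrite mulr_ge0// ltW.
  have : 0 <= a * `|t| by rewrite mulr_ge0// ltW.
  lra.
rewrite ler_wpM2r ?addr_ge0//; lra.
Qed.

(** The chain rule for f(e^(x+iy)), whose complex derivative is D z. *)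
Lemma polar_cr (f : C -> C) (x y : R) : cdiff f (cis (expR x) y) ->
  cr_at (fun x y => re (f (cis (expR x) y))) (fun x y => im (f (cis (expR x) y))) x y.
Proof.
set z := cis _ _ => -[D hD]; exists (re (D * z)), (im (D * z)) => e e0.
have z0 := nc_ge0 z; have D0 := nc_ge0 D.
have [e1 e10 [h11 h12]] : exists2 e1, 0 < e1 & e1 <= 1 /\ e1 * (2 * nc z + nc D * nc z) <= e.
  exists (Num.min 1 (e / (2 * nc z + nc D * nc z + 1))).
    by rewrite lt_min ltr01 divr_gt0// ltr_wpDl// addr_ge0// mulr_ge0.
  split; first by rewrite ge_min lexx.
  have K0 : 0 <= 2 * nc z + nc D * nc z by rewrite addr_ge0// mulr_ge0.
  apply: (@le_trans _ _ (e / (2 * nc z + nc D * nc z + 1) * (2 * nc z + nc D * nc z))).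
    by rewrite ler_wpM2r// ge_min lexx orbT.
  rewrite mulrAC ler_pdivrMr; last lra.
  by rewrite ler_pM2l//; lra.
have [d d0 hd] := hD _ e10; have [d' d0' hd'] := exp_lin e10.
have m0 : 0 < Num.min d' (d / (4 * (nc z + 1))).
  by rewrite lt_min d0' divr_gt0// mulr_gt0//; lra.
exists (Num.min d' (d / (4 * (nc z + 1)))) => // s t; rewrite !lt_min => /andP[s1 s2] /andP[t1 t2].
have {}hd' := hd' _ _ s1 t1.
have s0 := normr_ge0 s; have t0 := normr_ge0 t.
pose g := cis (expR s) t - 1.
have gst : nc g <= 2 * (`|s| + `|t|).
  rewrite /g -[cis _ _ - 1](subrK (mkc s t)); apply: le_trans (ncD _ _) _.
  have h : nc (mkc s t) <= `|s| + `|t| := nc_le_abs (mkc s t).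
  have : e1 * (`|s| + `|t|) <= 1 * (`|s| + `|t|) by rewrite ler_wpM2r ?addr_ge0.
  lra.
have wE : cis (expR (x + s)) (y + t) = z + z * g.
  by rewrite expRD -cisM -/z /g; ring.
have zg : nc (z * g) < d.
  rewrite ncM; move: s2 t2; rewrite ltr_pdivlMr; last lra.
  rewrite ltr_pdivlMr; last lra.
  move=> s2 t2; apply: (@le_lt_trans _ _ (nc z * (2 * (`|s| + `|t|)))); first by rewrite ler_wpM2l.
  nra.
have main : nc (f (cis (expR (x + s)) (y + t)) - f z - D * z * mkc s t) <= e * (`|s| + `|t|).
  have -> : f (cis (expR (x + s)) (y + t)) - f z - D * z * mkc s t =
    (f (z + z * g) - f z - D * (z * g)) + D * z * (g - mkc s t) by rewrite wE; ring.
  apply: le_trans (ncD _ _) _; rewrite [nc (D * z * _)]ncM [nc (D * z)]ncM.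
  have h3 := hd _ zg; rewrite ncM in h3.
  apply: (@le_trans _ _ (e1 * (2 * nc z + nc D * nc z) * (`|s| + `|t|))).
    apply: (@le_trans _ _ (e1 * (nc z * (2 * (`|s| + `|t|))) + nc D * nc z * (e1 * (`|s| + `|t|)))).
      apply: lerD.
        by apply: le_trans h3 _; rewrite ler_wpM2l ?(ltW e10)// ler_wpM2l.
      by rewrite ler_wpM2l// mulr_ge0.
    by rewrite le_eqVlt; apply/orP; left; apply/eqP; ring.
  by rewrite ler_wpM2r// addr_ge0.
split.
  apply: le_trans main; have := abs_re_le (f (cis (expR (x + s)) (y + t)) - f z - D * z * mkc s t).
  by rewrite 2!reB [re (_ * mkc _ _)]reM.
apply: le_trans main; have := abs_im_le (f (cis (expR (x + s)) (y + t)) - f z - D * z * mkc s t).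
by rewrite 2!imB [im (_ * mkc _ _)]imM [re _ * _ + _]addrC.
Qed.

(** The imaginary part of the integral of f over the circle with respect to the angle; the real part
    is obtained by applying this to i f. *)
Definition imean (f : C -> C) (r : R) : R := Int (fun y => im (f (cis r y))) 0 (pi *+ 2).

Let pi2 : 0 < pi *+ 2 :> R. Proof. by rewrite mulrn_wgt0// pi_gt0. Qed.

Lemma imean_const (f : C -> C) r1 r2 r r' : 0 <= r1 -> r1 < r < r2 -> r1 < r' < r2 ->
  (forall z, r1 < nc z < r2 -> cdiff f z) -> imean f r = imean f r'.
Proof.
move=> r10 /andP[a1 a2] /andP[b1 b2] df.
(* The annulus is shrunk to m < |z| < M because r1 may be 0, where the logarithm is of no use. *)
pose m := (r1 + Num.min r r') / 2; pose M := (Num.max r r' + r2) / 2.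
have mr : r1 < Num.min r r' by rewrite lt_min a1.
have Mr : Num.max r r' < r2 by rewrite gt_max a2.
have rr : Num.min r r' <= r by rewrite ge_min lexx.
have rr' : Num.min r r' <= r' by rewrite ge_min lexx orbT.
have rM : r <= Num.max r r' by rewrite le_max lexx.
have rM' : r' <= Num.max r r' by rewrite le_max lexx orbT.
have m0 : 0 < m by rewrite /m; lra.
have r0 : 0 < r by lra.
have r0' : 0 < r' by lra.
have M0 : 0 < M by rewrite /M; lra.
have H := @periodic_mean R (fun x y => re (f (cis (expR x) y))) (fun x y => im (f (cis (expR x) y)))
  (ln m) (ln M) _ (pi *+ 2) pi2 _ (ln r) (ln r').
have : Int (fun y => im (f (cis (expR (ln r)) y))) 0 (pi *+ 2) =
       Int (fun y => im (f (cis (expR (ln r')) y))) 0 (pi *+ 2).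
  apply: H.
  - move=> x y /andP[x1 x2]; apply: polar_cr; apply: df.
    rewrite nc_cis ger0_norm ?expR_ge0//.
    have : m < expR x by rewrite -[m]lnK ?posrE// ltr_expR.
    have : expR x < M by rewrite -[M]lnK ?posrE// ltr_expR.
    rewrite /m /M; lra.
  - by move=> x; rewrite cis2pi.
  - by rewrite in_itv/= !ltr_ln ?posrE//; rewrite /m /M; lra.
  - by rewrite in_itv/= !ltr_ln ?posrE//; rewrite /m /M; lra.
by rewrite !lnK ?posrE.
Qed.

Lemma ccont_circle (f : C -> C) (r : R) : (forall y, ccont f (cis r y)) ->
  forall e, 0 < e -> forall y, \forall p \near (y, r), nc (f (cis p.2 p.1) - f (cis r y)) <= e.
Proof.
move=> cf e e0 y; have [d d0 hd] := cf y e e0.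
have d2 : 0 < d / 2 by lra.
have c1 : (fun p : R * R => p.2 * cos p.1) p @[p --> (y, r)] --> r * cos y.
  apply: cvgM; first exact: cvg_snd.
  by apply: (cvg_comp fst cos); [exact: cvg_fst|exact: continuous_cos].
have c2 : (fun p : R * R => p.2 * sin p.1) p @[p --> (y, r)] --> r * sin y.
  apply: cvgM; first exact: cvg_snd.
  by apply: (cvg_comp fst sin); [exact: cvg_fst|exact: continuous_sin].
move/cvgrPdist_lt : c1 => /(_ _ d2) c1; move/cvgrPdist_lt : c2 => /(_ _ d2) c2.
near=> p; apply: hd; apply: le_lt_trans (nc_le_abs _) _; rewrite reB imB /=.
have h1 : `|r * cos y - p.2 * cos p.1| < d / 2 by near: p.
have h2 : `|r * sin y - p.2 * sin p.1| < d / 2 by near: p.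
rewrite distrC [X in _ + X]distrC; lra.
Unshelve. all: by end_near. Qed.

Lemma ccont_circle1 (f : C -> C) (r : R) : (forall y, ccont f (cis r y)) ->
  forall e, 0 < e -> forall y, \forall y' \near y, nc (f (cis r y') - f (cis r y)) <= e.
Proof.
move=> cf e e0 y.
have /nbhs_ballP := ccont_circle cf e0 y.
move=> [d /= d0 hd]; apply/nbhs_ballP; exists d => // y' hy'.
have := hd (y', r); rewrite /ball/= => /(_ _) H.
by apply: H; split => //=; exact: ballxx.
Qed.

Lemma cont_circle (f : C -> C) (r : R) : (forall y, ccont f (cis r y)) ->
  forall a b, cont_on a b (fun y => im (f (cis r y))).
Proof.
move=> cf a b y _; apply/cvgrPdist_le => e e0.
have h := ccont_circle1 cf e0 y.
near=> y'; rewrite distrC -imB; apply: le_trans (abs_im_le _) _.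
by near: y'.
Unshelve. all: by end_near. Qed.

Lemma imean_bound (f g : C -> C) r s e :
  (forall y, ccont f (cis r y)) -> (forall y, ccont g (cis s y)) ->
  (forall y, 0 <= y <= pi *+ 2 -> nc (f (cis r y) - g (cis s y)) <= e) ->
  `|imean f r - imean g s| <= e * (pi *+ 2).
Proof.
move=> cf cg h.
rewrite /imean -IntB; [|exact: cont_circle|exact: cont_circle].
have := @Int_approx R (fun x => im (f (cis r x)) - im (g (cis s x))) 0 e 0 (pi *+ 2).
rewrite mul0r !subr0; apply; first exact: ltW.
  by move=> y hy; apply: continuousB; apply: cont_circle hy.
move=> y hy; rewrite subr0 -imB; apply: le_trans (abs_im_le _) _; exact: h.
Qed.

(** Compactness of the interval of angles makes the continuity of f uniform along the circle. *)
Lemma imean_cont (f : C -> C) (r : R) : (forall y, ccont f (cis r y)) ->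
  (\forall s \near r, forall y, ccont f (cis s y)) ->
  forall e, 0 < e -> \forall s \near r, `|imean f s - imean f r| <= e.
Proof.
move=> cf cf' e e0.
pose e1 := e / (2 * (pi *+ 2)).
have e10 : 0 < e1 by rewrite divr_gt0// mulr_gt0.
have K : compact `[(0:R), pi *+ 2] by exact: segment_compact.
have /compact_near_coveringP/(_ R (nbhs r) (fun s y => nc (f (cis s y) - f (cis r y)) <= e1 *+ 2)) := K.
have FF : Filter (nbhs r) by exact: nbhs_filter.
move=> /(_ FF) H.
have {}H : \forall s \near r, `[(0:R), pi *+ 2] `<=` (fun y => nc (f (cis s y) - f (cis r y)) <= e1 *+ 2).
  apply: H => y _.
  have h1 := ccont_circle cf e10 y.
  have h2 := ccont_circle1 cf e10 y.
  have h3 : \forall p \near (y, r), nc (f (cis r p.1) - f (cis r y)) <= e1.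
    exact: (cvg_fst (F := nbhs y) (G := nbhs r)) h2.
  near=> p.
  have -> : f (cis p.2 p.1) - f (cis r p.1) = (f (cis p.2 p.1) - f (cis r y)) - (f (cis r p.1) - f (cis r y)) by ring.
  by apply: le_trans (ncB _ _) _; rewrite mulr2n lerD//; near: p.
near=> s.
have cs : forall y, ccont f (cis s y) by near: s.
have -> : e = (e1 *+ 2) * (pi *+ 2).
  by move: pi2; rewrite /e1; move: (pi *+ 2) => q q0; field; rewrite gt_eqF.
apply: imean_bound => // y hy.
have : `[(0:R), pi *+ 2] `<=` (fun y => nc (f (cis s y) - f (cis r y)) <= e1 *+ 2) by near: s.
by apply; rewrite /= in_itv/=.
Unshelve. all: by end_near. Qed.

(* On the circle of radius [rho] continuity suffices: for Cauchy's formula at [w],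
   the difference quotient at [w] is only known to be continuous at [w]. *)
Lemma imean_center (f : C -> C) (rho R0 r : R) : 0 <= rho -> 0 < r < R0 ->
  (forall z, nc z < R0 -> ccont f z) ->
  (forall z, 0 < nc z < R0 -> nc z != rho -> cdiff f z) ->
  imean f r = im (f 0) * (pi *+ 2).
Proof.
move=> rho0 /andP[r0 rR] cf df.
have ccis (s : R) : `|s| < R0 -> forall y, ccont f (cis s y) by move=> h y; apply: cf; rewrite nc_cis.
have M0 : imean f 0 = im (f 0) * (pi *+ 2).
  rewrite /imean.
  have -> : (fun y => im (f (cis 0 y))) = (fun=> im (f 0)).
    apply/funext => y; congr (im (f _)); apply: complex_eq; rewrite /cis /mkc /re /im /= mul0r//.
  by rewrite Int_cst ?subr0// ltW.
have nearR (s : R) : `|s| < R0 -> \forall t \near s, `|t| < R0.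
  move=> h; have d0 : 0 < R0 - `|s| by lra.
  apply/nbhs_ballP; exists (R0 - `|s|) => //= t; rewrite /ball/= => ht.
  have := ler_normD (t - s) s; rewrite subrK distrC; lra.
have cM (s : R) : `|s| < R0 -> forall e, 0 < e -> \forall t \near s, `|imean f t - imean f s| <= e.
  move=> h e e0; apply: imean_cont => //; first exact: ccis.
  by near=> t; apply: ccis; near: t; exact: nearR.
(* constancy on [s, t] passes to the closure by continuity of the mean *)
have closeL s (c : R) : 0 <= s < R0 ->
    (exists2 d, 0 < d & forall t, `|t - s| < d -> s < t -> imean f t = c) -> imean f s = c.
  move=> /andP[s0 sR] [d d0 hd]; apply/eqP; rewrite -subr_eq0 -normr_le0.
  apply/ler_addgt0Pr => e e0; rewrite add0r.
  have /nbhs_ballP[d' /= d'0 hd'] := cM s ltac:(by rewrite ger0_norm) e e0.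
  pose m := Num.min d d'; have m0 : 0 < m by rewrite lt_min d0.
  have m1 : m <= d by rewrite ge_min lexx.
  have m2 : m <= d' by rewrite ge_min lexx orbT.
  have tt : `|s + m / 2 - s| = m / 2 by rewrite addrC addKr ger0_norm; lra.
  rewrite distrC -(hd (s + m / 2)); [|rewrite tt; lra|lra].
  by apply: hd'; rewrite /ball/= distrC tt; lra.
have closeR s (c : R) : 0 < s < R0 ->
    (exists2 d, 0 < d & forall t, `|t - s| < d -> t < s -> imean f t = c) -> imean f s = c.
  move=> /andP[s0 sR] [d d0 hd]; apply/eqP; rewrite -subr_eq0 -normr_le0.
  apply/ler_addgt0Pr => e e0; rewrite add0r.
  have /nbhs_ballP[d' /= d'0 hd'] := cM s ltac:(by rewrite ger0_norm ?(ltW s0)) e e0.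
  pose m := Num.min d d'; have m0 : 0 < m by rewrite lt_min d0.
  have m1 : m <= d by rewrite ge_min lexx.
  have m2 : m <= d' by rewrite ge_min lexx orbT.
  have tt : `|s - m / 2 - s| = m / 2 by rewrite addrAC subrr add0r normrN ger0_norm; lra.
  rewrite distrC -(hd (s - m / 2)); [|rewrite tt; lra|lra].
  by apply: hd'; rewrite /ball/= distrC tt; lra.
have inner t : 0 < t -> t < rho -> t < R0 -> imean f t = imean f 0.
  move=> t0 trho tR; apply/esym/closeL; first lra.
  exists t => // s st s0.
  apply: (@imean_const f 0 (Num.min rho R0)); rewrite ?lt_min//.
    by move: st; rewrite subr0 ger0_norm ?(ltW s0)//; lra.
    by rewrite t0 trho.
  move=> z; rewrite lt_min => /andP[z0 /andP[z1 z2]]; apply: df; first by rewrite z0.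
  by rewrite lt_eqF.
have [rrho|rrho|rrho] := ltgtP r rho; first by rewrite inner.
- have E : imean f r = imean f rho.
    apply/esym/closeL; first lra.
    exists (r - rho); first lra.
    move=> t ht tr; apply: (@imean_const f rho R0) => //.
    + by move: ht; rewrite ger0_norm; lra.
    + by rewrite rrho.
    + by move=> z hz; apply: df; [lra|rewrite gt_eqF//; case/andP: hz].
  rewrite E; have [->//|rho1] := eqVneq rho 0.
  have {}rho0 : 0 < rho by rewrite lt_neqAle eq_sym rho1.
  rewrite -M0; apply: closeR; first lra.
  exists rho => // t ht tr; apply: inner => //; last lra.
  by move: ht; rewrite ltr_distl; lra.
- rewrite rrho -M0; apply: closeR; first lra.
  exists rho; first lra.
  move=> t ht tr; apply: inner => //; last lra.
  by move: ht; rewrite ltr_distl; lra.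
Unshelve. all: by end_near. Qed.

End polar.

(** * Cauchy's formula and Taylor coefficients *)

Section cauchy.
Context (R : realType).
Local Notation C := (Cplx R).
Implicit Types (f g : C -> C) (z w c : C) (r : R).

Let pi2 : 0 < pi *+ 2 :> R. Proof. by rewrite mulrn_wgt0// pi_gt0. Qed.

Lemma ofRM (x y : R) : ofR (x * y) = ofR x * ofR y.
Proof. by apply: complex_eq; rewrite ?reM ?imM /=; ring. Qed.

Lemma ofR_eq0 (x : R) : (ofR x == 0) = (x == 0).
Proof. by rewrite -nc_eq0 nc_ofR normr_eq0. Qed.

Lemma ofRV (x : R) : ofR x^-1 = (ofR x)^-1.
Proof.
have [->|x0] := eqVneq x 0; first by rewrite invr0 -[in RHS]/(0 : C) invr0.
have c0 : ofR x != 0 by rewrite ofR_eq0.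
by apply: (mulfI c0); rewrite -ofRM !mulfV.
Qed.

Lemma ofRX (x : R) n : ofR (x ^+ n) = ofR x ^+ n.
Proof. by elim: n => [|n IH]; rewrite ?expr0// !exprS ofRM IH. Qed.

Definition iC : C := mkc 0 1.

Lemma im_iC z : im (iC * z) = re z.
Proof. by rewrite imM /= mul0r add0r mul1r. Qed.

Lemma cdiffZ c (f : C -> C) z : cdiff f z -> cdiff (fun w => c * f w) z.
Proof. by move=> h; apply: cdiffM => //; exact: cdiff_cst. Qed.

Lemma cdiffB (f g : C -> C) z : cdiff f z -> cdiff g z -> cdiff (fun w => f w - g w) z.
Proof.
move=> hf hg; apply: (@cdiff_ext _ (fun w => f w + -1 * g w)).
  by move=> w; rewrite mulN1r.
by apply: cdiffD => //; exact: cdiffZ.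
Qed.

Definition on_circle (r : R) (f : C -> C) := forall y, ccont f (cis r y).

Lemma cdiff_circle r f : (forall z, nc z = r -> cdiff f z) -> 0 <= r -> on_circle r f.
Proof. by move=> h r0 y; apply: cdiff_cont; apply: h; rewrite nc_cis ger0_norm. Qed.

Definition cmean (f : C -> C) (r : R) : C :=
  ofR (pi *+ 2)^-1 * mkc (imean (fun z => iC * f z) r) (imean f r).

Lemma ccontZ c (f : C -> C) z : ccont f z -> ccont (fun w => c * f w) z.
Proof.
move=> h e e0.
have c0 : 0 < nc c + 1 by have := nc_ge0 c; lra.
have [d d0 hd] := h _ (divr_gt0 e0 c0); exists d => // w /hd.
rewrite -mulrBr ncM ler_pdivlMr// => H; apply: le_trans H.
rewrite mulrC ler_wpM2l ?nc_ge0//; lra.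
Qed.

Lemma ccontD (f g : C -> C) z : ccont f z -> ccont g z -> ccont (fun w => f w + g w) z.
Proof.
move=> hf hg e e0; have e2 : 0 < e / 2 by lra.
have [d d0 hd] := hf _ e2; have [d' d0' hd'] := hg _ e2.
exists (Num.min d d'); first by rewrite lt_min d0.
move=> w; rewrite lt_min => /andP[/hd h1 /hd' h2].
by rewrite opprD addrACA; apply: le_trans (ncD _ _) _; lra.
Qed.

Lemma imeanD f g r : on_circle r f -> on_circle r g ->
  imean (fun z => f z + g z) r = imean f r + imean g r.
Proof.
move=> cf cg; rewrite /imean -IntD; [|exact: cont_circle|exact: cont_circle].
by apply: eq_Int => y _; rewrite imD.
Qed.

Lemma imeanZ k f r : on_circle r f ->
  imean (fun z => ofR k * f z) r = k * imean f r.
Proof.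
move=> cf; rewrite /imean -IntZ; last exact: cont_circle.
by apply: eq_Int => y _; rewrite imZ.
Qed.

Lemma eq_imean f g r : (forall z, nc z = `|r| -> f z = g z) -> imean f r = imean g r.
Proof. by move=> h; apply: eq_Int => y _; rewrite h// nc_cis. Qed.

Lemma eq_cmean f g r : (forall z, nc z = `|r| -> f z = g z) -> cmean f r = cmean g r.
Proof.
by move=> h; rewrite /cmean (eq_imean h) (@eq_imean _ (fun z => iC * g z))// => z /h ->.
Qed.

Lemma cmeanD f g r : on_circle r f -> on_circle r g ->
  cmean (fun z => f z + g z) r = cmean f r + cmean g r.
Proof.
move=> cf cg; rewrite /cmean imeanD// -mulrDr; congr (_ * _).
rewrite (@eq_imean _ (fun z => iC * f z + iC * g z)) => [|z _]; last by rewrite mulrDr.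
rewrite imeanD; [by apply: complex_eq|by move=> y; apply: ccontZ|by move=> y; apply: ccontZ].
Qed.

Lemma cmeanZ c f r : on_circle r f -> cmean (fun z => c * f z) r = c * cmean f r.
Proof.
move=> cf; rewrite /cmean mulrCA; congr (_ * _).
have ci : on_circle r (fun z => iC * f z) by move=> y; apply: ccontZ.
have E g : on_circle r g -> imean (fun z => c * g z) r =
    re c * imean g r + im c * imean (fun z => iC * g z) r.
  move=> cg; have cig : on_circle r (fun z => iC * g z) by move=> y; apply: ccontZ.
  rewrite -!imeanZ// -imeanD; [|by move=> y; apply: ccontZ|by move=> y; apply: ccontZ].
  apply: eq_Int => y _; rewrite imD !imZ im_iC imM addrC; ring.
rewrite (E f cf) (@eq_imean _ (fun z => c * (iC * f z))) => [|z _]; last by rewrite mulrCA.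
rewrite (E _ ci) (@eq_imean (fun z => iC * (iC * f z)) (fun z => ofR (-1) * f z)) => [|z _]; last first.
  by rewrite mulrA; congr (_ * _); apply: complex_eq; rewrite ?reM ?imM /=; ring.
rewrite imeanZ//; apply: complex_eq; rewrite ?reM ?imM /=; ring.
Qed.

(** The factor 2 results from estimating real and imaginary parts separately. *)
Lemma nc_cmean f r B : on_circle r f -> (forall z, nc z = `|r| -> nc (f z) <= B) ->
  nc (cmean f r) <= 2 * B.
Proof.
move=> cf fB.
have H g : on_circle r g -> (forall z, nc z = `|r| -> nc (g z) <= B) -> `|imean g r| <= B * (pi *+ 2).
  move=> cg gB.
  have c0 : on_circle r (fun=> 0) by move=> y; apply: cdiff_cont; exact: cdiff_cst.
  have := @imean_bound _ g (fun=> 0) r r B cg c0.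
  have -> : imean (fun=> 0) r = 0 :> R.
    by rewrite /imean Int_cst ?mul0r// ltW.
  rewrite subr0; apply => y _; rewrite subr0; apply: gB; exact: nc_cis.
rewrite /cmean ncM nc_ofR ger0_norm ?invr_ge0 ?(ltW pi2)//.
rewrite ler_pdivrMl//; apply: le_trans (nc_le_abs _) _; rewrite /=.
have h1 : `|imean f r| <= B * (pi *+ 2) by apply: H.
have h2 : `|imean (fun z => iC * f z) r| <= B * (pi *+ 2).
  apply: H; first by move=> y; apply: ccontZ.
  move=> z /fB; rewrite ncM nc_mkc expr0n expr1n add0r sqrtr1 mul1r//.
have -> : pi *+ 2 * (2 * B) = B * (pi *+ 2) + B * (pi *+ 2) by ring.
exact: lerD.
Qed.

Lemma cmean_center f rho R0 r : 0 <= rho -> 0 < r < R0 ->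
  (forall z, nc z < R0 -> ccont f z) ->
  (forall z, 0 < nc z < R0 -> nc z != rho -> cdiff f z) -> cmean f r = f 0.
Proof.
move=> rho0 rR cf df; rewrite /cmean.
rewrite (imean_center rho0 rR cf df) (imean_center (f := fun z => iC * f z) rho0 rR); last 2 first.
- by move=> z /cf; exact: ccontZ.
- by move=> z z1 z2; apply: cdiffZ; exact: df.
rewrite im_iC; apply: complex_eq; rewrite ?reZ ?imZ /=.
  by rewrite mulrC mulfK// gt_eqF.
by rewrite mulrC mulfK// gt_eqF.
Qed.

Lemma pow2V_neq1 n : (0 < n)%N -> ((2 : R) ^+ n)^-1 != 1.
Proof.
move=> n0; have h : 1 < (2 : R) ^+ n.
  case: n n0 => // n _; rewrite exprS.
  have h2 : 1 <= (2 : R) ^+ n by elim: n => [|n IH]; rewrite ?expr0 // exprS; lra.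
  by move: (_ ^+ _) h2 => x; lra.
by rewrite invr_eq1; apply: contraTneq h => ->; rewrite ltxx.
Qed.

(** The mean of z^-n does not depend on the radius, yet doubling the radius multiplies it by 2^-n,
    which differs from 1. *)
Lemma cmean_pole n r : (0 < n)%N -> 0 < r -> cmean (fun z => z ^- n) r = 0.
Proof.
move=> n0 r0.
have df z : 0 < nc z -> cdiff (fun z : C => z ^- n) z.
  rewrite nc_gt0 => z0; apply: (@cdiff_ext _ (fun w => (w^-1) ^+ n)).
    by move=> w; rewrite exprVn.
  elim: n {n0} => [|n IH].
    by apply: (@cdiff_ext _ (fun=> 1)) => //; exact: cdiff_cst.
  apply: (@cdiff_ext _ (fun w => w^-1 * (w^-1) ^+ n)); first by move=> w; rewrite exprS.
  by apply: cdiffM => //; exact: cdiffV.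
have H c : imean (fun z => c * z ^- n) r = 0.
  have dc z : 0 < nc z -> cdiff (fun z : C => c * z ^- n) z by move=> /df; exact: cdiffZ.
  have cc : on_circle r (fun z => c * z ^- n).
    by apply: cdiff_circle; [move=> z zr; apply: dc; rewrite zr|exact: ltW].
  have E : imean (fun z => c * z ^- n) r = imean (fun z => c * z ^- n) (2 * r).
    apply: (@imean_const _ _ 0 (3 * r)) => //; [lra|lra|].
    by move=> z /andP[z0 _]; exact: dc.
  have [k kE k1] : exists2 k : R, ofR k = (ofR (2 : R) ^+ n)^-1 & k != 1.
    exists ((2 ^+ n)^-1); first by rewrite ofRV ofRX.
    exact: pow2V_neq1.
  have E2 : imean (fun z => c * z ^- n) (2 * r) = k * imean (fun z => c * z ^- n) r.
    have e3 y : c * cis (2 * r) y ^- n = ofR k * (c * cis r y ^- n).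
      have -> : cis (2 * r) y = ofR 2 * cis r y.
        by apply: complex_eq; rewrite ?reZ ?imZ /=; ring.
      by rewrite exprMn invfM kE mulrCA.
    rewrite -(imeanZ k cc) /imean.
    by apply: (@eq_Int R _ (fun y => im (ofR k * (c / cis r y ^+ n)))) => y _; exact: (congr1 (@im R) (e3 y)).
  have : (1 - k) * imean (fun z => c * z ^- n) r = 0.
    by rewrite mulrBl mul1r -E2 -E subrr.
  move=> /eqP; rewrite mulf_eq0 => /orP[|/eqP//].
  by rewrite subr_eq0 => /eqP k1'; case/eqP: k1.
rewrite /cmean (H iC).
have := H 1; rewrite (@eq_imean _ (fun z => z ^- n)) => [->|z _]; last by rewrite mul1r.
by apply: complex_eq; rewrite ?reZ ?imZ /= mulr0.
Qed.

Lemma cmean_cst c r : cmean (fun=> c) r = c.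
Proof.
have E (d : C) : imean (fun=> d) r = im d * (pi *+ 2).
  by rewrite /imean Int_cst ?subr0// ltW.
rewrite /cmean !E im_iC; apply: complex_eq; rewrite ?reZ ?imZ /=.
  by rewrite mulrC mulfK// gt_eqF.
by rewrite mulrC mulfK// gt_eqF.
Qed.

Section taylor.
Variables (f : C -> C) (R0 r : R).
Hypotheses (df : forall z, nc z < R0 -> cdiff f z) (rR : 0 < r < R0).

Definition tcoef (n : nat) : C := cmean (fun z => f z * z ^- n) r.

Let r0 : 0 < r. Proof. by case/andP: rR. Qed.

Let cV n z : nc z = r -> cdiff (fun z : C => z ^- n) z.
Proof.
move=> zr; have z0 : z != 0 by rewrite -nc_gt0 zr.
apply: (@cdiff_ext _ (fun w => (w^-1) ^+ n)); first by move=> w; rewrite exprVn.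
elim: n => [|n IH].
  by apply: (@cdiff_ext _ (fun=> 1)) => //; exact: cdiff_cst.
apply: (@cdiff_ext _ (fun w => w^-1 * (w^-1) ^+ n)); first by move=> w; rewrite exprS.
by apply: cdiffM => //; exact: cdiffV.
Qed.

Let dfr z : nc z = r -> cdiff f z.
Proof. by move=> zr; apply: df; rewrite zr; case/andP: rR. Qed.

Variable w : C.
Hypothesis wr : nc w < r.

(** The mean over |z| = r is the N-th Taylor remainder of f at w for N > 0, and zero for N = 0. *)
Let Rem N (z : C) := w ^+ N * (z ^- N * (z * ((f z - f w) * (z - w)^-1))).

Let dRem N z : nc z = r -> cdiff (Rem N) z.
Proof.
move=> zr; apply: cdiffZ; apply: cdiffM; first exact: cV.
apply: cdiffM; first exact: cdiff_id.
apply: cdiffM; first by apply: cdiffB; [exact: dfr|exact: cdiff_cst].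
have zw : z - w != 0 by rewrite subr_eq0; apply: contraTneq wr => <-; rewrite zr ltxx.
have [D hD] := cdiffV zw; exists D => e /hD[d d0 hd]; exists d => // u /hd.
by rewrite (addrAC z u).
Qed.

(** Cauchy's formula: z (f z - f w) / (z - w), completed at w by the derivative, is continuous,
    holomorphic off the circle through w, and zero at the origin; its mean is its value there. *)
Lemma Rem0 : cmean (Rem 0) r = 0.
Proof.
have wR : nc w < R0 by case/andP: rR => _; exact: lt_trans.
have [D hD] := df wR.
pose g z := z * (if z == w then D else (f z - f w) * (z - w)^-1).
have dg z : nc z < R0 -> z != w -> cdiff g z.
  move=> zR zw; have zw0 : 0 < nc (z - w) by rewrite nc_gt0 subr_eq0.
  apply: (@cdiff_near _ (fun z => z * ((f z - f w) * (z - w)^-1)) _ _ _ zw0).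
    move=> u uz; rewrite /g ifF//; apply/negbTE; apply: contraTneq uz => <-.
    by rewrite opprD addrA subrr sub0r ncN ltxx.
  apply: cdiffM; first exact: cdiff_id.
  apply: cdiffM; first by apply: cdiffB; [exact: df|exact: cdiff_cst].
  have zw' : z - w != 0 by rewrite subr_eq0.
  have [E hE] := cdiffV zw'; exists E => e /hE[d d0 hd]; exists d => // u /hd.
  by rewrite (addrAC z u).
have cg z : nc z < R0 -> ccont g z.
  move=> zR; have [->|zw] := eqVneq z w; last exact/cdiff_cont/dg.
  have ch : ccont (fun z => if z == w then D else (f z - f w) * (z - w)^-1) w.
    move=> e e0; have [d d0 hd] := hD e e0; exists d => // u ud.
    rewrite eqxx; have [_|uw] := eqVneq u w; first by rewrite subrr nc0 ltW.
    have uw0 : 0 < nc (u - w) by rewrite nc_gt0 subr_eq0.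
    have := hd _ ud; rewrite (_ : w + (u - w) = u) => [h|]; last by rewrite addrC subrK.
    have -> : (f u - f w) * (u - w)^-1 - D = (f u - f w - D * (u - w)) * (u - w)^-1.
      by field; rewrite subr_eq0.
    by rewrite ncM ncV ler_pdivrMr.
  have h1 := cdiff_cont (cdiff_id w).
  move=> e e0.
  set h := (fun z => if z == w then D else _) in ch.
  have K0 : 0 < nc (h w) + nc w + 1 by have := nc_ge0 (h w); have := nc_ge0 w; lra.
  have e10 : 0 < Num.min 1 (e / (nc (h w) + nc w + 1)) by rewrite lt_min ltr01 divr_gt0.
  have [d d0 hd] := ch _ e10; have [d' d0' hd'] := h1 _ e10.
  exists (Num.min d d'); first by rewrite lt_min d0.
  move=> u; rewrite lt_min => /andP[/hd a1 /hd' a2].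
  rewrite -/(h u) -/(h w) in a1 *; rewrite /g -/(h u) -/(h w).
  have -> : u * h u - w * h w = (u - w) * (h u - h w) + ((u - w) * h w + w * (h u - h w)) by ring.
  set m := Num.min _ _ in e10 a1 a2.
  have m1 : m <= 1 by rewrite ge_min lexx.
  have m2 : m * (nc (h w) + nc w + 1) <= e by rewrite -ler_pdivlMr// ge_min lexx orbT.
  apply: le_trans (ncD _ _) _; apply: le_trans (lerD (lexx _) (ncD _ _)) _; rewrite !ncM.
  have n1 := nc_ge0 (h w); have n2 := nc_ge0 w.
  apply: le_trans m2; rewrite mulrDr mulr1 addrC mulrDr lerD ?lerD//.
  - by rewrite ler_wpM2r.
  - by rewrite mulrC ler_wpM2r.
  - by rewrite -[leRHS]mulr1 ler_pM ?nc_ge0// (le_trans a1).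
have := @cmean_center g (nc w) R0 r (nc_ge0 w) rR cg.
rewrite (_ : g 0 = 0); last by rewrite /g mul0r.
move=> <-; last first.
  by move=> z /andP[_ zR] zw; apply: dg => //; apply: contraNneq zw => ->.
apply: eq_cmean => z zr; rewrite /Rem expr0 invr1 !mul1r /g ifF//.
apply/negbTE; apply: contraTneq wr => <-.
by rewrite zr ger0_norm ?ltxx// ltW.
Qed.

(** One step of the geometric expansion of z / (z - w). The mean of z^-N vanishes unless N = 0,
    which is why f w enters only once. *)
Lemma RemS N : cmean (Rem N) r = w ^+ N * tcoef N - (if N == 0%N then f w else 0) + cmean (Rem N.+1) r.
Proof.
have c1 : on_circle r (fun z => f z * z ^- N).
  by apply: cdiff_circle (ltW r0) => z zr; apply: cdiffM; [exact: dfr|exact: cV].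
have c2 : on_circle r (fun z => z ^- N) by apply: cdiff_circle (ltW r0) => z; exact: cV.
have c3 : on_circle r (Rem N.+1) by apply: cdiff_circle (ltW r0) => z; exact: dRem.
rewrite (@eq_cmean _ (fun z => (w ^+ N * (f z * z ^- N) + - (w ^+ N * f w) * (z ^- N)) + Rem N.+1 z)); last first.
  move=> z; rewrite ger0_norm ?(ltW r0)// => zr.
  have z0 : z != 0 by rewrite -nc_gt0 zr.
  have zw : z - w != 0 by rewrite subr_eq0; apply: contraTneq wr => <-; rewrite zr ltxx.
  by rewrite /Rem !exprS; field; rewrite zw z0 expf_neq0.
rewrite cmeanD//; last by move=> y; apply: ccontD; apply: ccontZ.
rewrite cmeanD; [|by move=> y; apply: ccontZ|by move=> y; apply: ccontZ].
rewrite (cmeanZ (w ^+ N) c1) (cmeanZ (- (w ^+ N * f w)) c2) -/(tcoef N).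
congr (_ + _); congr (_ + _).
case: eqP => [->|/eqP N0]; last by rewrite cmean_pole ?lt0n// mulr0 oppr0.
rewrite (@eq_cmean _ (fun=> 1)) => [|z _]; last by rewrite expr0 invr1.
by rewrite cmean_cst expr0 mul1r mulr1.
Qed.

Lemma taylor_rem N B : (forall z, nc z = r -> nc (f z) <= B) ->
  nc (f w - \sum_(n < N) tcoef n * w ^+ n) <=
    (nc w / r) ^+ N * (2 * (r / (r - nc w) * (B + nc (f w)))).
Proof.
move=> fB.
have rw : 0 < r - nc w by rewrite subr_gt0.
have H M : \sum_(n < M) tcoef n * w ^+ n - (if M == 0%N then 0 else f w) + cmean (Rem M) r = 0.
  elim: M => [|M IH]; first by rewrite big_ord0 subr0 add0r Rem0.
  have := IH; rewrite RemS big_ord_recr/=.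
  move: (cmean _ _) (tcoef M) (w ^+ M) (\sum_(n < M) _) (f w) => A T W S F.
  by case: (M == 0%N) => <-; ring.
case: N => [|N].
  rewrite big_ord0 subr0 expr0 mul1r.
  have B0 : 0 <= B by apply: le_trans (nc_ge0 _) (fB (cis r 0) _); rewrite nc_cis ger0_norm// ltW.
  have k1 : 1 <= r / (r - nc w) by rewrite ler_pdivlMr// mul1r; have := nc_ge0 w; lra.
  have := nc_ge0 (f w); nra.
have -> : f w - \sum_(n < N.+1) tcoef n * w ^+ n = cmean (Rem N.+1) r.
  have := H N.+1; rewrite /=.
  move: (cmean _ _) (\sum_(n < N.+1) _) => A S h.
  have h2 : f w - S - A = - (S - f w + A) by ring.
  by apply/eqP; rewrite -subr_eq0 h2 h oppr0.
have c3 : on_circle r (Rem N.+1) by apply: cdiff_circle (ltW r0) => z; exact: dRem.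
rewrite mulrCA; apply: nc_cmean => // z; rewrite ger0_norm ?(ltW r0)// => zr.
rewrite /Rem ncM ncX ncM ncV ncX zr mulrA -exprVn -exprMn ler_wpM2l ?exprn_ge0 ?divr_ge0 ?nc_ge0 ?(ltW r0)//.
rewrite !ncM zr ncV -mulrA ler_wpM2l ?(ltW r0)// mulrC ler_pM ?invr_ge0 ?nc_ge0//.
  by rewrite lef_pV2 ?posrE//; have := ncB_ge z w; rewrite zr; lra.
apply: le_trans (ncB _ _) _; rewrite lerD2r; exact: fB.
Qed.

End taylor.

Lemma tcoef0 f R0 r : (forall z, nc z < R0 -> cdiff f z) -> 0 < r < R0 -> tcoef f r 0 = f 0.
Proof.
move=> df rR; rewrite /tcoef (@eq_cmean _ f) => [|z _]; last by rewrite expr0 invr1 mulr1.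
apply: (@cmean_center f 0 R0) => // z; first by move=> /df/cdiff_cont.
by move=> /andP[_ /df].
Qed.

Lemma circle_bound f r : on_circle r f ->
  exists B, forall y, 0 <= y <= pi *+ 2 -> nc (f (cis r y)) <= B.
Proof.
move=> cf.
have K : compact `[(0:R), pi *+ 2] by exact: segment_compact.
have /compact_near_coveringP/(_ R +oo (fun M y => nc (f (cis r y)) <= M)) := K.
move=> /(_ _) H.
have {}H : \forall M \near +oo, `[(0:R), pi *+ 2] `<=` (fun y => nc (f (cis r y)) <= M).
  apply: H => y _.
  have h2 := ccont_circle1 cf ltr01 y.
  near=> y' M => /=.
  have h : nc (f (cis r y') - f (cis r y)) <= 1 by near: y'.
  rewrite -[f (cis r y')](subrK (f (cis r y))); apply: le_trans (ncD _ _) _.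
  apply: (@le_trans _ _ (1 + nc (f (cis r y)))); first by rewrite lerD2r.
  by near: M; apply: nbhs_pinfty_ge; rewrite num_real.
have [M [_ hM]] := H; exists (M + 1) => y hy.
by apply: (hM (M + 1)); rewrite /= ?in_itv//= ltrDl.
Unshelve. all: by end_near. Qed.

End cauchy.

(** * Holomorphy in several variables *)

Section holomorphy.
Context (R : realType) (m : nat).
Local Notation C := (Cplx R).
Implicit Types (f : 'rV[C]_m -> C^o) (z h : 'rV[C]_m).

Definition N1 h : R := \sum_j nc (h 0 j).

(** Frechet differentiability with explicit partial derivatives and the real-valued l^1 norm. *)
Definition hdiff f z := exists c : 'I_m -> C, forall e : R, 0 < e ->
  exists2 d : R, 0 < d & forall h, N1 h < d ->
    nc (f (z + h) - f z - \sum_j c j * h 0 j : C) <= e * N1 h.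

Lemma N1_ge0 h : 0 <= N1 h. Proof. by apply: sumr_ge0 => j _; exact: nc_ge0. Qed.

Lemma N1_ge h j : nc (h 0 j) <= N1 h.
Proof. by rewrite /N1 (bigD1 j)//= lerDl sumr_ge0// => k _; exact: nc_ge0. Qed.

Lemma N1Z c h : N1 (c *: h) = nc c * N1 h.
Proof. by rewrite /N1 mulr_sumr; apply: eq_bigr => j _; rewrite mxE ncM. Qed.

Lemma N1D h h' : N1 (h + h') <= N1 h + N1 h'.
Proof. by rewrite /N1 -big_split; apply: ler_sum => j _; rewrite mxE ncD. Qed.

Lemma N1_lt h d : (forall j, nc (h 0 j) <= d) -> N1 h <= m%:R * d.
Proof.
move=> hd; apply: (@le_trans _ _ (\sum_(j < m) d)); first exact: ler_sum.
by rewrite sumr_const card_ord mulr_natl.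
Qed.

Lemma normC_nc (z : C) : `|z| = ofR (nc z). Proof. by []. Qed.

Lemma ofR_le (x y : R) : (ofR x <= ofR y) = (x <= y). Proof. exact: lecR. Qed.
Lemma ofR_lt (x y : R) : (ofR x < ofR y) = (x < y). Proof. exact: ltcR. Qed.

Lemma ofRn k : ofR k%:R = k%:R :> C.
Proof.
elim: k => [|k IH]; first by apply: complex_eq.
by rewrite -natr1 -[in RHS]natr1 -IH; apply: complex_eq; rewrite ?reD ?imD /=; ring.
Qed.

Lemma Cpos (e : C) : 0 < e -> exists2 x : R, 0 < x & e = ofR x.
Proof.
case: e => a b; rewrite ltcE /= => /andP[/eqP b0 a0]; exists a => //.
by rewrite b0.
Qed.

Lemma norm_le_N1 h : `|h| <= ofR (N1 h).
Proof.
have [->|] := eqVneq `|h| 0; first by rewrite ofR_le N1_ge0.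
move=> h0; have [[i j] /= E] := mx_norm_neq0 h0.
by rewrite (E : `|h| = _) ord1 normC_nc ofR_le N1_ge.
Qed.

Lemma norm_ge_coord h j : ofR (nc (h 0 j)) <= `|h|.
Proof.
have H ij : `|h ij.1 ij.2| <= mx_norm h.
  by rewrite mx_normE -[leLHS]nngE num_le; exact: le_bigmax.
exact: (H (0, j)).
Qed.

Lemma norm_ge_N1 h : ofR (N1 h) <= m%:R * `|h|.
Proof.
rewrite /N1 (big_morph (@ofR R) (id1 := 0) (op1 := +%R))//; last first.
  by move=> x y; apply: complex_eq; rewrite ?reD ?imD //= addr0.
apply: (@le_trans _ _ (\sum_(j < m) `|h|)); first by apply: ler_sum => j _; exact: norm_ge_coord.
by rewrite sumr_const card_ord mulr_natl.
Qed.

(** The l^1 norm and the complex-valued maximum norm bound each other up to the factor m, so both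
    notions of remainder agree. *)
Lemma hdiffP f z : differentiable f z <-> hdiff f z.
Proof.
split=> [df|[c hc]].
  have [_ /eqaddoP o] := (diff_locallyP z f).1 df.
  exists (fun j => 'd f z (delta_mx 0 j)) => e e0.
  have e0' : 0 < ofR e by rewrite (ofR_lt 0).
  have /nbhs_norm0P[d d0 hd] := o _ e0'.
  have [d' d'0 dE] := Cpos d0; exists d' => // h hN.
  have := hd h (le_lt_trans (norm_le_N1 h) _); rewrite dE ofR_lt => /(_ hN).
  rewrite /= => /(le_trans _) h1.
  have {h1} : `|(f \o shift z - (cst (f z) + 'd f z)) h| <= ofR (e * N1 h).
    by apply: (le_trans (hd h _)); [rewrite dE; apply: le_lt_trans (norm_le_N1 h) _; rewrite ofR_lt|
      rewrite ofRM ler_wpM2l ?norm_le_N1// ltW].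
  rewrite normC_nc ofR_le; congr (nc _ <= _).
  rewrite -[LHS]/(f (h + z) - (f z + 'd f z h)) opprD addrA (addrC h); congr (_ - _).
  rewrite {1}[h]row_sum_delta linear_sum; apply: eq_bigr => j _.
  by rewrite linearZ/= mulrC.
pose D h : C^o := \sum_j c j * h 0 j.
have D0 : linear D.
  move=> k h h'; rewrite /D scaler_sumr -big_split; apply: eq_bigr => j _.
  by rewrite !mxE mulrDr mulrCA.
pose DD := GRing.isLinear.Build C 'rV[C]_m C^o *:%R D D0.
pose L : {linear 'rV[C]_m -> C^o} := HB.pack D DD.
have Db h : nc (D h : C) <= (\sum_j nc (c j)) * N1 h.
  rewrite /D; apply: le_trans (nc_sum _ _ _) _; rewrite mulr_suml; apply: ler_sum => j _.
  by rewrite ncM ler_wpM2l ?nc_ge0 ?N1_ge.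
pose K := \sum_j nc (c j) + 1.
have S0 : 0 <= \sum_j nc (c j) by apply: sumr_ge0 => j _; exact: nc_ge0.
have K0 : 0 < K by rewrite /K; lra.
have small x : 0 < x -> 0 < ofR (x / (K * (m%:R + 1))) :> C.
  by move=> x0; rewrite (ofR_lt 0) divr_gt0// mulr_gt0// ltr_wpDl.
have smallN x h : 0 < x -> `|h| < ofR (x / (K * (m%:R + 1))) -> N1 h <= x / K.
  move=> x0 hx; rewrite -ofR_le; apply: le_trans (norm_ge_N1 h) _.
  apply: le_trans (ler_wpM2l _ (ltW hx)) _ => //.
  rewrite -(ofRn m).
  have M1 : 0 < m%:R + 1 :> R by rewrite ltr_wpDl.
  have xK : 0 <= x / K by rewrite divr_ge0 ?ltW.
  rewrite -ofRM ofR_le (_ : m%:R * _ = x / K * (m%:R / (m%:R + 1))); last first.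
    by field; rewrite !gt_eqF.
  by rewrite ler_piMr// ler_pdivrMr// mul1r lerDl.
have Lc : continuous L.
  move=> x; apply/(@cvgrPdist_le C C^o _ (nbhs x) _) => e e0; have [y y0 ->] := Cpos e0.
  apply/(@nbhs_normP C 'rV[C]_m x); exists (ofR (y / (K * (m%:R + 1)))); first exact: small.
  move=> t /= /(smallN _ _ y0) ht; rewrite -(linearB L x t) normC_nc ofR_le.
  apply: le_trans (Db _) _.
  apply: (@le_trans _ _ (K * N1 (x - t))); first by rewrite ler_wpM2r ?N1_ge0// lerDl.
  by rewrite mulrC -ler_pdivlMr.
have E := @diff_unique C 'rV[C]_m C^o f L z Lc.
have {}E : 'd f z = L :> ('rV[C]_m -> C^o) /\ (f \o shift z = cst (f z) + (L : 'rV[C]_m -> C^o) +o_ (0 : 'rV[C]_m) id).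
  suff EE : f \o shift z = cst (f z) + (L : 'rV[C]_m -> C^o) +o_ (0 : 'rV[C]_m) id by split; [exact: E|].
  apply/eqaddoP => e e0; have [x x0 xE] := Cpos e0.
  have xm : 0 < x / (m%:R + 1) by rewrite divr_gt0// ltr_wpDl.
  have [d d0 hd] := hc _ xm.
  have Kd : 0 < K * d / 2 by rewrite divr_gt0// mulr_gt0.
  apply/(@nbhs_norm0P C 'rV[C]_m); exists (ofR (K * d / 2 / (K * (m%:R + 1)))); first exact: small.
  move=> h /(smallN _ _ Kd) hN.
  have {}hN : N1 h < d.
    apply: le_lt_trans hN _; rewrite (_ : _ / K = d / 2); first lra.
    by field; rewrite gt_eqF.
  have := hd h hN; rewrite -ofR_le xE => H.
  have -> : `|(f \o shift z - (cst (f z) + L)) h| = ofR (nc (f (z + h) - f z - D h : C)).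
    rewrite -normC_nc; congr `|_|.
    by rewrite -[LHS]/(f (h + z) - (f z + D h)) opprD addrA (addrC h).
  apply: le_trans H _; rewrite ofRM (ofRM x) -mulrA ler_wpM2l ?(ofR_le 0) ?(ltW x0)//.
  rewrite ofRV mulrC ler_pdivrMr; last by rewrite (ofR_lt 0) ltr_wpDl.
  apply: le_trans (norm_ge_N1 h) _; rewrite mulrC ler_wpM2l//.
  by rewrite -ofRn ofR_le lerDl.
by case: E => E1 E2; apply/diff_locallyP; rewrite E1.
Qed.

End holomorphy.

(** * Hilbert spaces and summable operators *)

Section hilbert.
Context (R : realType) (V : lmodType (Cplx R)).
Local Notation C := (Cplx R).
Variables (H : set V) (ip : V -> V -> C).

Definition cj (z : C) : C := Num.conj z.

Lemma re_cj z : re (cj z) = re z. Proof. by case: z. Qed.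
Lemma im_cj z : im (cj z) = - im z. Proof. by case: z. Qed.
Lemma cjM z w : cj (z * w) = cj z * cj w. Proof. exact: rmorphM. Qed.
Lemma cjD z w : cj (z + w) = cj z + cj w. Proof. exact: rmorphD. Qed.
Lemma cjK z : cj (cj z) = z. Proof. by apply: complex_eq; rewrite ?re_cj ?im_cj ?opprK. Qed.
Lemma cj0 : cj 0 = 0. Proof. exact: rmorph0. Qed.
Lemma cj_ofR x : cj (ofR x) = ofR x.
Proof. by apply: complex_eq; rewrite ?re_cj ?im_cj //= oppr0. Qed.
Lemma nc_cj z : nc (cj z) = nc z.
Proof.
by apply/eqP; rewrite -(eqrXn2 (_ : 0 < 2)%N) ?nc_ge0// !sqr_nc re_cj im_cj sqrrN.
Qed.
Lemma cjMr z : cj z * z = ofR (nc z ^+ 2).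
Proof.
by apply: complex_eq; rewrite ?reM ?imM re_cj im_cj ?sqr_nc /=; ring.
Qed.

Record hilbert : Prop := Hilbert {
  hil0 : H 0;
  hilL : forall c f g, H f -> H g -> H (c *: f + g);
  hil_ip : forall c f g h, H f -> H g -> H h -> ip (c *: f + g) h = c * ip f h + ip g h;
  hil_cj : forall f g, H f -> H g -> ip g f = cj (ip f g);
  hil_ge0 : forall f, H f -> 0 <= re (ip f f);
  hil_eq0 : forall f, H f -> re (ip f f) = 0 -> f = 0;
  hil_complete : forall u : nat -> V, (forall n, H (u n)) ->
    (forall e : R, 0 < e -> exists N, forall k l, (N <= k)%N -> (N <= l)%N ->
       hnorm ip (u k - u l) <= e) ->
    exists2 f, H f & forall e : R, 0 < e -> exists N, forall k, (N <= k)%N ->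
       hnorm ip (u k - f) <= e }.

Hypothesis hil : hilbert.
Local Notation nm := (hnorm ip).
Local Notation N2 f := (re (ip f f)).

Lemma HZ c f : H f -> H (c *: f).
Proof. by move=> hf; rewrite -[_ *: _]addr0; apply: (hilL hil) => //; exact: (hil0 hil). Qed.
Lemma HD f g : H f -> H g -> H (f + g).
Proof. by move=> hf hg; rewrite -[f]scale1r; exact: (hilL hil). Qed.
Lemma HN f : H f -> H (- f). Proof. by move=> hf; rewrite -scaleN1r; exact: HZ. Qed.
Lemma HB f g : H f -> H g -> H (f - g).
Proof. by move=> hf hg; apply: HD => //; exact: HN. Qed.
Lemma Hsum (I : Type) (r : seq I) (F : I -> V) : (forall i, H (F i)) -> H (\sum_(i <- r) F i).
Proof.
move=> hF; elim: r => [|i r IH]; first by rewrite big_nil; exact: (hil0 hil).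
by rewrite big_cons; exact: HD.
Qed.

Lemma ipDl f g h : H f -> H g -> H h -> ip (f + g) h = ip f h + ip g h.
Proof. by move=> hf hg hh; rewrite -[f in LHS]scale1r (hil_ip hil)// mul1r. Qed.
Lemma ip0l h : H h -> ip 0 h = 0.
Proof.
move=> hh; have h0 := hil0 hil; have := ipDl h0 h0 hh.
by rewrite addr0 => /eqP; rewrite -subr_eq0 opprD addrA subrr sub0r oppr_eq0 => /eqP.
Qed.
Lemma ipZl c f h : H f -> H h -> ip (c *: f) h = c * ip f h.
Proof. by move=> hf hh; rewrite -[_ *: _]addr0 (hil_ip hil) ?ip0l ?addr0//; exact: (hil0 hil). Qed.
Lemma ipNl f h : H f -> H h -> ip (- f) h = - ip f h.
Proof. by move=> hf hh; rewrite -scaleN1r ipZl// mulN1r. Qed.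
Lemma ipBl f g h : H f -> H g -> H h -> ip (f - g) h = ip f h - ip g h.
Proof. by move=> hf hg hh; rewrite ipDl ?ipNl//; exact: HN. Qed.
Lemma ipZr c f h : H f -> H h -> ip f (c *: h) = cj c * ip f h.
Proof.
by move=> hf hh; rewrite (hil_cj hil (HZ c hh) hf) ipZl// cjM -(hil_cj hil).
Qed.
Lemma ipDr f g h : H f -> H g -> H h -> ip f (g + h) = ip f g + ip f h.
Proof.
by move=> hf hg hh; rewrite (hil_cj hil (HD hg hh) hf) ipDl// cjD -!(hil_cj hil).
Qed.
Lemma ip0r h : H h -> ip h 0 = 0.
Proof. by move=> hh; rewrite (hil_cj hil (hil0 hil) hh) ip0l// cj0. Qed.
Lemma ipNr f h : H f -> H h -> ip f (- h) = - ip f h.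
Proof. by move=> hf hh; rewrite -scaleN1r ipZr// /cj rmorphN rmorph1 mulN1r. Qed.
Lemma ipBr f g h : H f -> H g -> H h -> ip f (g - h) = ip f g - ip f h.
Proof. by move=> hf hg hh; rewrite ipDr ?ipNr//; exact: HN. Qed.
Lemma ip_suml (I : Type) (r : seq I) (F : I -> V) h : (forall i, H (F i)) -> H h ->
  ip (\sum_(i <- r) F i) h = \sum_(i <- r) ip (F i) h.
Proof.
move=> hF hh; elim: r => [|i r IH]; first by rewrite !big_nil ip0l.
by rewrite !big_cons ipDl ?IH//; exact: Hsum.
Qed.

Lemma ip_real f : H f -> ip f f = ofR (N2 f).
Proof.
move=> hf; have := congr1 (@im R) (hil_cj hil hf hf); rewrite im_cj => h.
by apply: complex_eq => //=; lra.
Qed.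

Lemma N2E c f g : H f -> H g ->
  N2 (c *: f + g) = nc c ^+ 2 * N2 f + 2 * re (c * ip f g) + N2 g.
Proof.
move=> hf hg; have hcf := HZ c hf.
have hcg := HD hcf hg; rewrite ipDl// !ipDr// !ipZl// !ipZr//.
rewrite (hil_cj hil hf hg) (ip_real hf).
rewrite sqr_nc !(reD, reM, imD, imM, re_cj, im_cj) /=; ring.
Qed.

Lemma sqr_nm f : H f -> nm f ^+ 2 = N2 f.
Proof. by move=> hf; rewrite sqr_sqrtr//; exact: (hil_ge0 hil). Qed.
Lemma nm_ge0 f : 0 <= nm f. Proof. exact: sqrtr_ge0. Qed.
Lemma nmZ c f : H f -> nm (c *: f) = nc c * nm f.
Proof.
move=> hf; apply/eqP; rewrite -(eqrXn2 (_ : 0 < 2)%N) ?nm_ge0// ?mulr_ge0 ?nc_ge0 ?nm_ge0//.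
rewrite exprMn !sqr_nm//; last exact: HZ.
rewrite ipZl ?ipZr//; last exact: HZ.
rewrite (ip_real hf) mulrA (mulrC c) cjMr reZ //.
Qed.
Lemma nmN f : H f -> nm (- f) = nm f.
Proof. by move=> hf; rewrite -scaleN1r nmZ// ncN nc1 mul1r. Qed.

Lemma cauchy_schwarz f g : H f -> H g -> nc (ip f g) <= nm f * nm g.
Proof.
move=> hf hg; have [g0|g0] := eqVneq (N2 g) 0.
  by rewrite (hil_eq0 hil hg g0) ip0r// nc0 mulr_ge0 ?nm_ge0.
have gp : 0 < N2 g by rewrite lt_neqAle eq_sym g0 (hil_ge0 hil).
rewrite -(ler_pXn2r (n := 2)) ?nnegrE ?nc_ge0 ?mulr_ge0 ?nm_ge0//.
rewrite exprMn !sqr_nm//.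
have := hil_ge0 hil (hilL hil (- (ip f g / ofR (N2 g))) hg hf).
rewrite N2E// (hil_cj hil hf hg) ncN ncM ncV nc_ofR gtr0_norm//.
have -> : re (- (ip f g / ofR (N2 g)) * cj (ip f g)) = - (nc (ip f g) ^+ 2 / N2 g).
  rewrite mulNr reN mulrAC (mulrC _ (cj _)) cjMr -ofRV -ofRM //.
move: (nc _) (N2 g) (N2 f) gp => c n m n0.
have -> : (c / n) ^+ 2 * n + 2 * - (c ^+ 2 / n) + m = m - c ^+ 2 / n.
  by field; rewrite gt_eqF.
by rewrite subr_ge0 ler_pdivrMr.
Qed.

Lemma nmD f g : H f -> H g -> nm (f + g) <= nm f + nm g.
Proof.
move=> hf hg; rewrite -(ler_pXn2r (n := 2)) ?nnegrE ?addr_ge0 ?nm_ge0//.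
rewrite sqr_nm; last exact: HD.
rewrite -[f in X in X <= _]scale1r N2E// nc1 mul1r expr1n mul1r sqrrD !sqr_nm//.
have := le_trans (abs_re_le _) (cauchy_schwarz hf hg).
by move=> /ler_normlW; lra.
Qed.

Lemma nmB_tri f g h : H f -> H g -> H h -> nm (f - h) <= nm (f - g) + nm (g - h).
Proof.
move=> hf hg hh; have -> : f - h = (f - g) + (g - h) by rewrite addrA subrK.
by apply: nmD; exact: HB.
Qed.

Lemma nm_sub f g : H f -> H g -> nm (f - g) = nm (g - f).
Proof. by move=> hf hg; rewrite -opprB nmN//; exact: HB. Qed.

Lemma parallelogram f s t : H f -> H s -> H t ->
  N2 (s - t) + 4 * N2 (f - (ofR 2^-1 *: (s + t))) = 2 * N2 (f - s) + 2 * N2 (f - t).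
Proof.
move=> hf hs ht.
have h1 := HB hf hs; have h2 := HB hf ht.
have -> : s - t = (-1) *: (f - s) + (f - t).
  by rewrite scaleN1r opprB -addrA (addrA (- f)) addNr sub0r.
have E : f - (ofR 2^-1 *: (s + t)) = ofR 2^-1 *: (1 *: (f - s) + (f - t)).
  rewrite scale1r addrACA -opprD scalerBr [in RHS]scalerDr -scalerDl; congr (_ - _).
  rewrite (_ : _ + _ = 1) ?scale1r//.
  by apply: complex_eq; rewrite ?reD ?imD /=; [field|ring].
rewrite E -(sqr_nm (HZ _ (hilL hil _ h1 h2))) nmZ ?exprMn ?sqr_nm//; last first.
- exact: (hilL hil).
- exact: (hilL hil).
rewrite nc_ofR !N2E// ncN nc1 mulN1r mul1r reN gtr0_norm ?invr_gt0//.
by move: (N2 _) (N2 _) (re _) => x y z; field.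
Qed.

(* [x] is the component of [f] orthogonal to the closure of [S]. *)
Lemma orth_component (S : set V) f : (forall s, S s -> H s) -> S 0 ->
  (forall c s t, S s -> S t -> S (c *: s + t)) -> H f ->
  exists x, [/\ H x, forall s, S s -> ip x s = 0 &
    forall e : R, 0 < e -> exists2 s, S s & nm (f - s - x) < e].
Proof.
move=> SH S0 SL hf.
pose A := [set N2 (f - s) | s in S].
have A0 : has_inf A.
  split; first by exists (N2 (f - 0)), 0.
  by exists 0 => _ [s /SH hs <-]; apply: (hil_ge0 hil); exact: HB.
pose D := inf A.
have DA s : S s -> D <= N2 (f - s) by move=> hs; apply: ge_inf; [exact: A0.2|exists s].
have D0 : 0 <= D.
  apply: lb_le_inf; first exact: A0.1.
  by move=> _ [s /SH hs <-]; apply: (hil_ge0 hil); exact: HB.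
have /choice[u hu] : forall n : nat, exists s, S s /\ N2 (f - s) < D + n.+1%:R^-1.
  move=> n; have [_ [s hs <-] hl] := @inf_adherent _ A n.+1%:R^-1 (ltac:(by rewrite invr_gt0)) A0.
  by exists s.
have uS n : S (u n) by have [] := hu n.
have uH n : H (u n) by exact/SH/uS.
have small (e : R) : 0 < e -> exists N, forall k, (N <= k)%N -> k.+1%:R^-1 <= e.
  move=> e0; have [N hN] := ltr_add_invr (lt_le_trans e0 (lexx e) : 0 < e); exists N => k Nk.
  rewrite add0r in hN; apply: le_trans (ltW hN).
  by rewrite lef_pV2 ?posrE// ler_nat.
have half k l : S (ofR 2^-1 *: (u k + u l)).
  rewrite scalerDr; apply: (SL) => //.
  by rewrite -[_ *: _]addr0; exact: (SL).
have [e e0|s hs us] := hil_complete hil uH.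
  have e4 : 0 < e ^+ 2 / 4 by rewrite divr_gt0 ?exprn_gt0.
  have [N hN] := small _ e4; exists N => k l Nk Nl.
  rewrite -(ler_pXn2r (n := 2)) ?nnegrE ?nm_ge0 ?(ltW e0)// sqr_nm; last exact: HB.
  have := parallelogram hf (uH k) (uH l).
  have := DA _ (half k l); have [_] := hu k; have [_] := hu l; have := hN _ Nk; have := hN _ Nl.
  move: (N2 (u k - u l)) (N2 (f - _ *: _)) (N2 (f - u k)) (N2 (f - u l)) k.+1%:R^-1 l.+1%:R^-1 (e ^+ 2) => *; lra.
have hx := HB hf hs; exists (f - s); split=> //; last first.
  move=> e e0; have e2 : 0 < e / 2 by lra.
  have [N hN] := us _ e2; exists (u N) => //.
  rewrite opprB addrC addrA subrK nm_sub//; have := hN N (leqnn _); lra.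
move=> t St; have ht := SH _ St.
have N2x : nm (f - s) <= Num.sqrt D.
  apply/ler_addgt0Pr => e e0; have e2 : 0 < e / 2 by lra.
  have [N1 hN1] := us _ e2.
  have e24 : 0 < (e / 2) ^+ 2 by rewrite exprn_gt0.
  have [M hM] := small _ e24.
  pose n := maxn N1 M.
  apply: le_trans (nmB_tri hf (uH n) hs) _.
  have h1 : nm (f - u n) <= Num.sqrt D + e / 2.
    rewrite -(ler_pXn2r (n := 2)) ?nnegrE ?nm_ge0 ?addr_ge0 ?sqrtr_ge0 ?(ltW e2)//.
    rewrite sqr_nm; last exact: HB.
    rewrite sqrrD sqr_sqrtr//.
    have [_ h] := hu n; have := hM n (leq_maxr _ _).
    have : 0 <= Num.sqrt D * (e / 2) by rewrite mulr_ge0 ?sqrtr_ge0 ?(ltW e2).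
    rewrite mulr2n; move: h; move: (N2 _) n.+1%:R^-1 ((e / 2) ^+ 2) (Num.sqrt D * (e / 2)) => *; lra.
  have := hN1 n (leq_maxl _ _); lra.
have low (c : C) : Num.sqrt D <= nm (c *: t + (f - s)).
  have hct := hilL hil c ht hx.
  apply/ler_addgt0Pr => e e0; have [N hN] := us _ e0.
  have h1 : Num.sqrt D <= nm (f - (u N - c *: t)).
    rewrite ler_sqrt; last by apply: (hil_ge0 hil); apply: HB => //; apply: HB => //; exact: HZ.
    by apply: DA; rewrite addrC -scaleNr; exact: (SL).
  apply: le_trans h1 _.
  have -> : f - (u N - c *: t) = (c *: t + (f - s)) + (s - u N).
    by rewrite opprB -addrA (addrA (f - s)) subrK addrCA.
  apply: le_trans (nmD hct (HB hs (uH N))) _.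
  by rewrite lerD2l nm_sub//; exact: hN.
pose q := ip t (f - s).
have K (c : C) : 0 <= nc c ^+ 2 * N2 t + 2 * re (c * q).
  have h : nm (f - s) <= nm (c *: t + (f - s)) := le_trans N2x (low c).
  have : nm (f - s) ^+ 2 <= nm (c *: t + (f - s)) ^+ 2.
    by rewrite ler_pXn2r ?nnegrE ?nm_ge0.
  rewrite !sqr_nm//; last exact: (hilL hil).
  rewrite N2E// /q; lra.
have N2t := hil_ge0 hil ht.
(* Moving the closest point by this multiple of t would shorten the distance unless q = 0; the 1
   keeps the divisor positive. *)
have := K (- (ofR (N2 t + 1)^-1 * cj q)).
rewrite ncN ncM nc_ofR nc_cj mulNr reN -(mulrA (ofR _)) cjMr -ofRM /= => h.
have n1 : 0 < N2 t + 1 by lra.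
rewrite gtr0_norm ?invr_gt0// in h.
have q0 : q = 0.
  apply/eqP; rewrite -nc_eq0 -sqrf_eq0.
  set n := N2 t in h n1 N2t; set c := nc q in h *.
  have m0 : 0 < (n + 1)^-1 by rewrite invr_gt0.
  have nm1 : (n + 1)^-1 * n = 1 - (n + 1)^-1 by field; rewrite gt_eqF.
  have : 0 <= (n + 1)^-1 * c ^+ 2 * (- 1 - (n + 1)^-1).
    apply: le_trans h _; rewrite le_eqVlt; apply/orP; left; apply/eqP.
    by rewrite exprMn; field; rewrite gt_eqF.
  rewrite nmulr_lge0; last by lra.
  by rewrite pmulr_rle0// => hc; rewrite eq_le hc sqr_ge0.
by rewrite (hil_cj hil ht hx) -/q q0 cj0.
Qed.

(** The representing vector is a multiple of the component, orthogonal to the kernel of L, of a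
    vector where L does not vanish. *)
Lemma riesz (L : V -> C) (M : R) :
  (forall c f g, H f -> H g -> L (c *: f + g) = c * L f + L g) ->
  (forall f, H f -> nc (L f) <= M * nm f) ->
  exists2 h, H h & forall f, H f -> L f = ip f h.
Proof.
move=> LL LM; have h0 := hil0 hil.
have L0 : L 0 = 0.
  have := LL 1 0 0 h0 h0; rewrite scale1r addr0 mul1r => /eqP.
  by rewrite -subr_eq0 opprD addrA subrr sub0r oppr_eq0 => /eqP.
have [[f [hf Lf]]|/forallNP Lz] := pselect (exists f, H f /\ L f <> 0); last first.
  by exists 0 => // f hf; rewrite ip0r//; apply/eqP/negPn/negP => /eqP n0; apply: (Lz f).
pose S := [set s | H s /\ L s = 0].
have [|||x [hx xS xf]] := @orth_component S f _ _ _ hf.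
- by move=> s [].
- by split.
- by move=> c s t [hs Ls] [ht Lt]; split; [exact: (hilL hil)|rewrite LL// Ls Lt mulr0 addr0].
have Lx : L x = L f.
  have M0 : 0 <= `|M| by [].
  apply/eqP; rewrite eq_sym -subr_eq0 -nc_eq0 -normr_le0 ger0_norm ?nc_ge0//.
  apply/ler_addgt0Pr => e e0; rewrite add0r.
  have [s [hs Ls] fs] := xf (e / (`|M| + 1)) (ltac:(by rewrite divr_gt0// ltr_wpDl)).
  have hfs := HB hf hs.
  have -> : L f - L x = L (f - s - x).
    rewrite -(addrC (- x)) -scaleN1r LL// -(addrC (- s)) -scaleN1r LL// Ls.
    by rewrite mulr0 add0r mulN1r addrC.
  apply: le_trans (LM _ (HB hfs hx)) _.
  rewrite ltr_pdivlMr ?ltr_wpDl// in fs.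
  apply: le_trans (ler_wpM2r (nm_ge0 _) (ler_norm M)) _.
  by rewrite mulrC; apply: le_trans (ltW fs); rewrite ler_wpM2l ?nm_ge0 ?lerDl.
have x0 : N2 x != 0.
  by apply/eqP => /(hil_eq0 hil hx) x0; apply: Lf; rewrite -Lx x0 L0.
pose q := cj (L x) / ofR (N2 x).
exists (q *: x); first exact: HZ.
move=> g hg; rewrite ipZr//.
have Lx0 : L x != 0 by apply/eqP; rewrite Lx.
have hd := hilL hil (- (L g / L x)) hx hg.
have : ip (- (L g / L x) *: x + g) x = 0.
  rewrite (hil_cj hil hx hd) xS ?cj0//; split=> //.
  by rewrite LL// mulNr divfK// addNr.
rewrite (hil_ip hil)// (ip_real hx) => /eqP; rewrite addrC mulNr subr_eq0 => /eqP ->.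
have -> : cj q = L x / ofR (N2 x) by rewrite cjM cjK -ofRV cj_ofR.
have Nx : ofR (N2 x) != 0 by rewrite ofR_eq0.
by move: (ofR _) Nx (L g) (L x) Lx0 => n n0 u v v0; field; rewrite v0 n0.
Qed.

Section adjoints.
Variable T : V -> V.
Hypothesis bT : bounded_operator H ip T.

Lemma bop_H f : H f -> H (T f). Proof. by case: bT => h _ _; exact: h. Qed.
Lemma bop_lin c f g : H f -> H g -> T (c *: f + g) = c *: T f + T g.
Proof. by case: bT => _ h _; exact: h. Qed.

Lemma ip_inj h h' : H h -> H h' -> (forall f, H f -> ip f h = ip f h') -> h = h'.
Proof.
move=> hh hh' E; apply/eqP; rewrite -subr_eq0; apply/eqP.
have hd := HB hh hh'; apply: (hil_eq0 hil) => //.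
by rewrite ipBr// E// subrr.
Qed.

Lemma adjointP g : H g -> H (adjoint H ip T g) /\
  forall f, H f -> ip (T f) g = ip f (adjoint H ip T g).
Proof.
move=> hg; rewrite /adjoint; case: xgetP => [h -> //|nh].
case: bT => [TH TL [M TM]].
have [c f f' hf hf'|f hf|h hh Lh] := @riesz (fun f => ip (T f) g) (M * nm g).
- by rewrite TL// (hil_ip hil)//; exact: TH.
- by rewrite mulrAC; apply: le_trans (cauchy_schwarz (TH _ hf) hg) _; rewrite ler_wpM2r ?nm_ge0 ?TM.
by case: (nh h).
Qed.

Lemma adjointE g h : H g -> H h -> (forall f, H f -> ip (T f) g = ip f h) ->
  adjoint H ip T g = h.
Proof.
move=> hg hh E; have [ha aE] := adjointP hg.
by apply: ip_inj => // f hf; rewrite -aE// E.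
Qed.

Lemma adjoint_bounded : bounded_operator H ip (adjoint H ip T).
Proof.
split; first by move=> f /adjointP[].
  move=> c f g hf hg; have [haf aEf] := adjointP hf; have [hag aEg] := adjointP hg.
  apply: adjointE; [exact: (hilL hil)|exact: (hilL hil)|move=> k hk].
  have hTk := bop_H hk; have h1 := HZ c hf; have h2 := HZ c haf.
  by rewrite !ipDr// !ipZr// aEf// aEg.
case: bT => [TH TL [M TM]]; exists `|M| => g hg; have [ha aE] := adjointP hg.
set h := adjoint H ip T g in ha aE *.
have : nm h ^+ 2 <= `|M| * nm g * nm h.
  rewrite sqr_nm// -aE//; apply: le_trans (ler_norm _) _; apply: le_trans (abs_re_le _) _.
  apply: le_trans (cauchy_schwarz (TH _ ha) hg) _.
  rewrite mulrAC ler_wpM2r ?nm_ge0//; apply: le_trans (TM _ ha) _.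
  by rewrite ler_wpM2r ?nm_ge0// ler_norm.
have := nm_ge0 h; rewrite le_eqVlt => /orP[/eqP <-|h0].
  by move=> _; rewrite mulr_ge0 ?nm_ge0.
by rewrite expr2 ler_pM2r.
Qed.

End adjoints.

Lemma bounded_comp S T : bounded_operator H ip S -> bounded_operator H ip T ->
  bounded_operator H ip (S \o T).
Proof.
move=> [SH SL [M SM]] [TH TL [N TN]]; split => /=.
- by move=> f hf; apply/SH/TH.
- by move=> c f g hf hg; rewrite TL// SL//; exact: TH.
exists (`|M| * N) => f hf; apply: le_trans (SM _ (TH _ hf)) _.
apply: le_trans (ler_wpM2r (nm_ge0 _) (ler_norm M)) _.
by rewrite -mulrA ler_wpM2l ?TN.
Qed.

Lemma bounded_sub S T : bounded_operator H ip S -> bounded_operator H ip T ->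
  bounded_operator H ip (fun f => S f - T f).
Proof.
move=> [SH SL [M SM]] [TH TL [N TN]]; split.
- by move=> f hf; apply: HB; [exact: SH|exact: TH].
- move=> c f g hf hg; rewrite TL// SL// scalerBr opprD addrACA //.
exists (M + N) => f hf; apply: le_trans (nmD (SH _ hf) (HN (TH _ hf))) _.
by rewrite nmN ?mulrDl ?lerD ?SM ?TN//; exact: TH.
Qed.

Lemma commutator_bounded S T : bounded_operator H ip S -> bounded_operator H ip T ->
  bounded_operator H ip (commutator S T).
Proof. by move=> bS bT; apply: bounded_sub; exact: bounded_comp. Qed.

(** So the adjoint of a commutator of coordinate multiplications is the commutator with exchanged
    indices, which can be evaluated on a basis. *)
Lemma adjoint_commutator S T f : bounded_operator H ip S -> bounded_operator H ip T -> H f ->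
  adjoint H ip (commutator S (adjoint H ip T)) f = commutator T (adjoint H ip S) f.
Proof.
move=> bS bT hf; have bA := adjoint_bounded bT; have bB := adjoint_bounded bS.
have bK := commutator_bounded bS bA; have bL := commutator_bounded bT bB.
apply: (adjointE bK) => //; first exact: (bop_H bL).
move=> g hg; rewrite /commutator.
have hAg := bop_H bA hg; have hSg := bop_H bS hg.
have hBf := bop_H bB hf; have hTf := bop_H bT hf.
rewrite ipBl// ?ipBr//; first last.
- exact: (bop_H bA).
- exact: (bop_H bS).
- exact: (bop_H bB).
- exact: (bop_H bT).
congr (_ - _).
  rewrite (adjointP bS hf).2// (hil_cj hil hBf hAg) -(adjointP bT hg).2 //.
  by rewrite -(hil_cj hil) //; exact: (bop_H bT).
rewrite -(adjointP bS hTf).2// (hil_cj hil hf (bop_H bA hSg)) -(adjointP bT hSg).2//.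
by rewrite -(hil_cj hil).
Qed.

Section basis.
Variables (I : choiceType) (e : I -> V).
Hypothesis eH : forall i, H (e i).
Hypothesis eO : forall i j, ip (e i) (e j) = (i == j)%:R.

(** The component of f orthogonal to the span of the [e i] is zero by totality, so the span
    approximates f. *)
Lemma basis_of_total :
  (forall x, H x -> (forall i, ip x (e i) = 0) -> x = 0) -> orthonormal_basis H ip e.
Proof.
move=> tot; split=> // f hf eps eps0.
pose S := [set s | exists l : seq (C * I), s = \sum_(x <- l) x.1 *: e x.2].
have [|||x [hx xS xf]] := @orth_component S f _ _ _ hf.
- by move=> _ [l ->]; apply: Hsum => -[c i]; exact: HZ.
- by exists [::]; rewrite big_nil.
- move=> c _ _ [l ->] [l' ->]; exists ([seq (c * x.1, x.2) | x <- l] ++ l').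
  rewrite big_cat big_map/= scaler_sumr; congr (_ + _).
  by apply: eq_bigr => y _; rewrite scalerA.
have [_ [l ->] h] := xf _ eps0.
have x0 : x = 0.
  apply: tot => // i; apply: xS; exists [:: (1, i)].
  by rewrite big_seq1 scale1r.
rewrite x0 subr0 in h.
(* Repeated indices are merged: each coefficient is the sum over all terms with that index. *)
exists (undup [seq x.2 | x <- l]), (fun i => \sum_(x <- l | x.2 == i) x.1).
rewrite (_ : \sum_(i <- _) _ = \sum_(x <- l) x.1 *: e x.2)//.
under eq_bigr do rewrite scaler_suml.
rewrite (exchange_big_dep predT)//= big_seq [RHS]big_seq; apply: eq_bigr => y yl.
rewrite (eq_bigr (fun=> y.1 *: e y.2)); last by move=> i /eqP ->.
rewrite -big_filter (_ : [seq i <- undup _ | y.2 == i] = [:: y.2]) ?big_seq1//.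
rewrite (eq_filter (a2 := pred1 y.2)); last by move=> i /=; rewrite eq_sym.
by rewrite filter_pred1_uniq ?undup_uniq// mem_undup map_f.
Qed.

Section partial_sums.
Variables (r : seq I) (f : V).
Hypotheses (ur : uniq r) (hf : H f).

Let s := \sum_(i <- r) ip f (e i) *: e i.
Let W := \sum_(i <- r) nc (ip f (e i)) ^+ 2.

Let hs : H s. Proof. by apply: Hsum => i; exact: HZ. Qed.

Let sf : ip s f = ofR W.
Proof.
rewrite /s ip_suml//; last by move=> i; exact: HZ.
rewrite (eq_bigr (fun i => ofR (nc (ip f (e i)) ^+ 2))); last first.
  by move=> i _; rewrite ipZl// (hil_cj hil hf (eH i)) mulrC cjMr.
apply/esym/(big_morph (@ofR R)) => //.
by move=> x y; apply: complex_eq; rewrite ?reD ?imD //= addr0.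
Qed.

Let si i : i \in r -> ip s (e i) = ip f (e i).
Proof.
move=> ir; rewrite /s ip_suml//; last by move=> k; exact: HZ.
rewrite (bigD1_seq i)//= ipZl// eO eqxx mulr1 big1 ?addr0// => k ki.
by rewrite ipZl// eO (negbTE ki) mulr0.
Qed.

Let ss : ip s s = ip s f.
Proof.
rewrite {1 3}/s !ip_suml//; try by move=> i; exact: HZ.
rewrite big_seq [RHS]big_seq; apply: eq_bigr => i ir.
by rewrite !ipZl// (hil_cj hil hs (eH i)) (hil_cj hil hf (eH i)) si.
Qed.

Let N2fs : N2 (f - s) = N2 f - W.
Proof.
rewrite addrC -scaleN1r N2E// ss sf ncN nc1 mulN1r reN /=; ring.
Qed.

Lemma bessel : W <= N2 f.
Proof. by rewrite -subr_ge0 -N2fs; apply: (hil_ge0 hil); exact: HB. Qed.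

Lemma best_approx (r' : seq I) (c : I -> C) : {subset r' <= r} ->
  N2 f - W <= N2 (f - \sum_(i <- r') c i *: e i).
Proof.
move=> sub; set t := \sum_(i <- r') _.
have ht : H t by apply: Hsum => i; exact: HZ.
have hst := HB hs ht; have hfs := HB hf hs.
have perp i : i \in r -> ip (e i) (f - s) = 0.
  by move=> ir; rewrite (hil_cj hil hfs (eH i)) ipBl// si// subrr cj0.
have sp : ip s (f - s) = 0.
  rewrite {1}/s ip_suml//; last by move=> i; exact: HZ.
  by rewrite big_seq big1// => i ir; rewrite ipZl// perp// mulr0.
have tp : ip t (f - s) = 0.
  rewrite {1}/t ip_suml//; last by move=> i; exact: HZ.
  by rewrite big_seq big1// => i ir; rewrite ipZl// perp ?mulr0// sub.
have -> : f - t = 1 *: (s - t) + (f - s) by rewrite scale1r [RHS]addrC addrA subrK.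
have stp : ip (s - t) (f - s) = 0 by rewrite ipBl// sp tp subrr.
rewrite N2E// stp nc1 expr1n mul1r !mulr0 addr0 N2fs lerDr.
exact: (hil_ge0 hil).
Qed.

End partial_sums.

End basis.

(** Parseval's identity in finite form; it holds for every larger finite family, so that one family
    can serve several vectors. *)
Lemma parseval_approx (I : choiceType) (e : I -> V) f eps : orthonormal_basis H ip e ->
  H f -> 0 < eps -> exists r : seq I, forall r', uniq r' -> {subset r <= r'} ->
    N2 f - eps <= \sum_(i <- r') nc (ip f (e i)) ^+ 2.
Proof.
move=> [eH eO eD] hf eps0; have s0 : 0 < Num.sqrt eps by rewrite sqrtr_gt0.
have [r [c h]] := eD f hf _ s0; exists r => r' ur sub.
rewrite lerBlDr addrC -lerBlDr; apply: le_trans (best_approx eH eO ur hf c sub) _.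
have ht : H (\sum_(i <- r) c i *: e i) by apply: Hsum => i; exact: HZ.
rewrite -sqr_nm; last exact: HB.
rewrite -[leRHS](sqr_sqrtr (ltW eps0)) ler_pXn2r ?nnegrE ?nm_ge0 ?sqrtr_ge0//.
exact: ltW.
Qed.

(** * Summability of operators with a known eigenbasis *)

Section diagonal.
Variables (I : choiceType) (e : I -> V) (T : V -> V) (d : I -> R).
Hypotheses (eB : orthonormal_basis H ip e) (bT : bounded_operator H ip T).
Hypothesis d0 : forall i, 0 <= d i.
Hypothesis TTe : forall i, T (adjoint H ip T (e i)) = ofR (d i ^+ 2) *: e i.

(** Eigenvectors of a self-adjoint operator for different eigenvalues are orthogonal, so d k = s i
    whenever e k and e' i are not. The sums of d^p are then compared with those of s^p through the
    matrix of |<e k, e' i>|^2: Parseval bounds its rows from below, Bessel its columns from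
    above. *)
Lemma diag_summable p : 0 < p -> summable_operator H ip p T ->
  exists M, forall r : seq I, uniq r -> \sum_(i <- r) d i `^ p <= M.
Proof.
move=> p0 [_ [I' [s [[s0 [e' e'B Te']] fin]]]].
have [eH eO _] := eB; have [e'H e'O _] := e'B.
have key i k : ip (e k) (e' i) != 0 -> s i = d k.
  move=> n0; have h1 := (adjointP bT (e'H i)).1; have h2 := (adjointP bT (eH k)).1.
  have E : ip (T (adjoint H ip T (e k))) (e' i) = ip (e k) (T (adjoint H ip T (e' i))).
    rewrite (adjointP bT (e'H i)).2// (hil_cj hil h1 h2) -(adjointP bT (eH k)).2//.
    by rewrite -(hil_cj hil)//; exact: bop_H.
  move: E; rewrite TTe Te' ipZl// ipZr// -/(ofR _) cj_ofR => /(mulIf n0).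
  by move=> /(congr1 (@re R))/= /eqP; rewrite eqrXn2// => /eqP.
pose E := \esum_(i in [set: I']) (s i `^ p)%:E.
have E0 : (0 <= E)%E by apply: esum_ge0 => i _; rewrite lee_fin powR_ge0.
have Ef : E \is a fin_num by rewrite ge0_fin_numE.
have bE (r : seq I') : uniq r -> \sum_(i <- r) s i `^ p <= fine E.
  move=> ur; rewrite -lee_fin fineK//.
  apply: ereal_sup_ge; exists (\sum_(i <- r) (s i `^ p)%:E)%E; last by rewrite sumEFin.
  exists [set` r] => //; last by rewrite -fsbig_seq.
exists (2 * fine E) => r ur.
(* Finitely many e' i capture at least half of the squared norm of each e k, hence the factor 2. *)
have h2 : (0 : R) < 2^-1 by rewrite invr_gt0.
have /choice[R' hR'] k := parseval_approx e'B (eH k) h2.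
pose r' := undup (flatten [seq R' k | k <- r]).
have ur' : uniq r' by exact: undup_uniq.
have lb k : k \in r -> 2^-1 <= \sum_(i <- r') nc (ip (e k) (e' i)) ^+ 2.
  move=> kr; apply: le_trans (hR' k r' ur' _).
    by rewrite eO eqxx/=; lra.
  by move=> i ir; rewrite mem_undup; apply/flattenP; exists (R' k) => //; exact: map_f.
rewrite -ler_pdivrMl//; apply: le_trans (bE r' ur').
apply: (@le_trans _ _ (\sum_(k <- r) \sum_(i <- r') d k `^ p * nc (ip (e k) (e' i)) ^+ 2)).
  rewrite mulr_sumr big_seq [leRHS]big_seq; apply: ler_sum => k kr.
  by rewrite -mulr_sumr mulrC ler_wpM2l ?powR_ge0 ?lb.
rewrite exchange_big/=; apply: ler_sum => i _.
apply: (@le_trans _ _ (\sum_(k <- r) s i `^ p * nc (ip (e' i) (e k)) ^+ 2)).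
  apply: ler_sum => k _; rewrite (hil_cj hil (eH k) (e'H i)) nc_cj.
  have [->|/key ->//] := eqVneq (ip (e k) (e' i)) 0.
  by rewrite nc0 expr0n/= !mulr0.
rewrite -mulr_sumr -[leRHS]mulr1 ler_wpM2l ?powR_ge0//.
apply: le_trans (bessel eH eO ur (e'H i)) _.
by rewrite e'O eqxx.
Qed.

Lemma summable_diag p M : (forall r : seq I, uniq r -> \sum_(i <- r) d i `^ p <= M) ->
  summable_operator H ip p T.
Proof.
move=> hM; split=> //; exists I, d; split; first by split => //; exists e.
apply: (@le_lt_trans _ _ M%:E); last exact: ltry.
apply: ge_ereal_sup => _ [A [finA _] <-].
have [r ur ->] : exists2 r : seq I, uniq r & A = [set` r].
  have /finite_seqP[t ->] := finA; exists (undup t); first exact: undup_uniq.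
  by apply/seteqP; split => x /=; rewrite mem_undup.
by rewrite -fsbig_seq// sumEFin lee_fin hM.
Qed.

End diagonal.

End hilbert.

(** * Bergman spaces *)

Section discrete_means.
Context (R : realType).
Local Notation C := (Cplx R).
Implicit Types (z w : C).

Definition ccvg (u : nat -> C) (l : C) :=
  forall e : R, 0 < e -> exists N, forall k, (N <= k)%N -> nc (u k - l) <= e.

Lemma ccvg_nc u l : ccvg u l -> nc (u k) @[k --> \oo] --> nc l.
Proof.
move=> h; apply/cvgrPdist_le => e /h[N hN]; exists N => // k /= /hN.
apply: le_trans; rewrite distrC ler_norml; have := ncB_ge (u k) l.
by have := ncB_ge l (u k); rewrite nc_sub; lra.
Qed.

Lemma real_complete (u : R^nat) :
  (forall e : R, 0 < e -> exists N, forall k l, (N <= k)%N -> (N <= l)%N -> `|u k - u l| <= e) ->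
  exists l : R, u k @[k --> \oo] --> l.
Proof.
move=> h; suff : cvgn u by move=> c; exists (limn u).
apply: cauchy_cvg; apply: cauchy_exP => e e0.
have e2 : 0 < e / 2 by lra.
have [N hN] := h _ e2; exists (u N); exists N => // k /= Nk.
by rewrite /ball/=; have := hN _ _ (leqnn N) Nk; lra.
Qed.

Lemma C_complete (u : nat -> C) :
  (forall e : R, 0 < e -> exists N, forall k l, (N <= k)%N -> (N <= l)%N -> nc (u k - u l) <= e) ->
  exists l, ccvg u l.
Proof.
move=> h.
have [|x hx] := @real_complete (fun k => re (u k)).
  move=> e /h[N hN]; exists N => k l Nk Nl; rewrite -reB.
  exact: le_trans (abs_re_le _) (hN _ _ Nk Nl).
have [|y hy] := @real_complete (fun k => im (u k)).
  move=> e /h[N hN]; exists N => k l Nk Nl; rewrite -imB.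
  exact: le_trans (abs_im_le _) (hN _ _ Nk Nl).
exists (mkc x y) => e e0; have e2 : 0 < e / 2 by lra.
move/cvgrPdist_le : hx => /(_ _ e2)[N _ hN]; move/cvgrPdist_le : hy => /(_ _ e2)[M _ hM].
exists (maxn N M) => k; rewrite geq_max => /andP[/hN /= h1 /hM /= h2].
apply: le_trans (nc_le_abs _) _; rewrite reB imB /=.
by rewrite distrC (distrC _ y); lra.
Qed.

Lemma ccvg_uniq u l l' : ccvg u l -> ccvg u l' -> l = l'.
Proof.
move=> h h'; apply/eqP; rewrite -subr_eq0 -nc_eq0 eq_le nc_ge0 andbT.
apply/ler_addgt0Pr => e e0; have e2 : 0 < e / 2 by lra.
have [N hN] := h _ e2; have [M hM] := h' _ e2.
have := hN _ (leq_maxl N M); have := hM _ (leq_maxr N M).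
set x := u _ => h1 h2; have -> : l - l' = (x - l') - (x - l) by ring.
have := ncB (x - l') (x - l); lra.
Qed.

Lemma ccvgB u v l l' : ccvg u l -> ccvg v l' -> ccvg (fun k => u k - v k) (l - l').
Proof.
move=> h h' e e0; have e2 : 0 < e / 2 by lra.
have [N hN] := h _ e2; have [M hM] := h' _ e2; exists (maxn N M) => k.
rewrite geq_max => /andP[/hN h1 /hM h2].
have -> : u k - v k - (l - l') = (u k - l) - (v k - l') by ring.
have := ncB (u k - l) (v k - l'); lra.
Qed.

Lemma ccvg_cst l : ccvg (fun=> l) l.
Proof. by move=> e e0; exists 0%N => k _; rewrite subrr nc0 ltW. Qed.

Lemma cis_onto (r : R) z : nc z = r -> 0 < r -> exists2 y, 0 <= y <= pi *+ 2 & z = cis r y.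
Proof.
move=> zr r0; have E := sqr_nc z; rewrite zr in E.
have rr : -1 <= re z / r <= 1.
  have := abs_re_le z; rewrite zr ler_norml => /andP[h1 h2].
  by rewrite ler_pdivrMr ?ler_pdivlMr// mulN1r mul1r h1 h2.
have ys := @acos_ge0 R _ rr; have yp := @acos_lepi R _ rr.
have cE : r * cos (acos (re z / r)) = re z by rewrite acosK// mulrC divfK ?gt_eqF.
have sE : r * sin (acos (re z / r)) = `|im z|.
  rewrite sin_acos// -[LHS]ger0_norm; last by rewrite mulr_ge0 ?sqrtr_ge0 ?ltW.
  apply/eqP; rewrite -(eqrXn2 (_ : 0 < 2)%N) ?normr_ge0// !(real_normK (num_real _)) exprMn sqr_sqrtr; last first.
    by rewrite subr_ge0 -(real_normK (num_real _)) expr_le1// ler_norml.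
  apply/eqP; rewrite -[im z ^+ 2](addKr (re z ^+ 2)) -E exprMn exprVn; field; rewrite gt_eqF//.
have [i0|i0] := leP 0 (im z).
  exists (acos (re z / r)); first by rewrite ys mulr2n; have := pi_ge0 R; lra.
  by apply: complex_eq => /=; rewrite ?cE// sE ger0_norm.
exists (pi *+ 2 - acos (re z / r)); first by rewrite mulr2n; have := pi_ge0 R; lra.
by apply: complex_eq => /=; rewrite ?cosB ?sinB cos2pi sin2pi; [rewrite mul1r mul0r addr0 cE|
  rewrite mul0r mul1r sub0r mulrN sE ltr0_norm// opprK].
Qed.

Lemma circle_boundC (f : C -> C) (r : R) : 0 < r -> on_circle r f ->
  exists B, forall z, nc z = r -> nc (f z) <= B.
Proof.
move=> r0 /circle_bound[B hB]; exists B => z zr.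
by have [y yp ->] := cis_onto zr r0; exact: hB.
Qed.

Definition zeta (N : nat) : C := cis 1 (pi *+ 2 / N%:R).

Lemma zetaX N k : zeta N ^+ k = cis 1 (k%:R * (pi *+ 2 / N%:R)).
Proof.
elim: k => [|k IH].
  by rewrite expr0 mul0r /cis cos0 sin0 mulr1 mulr0.
rewrite exprS IH cisM mulr1; congr (cis _ _).
have E : k.+1%:R = 1 + k%:R :> R by rewrite mulrS.
by move: (pi *+ 2 / _) => x; rewrite E mulrDl mul1r.
Qed.

Lemma nc_zeta N : nc (zeta N) = 1. Proof. by rewrite nc_cis normr1. Qed.
Lemma nc_zetaX N k : nc (zeta N ^+ k) = 1. Proof. by rewrite ncX nc_zeta expr1n. Qed.
Lemma zetaX_neq0 N k : zeta N ^+ k != 0. Proof. by rewrite -nc_gt0 nc_zetaX. Qed.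

Lemma zetaN N : (0 < N)%N -> zeta N ^+ N = 1.
Proof.
move=> N0; rewrite zetaX mulrC divfK ?pnatr_eq0 -?lt0n//.
by rewrite /cis cos2pi sin2pi mulr1 mulr0.
Qed.

Lemma zeta_prim N d : (0 < d < N)%N -> zeta N ^+ d != 1.
Proof.
move=> /andP[d0 dN]; rewrite zetaX; apply/eqP => /(congr1 (@re R)) /=.
rewrite mul1r; pose x : R := d%:R * pi / N%:R.
have N0 : 0 < N%:R :> R by rewrite ltr0n (ltn_trans d0).
have -> : d%:R * (pi *+ 2 / N%:R) = x *+ 2 by rewrite /x !mulr2n mulrDl mulrDr mulrA.
rewrite cos_mulr2n => h.
have x0 : 0 < x by rewrite divr_gt0// mulr_gt0 ?pi_gt0// ltr0n.
have xp : x < pi by rewrite ltr_pdivrMr// mulrC ltr_pM2l ?pi_gt0// ltr_nat.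
have := @sin_gt0_pi _ x; rewrite x0 xp => /(_ isT); have := cos2Dsin2 x; nra.
Qed.

Lemma zeta_mod N e : (0 < N)%N -> zeta N ^+ e = zeta N ^+ (e %% N).
Proof. by move=> N0; rewrite {1}(divn_eq e N) exprD mulnC exprM zetaN// expr1n mul1r. Qed.

Lemma sum_zeta N e : (0 < N)%N ->
  \sum_(k < N) zeta N ^+ (e * k) = if (N %| e)%N then N%:R else 0.
Proof.
move=> N0; case: ifPn => [/dvdnP[q ->]|ne].
  rewrite (eq_bigr (fun=> 1)) ?sumr_const ?card_ord// => k _.
  by rewrite mulnAC mulnC exprM zetaN// expr1n.
under eq_bigr do rewrite exprM.
have : zeta N ^+ e - 1 != 0.
  rewrite subr_eq0 zeta_mod// zeta_prim// ltn_mod N0 andbT lt0n.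
  exact: ne.
move=> n0; apply: (mulfI n0); rewrite mulr0 -subrX1 -exprM mulnC exprM zetaN// expr1n subrr //.
Qed.

(** The discrete Fourier coefficient of order n on the unit circle. *)
Definition dmean (N n : nat) (f : C -> C) : C :=
  N%:R^-1 * \sum_(k < N) (zeta N ^+ (n * k))^-1 * f (zeta N ^+ k).

Lemma dmeanD N n f g : dmean N n (fun z => f z + g z) = dmean N n f + dmean N n g.
Proof.
rewrite /dmean -mulrDr -big_split; congr (_ * _); apply: eq_bigr => k _; exact: mulrDr.
Qed.

Lemma dmean_poly N n M (a : nat -> C) : (n < N)%N -> (M <= N)%N ->
  dmean N n (fun z => \sum_(l < M) a l * z ^+ l) = if (n < M)%N then a n else 0.
Proof.
move=> nN MN; have N0 : (0 < N)%N by exact: leq_ltn_trans nN.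
rewrite /dmean; under eq_bigr do rewrite mulr_sumr.
rewrite exchange_big/= mulr_sumr.
have E (l : 'I_M) : N%:R^-1 * \sum_(k < N) (zeta N ^+ (n * k))^-1 * (a l * (zeta N ^+ k) ^+ l) =
    if (l == n :> nat) then a l else 0.
  (* The exponent l - n is shifted by the period N to avoid truncated subtraction. *)
  rewrite (eq_bigr (fun k : 'I_N => a l * zeta N ^+ ((l + N - n) * k))); last first.
    move=> k _; rewrite mulrCA; congr (_ * _).
    apply: (mulfI (zetaX_neq0 N (n * k))); rewrite mulVKf ?zetaX_neq0//.
    rewrite -exprM -exprD -mulnDl subnKC; last by rewrite (leq_trans (ltnW nN)) ?leq_addl.
    by rewrite mulnDl exprD (exprM _ N) zetaN// expr1n mulr1 mulnC.
  rewrite -mulr_sumr sum_zeta//.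
  have lN : (l < N)%N by exact: leq_trans MN.
  have -> : (N %| l + N - n)%N = (l == n :> nat).
    apply/idP/eqP => [|->]; last by rewrite addKn.
    have [ln|nl|//] := ltngtP l n.
      have h1 : (0 < l + N - n < N)%N by apply/andP; split; lia.
      by move=> /dvdn_leq; lia.
    rewrite (_ : l + N - n = (l - n) + N)%N; last lia.
    rewrite dvdn_addl// => /dvdn_leq; lia.
  case: ifP => _; last by rewrite !mulr0.
  by rewrite mulrCA mulVf ?mulr1// pnatr_eq0 -lt0n.
rewrite (eq_bigr _ (fun l _ => E l)) -big_mkcond/=.
case: ifPn => nM; first by rewrite (big_pred1 (Ordinal nM)).
by rewrite big_pred0// => l; apply/negbTE; apply: contraNneq nM => <-.
Qed.

Lemma nc_dmean N n f B : (0 < N)%N -> (forall k, (k < N)%N -> nc (f (zeta N ^+ k)) <= B) ->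
  nc (dmean N n f) <= B.
Proof.
move=> N0 fB; rewrite /dmean ncM ncV -ofRn nc_ofR normr_nat ler_pdivrMl ?ltr0n//.
apply: le_trans (nc_sum _ _ _) _; rewrite -[N in leRHS]card_ord mulr_natl -sumr_const.
by apply: ler_sum => k _; rewrite ncM ncV nc_zetaX invr1 mul1r fB.
Qed.

Lemma sqr_nc_dmean N f : (0 < N)%N ->
  nc (dmean N 0 f) ^+ 2 <= N%:R^-1 * \sum_(k < N) nc (f (zeta N ^+ k)) ^+ 2.
Proof.
move=> N0; rewrite /dmean ncM ncV -ofRn nc_ofR normr_nat exprMn.
have N0' : 0 < N%:R :> R by rewrite ltr0n.
rewrite exprVn expr2 invfM -mulrA ler_pM2l ?invr_gt0// ler_pdivrMl//.
have h : nc (\sum_(k < N) (zeta N ^+ (0 * k))^-1 * f (zeta N ^+ k)) <= \sum_(k < N) nc (f (zeta N ^+ k)).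
  by apply: le_trans (nc_sum _ _ _) _; apply: ler_sum => k _; rewrite mul0n expr0 invr1 mul1r.
apply: (@le_trans _ _ ((\sum_(k < N) nc (f (zeta N ^+ k))) ^+ 2)).
  by rewrite ler_pXn2r ?nnegrE ?nc_ge0// (le_trans _ h) ?nc_ge0.
suff H (F : 'I_N -> R) : (\sum_(k < N) F k) ^+ 2 <= N%:R * \sum_(k < N) F k ^+ 2 by exact: H.
set S := \sum_(k < N) F k; rewrite -subr_ge0.
have : 0 <= \sum_(k < N) (F k - S / N%:R) ^+ 2 by apply: sumr_ge0 => k _; exact: sqr_ge0.
have -> : \sum_(k < N) (F k - S / N%:R) ^+ 2 = \sum_(k < N) F k ^+ 2 - S ^+ 2 / N%:R.
  rewrite (eq_bigr (fun k => F k ^+ 2 + (- (2 * (S / N%:R)) * F k + (S / N%:R) ^+ 2))); last first.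
    by move=> k _; ring.
  rewrite !big_split/= -mulr_sumr -/S sumr_const card_ord -mulr_natl.
  by rewrite exprMn; field; rewrite gt_eqF.
by rewrite !subr_ge0 ler_pdivrMr// mulrC.
Qed.

(** The mean over N + 1 roots of unity treats the Taylor polynomial of degree N exactly, and the
    remainder is geometrically small since |l z| <= 1 < r. *)
Lemma dmean_cvgZ f (R0 r : R) n (l : C) : (forall z, nc z < R0 -> cdiff f z) -> 1 < r < R0 ->
  nc l <= 1 -> ccvg (fun N => dmean N.+1 n (fun z => f (l * z))) (l ^+ n * tcoef f r n).
Proof.
move=> df /andP[r1 rR] l1; have r0 : 0 < r by lra.
have rR0 : 0 < r < R0 by rewrite r0.
have [B hB] : exists B, forall z, nc z = r -> nc (f z) <= B.
  by apply: circle_boundC => //; apply: cdiff_circle (ltW r0) => z zr; apply: df; rewrite zr.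
have [B1 hB1] : exists B, forall z, nc z = nc l -> nc (f z) <= B.
  have [->|l0] := eqVneq l 0.
    by exists (nc (f 0)) => z /eqP; rewrite nc0 nc_eq0 => /eqP ->.
  apply: circle_boundC; first by rewrite nc_gt0.
  by apply: cdiff_circle (nc_ge0 l) => z zr; apply: df; rewrite zr; lra.
pose K := 2 * (r / (r - 1) * (`|B| + `|B1|)).
have K0 : 0 <= K by rewrite !mulr_ge0 ?addr_ge0 ?invr_ge0//; lra.
have rem N w : nc w = nc l -> nc (f w - \sum_(k < N) tcoef f r k * w ^+ k) <= r^-1 ^+ N * K.
  move=> w1; have wr : nc w < r by rewrite w1; lra.
  apply: le_trans (taylor_rem df rR0 wr N hB) _; rewrite w1.
  have nl0 := nc_ge0 l.
  have q0 : 0 <= r / (r - nc l) by apply: divr_ge0; lra.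
  have b1 : B + nc (f w) <= `|B| + `|B1|.
    by apply: lerD; [exact: ler_norm|exact: le_trans (hB1 _ w1) (ler_norm _)].
  apply: (@le_trans _ _ ((nc l / r) ^+ N * K)).
    rewrite ler_wpM2l ?exprn_ge0 ?divr_ge0 ?(ltW r0)// /K ler_wpM2l//.
    apply: (@le_trans _ _ (r / (r - nc l) * (`|B| + `|B1|))); first by rewrite ler_wpM2l.
    rewrite ler_wpM2r ?addr_ge0// ler_wpM2l ?(ltW r0)// lef_pV2 ?posrE; lra.
  rewrite ler_wpM2r// lerXn2r ?nnegrE ?divr_ge0 ?invr_ge0 ?(ltW r0)//.
  by rewrite ler_pdivrMr// mulVf ?gt_eqF.
move=> e e0.
have : (geometric K r^-1) k @[k --> \oo] --> (0 : R).
  by apply: cvg_geometric; rewrite ger0_norm ?invr_ge0 ?(ltW r0)// invf_lt1.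
move=> /cvgr0Pnorm_le/(_ _ e0)[N0 _ hN0]; exists (maxn N0 n) => N; rewrite geq_max => /andP[NN nN].
have := hN0 N.+1 (leqW NN); rewrite /= => h.
have -> : dmean N.+1 n (fun z => f (l * z)) - l ^+ n * tcoef f r n =
   dmean N.+1 n (fun z => f (l * z) - \sum_(k < N.+1) tcoef f r k * (l * z) ^+ k).
  set g := (fun z => f (l * z) - _).
  pose P z := \sum_(k < N.+1) (l ^+ k * tcoef f r k) * z ^+ k.
  have PE z : P z = \sum_(k < N.+1) tcoef f r k * (l * z) ^+ k.
    apply: eq_bigr => k _; rewrite (exprMn k l z) [RHS]mulrA; congr (_ * _); exact: mulrC.
  have fE : (fun z => f (l * z)) = (fun z => g z + P z).
    by apply/funext => z; rewrite PE /g subrK.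
  rewrite {1}fE dmeanD (dmean_poly (fun k => l ^+ k * tcoef f r k))// ltnS nN.
  by rewrite addrK.
apply: le_trans (nc_dmean _ _ _) (le_trans (ler_norm _) h) => // k _.
by rewrite [leRHS]mulrC; apply: rem; rewrite ncM nc_zetaX mulr1.
Qed.

Lemma dmean_cvg f (R0 r : R) n : (forall z, nc z < R0 -> cdiff f z) -> 1 < r < R0 ->
  ccvg (fun N => dmean N.+1 n f) (tcoef f r n).
Proof.
move=> df rR; have := @dmean_cvgZ f R0 r n 1 df rR; rewrite nc1 lexx expr1n mul1r => /(_ isT).
by have -> : (fun z => f (1 * z)) = f by apply/funext => z; rewrite mul1r.
Qed.

End discrete_means.

(** * Measurability of functions that are continuous at the points of a domain *)

Section measurability.
Context (R : realType) (m : nat).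
Local Notation C := (Cplx R).
Local Notation L := (measurableTypeR R).
Local Notation pt := (m.-tuple (L * L)).

Definition cp (x : pt) : 'rV[C]_m := @Cpoint R m x.

Lemma cpE x j : cp x 0 j = mkc (tnth x j).1 (tnth x j).2.
Proof. by rewrite mxE. Qed.

Section grid.
Variable n : nat.

Definition gridq (x : pt) : {ffun 'I_m -> int * int} :=
  [ffun j => (Num.floor ((tnth x j).1 * n.+1%:R), Num.floor ((tnth x j).2 * n.+1%:R))].

Definition grid (t : {ffun 'I_m -> int * int}) : 'rV[C]_m :=
  \row_j mkc ((t j).1%:~R / n.+1%:R) ((t j).2%:~R / n.+1%:R).

Lemma measurable_gridq t : measurable (gridq @^-1` [set t]).
Proof.
pose A j : set pt := [set x | Num.floor ((tnth x j).1 * n.+1%:R) = (t j).1 /\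
   Num.floor ((tnth x j).2 * n.+1%:R) = (t j).2].
have -> : gridq @^-1` [set t] = \bigcap_(j in [set: 'I_m]) A j.
  apply/seteqP; split=> [x /= xt j _|x h /=]; first by rewrite /A/= -xt ffunE.
  by apply/ffunP => j; rewrite ffunE; have [-> ->] := h j I; case: (t j).
apply: fin_bigcap_measurable => // j _.
have mf1 : measurable_fun setT (fun x : pt => (tnth x j).1 * n.+1%:R : L).
  apply: measurable_funM => //.
  by apply: (measurableT_comp measurable_fst); exact: measurable_tnth.
have mf2 : measurable_fun setT (fun x : pt => (tnth x j).2 * n.+1%:R : L).
  apply: measurable_funM => //.
  by apply: (measurableT_comp measurable_snd); exact: measurable_tnth.
have cell (k : int) (f : pt -> L) : measurable_fun setT f ->
    measurable [set x | Num.floor (f x : R) = k].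
  move=> mf; rewrite (_ : [set x | _] = f @^-1` `[k%:~R, (k + 1)%:~R[).
    by rewrite -[X in measurable X]setTI; exact: mf.
  apply/seteqP; split => x /=; rewrite in_itv/=; first by move=> <-; exact: floor_itv.
  exact: floor_def.
exact: measurableI (cell _ _ mf1) (cell _ _ mf2).
Qed.

Lemma grid_dist x : N1 (grid (gridq x) - cp x) <= m%:R * (2 / n.+1%:R).
Proof.
apply: N1_lt => j.
have -> : (grid (gridq x) - cp x) 0 j =
    mkc ((Num.floor ((tnth x j).1 * n.+1%:R))%:~R / n.+1%:R - (tnth x j).1)
        ((Num.floor ((tnth x j).2 * n.+1%:R))%:~R / n.+1%:R - (tnth x j).2).
  by rewrite !mxE ffunE.
apply: le_trans (nc_le_abs _) _; rewrite /re /im /=.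
have H (y : R) : `|(Num.floor (y * n.+1%:R))%:~R / n.+1%:R - y| <= n.+1%:R^-1.
  have n0 : 0 < n.+1%:R :> R by [].
  have /andP[h1 h2] := floor_itv (y * n.+1%:R).
  rewrite ler_norml; apply/andP; split.
    rewrite lerBrDr ler_pdivlMr// mulrDl mulNr mulVf ?gt_eqF//.
    by move: h2; rewrite intrD; lra.
  rewrite lerBlDr ler_pdivrMr// mulrDl mulVf ?gt_eqF//; lra.
rewrite (_ : 2 / n.+1%:R = n.+1%:R^-1 + n.+1%:R^-1); last by ring.
by apply: lerD; exact: H.
Qed.

End grid.

Variable O : set 'rV[C]_m.
Let D := cp @^-1` O.

(** A pointwise limit on D of the functions sampling f at the corners of a grid of mesh 1 / (n + 1);
    these take countably many values on measurable cells. *)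
Lemma cont_measurable (f : 'rV[C]_m -> R) :
  (forall z, O z -> forall e : R, 0 < e -> exists2 d : R, 0 < d &
    forall h, N1 h < d -> `|f (z + h) - f z| <= e) ->
  measurable_fun D (fun x : pt => f (cp x) : L).
Proof.
move=> cf; apply: (measurable_fun_cvg (h := fun n (x : pt) => f (grid n (gridq n x)))).
  move=> n mD B mB.
  suff : measurable ((fun x : pt => f (grid n (gridq n x))) @^-1` B) by exact: measurableI.
  rewrite (_ : _ @^-1` B = \bigcup_t (if f (grid n t) \in B then gridq n @^-1` [set t] else set0)).
    apply: countable_bigcupT_measurable; first exact: countableP.
    by move=> t; case: ifP => _; [exact: measurable_gridq|exact: measurable0].
  apply/seteqP; split => [x /= Bx|x [t _] /=].
    by exists (gridq n x) => //=; rewrite mem_set.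
  by case: ifPn => //= /set_mem Bt xt; rewrite xt.
move=> x Dx; apply/cvgrPdist_le => e e0; have [d d0 hd] := cf _ Dx e e0.
have : (2 * m%:R) * n.+1%:R^-1 @[n --> \oo] --> (2 * m%:R * 0 : R).
  by apply: cvgMr; exact: cvg_harmonic.
rewrite mulr0 => /cvgrPdist_lt/(_ _ d0)[N _ hN]; exists N => // n /= /hN /=.
rewrite sub0r normrN ger0_norm ?mulr_ge0 ?invr_ge0// => h.
rewrite distrC; have := hd (grid n (gridq n x) - cp x).
rewrite (_ : cp x + (_ - _) = grid n (gridq n x)); last by rewrite addrC subrK.
apply; by apply: le_lt_trans (grid_dist n x) _; rewrite mulrCA mulrA.
Qed.

Lemma hdiff_cont (f : 'rV[C]_m -> C^o) z : hdiff f z -> forall e : R, 0 < e ->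
  exists2 d : R, 0 < d & forall h, N1 h < d -> nc (f (z + h) - f z : C) <= e.
Proof.
move=> [c hc] e e0; have [d d0 hd] := hc 1 ltr01.
have S0 : 0 <= \sum_j nc (c j) by apply: sumr_ge0 => j _; exact: nc_ge0.
pose K := 1 + \sum_j nc (c j); have K0 : 0 < K by rewrite /K; lra.
exists (Num.min d (e / K)); first by rewrite lt_min d0 divr_gt0.
move=> h; rewrite lt_min => /andP[/hd h1 h2].
rewrite -[X in nc X](subrK (\sum_j c j * h 0 j)); apply: le_trans (ncD _ _) _.
apply: (@le_trans _ _ (K * N1 h)); last by rewrite mulrC -ler_pdivlMr// ltW.
rewrite /K mulrDl; apply: lerD => //.
apply: le_trans (nc_sum _ _ _) _; rewrite mulr_suml; apply: ler_sum => j _.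
by rewrite ncM ler_wpM2l ?nc_ge0 ?N1_ge.
Qed.

Section hol.
Variable f : 'rV[C]_m -> C^o.
Hypothesis df : forall z, O z -> hdiff f z.

Lemma measurable_re : measurable_fun D (fun x : pt => re (f (cp x)) : L).
Proof.
apply: (cont_measurable (f := fun z => re (f z))) => z Oz e e0.
have [d d0 hd] := hdiff_cont (df Oz) e0; exists d => // h /hd.
by apply: le_trans; rewrite -reB abs_re_le.
Qed.

Lemma measurable_im : measurable_fun D (fun x : pt => im (f (cp x)) : L).
Proof.
apply: (cont_measurable (f := fun z => im (f z))) => z Oz e e0.
have [d d0 hd] := hdiff_cont (df Oz) e0; exists d => // h /hd.
by apply: le_trans; rewrite -imB abs_im_le.
Qed.

Lemma measurable_nc2 : measurable_fun D (fun x : pt => nc (f (cp x)) ^+ 2 : L).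
Proof.
rewrite (_ : (fun x => _) = (fun x : pt => re (f (cp x)) ^+ 2 + im (f (cp x)) ^+ 2 : L)).
  apply: measurable_funD; apply: measurable_funX; [exact: measurable_re|exact: measurable_im].
by apply/funext => x; rewrite sqr_nc.
Qed.

End hol.

End measurability.

(** * The inner product of the Bergman space *)

Section bergman_form.
Context (R : realType) (m : nat).
Local Notation C := (Cplx R).
Local Notation L := (measurableTypeR R).
Local Notation pt := (m.-tuple (L * L)).
Local Notation lm := (lebesgue_Cm R m).
Variable O : set 'rV[C]_m.
Local Notation D := (@cp R m @^-1` O).
Hypothesis mD : measurable D.
Local Notation H := (bergman_space O).
Local Notation ip := (bergman_ip O).
Implicit Types (f g h : 'rV[C]_m -> C^o).

Definition hol f := (forall z, O z -> hdiff f z) /\ (forall z, ~ O z -> f z = 0).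

Definition I2 f : \bar R := (\int[lm]_(x in D) (nc (f (cp x)) ^+ 2)%:E)%E.

Lemma bergP f : H f <-> hol f /\ (I2 f < +oo)%E.
Proof.
split=> [[df f0 /integrableP[_ fi]]|[[df f0] fi]].
  split; first by split => // z /df /hdiffP.
  apply: le_lt_trans fi; apply: ge0_le_integral => //.
  - by move=> x _; rewrite lee_fin sqr_ge0.
  - by apply/measurable_EFinP; apply: measurable_nc2 => // z /df /hdiffP.
  - apply: measurableT_comp => //; apply/measurable_EFinP.
    by apply: measurable_nc2 => // z /df /hdiffP.
  - by move=> x _; rewrite lee_fin ler_norm.
split=> //; first by move=> z /df /hdiffP.
apply/integrableP; split; first by apply/measurable_EFinP; exact: measurable_nc2.
by under eq_integral do rewrite gee0_abs ?lee_fin ?sqr_ge0//.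
Qed.

Lemma nc_int f : H f -> lm.-integrable D (fun x => (nc (f (cp x)) ^+ 2)%:E).
Proof. by move=> [_ _]. Qed.

Lemma re_mul_int f g : H f -> H g ->
  lm.-integrable D (EFin \o (fun x => re (f (cp x) * cj (g (cp x) : C)))).
Proof.
move=> hf hg; have [[df f0] _] := (bergP f).1 hf; have [[dg g0] _] := (bergP g).1 hg.
apply: (le_integrable mD _ _ (integrableD mD (nc_int hf) (nc_int hg))).
  apply/measurable_EFinP; under eq_fun do rewrite reM re_cj im_cj mulrN opprK.
  apply: measurable_funD; apply: measurable_funM.
  - exact: (measurable_re df).
  - exact: (measurable_re dg).
  - exact: (measurable_im df).
  - exact: (measurable_im dg).
move=> x _ /=; rewrite lee_fin; apply: le_trans (abs_re_le _) _; rewrite ncM nc_cj.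
rewrite ger0_norm ?addr_ge0 ?sqr_ge0//.
move: (nc _) (nc _) => a b; nra.
Qed.

Lemma im_mul_int f g : H f -> H g ->
  lm.-integrable D (EFin \o (fun x => im (f (cp x) * cj (g (cp x) : C)))).
Proof.
move=> hf hg; have [[df f0] _] := (bergP f).1 hf; have [[dg g0] _] := (bergP g).1 hg.
apply: (le_integrable mD _ _ (integrableD mD (nc_int hf) (nc_int hg))).
  apply/measurable_EFinP; under eq_fun do rewrite imM re_cj im_cj mulrN.
  apply: measurable_funD; last first.
    by apply: measurable_funM; [exact: (measurable_im df)|exact: (measurable_re dg)].
  apply: measurableT_comp => //.
  by apply: measurable_funM; [exact: (measurable_re df)|exact: (measurable_im dg)].
move=> x _ /=; rewrite lee_fin; apply: le_trans (abs_im_le _) _; rewrite ncM nc_cj.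
rewrite ger0_norm ?addr_ge0 ?sqr_ge0//.
move: (nc _) (nc _) => a b; nra.
Qed.

Lemma re_ip f g : re (ip f g) = (\int[lm]_(x in D) re (f (cp x) * cj (g (cp x) : C)))%R.
Proof. by []. Qed.

Lemma im_ip f g : im (ip f g) = (\int[lm]_(x in D) im (f (cp x) * cj (g (cp x) : C)))%R.
Proof. by []. Qed.

Lemma bergL c f g : H f -> H g -> H (c *: f + g).
Proof.
move=> hf hg; have [[df f0] fi] := (bergP f).1 hf; have [[dg g0] gi] := (bergP g).1 hg.
have dfg : hol (c *: f + g).
  split=> z; last first.
    by move=> nz; rewrite -[LHS]/(c * f z + g z) f0// g0// mulr0 addr0.
  move=> Oz; have [a ha] := df _ Oz; have [b hb] := dg _ Oz.
  exists (fun j => c * a j + b j) => e e0.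
  have c0 : 0 < nc c + 1 by have := nc_ge0 c; lra.
  have e1 : 0 < e / 2 / (nc c + 1) by rewrite divr_gt0// divr_gt0.
  have e2 : 0 < e / 2 by lra.
  have [d d0 hd] := ha _ e1; have [d' d0' hd'] := hb _ e2.
  exists (Num.min d d'); first by rewrite lt_min d0.
  move=> h; rewrite lt_min => /andP[/hd h1 /hd' h2].
  rewrite -[X in nc X]/(c * f (z + h) + g (z + h) - (c * f z + g z) - \sum_j (c * a j + b j) * h 0 j).
  have -> : \sum_j (c * a j + b j) * h 0 j = c * (\sum_j a j * h 0 j) + \sum_j b j * h 0 j.
    by rewrite mulr_sumr -big_split; apply: eq_bigr => j _; rewrite mulrDl mulrA.
  move: (\sum_j _) (\sum_j _) h1 h2 => B A h1 h2.
  have -> : c * f (z + h) + g (z + h) - (c * f z + g z) - (c * A + B) =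
    c * (f (z + h) - f z - A : C) + (g (z + h) - g z - B : C) by rewrite /=; ring.
  apply: le_trans (ncD _ _) _; rewrite ncM.
  have : nc c * nc (f (z + h) - f z - A : C) <= e / 2 * N1 h.
    apply: (@le_trans _ _ ((nc c + 1) * (e / 2 / (nc c + 1) * N1 h))).
      by apply: ler_pM; rewrite ?nc_ge0// lerDl.
    by rewrite mulrA (mulrC (nc c + 1)) divfK// gt_eqF.
  lra.
split; [by move=> z Oz; apply/hdiffP; case: dfg => h _; exact: h|by case: dfg|].
apply: (le_integrable mD _ _ (integrableD mD
  (integrableZl mD (2 * nc c ^+ 2) (nc_int hf)) (integrableZl mD 2 (nc_int hg)))).
  by apply/measurable_EFinP; apply: measurable_nc2 => z Oz; case: dfg => h _; exact: h.
move=> x _ /=; rewrite lee_fin -[ComplexField.Normc.normc _]/(nc (c * f (cp x) + g (cp x))).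
rewrite !ger0_norm ?addr_ge0 ?mulr_ge0 ?nc_ge0 ?sqr_ge0//.
have h := ncD (c * f (cp x)) (g (cp x)); rewrite ncM in h.
have h0 := nc_ge0 (c * f (cp x) + g (cp x)).
apply: (@le_trans _ _ ((nc c * nc (f (cp x)) + nc (g (cp x))) ^+ 2)).
  by rewrite ler_pXn2r ?nnegrE// (le_trans h0).
move: (nc c) (nc (f _)) (nc (g _)) => u v w; rewrite -subr_ge0.
rewrite (_ : _ - _ = (u * v - w) ^+ 2) ?sqr_ge0//; ring.
Qed.

Lemma berg0 : H 0.
Proof.
apply/bergP; split.
  split=> // z Oz; exists (fun=> 0) => e e0; exists 1 => // h _.
  rewrite -[X in nc X]/(0 - 0 - \sum_j 0 * h 0 j) big1; last by move=> j _; rewrite mul0r.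
  by rewrite !subr0 nc0 mulr_ge0 ?N1_ge0 ?ltW.
rewrite /I2 integral0_eq// => x _.
by rewrite -[X in nc X]/(0 : C) nc0 expr0n.
Qed.

Lemma berg_ipL c f g h : H f -> H g -> H h -> ip (c *: f + g) h = c * ip f h + ip g h.
Proof.
move=> hf hg hh; have hr := re_mul_int hf hh; have hi := im_mul_int hf hh.
have gr := re_mul_int hg hh; have gi := im_mul_int hg hh.
apply: complex_eq.
  rewrite reD reM re_ip (im_ip f h) (re_ip f h) (re_ip g h).
  rewrite -(RintegralZl (re c) mD hr) -mulNr -(RintegralZl (- im c) mD hi).
  have e1 := integrableZl mD (re c) hr; have e2 := integrableZl mD (- im c) hi.
  rewrite -(RintegralD mD e1 e2) -(RintegralD mD _ gr); last exact: (integrableD mD e1 e2).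
  apply: eq_Rintegral => x _.
  rewrite -[(c *: f + g) (cp x)]/(c * f (cp x) + g (cp x)).
  by rewrite mulrDl reD -mulrA reM mulNr.
rewrite imD imM im_ip (im_ip f h) (re_ip f h) (im_ip g h).
rewrite -(RintegralZl (re c) mD hi) -(RintegralZl (im c) mD hr).
have e1 := integrableZl mD (re c) hi; have e2 := integrableZl mD (im c) hr.
rewrite -(RintegralD mD e1 e2) -(RintegralD mD _ gi); last exact: (integrableD mD e1 e2).
apply: eq_Rintegral => x _.
rewrite -[(c *: f + g) (cp x)]/(c * f (cp x) + g (cp x)).
by rewrite mulrDl imD -mulrA imM.
Qed.

Lemma berg_cj f g : H f -> H g -> ip g f = cj (ip f g).
Proof.
move=> hf hg; have hr := re_mul_int hf hg; have hi := im_mul_int hf hg.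
apply: complex_eq; rewrite ?re_cj ?im_cj ?re_ip ?im_ip.
  by apply: eq_Rintegral => x _; rewrite !reM !re_cj !im_cj; ring.
rewrite -mulN1r -(RintegralZl _ mD hi).
by apply: eq_Rintegral => x _; rewrite !imM !re_cj !im_cj; ring.
Qed.

Lemma re_ipE f : H f -> re (ip f f) = fine (I2 f).
Proof.
move=> hf; rewrite re_ip /Rintegral; congr (fine _); apply: eq_integral => x _.
by rewrite mulrC cjMr.
Qed.

Lemma I2E f : H f -> I2 f = (re (ip f f))%:E.
Proof.
move=> hf; rewrite re_ipE// fineK// ge0_fin_numE ?((bergP f).1 hf).2//.
by apply: integral_ge0 => x _; rewrite lee_fin sqr_ge0.
Qed.

Lemma berg_ge0 f : H f -> 0 <= re (ip f f).
Proof.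
by move=> hf; rewrite -lee_fin -I2E//; apply: integral_ge0 => x _; rewrite lee_fin sqr_ge0.
Qed.

Lemma measurable_hol f : hol f -> measurable_fun setT (fun x : pt => nc (f (cp x)) ^+ 2 : L).
Proof.
move=> [df f0].
rewrite (_ : (fun x => _) = (fun x : pt => nc (f (cp x)) ^+ 2) \_ D).
  by apply/(measurable_restrictT _ mD); exact: (measurable_nc2 df).
apply/funext => x; rewrite patchE; case: ifPn => // /negP xD.
by rewrite f0 ?nc0 ?expr0n// => Dx; apply: xD; rewrite inE.
Qed.

Lemma I2T f : hol f -> I2 f = (\int[lm]_x (nc (f (cp x)) ^+ 2)%:E)%E.
Proof.
move=> [df f0]; rewrite /I2 integral_mkcond; apply: eq_integral => x _.
rewrite patchE; case: ifPn => // /negP xD.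
by rewrite f0 ?nc0 ?expr0n// => Dx; apply: xD; rewrite inE.
Qed.

End bergman_form.

Section fatou_le.
Context d (T : measurableType d) (R : realType) (mu : {measure set T -> \bar R}).
Local Open Scope ereal_scope.

(** Replacing u n by its minimum with g turns the asymptotic lower bound into convergence to g. *)
Lemma fatou_le (D : set T) (u : nat -> T -> R) (g : T -> R) (B : \bar R) : measurable D ->
  (forall n, measurable_fun D (u n)) -> measurable_fun D g ->
  (forall n x, (0 <= u n x)%R) -> (forall x, (0 <= g x)%R) ->
  (forall x, D x -> forall e : R, (0 < e)%R ->
     exists N, forall n, (N <= n)%N -> (g x - e <= u n x)%R) ->
  (forall n, \int[mu]_(x in D) (u n x)%:E <= B) -> \int[mu]_(x in D) (g x)%:E <= B.
Proof.
move=> mD mu_ mg u0 g0 ug uB.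
pose v n x : R := Num.min (u n x) (g x).
have v0 n x : (0 <= v n x)%R by rewrite /v le_min u0 g0.
have mv n : measurable_fun D (v n) by apply: measurable_minr.
have -> : \int[mu]_(x in D) (g x)%:E = \int[mu]_(x in D) limn_einf (fun n => (v n x)%:E).
  apply: eq_integral => x /set_mem Dx.
  suff /cvg_limn_einf_sup[-> _] : (fun n => (v n x)%:E) @ \oo --> (g x)%:E by [].
  apply: cvg_EFin; first exact: nearW.
  apply/cvgrPdist_le => e e0; have [N hN] := ug x Dx e e0; exists N => // n /= /hN h.
  rewrite ler_norml /v /Num.min; case: ltP => h2; lra.
apply: le_trans (fatou mu mD _ _) _.
- by move=> n; apply/measurable_EFinP.
- by move=> n x _; rewrite lee_fin.
rewrite limn_einf_lim; apply: lime_le; first exact: is_cvg_einfs.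
apply: nearW => n; apply: (@le_trans _ _ (\int[mu]_(x in D) (v n x)%:E)).
  by apply: ereal_inf_lbound; exists n => /=.
apply: le_trans (uB n); apply: ge0_le_integral => //.
- by move=> x _; rewrite lee_fin.
- by apply/measurable_EFinP.
- by apply/measurable_EFinP.
- by move=> x _; rewrite lee_fin /v ge_min lexx.
Qed.

End fatou_le.

Section tcoef1.
Context (R : realType).
Local Notation C := (Cplx R).

(** Compares, at one small real point t, the Taylor remainder of order 2, of size K t^2, with the
    remainder in the definition of the derivative. *)
Lemma tcoef1 (f : C -> C) (R0 r : R) (D : C) : (forall z, nc z < R0 -> cdiff f z) -> 0 < r < R0 ->
  (forall e : R, 0 < e -> exists2 d : R, 0 < d & forall w, nc w < d ->
     nc (f w - f 0 - D * w) <= e * nc w) -> tcoef f r 1 = D.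
Proof.
move=> df rR hD; have /andP[r0 rR'] := rR.
have [B hB] : exists B, forall z, nc z = r -> nc (f z) <= B.
  by apply: circle_boundC => //; apply: cdiff_circle (ltW r0) => z zr; apply: df; rewrite zr.
have [d0 d00 hd0] := cdiff_cont (df 0 (ltac:(by rewrite nc0; lra))) ltr01.
pose B' := `|B| + nc (f 0) + 1.
have B'0 : 0 < B' by rewrite /B' ltr_wpDl// addr_ge0 ?nc_ge0.
pose K := 4 * B' / r ^+ 2; have K0 : 0 < K by rewrite divr_gt0 ?exprn_gt0// mulr_gt0.
apply/eqP; rewrite -subr_eq0 -nc_eq0 eq_le nc_ge0 andbT.
apply/ler_addgt0Pr => e e0; rewrite add0r.
have [d1 d10 hd1] := hD (e / 2) (ltac:(by rewrite divr_gt0)).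
pose t := Num.min (r / 2) (Num.min (d0 / 2) (Num.min (d1 / 2) (e / 2 / K))).
have t0 : 0 < t.
  have p1 : 0 < r / 2 by lra.
  have p2 : 0 < d0 / 2 by lra.
  have p3 : 0 < d1 / 2 by lra.
  have p4 : 0 < e / 2 / K by apply: divr_gt0 => //; lra.
  by rewrite /t !lt_min p1 p2 p3 p4.
have t1 : t <= r / 2 by rewrite ge_min lexx.
have t2 : t <= d0 / 2 by rewrite /t !ge_min lexx orbT.
have t3 : t <= d1 / 2 by rewrite /t !ge_min lexx !orbT.
have t4 : t <= e / 2 / K by rewrite /t !ge_min lexx !orbT.
have nt : nc (ofR t) = t by rewrite nc_ofR gtr0_norm.
have h1 := hd1 (ofR t) (ltac:(by rewrite nt; lra)); rewrite nt in h1.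
have h2 := taylor_rem df rR (ltac:(by rewrite nt; lra) : nc (ofR t) < r) 2 hB.
rewrite nt !big_ord_recl big_ord0 addr0 expr0 mulr1 expr1 (tcoef0 df rR) in h2.
have fb : nc (f (ofR t)) <= nc (f 0) + 1.
  have := hd0 (ofR t); rewrite subr0 nt => /(_ (ltac:(lra))).
  by have := ncB_ge (f (ofR t)) (f 0); lra.
have h3 : (t / r) ^+ 2 * (2 * (r / (r - t) * (B + nc (f (ofR t))))) <= K * t ^+ 2.
  have q : r / (r - t) <= 2 by rewrite ler_pdivrMr; lra.
  have q0 : 0 <= r / (r - t) by apply: divr_ge0; lra.
  have s1 : B + nc (f (ofR t)) <= B' by rewrite /B'; have := ler_norm B; lra.
  have s2 : r / (r - t) * (B + nc (f (ofR t))) <= 2 * B'.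
    apply: (@le_trans _ _ (r / (r - t) * B')); first by rewrite ler_wpM2l.
    by rewrite ler_wpM2r ?(ltW B'0).
  rewrite (_ : K * t ^+ 2 = (t / r) ^+ 2 * (2 * (2 * B'))); last by rewrite /K; field; rewrite gt_eqF.
  by rewrite ler_wpM2l ?sqr_ge0// ler_wpM2l.
have h4 : nc ((tcoef f r 1 - D) * ofR t) <= e / 2 * t + K * t ^+ 2.
  have -> : (tcoef f r 1 - D) * ofR t = (f (ofR t) - f 0 - D * ofR t) - (f (ofR t) - (f 0 + tcoef f r 1 * ofR t)) by ring.
  apply: le_trans (ncB _ _) (lerD h1 (le_trans h2 h3)).
rewrite ncM nt in h4.
have h5 : K * t <= e / 2 by rewrite mulrC -ler_pdivlMr.
rewrite -(ler_pM2r t0); apply: le_trans h4 _.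
rewrite expr2 mulrA -mulrDl ler_pM2r//; lra.
Qed.

End tcoef1.

(** * Point evaluations and completeness of the Bergman space *)

Section bergman_complete.
Context (R : realType) (m : nat).
Local Notation C := (Cplx R).
Local Notation L := (measurableTypeR R).
Local Notation pt := (m.-tuple (L * L)).
Local Notation lm := (lebesgue_Cm R m).
Variable O : set 'rV[C]_m.
Local Notation D := (@cp R m @^-1` O).
Hypothesis mD : measurable D.
Hypothesis Oopen : forall z, O z -> exists2 d : R, 0 < d & forall h, N1 h < d -> O (z + h).
Local Notation H := (bergman_space O).
Local Notation ip := (bergman_ip O).
Implicit Types (f g : 'rV[C]_m -> C^o) (h : 'rV[C]_m).

Lemma slice_cdiff f w h (R0 : R) : hol O f -> (forall l : C, nc l < R0 -> O (w + l *: h)) ->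
  forall l : C, nc l < R0 -> cdiff (fun l => f (w + l *: h)) l.
Proof.
move=> [df _] hO l /hO /df[c hc]; exists (\sum_j c j * h 0 j) => e e0.
have K0 : 0 < N1 h + 1 by rewrite ltr_wpDl ?N1_ge0.
have [d d0 hd] := hc _ (divr_gt0 e0 K0).
exists (d / (N1 h + 1)); first exact: divr_gt0.
move=> t td; have := hd (t *: h); rewrite N1Z.
have ht : nc t * N1 h <= nc t * (N1 h + 1) by rewrite ler_wpM2l ?nc_ge0// lerDl.
move=> /(_ _) h1.
have {}h1 : nc (f (w + l *: h + t *: h) - f (w + l *: h) - \sum_j c j * (t *: h) 0 j : C) <= e / (N1 h + 1) * (nc t * N1 h).
  by apply: h1; apply: le_lt_trans ht _; rewrite -ltr_pdivlMr.
rewrite scalerDl addrA; have -> : (\sum_j c j * h 0 j) * t = \sum_j c j * (t *: h) 0 j.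
  by rewrite mulr_suml; apply: eq_bigr => j _; rewrite mxE -mulrA (mulrC t).
apply: le_trans h1 _; rewrite -mulrA ler_wpM2l ?(ltW e0)// ler_pdivrMl//.
by rewrite [leRHS]mulrC.
Qed.

Definition affine (w : 'rV[C]_m) (c : C) (x : pt) : pt :=
  tmap (fun j (p : L * L) => ((re c * p.1 - im c * p.2) + re (w 0 j) : L,
                              (im c * p.1 + re c * p.2) + im (w 0 j) : L)) x.

Lemma cp_affine w c x : cp (affine w c x) = w + c *: cp x.
Proof.
apply/rowP => j; rewrite !mxE tnth_mktuple.
case: c => a b; case: (w 0 j) => u v; rewrite /re /im /=.
by congr (_ +i* _); rewrite addrC//; congr (v + _); rewrite addrC.
Qed.

Lemma measure_pres_affine w c : nc c = 1 -> measure_pres lm (affine w c).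
Proof.
move=> c1; apply: measure_pres_tmap => j.
apply: (measure_pres_comp (measure_pres_translate2 (re (w 0 j)) (im (w 0 j))) (@measure_pres_rot R (re c) (im c) _)).
by rewrite -sqr_nc c1 expr1n.
Qed.

(** Written as an ellipsoid with all exponents 1, so that [integral_monof] gives its volume. *)
Definition ballm (y : R) : set pt := [set x | \sum_(j < m) sqn (tnth x j) `^ 1 < y].

Lemma measurable_ballm y : measurable (ballm y).
Proof.
rewrite (_ : ballm y = (fun x : pt => \sum_(j < m) sqn (tnth x j) `^ 1 : L) @^-1` `]-oo, y[).
  rewrite -[X in measurable X]setTI; apply: measurable_sum => // j.
  exact: (measurableT_comp (measurable_pow 1) (measurable_sqn_tnth j)).
by apply/seteqP; split => x /=; rewrite in_itv.
Qed.

Lemma ballm_pos (y : R) : 0 < y -> exists2 V : R, 0 < V & lm (ballm y) = V%:E.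
Proof.
move=> y0; pose V := mono_weight (fun=> 1 : R) (fun _ : 'I_m => 0%N) * psi (tdeg (fun=> 1 : R) (fun _ : 'I_m => 0%N)) y.
exists V.
  rewrite mulr_gt0//; last by rewrite /psi y0 powR_gt0.
  rewrite divr_gt0 ?Pi_gt0 ?tdeg_ge0//; apply: prodr_gt0 => j _.
  by rewrite mulr_gt0 ?discA_gt0// divr_gt0// Pi_gt0// divr_ge0.
rewrite -(integral_monof (fun _ : 'I_m => 0%N) y (fun=> ltr01)).
rewrite -[LHS]mul1e -(integral_cst _ (measurable_ballm y)) integral_mkcond.
apply: eq_integral => x _; rewrite patchE /monof; case: ifPn => [/set_mem|/negP] h.
  by rewrite ifT// big1 // => j _; rewrite expr0.
by rewrite ifF//; apply/negP => hh; apply: h; rewrite inE.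
Qed.

(** The averages of |f|^2 over w + zeta^k x eventually exceed |f w|^2 - e, by convergence of
    discrete means and Cauchy-Schwarz. As the maps x -> w + zeta^k x preserve measure, their
    integrals are the squared norm of f, and Fatou's lemma concludes. The constant depends on d
    alone. *)
Lemma submean (d : R) : 0 < d -> exists2 V : R, 0 < V & forall w f,
  (forall h, N1 h < d -> O (w + h)) -> H f -> V * nc (f w) ^+ 2 <= re (ip f f).
Proof.
(* A point x of the ball of radius s has l^1 norm below d / 2, so w + l x stays in O for |l| < 2. *)
move=> d0; pose s := d / (2 * (m%:R + 1)).
have m1 : 0 < m%:R + 1 :> R by rewrite ltr_wpDl.
have s0 : 0 < s by rewrite divr_gt0// mulr_gt0.
have [V V0 hV] := ballm_pos (exprn_gt0 2 s0).
exists V => // w f wO hf; have [hol_f _] := (bergP mD f).1 hf.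
rewrite -lee_fin -(I2E mD hf) EFinM -hV muleC -integral_cst; last exact: measurable_ballm.
pose U n x := n.+1%:R^-1 * \sum_(k < n.+1) nc (f (cp (affine w (zeta R n.+1 ^+ k) x))) ^+ 2.
have mnc := measurable_hol mD hol_f.
have mU n (k : 'I_n.+1) : measurable_fun setT (fun x : pt => nc (f (cp (affine w (zeta R n.+1 ^+ k) x))) ^+ 2 : L).
  apply: (measurableT_comp mnc); apply: (measure_pres_affine w _).1.
  exact: nc_zetaX.
have mUn n : measurable_fun setT (U n : pt -> L).
  by apply: measurable_funM => //; apply: measurable_sum => k; exact: mU.
have U0 n x : 0 <= U n x.
  by rewrite mulr_ge0 ?invr_ge0//; apply: sumr_ge0 => k _; exact: sqr_ge0.
apply: (@fatou_le _ _ _ lm (ballm (s ^+ 2)) U (fun=> nc (f w) ^+ 2)) => //.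
- exact: measurable_ballm.
- by move=> n; exact: measurable_funTS (mUn n).
- by move=> x; exact: sqr_ge0.
- move=> x xE e e0.
  have xd : N1 (cp x) < d / 2.
    have h : N1 (cp x) <= m%:R * s.
      apply: N1_lt => j; rewrite cpE -(ler_pXn2r (n := 2)) ?nnegrE ?nc_ge0 ?(ltW s0)//.
      rewrite sqr_nc -[leLHS]/(sqn (tnth x j)); apply: ltW; apply: le_lt_trans xE.
      rewrite (bigD1 j)//= powRr1 ?sqn_ge0// lerDl; apply: sumr_ge0 => i _.
      exact: powR_ge0.
    apply: le_lt_trans h _; rewrite /s.
    rewrite (_ : d / 2 = (m%:R + 1) * (d / (2 * (m%:R + 1)))); last by field; rewrite gt_eqF.
    by rewrite ltr_pM2r// ltrDl.
  have sl (l : C) : nc l < 2 -> O (w + l *: cp x).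
    move=> l2; apply: wO; rewrite N1Z; apply: (@le_lt_trans _ _ (2 * N1 (cp x))); last lra.
    by rewrite ler_wpM2r ?N1_ge0// ltW.
  have cd := slice_cdiff hol_f sl.
  have r32 : 1 < (3 / 2 : R) < 2 by apply/andP; split; lra.
  have r32' : 0 < (3 / 2 : R) < 2 by apply/andP; split; lra.
  have := dmean_cvg 0 cd r32; rewrite (tcoef0 cd r32') scale0r addr0 => /ccvg_nc h.
  have /cvgrPdist_le/(_ _ e0)[N _ hN] : (nc (dmean k.+1 0 (fun l => f (w + l *: cp x))) * nc (dmean k.+1 0 (fun l => f (w + l *: cp x)))) @[k --> \oo] --> nc (f w) * nc (f w) by exact: (cvgM h h).
  exists N => n /= /hN /= {}hN.
  apply: (@le_trans _ _ (nc (dmean n.+1 0 (fun l => f (w + l *: cp x))) ^+ 2)).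
    by move: hN; rewrite ler_norml expr2 [in X in _ -> X]expr2 => /andP[_]; lra.
  apply: le_trans (sqr_nc_dmean _ (ltn0Sn n)) _.
  by rewrite /U; under [in leRHS]eq_bigr do rewrite cp_affine.
- move=> n; rewrite I2T//.
  apply: (@le_trans _ _ (\int[lm]_x (U n x)%:E)%E).
    apply: ge0_subset_integral => //; first exact: measurable_ballm.
      by apply/measurable_EFinP; exact: mUn.
    by move=> x _; rewrite lee_fin.
  have eqk (k : 'I_n.+1) :
      (\int[lm]_x (nc (f (cp (affine w (zeta R n.+1 ^+ k) x))) ^+ 2)%:E = \int[lm]_x (nc (f (cp x)) ^+ 2)%:E)%E.
    have mp := measure_pres_affine w (nc_zetaX R n.+1 k).
    rewrite -(@measure_pres_integral _ _ _ lm setT _ (fun x : pt => (nc (f (cp x)) ^+ 2)%:E) mp)//.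
      by apply/measurable_EFinP.
    by move=> x _; rewrite lee_fin sqr_ge0.
  rewrite /U; under eq_integral do rewrite EFinM -sumEFin.
  rewrite ge0_integralZl//; last 2 first.
  + by apply: emeasurable_sum => k; apply/measurable_EFinP; exact: mU.
  + by move=> x _; apply: sume_ge0 => k _; rewrite lee_fin sqr_ge0.
  rewrite ge0_integral_sum//; last 2 first.
  + by move=> k; apply/measurable_EFinP; exact: mU.
  + by move=> k x _; rewrite lee_fin sqr_ge0.
  rewrite (eq_bigr (fun=> (re (ip f f))%:E)); last first.
    by move=> k _; rewrite eqk -(I2T hol_f) (I2E mD hf).
  rewrite -(I2T hol_f) (I2E mD hf) sumEFin sumr_const card_ord -EFinM lee_fin.
  by rewrite -[re (ip f f) *+ n.+1]mulr_natl mulrA mulVf ?mul1r// pnatr_eq0.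
Qed.

(** The one-variable Taylor estimate along the line through h. The constant depends on f only
    through the bound M, so the estimate survives pointwise limits. *)
Lemma hol_taylor2 (z : 'rV[C]_m) (d M : R) f c : 0 < d -> 0 <= M -> hol O f ->
  (forall h, N1 h < d -> O (z + h)) ->
  (forall h, N1 h < d -> nc (f (z + h)) <= M) ->
  (forall e : R, 0 < e -> exists2 d : R, 0 < d & forall h, N1 h < d ->
    nc (f (z + h) - f z - \sum_j c j * h 0 j : C) <= e * N1 h) ->
  forall h, N1 h < d / 4 ->
    nc (f (z + h) - f z - \sum_j c j * h 0 j : C) <= 32 * M / d ^+ 2 * N1 h ^+ 2.
Proof.
move=> d0 M0 hf zO fM hc h hd; have [h0|h0] := eqVneq (N1 h) 0.
  have -> : h = 0.
    apply/rowP => j; rewrite mxE; apply/eqP; rewrite -nc_eq0 eq_le nc_ge0 andbT -h0.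
    exact: N1_ge.
  rewrite addr0 subrr sub0r big1; last by move=> j _; rewrite mxE mulr0.
  rewrite oppr0 nc0 mulr_ge0 ?sqr_ge0// divr_ge0 ?sqr_ge0//; lra.
have hp : 0 < N1 h by rewrite lt_neqAle eq_sym h0 N1_ge0.
(* The direction is normalized to length d / 2, which puts the disc of radius 2 inside the
   domain. *)
pose k := d / 2 / N1 h; have k0 : 0 < k by rewrite !divr_gt0.
pose h' := ofR k *: h.
have N1h' : N1 h' = d / 2 by rewrite N1Z nc_ofR gtr0_norm// divfK.
have sl (l : C) : nc l < 2 -> N1 (l *: h') < d.
  by move=> l2; rewrite N1Z N1h'; have := nc_ge0 l; nra.
have cd := slice_cdiff hf (fun l hl => zO _ (sl l hl)).
pose l0 := ofR k^-1.
have l0h : l0 *: h' = h by rewrite scalerA -ofRM mulVf ?gt_eqF// scale1r.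
have nl0 : nc l0 = N1 h / (d / 2).
  by rewrite nc_ofR gtr0_norm ?invr_gt0// /k invf_div.
have l02 : nc l0 < 1 / 2 by rewrite nl0 ltr_pdivrMr; lra.
have r12 : 0 < (1 : R) < 2 by apply/andP; split; lra.
have := taylor_rem cd r12 (ltac:(lra) : nc l0 < 1) 2 (B := M) _.
rewrite !big_ord_recl big_ord0 addr0 expr0 mulr1 expr1 (tcoef0 cd r12) scale0r addr0 l0h.
have -> : tcoef (fun l => f (z + l *: h')) 1 1 = \sum_j c j * h' 0 j.
  apply: (tcoef1 cd r12) => e e0.
  have K0 : 0 < d / 2 by lra.
  have [d1 d10 hd1] := hc _ (divr_gt0 e0 K0).
  exists (d1 / (d / 2)); first exact: divr_gt0.
  move=> t td; rewrite scale0r addr0; have := hd1 (t *: h'); rewrite N1Z N1h'.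
  rewrite -ltr_pdivlMr// => /(_ td).
  rewrite (_ : e / (d / 2) * (nc t * (d / 2)) = e * nc t); last by field; rewrite gt_eqF.
  congr (nc (_ - _) <= _); rewrite mulr_suml; apply: eq_bigr => j _.
  by rewrite mxE -mulrA (mulrC t).
rewrite (_ : (\sum_j c j * h' 0 j) * l0 = \sum_j c j * h 0 j); last first.
  rewrite mulr_suml -[in RHS]l0h; apply: eq_bigr => j _; rewrite !mxE.
  by rewrite -mulrA; congr (_ * _); exact: mulrC.
rewrite opprD addrA => h1; apply: le_trans (h1 _) _.
  by move=> l l1; apply: fM; apply: sl; lra.
rewrite divr1 nl0.
have q : 1 / (1 - N1 h / (d / 2)) <= 2.
  by rewrite -nl0 ler_pdivrMr; lra.
have fh : nc (f (z + h)) <= M by apply: fM; lra.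
rewrite (_ : 32 * M / d ^+ 2 * N1 h ^+ 2 = (N1 h / (d / 2)) ^+ 2 * (2 * (2 * (M + M)))); last first.
  by field; rewrite gt_eqF.
rewrite ler_wpM2l ?sqr_ge0// ler_wpM2l// ler_pM//; last by rewrite lerD2l.
  by rewrite -nl0 divr_ge0//; lra.
by rewrite addr_ge0 ?nc_ge0.
Qed.

Lemma ccvg_le (u : nat -> C) l b : ccvg u l -> (forall n, nc (u n) <= b) -> nc l <= b.
Proof.
move=> ul ub; apply/ler_addgt0Pr => e /ul[N hN]; have := hN N (leqnn _); have := ub N.
by have := ncB_ge l (u N); rewrite nc_sub; lra.
Qed.

Lemma ccvg_sum (u : nat -> 'I_m -> C) (l a : 'I_m -> C) : (forall j, ccvg (u ^~ j) (l j)) ->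
  ccvg (fun n => \sum_j u n j * a j) (\sum_j l j * a j).
Proof.
move=> ul e e0; pose A := \sum_j nc (a j) + 1.
have A0 : 0 < A by rewrite ltr_wpDl// sumr_ge0// => j _; exact: nc_ge0.
have /choice[N hN] j := ul j _ (divr_gt0 e0 A0).
exists (\max_j N j) => k kN; rewrite -sumrB; apply: le_trans (nc_sum _ _ _) _.
apply: (@le_trans _ _ (\sum_j e / A * nc (a j))).
  apply: ler_sum => j _; rewrite -mulrBl ncM ler_wpM2r ?nc_ge0//; apply: hN.
  by apply: leq_trans kN; exact: leq_bigmax.
rewrite -mulr_sumr -mulrA ger_pMr// ler_pdivrMl// mulr1 lerDl //.
Qed.

(** Bounded norms give locally uniform bounds by [submean], hence a common quadratic remainder; it
    makes the partial derivatives converge and the limit holomorphic. Fatou's lemma bounds its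
    norm. *)
Lemma bergman_limit (u : nat -> 'rV[C]_m -> C^o) g B : (forall n, H (u n)) ->
  (forall n, re (ip (u n) (u n)) <= B) -> (forall z, ~ O z -> g z = 0) ->
  (forall z, O z -> ccvg (fun n => u n z) (g z)) -> H g /\ re (ip g g) <= B.
Proof.
move=> uH uB g0 ug.
have uhol n : hol O (u n) by have [] := (bergP mD (u n)).1 (uH n).
have holg : hol O g.
  split=> // z Oz; have [d d0 zO] := Oopen Oz.
  have d20 : 0 < d / 2 by lra.
  have [V V0 hV] := submean d20.
  pose M := `|B| / V + 1.
  have M1 : 1 <= M by rewrite /M lerDr divr_ge0// ltW.
  have uM n h : N1 h < d / 2 -> nc (u n (z + h)) <= M.
    move=> hd; have := hV (z + h) (u n) _ (uH n).
    have zhO h' : N1 h' < d / 2 -> O (z + h + h').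
      by move=> h'd; rewrite -addrA; apply: zO; apply: le_lt_trans (N1D _ _) _; lra.
    move=> /(_ zhO) h1; have h2 := le_trans h1 (le_trans (uB n) (ler_norm B)).
    rewrite mulrC -ler_pdivlMr// in h2.
    by move: h2; rewrite /M; have := nc_ge0 (u n (z + h)); move: (nc _) (_ / _) => t s; nra.
  have zO2 h : N1 h < d / 2 -> O (z + h) by move=> hd; apply: zO; lra.
  have M0 : 0 <= M by lra.
  have /choice[c hc] n := (uhol n).1 z Oz.
  have T n := hol_taylor2 d20 M0 (uhol n) zO2 (uM n) (hc n).
  set K := 32 * M / (d / 2) ^+ 2 in T.
  have K0 : 0 < K by rewrite divr_gt0 ?exprn_gt0// mulr_gt0//; lra.
  have ucauchy w : O w -> forall e : R, 0 < e -> exists N, forall k l, (N <= k)%N -> (N <= l)%N ->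
      nc (u k w - u l w : C) <= e.
    move=> Ow e e0; have [N hN] := ug w Ow (e / 2) (ltac:(by rewrite divr_gt0)).
    exists N => k l /hN h1 /hN h2.
    have -> : u k w - u l w = (u k w - g w : C) - (u l w - g w : C) by rewrite opprB addrA subrK.
    by apply: le_trans (ncB _ _) _; lra.
  have /choice[C0 hC0] j : exists l, ccvg (c ^~ j) l.
    apply: C_complete => e e0.
    (* A displacement t along the j-th axis isolates the j-th derivative: the values contribute at
       most e t / 2, the two remainders 2 K t^2 <= e t / 2. *)
    pose t := Num.min (d / 16) (e / 4 / K).
    have t0 : 0 < t.
      have p1 : 0 < d / 16 by lra.
      have p2 : 0 < e / 4 / K by apply: divr_gt0 => //; lra.
      by rewrite /t lt_min p1 p2.
    have t1 : t <= d / 16 by rewrite ge_min lexx.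
    have t2 : K * t <= e / 4 by rewrite mulrC -ler_pdivlMr// ge_min lexx orbT.
    pose h : 'rV[C]_m := \row_i (if i == j then ofR t else 0).
    have hE (a : 'I_m -> C) : \sum_i a i * h 0 i = a j * ofR t.
      rewrite (bigD1 j)//= mxE eqxx big1 ?addr0// => i ij.
      by rewrite mxE (negbTE ij) mulr0.
    have N1h : N1 h = t.
      rewrite /N1 (bigD1 j)//= mxE eqxx big1 ?addr0 ?nc_ofR ?gtr0_norm// => i ij.
      by rewrite mxE (negbTE ij) nc0.
    have e1 : 0 < e / 4 * t by apply: mulr_gt0 => //; lra.
    have [N hN] := ucauchy (z + h) (zO h (ltac:(rewrite N1h; lra))) _ e1.
    have [N' hN'] := ucauchy z Oz _ e1.
    exists (maxn N N') => k l; rewrite !geq_max => /andP[kN kN'] /andP[lN lN'].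
    have hk := T k h (ltac:(rewrite N1h; lra)); have hl := T l h (ltac:(rewrite N1h; lra)).
    rewrite hE N1h in hk; rewrite hE N1h in hl.
    rewrite -(ler_pM2r t0); have nt : nc (ofR t) = t by rewrite nc_ofR gtr0_norm.
    rewrite -[X in _ * X <= _]nt -ncM.
    have -> : (c k j - c l j) * ofR t =
       ((u k (z + h) - u l (z + h) : C) - (u k z - u l z : C)) -
       ((u k (z + h) - u k z - c k j * ofR t : C) - (u l (z + h) - u l z - c l j * ofR t : C)).
      by rewrite /=; ring.
    apply: le_trans (ncB _ _) _.
    apply: le_trans (lerD (ncB _ _) (ncB _ _)) _.
    apply: le_trans (lerD (lerD (hN _ _ kN lN) (hN' _ _ kN' lN')) (lerD hk hl)) _.
    by rewrite expr2 mulrA; have := ler_wpM2r (ltW t0) t2; lra.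
  exists C0 => e e0.
  exists (Num.min (d / 2 / 4) (e / K)).
    have p1 : 0 < d / 2 / 4 by lra.
    have p2 : 0 < e / K by apply: divr_gt0.
    by rewrite lt_min p1 p2.
  move=> h; rewrite lt_min => /andP[h1 h2].
  apply: (@le_trans _ _ (K * N1 h ^+ 2)); last first.
    rewrite expr2 mulrA ler_wpM2r ?N1_ge0//.
    by rewrite mulrC -ler_pdivlMr// ltW.
  apply: (@ccvg_le (fun n => u n (z + h) - u n z - \sum_j c n j * h 0 j : C)).
    apply: ccvgB; last exact: ccvg_sum.
    by apply: ccvgB; apply: ug => //; apply: zO; lra.
  by move=> n; exact: T.
have hI : (I2 O g <= B%:E)%E.
  apply: (@fatou_le _ _ _ lm D (fun n x => nc (u n (cp x)) ^+ 2)) => //.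
  - by move=> n; exact: (measurable_nc2 (uhol n).1).
  - exact: (measurable_nc2 holg.1).
  - by move=> n x; exact: sqr_ge0.
  - by move=> x; exact: sqr_ge0.
  - move=> x Dx e e0; have h := ccvg_nc (ug _ Dx).
    have /cvgrPdist_le/(_ _ e0)[N _ hN] : (nc (u n (cp x)) * nc (u n (cp x))) @[n --> \oo] -->
       nc (g (cp x)) * nc (g (cp x)) by exact: (cvgM h h).
    exists N => n /= /hN /=; rewrite ler_norml !expr2 => /andP[_]; lra.
  - by move=> n; rewrite -[leLHS]/(I2 O (u n)) (I2E mD (uH n)) lee_fin.
have gH : H g by apply/(bergP mD); split => //; apply: le_lt_trans hI _; exact: ltry.
by split => //; rewrite -lee_fin -(I2E mD).
Qed.

Lemma bergman_hilbert : hilbert H ip.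
Proof.
split.
- exact: (berg0 mD).
- exact: (bergL mD).
- exact: (berg_ipL mD).
- exact: (berg_cj mD).
- exact: (berg_ge0 mD).
- move=> f hf f0; have [[df fz] _] := (bergP mD f).1 hf.
  apply/funext => z; have [Oz|/fz//] := pselect (O z).
  have [d d0 zO] := Oopen Oz; have [V V0 hV] := submean d0.
  have := hV z f zO hf; rewrite f0 pmulr_rle0// => h.
  apply/eqP; rewrite -(nc_eq0 (f z : C)) -sqrf_eq0 eq_le h.
  exact: sqr_ge0.
move=> u uH uC.
have ucauchy w : O w -> exists l, ccvg (fun n => u n w) l.
  move=> Ow; apply: C_complete => e e0; have [d d0 wO] := Oopen Ow.
  have [V V0 hV] := submean d0.
  have [N hN] := uC (e * Num.sqrt V) (ltac:(by rewrite mulr_gt0// sqrtr_gt0)).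
  exists N => k l /hN {}hN /hN hkl.
  have hd : H (u k - u l) by rewrite addrC -scaleN1r; exact: (bergL mD).
  have := hV w _ wO hd; rewrite -ler_pdivlMl//.
  have -> : (u k - u l) w = (u k w - u l w : C) by [].
  move=> h1; rewrite -(ler_pXn2r (n := 2)) ?nnegrE ?nc_ge0 ?(ltW e0)//; apply: le_trans h1 _.
  rewrite ler_pdivrMl// mulrC.
  have : hnorm ip (u k - u l) ^+ 2 <= (e * Num.sqrt V) ^+ 2.
    by rewrite ler_pXn2r ?nnegrE ?sqrtr_ge0 ?mulr_ge0 ?sqrtr_ge0 ?(ltW e0)//; exact: hkl.
  by rewrite exprMn [Num.sqrt V ^+ 2]sqr_sqrtr ?(ltW V0)// sqr_sqrtr//; exact: (berg_ge0 mD).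
have /choice[g hg] z : exists l : C, (O z -> ccvg (fun n => u n z) l) /\ (~ O z -> l = 0).
  have [Oz|nO] := pselect (O z); last by exists 0.
  by have [l hl] := ucauchy z Oz; exists l.
(* Norm convergence follows by applying [bergman_limit] to the sequence n -> u k - u (N + n),
   bounded by e^2 and converging pointwise to u k - g. *)
have gL N (e : R) : (forall k l, (N <= k)%N -> (N <= l)%N -> hnorm ip (u k - u l) <= e) ->
    forall k, (N <= k)%N -> H (u k - (g : _ -> C^o)) /\ re (ip (u k - (g : _ -> C^o)) (u k - (g : _ -> C^o))) <= e ^+ 2.
  move=> hN k Nk; apply: (@bergman_limit (fun n => u k - u (N + n)%N)).
  - by move=> n; rewrite addrC -scaleN1r; exact: (bergL mD).
  - move=> n; have hd : H (u k - u (N + n)%N) by rewrite addrC -scaleN1r; exact: (bergL mD).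
    have := hN k (N + n)%N Nk (leq_addr _ _); rewrite -(ler_pXn2r (n := 2)) ?nnegrE ?sqrtr_ge0//; last first.
      by have := hN k k Nk Nk; apply: le_trans; exact: sqrtr_ge0.
    by rewrite sqr_sqrtr//; exact: (berg_ge0 mD).
  - move=> z nO; have [[_ uz] _] := (bergP mD (u k)).1 (uH k).
    by rewrite -[LHS]/(u k z - g z) (hg z).2// uz// subr0.
  - move=> z Oz; apply: (@ccvgB _ (fun=> u k z) (fun n => u (N + n)%N z)); first exact: ccvg_cst.
    move=> e1 /((hg z).1 Oz)[N' hN']; exists N' => n nN'; apply: hN'.
    by rewrite (leq_trans nN')// leq_addl.
exists (g : _ -> C^o).
  have [N hN] := uC 1 ltr01; have [h1 _] := gL N 1 hN N (leqnn _).
  have -> : (g : _ -> C^o) = (-1) *: (u N - (g : _ -> C^o)) + u N.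
    by rewrite scaleN1r opprB subrK.
  exact: (bergL mD).
move=> e e0; have [N hN] := uC e e0; exists N => k Nk.
have [h1 h2] := gL N e hN k Nk.
rewrite -(ler_pXn2r (n := 2)) ?nnegrE ?sqrtr_ge0 ?(ltW e0)// sqr_sqrtr//; exact: (berg_ge0 mD).
Qed.

End bergman_complete.

(** * Holomorphy of polynomials *)

Section hol_products.
Context (R : realType) (m : nat).
Local Notation C := (Cplx R).
Implicit Types (f g : 'rV[C]_m -> C^o) (h z : 'rV[C]_m).

Lemma hdiff_mul f g z : hdiff f z -> hdiff g z -> hdiff (fun z => f z * g z : C^o) z.
Proof.
move=> /hdiffP df /hdiffP dg; apply/hdiffP.
exact: (@differentiableM C 'rV[C]_m f g z df dg).
Qed.

Lemma hdiff_coord (j : 'I_m) z : hdiff (fun z => z 0 j : C^o) z.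
Proof.
exists (fun i => (i == j)%:R) => e e0; exists 1 => // h _.
rewrite !mxE (bigD1 j)//= eqxx mul1r big1 ?addr0; last first.
  by move=> i /negbTE ->; rewrite mul0r.
have -> : z 0 j + h 0 j - z 0 j - h 0 j = 0 :> C by ring.
by rewrite nc0 mulr_ge0 ?N1_ge0 ?ltW.
Qed.

Lemma hdiff_cst (c : C) z : hdiff (fun=> c : C^o) z.
Proof.
exists (fun=> 0) => e e0; exists 1 => // h _.
rewrite big1; last by move=> j _; rewrite mul0r.
by rewrite subrr subr0 nc0 mulr_ge0 ?N1_ge0 ?ltW.
Qed.

Lemma hdiff_near f g z (d : R) : 0 < d -> (forall h, N1 h < d -> f (z + h) = g (z + h)) ->
  hdiff f z -> hdiff g z.
Proof.
move=> d0 fg [c hc]; exists c => e e0; have [d' d'0 hd] := hc e e0.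
exists (Num.min d d'); first by rewrite lt_min d0.
move=> h; rewrite lt_min => /andP[h1 h2]; rewrite -fg//.
have := fg 0; rewrite addr0 => <-; first exact: hd.
by rewrite /N1 big1// => j _; rewrite mxE nc0.
Qed.

Lemma hdiff_prod (I : Type) (s : seq I) (F : I -> 'rV[C]_m -> C^o) z :
  (forall i, hdiff (F i) z) -> hdiff (fun z => \prod_(i <- s) (F i z : C) : C^o) z.
Proof.
move=> hF; elim: s => [|i s IH].
  by under [X in hdiff X]eq_fun do rewrite big_nil; exact: hdiff_cst.
by under [X in hdiff X]eq_fun do rewrite big_cons; exact: hdiff_mul.
Qed.

Lemma hdiff_pow (j : 'I_m) n z : hdiff (fun z => (z 0 j : C) ^+ n : C^o) z.
Proof.
elim: n => [|n IH].
  by under [X in hdiff X]eq_fun do rewrite expr0; exact: hdiff_cst.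
by under [X in hdiff X]eq_fun do rewrite exprS; apply: hdiff_mul => //; exact: hdiff_coord.
Qed.

End hol_products.

(** * Density of the monomials on Reinhardt domains *)

Section reinhardt.
Context (R : realType) (m : nat).
Local Notation C := (Cplx R).
Local Notation L := (measurableTypeR R).
Local Notation pt := (m.-tuple (L * L)).
Local Notation lm := (lebesgue_Cm R m).
Variable O : set 'rV[C]_m.
Local Notation D := (@cp R m @^-1` O).
Hypothesis mD : measurable D.
Hypothesis Oopen : forall z, O z -> exists2 d : R, 0 < d & forall h, N1 h < d -> O (z + h).
Hypothesis Osolid : forall z w : 'rV[C]_m, O z -> (forall j, nc (w 0 j) <= nc (z 0 j)) -> O w.
Local Notation H := (bergman_space O).
Local Notation ip := (bergman_ip O).
Implicit Types (f g : 'rV[C]_m -> C^o) (h z w : 'rV[C]_m) (j : 'I_m) (l : C).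

Let hil := bergman_hilbert mD Oopen.

Definition scale j l z : 'rV[C]_m := \row_i (if i == j then l * z 0 i else z 0 i).

Lemma scaleD j l z h : scale j l (z + h) = scale j l z + scale j l h.
Proof. by apply/rowP => i; rewrite !mxE; case: ifP => // _; rewrite mulrDr. Qed.

Lemma scale_scale j l l' z : scale j l (scale j l' z) = scale j (l * l') z.
Proof. by apply/rowP => i; rewrite !mxE; case: (i == j); rewrite ?mulrA. Qed.

Lemma scaleC i j l l' z : scale i l (scale j l' z) = scale j l' (scale i l z).
Proof. by apply/rowP => k; rewrite !mxE; case: ifP; case: ifP => // _ _; rewrite mulrCA. Qed.

Lemma scale1 j z : scale j 1 z = z.
Proof. by apply/rowP => i; rewrite !mxE mul1r if_same. Qed.

Lemma nc_scale_le j l z i : nc l <= 1 -> nc (scale j l z 0 i) <= nc (z 0 i).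
Proof.
by move=> l1; rewrite mxE; case: ifP => // _; rewrite ncM ler_piMl ?nc_ge0.
Qed.

Lemma O_scale j l z : nc l <= 1 -> O z -> O (scale j l z).
Proof. by move=> l1 Oz; apply: (Osolid Oz) => i; exact: nc_scale_le. Qed.

Lemma nO_scale j l z : nc l = 1 -> ~ O z -> ~ O (scale j l z).
Proof.
move=> l1 nO Os; apply: nO; apply: (Osolid Os) => i.
by rewrite mxE; case: ifP => // _; rewrite ncM l1 mul1r.
Qed.

Lemma scale_affine j l z : scale j l z = scale j 0 z + l *: \row_i (if i == j then z 0 i else 0).
Proof.
by apply/rowP => i; rewrite !mxE; case: ifP => _; rewrite ?mul0r ?add0r// mulr0 addr0.
Qed.

(** Openness lets z_j move slightly outward, and solidity fills in the disc. *)
Lemma scale_margin j z : O z -> exists2 R0 : R, 1 < R0 & forall l, nc l < R0 -> O (scale j l z).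
Proof.
move=> Oz; have [d d0 hd] := Oopen Oz.
have n0 := nc_ge0 (z 0 j); pose t := d / (2 * (nc (z 0 j) + 1)).
have t0 : 0 < t by rewrite divr_gt0//; lra.
exists (1 + t); first by lra.
move=> l lt; pose w := z + ofR t *: \row_i (if i == j then z 0 i else 0).
have Ow : O w.
  apply: hd; rewrite N1Z nc_ofR gtr0_norm// /N1 (bigD1 j)//= mxE eqxx big1 ?addr0; last first.
    by move=> i /negbTE ij; rewrite mxE ij nc0.
  rewrite /t mulrAC ltr_pdivrMr; last lra.
  by rewrite ltr_pM2l//; lra.
apply: (Osolid Ow) => i; rewrite !mxE; case: eqP => [->|_]; last by rewrite mulr0 addr0.
rewrite (_ : z 0 j + ofR t * z 0 j = (1 + ofR t) * z 0 j); last by rewrite mulrDl mul1r.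
rewrite !ncM ler_wpM2r//.
have -> : nc (1 + ofR t) = 1 + t.
  rewrite (_ : 1 + ofR t = ofR (1 + t)) ?nc_ofR ?gtr0_norm//; first lra.
  by apply: complex_eq; rewrite ?reD ?imD /= ?addr0.
exact: ltW.
Qed.

Lemma scale_cdiff j f z (R0 : R) : hol O f -> (forall l, nc l < R0 -> O (scale j l z)) ->
  forall l, nc l < R0 -> cdiff (fun l => f (scale j l z)) l.
Proof.
move=> hf hO l lR.
apply: (@cdiff_ext _ (fun l => f (scale j 0 z + l *: \row_i (if i == j then z 0 i else 0)))).
  by move=> t; rewrite -scale_affine.
by apply: (slice_cdiff hf (R0 := R0)) => // t /hO; rewrite scale_affine.
Qed.

Definition rotf j l f : 'rV[C]_m -> C^o := fun z => f (scale j l z).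

Lemma rotf_lin j l c f g : rotf j l (c *: f + g) = c *: rotf j l f + rotf j l g.
Proof. by []. Qed.

Lemma N1_scale j l h : nc l = 1 -> N1 (scale j l h) = N1 h.
Proof.
by move=> l1; apply: eq_bigr => i _; rewrite mxE; case: ifP => // _; rewrite ncM l1 mul1r.
Qed.

Lemma rotf_hol j l f : nc l = 1 -> hol O f -> hol O (rotf j l f).
Proof.
move=> l1 [df f0]; split => z; last by move=> nO; apply: f0; exact: nO_scale.
move=> Oz; have [|c hc] := df (scale j l z); first by apply: O_scale => //; rewrite l1.
exists (fun i => c i * (if i == j then l else 1)) => e /hc[d d0 hd]; exists d => // h hh.
rewrite /rotf scaleD -(N1_scale j h l1).
have -> : \sum_i c i * (if i == j then l else 1) * h 0 i = \sum_i c i * (scale j l h) 0 i.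
  by apply: eq_bigr => i _; rewrite mxE; case: (i == j); rewrite ?mulr1 ?mulrA.
by apply: hd; rewrite N1_scale.
Qed.

Definition rotp j l (x : pt) : pt :=
  tmap (fun i p => if i == j then rot (re l) (im l) p else p) x.

Lemma cp_rotp j l x : cp (rotp j l x) = scale j l (cp x).
Proof.
apply/rowP => i; rewrite !mxE tnth_mktuple; case: ifP => // _.
case: l => a b; rewrite /rot /re /im /=; congr (_ +i* _); by rewrite addrC.
Qed.

Lemma measure_pres_rotp j l : nc l = 1 -> measure_pres lm (rotp j l).
Proof.
move=> l1; apply: measure_pres_tmap => i; case: (i == j); last exact: measure_pres_id.
by apply: measure_pres_rot; rewrite -sqr_nc l1 expr1n.
Qed.

Lemma I2_rotf j l f : nc l = 1 -> hol O f -> I2 O (rotf j l f) = I2 O f.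
Proof.
move=> l1 hf; rewrite (I2T hf) (I2T (rotf_hol j l1 hf)).
have mp := measure_pres_rotp j l1.
rewrite -(@measure_pres_integral _ _ _ lm setT _ (fun x : pt => (nc (f (cp x)) ^+ 2)%:E) mp)//.
- by apply: eq_integral => x _; rewrite cp_rotp.
- by apply/measurable_EFinP; exact: (measurable_hol mD hf).
- by move=> x _; rewrite lee_fin sqr_ge0.
Qed.

Lemma rotf_H j l f : nc l = 1 -> H f -> H (rotf j l f).
Proof.
move=> l1 /(bergP mD)[hf fi]; apply/(bergP mD); split; first exact: rotf_hol.
by rewrite I2_rotf.
Qed.

Lemma N2_rotf j l f : nc l = 1 -> H f -> re (ip (rotf j l f) (rotf j l f)) = re (ip f f).
Proof.
move=> l1 hf; have [h _] := (bergP mD f).1 hf.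
apply: EFin_inj; rewrite -(I2E mD hf) -(I2E mD (rotf_H j l1 hf)).
exact: I2_rotf.
Qed.

(** Polarization of the invariance of the norm. *)
Lemma ip_rotf j l f g : nc l = 1 -> H f -> H g -> ip (rotf j l f) (rotf j l g) = ip f g.
Proof.
move=> l1 hf hg; have rf := rotf_H j l1 hf; have rg := rotf_H j l1 hg.
have K c : re (c * ip (rotf j l f) (rotf j l g)) = re (c * ip f g).
  have hcfg := bergL mD c hf hg.
  have := N2_rotf j l1 hcfg; rewrite rotf_lin (N2E hil c rf rg) (N2E hil c hf hg).
  rewrite !N2_rotf//; lra.
apply: complex_eq; first by have := K 1; rewrite !mul1r.
(* The factor -i turns the imaginary part into a real part. *)
have := K (- iC R); rewrite !mulNr !reN !reM /=; lra.
Qed.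

Definition homog j n f := forall z, O z -> forall l, nc l <= 1 -> f (scale j l z) = l ^+ n * f z.

Lemma homog_rotf j n f l : hol O f -> homog j n f -> nc l = 1 -> rotf j l f = l ^+ n *: f.
Proof.
move=> [_ f0] hf l1; apply/funext => z; have [Oz|nO] := pselect (O z).
  by rewrite /rotf hf// l1.
rewrite -[LHS]/(f (scale j l z)) -[RHS]/(l ^+ n * f z) !f0 ?mulr0//.
exact: nO_scale.
Qed.

Section component.
Variables (j : 'I_m) (n : nat) (f : 'rV[C]_m -> C^o).
Hypothesis hf : H f.

Let holf : hol O f. Proof. by have [] := (bergP mD f).1 hf. Qed.

Definition dmeanf N : 'rV[C]_m -> C^o := fun z => dmean N n (fun l => f (scale j l z)).

Lemma dmeanfE N : dmeanf N =
  \sum_(k < N) (N%:R^-1 * (zeta R N ^+ (n * k))^-1) *: rotf j (zeta R N ^+ k) f.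
Proof.
apply/funext => z; rewrite /dmeanf /dmean mulr_sumr fct_sumE; apply: eq_bigr => k _.
by rewrite mulrA.
Qed.

Lemma dmeanf_H N : H (dmeanf N).
Proof.
rewrite dmeanfE; apply: (Hsum hil) => k; apply: (HZ hil); apply: rotf_H => //.
exact: nc_zetaX.
Qed.

Lemma dmeanf_le N : (0 < N)%N -> re (ip (dmeanf N) (dmeanf N)) <= re (ip f f).
Proof.
move=> N0; have hd := dmeanf_H N.
rewrite -(sqr_nm hil hd) -(sqr_nm hil hf) ler_pXn2r ?nnegrE ?nm_ge0//.
rewrite dmeanfE.
have tri (I : Type) (s : seq I) (F : I -> 'rV[C]_m -> C^o) : (forall i, H (F i)) ->
    hnorm ip (\sum_(i <- s) F i) <= \sum_(i <- s) hnorm ip (F i).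
  move=> hF; elim: s => [|i s IH].
    by rewrite !big_nil /hnorm (ip0l hil (hil0 hil)) sqrtr0.
  by rewrite !big_cons; apply: le_trans (nmD hil _ (Hsum hil _ hF)) _ => //; rewrite lerD2l.
have hr k : H (rotf j (zeta R N ^+ k) f) by apply: rotf_H => //; exact: nc_zetaX.
apply: le_trans (tri _ _ _ _) _; first by move=> k; apply: (HZ hil).
rewrite (eq_bigr (fun=> N%:R^-1 * hnorm ip f)); last first.
  move=> k _; rewrite (nmZ hil)// ncM !ncV -ofRn nc_ofR normr_nat nc_zetaX invr1 mulr1.
  by congr (_ * _); rewrite /hnorm -/(re _) N2_rotf// nc_zetaX.
by rewrite sumr_const card_ord -[X in X <= _]mulr_natl mulrA divff ?mul1r// pnatr_eq0 -lt0n.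
Qed.

Lemma component_ex : exists g, forall z,
  (O z -> ccvg (fun N => dmeanf N.+1 z) (g z)) /\ (~ O z -> g z = 0).
Proof.
suff /choice[g hg] : forall z, exists l : C^o,
   (O z -> ccvg (fun N => dmeanf N.+1 z) l) /\ (~ O z -> l = 0) by exists g.
move=> z; have [Oz|nO] := pselect (O z); last by exists 0.
have [R0 R01 hR] := scale_margin j Oz.
have rr : 1 < (1 + R0) / 2 < R0 by apply/andP; split; lra.
exists (tcoef (fun l => f (scale j l z)) ((1 + R0) / 2) n); split => [_|/(_ Oz)//].
exact: (dmean_cvg n (scale_cdiff holf hR) rr).
Qed.

(* Averaging over rotations of [z_j] isolates the part of [f] that is
   homogeneous of degree [n] in [z_j]. *)
Definition component := projT1 (cid component_ex).

Lemma component_cvg z : O z -> ccvg (fun N => dmeanf N.+1 z) (component z).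
Proof. by move=> Oz; rewrite /component; case: cid => g /= /(_ z)[+ _]; exact. Qed.

Lemma component0 z : ~ O z -> component z = 0.
Proof. by move=> Oz; rewrite /component; case: cid => g /= /(_ z)[_ +]; exact. Qed.

Lemma component_H : H component.
Proof.
exact: (bergman_limit mD Oopen (fun N => dmeanf_H N.+1)
  (fun N => dmeanf_le (ltn0Sn N)) component0 component_cvg).1.
Qed.

Lemma component_tcoef z (R0 r : R) : O z -> (forall l, nc l < R0 -> O (scale j l z)) ->
  1 < r < R0 -> component z = tcoef (fun l => f (scale j l z)) r n.
Proof.
move=> Oz hR rr; apply: (ccvg_uniq (component_cvg Oz)).
exact: (dmean_cvg n (scale_cdiff holf hR) rr).
Qed.

Lemma component_homog : homog j n component.
Proof.
move=> z Oz l l1; have [R0 R01 hR] := scale_margin j Oz.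
have rr : 1 < (1 + R0) / 2 < R0 by apply/andP; split; lra.
rewrite (component_tcoef Oz hR rr).
apply: (ccvg_uniq (component_cvg (O_scale j l1 Oz))).
have := dmean_cvgZ n (scale_cdiff holf hR) rr l1.
congr ccvg; apply/funext => N; congr dmean; apply/funext => t.
by rewrite scale_scale mulrC.
Qed.

(** Scalings in different coordinates commute, so taking components in z_j preserves homogeneity in
    z_i. *)
Lemma component_homog_other i a : homog i a f -> homog i a component.
Proof.
move=> hi z Oz l l1; apply: (ccvg_uniq (component_cvg (O_scale i l1 Oz))).
move=> e e0; have la0 := nc_ge0 (l ^+ a).
have [N hN] := component_cvg Oz (e := e / (nc (l ^+ a) + 1)) (ltac:(by rewrite divr_gt0// ltr_wpDl)).
exists N => k /hN hk.
have -> : dmeanf k.+1 (scale i l z) = l ^+ a * dmeanf k.+1 z.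
  rewrite /dmeanf /dmean [RHS]mulrCA [in RHS]mulr_sumr; congr (_ * _); apply: eq_bigr => q _.
  rewrite [RHS]mulrCA; congr (_ * _); rewrite scaleC; apply: hi => //.
  by apply: O_scale => //; rewrite nc_zetaX.
rewrite -mulrBr ncM; apply: (@le_trans _ _ ((nc (l ^+ a) + 1) * (e / (nc (l ^+ a) + 1)))).
  by rewrite ler_pM ?nc_ge0 ?lerDl.
by rewrite mulrC divfK// gt_eqF// ltr_wpDl.
Qed.

End component.

(** The reproducing kernel at w: [submean] makes evaluation bounded, and Riesz represents it. *)
Lemma evaluation w : O w -> exists2 K, H K & forall f, H f -> f w = ip f K.
Proof.
move=> Ow; have [d d0 wO] := Oopen Ow; have [V V0 hV] := submean mD d0.
have [|f hf|K hK hE] := @riesz _ _ _ _ hil (fun f => f w : C) (Num.sqrt V^-1).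
- by move=> c f g _ _.
- rewrite -(ler_pXn2r (n := 2)) ?nnegrE ?nc_ge0 ?mulr_ge0 ?sqrtr_ge0//.
  rewrite exprMn sqr_sqrtr ?invr_ge0 ?(ltW V0)// (sqr_nm hil hf) ler_pdivlMl//.
  exact: hV.
by exists K.
Qed.

(** A bounded, pointwise convergent sequence converges weakly: the vectors s with <u n - g, s> -> 0
    form a subspace containing all reproducing kernels, so a vector orthogonal to it vanishes
    pointwise; boundedness extends the convergence to its closure. *)
Lemma weak_limit (u : nat -> 'rV[C]_m -> C^o) g (B : R) (h : 'rV[C]_m -> C^o) : (forall n, H (u n)) ->
  (forall n, re (ip (u n) (u n)) <= B) -> H g ->
  (forall z, O z -> ccvg (fun n => u n z) (g z)) -> H h ->
  (forall n, ip (u n) h = 0) -> ip g h = 0.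
Proof.
move=> uH uB hg ug hh u0.
pose S := [set s | H s /\ ccvg (fun n => ip (u n - g) s) 0].
have hug n : H (u n - g) by exact: (HB hil).
have [|||x [hx xS xh]] := @orth_component _ _ _ _ hil S h _ _ _ hh.
- by move=> s [].
- split; first exact: (hil0 hil).
  by move=> e e0; exists 0%N => k _; rewrite (ip0r hil)// subrr nc0 ltW.
- move=> c s t [hs sC] [ht tC]; split; first exact: (bergL mD).
  move=> e e0; have K0 : 0 < nc c + 1 by rewrite ltr_wpDl ?nc_ge0.
  have e1 : 0 < e / 2 / (nc c + 1) by rewrite !divr_gt0.
  have e2 : 0 < e / 2 by rewrite divr_gt0.
  have [N hN] := sC _ e1; have [M hM] := tC _ e2; exists (maxn N M) => k.
  rewrite geq_max => /andP[/hN h1 /hM h2]; rewrite !subr0 in h1 h2 *.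
  have hcs := HZ hil c hs; rewrite (ipDr hil)// (ipZr hil)//.
  apply: le_trans (ncD _ _) _; rewrite ncM nc_cj.
  have : nc c * nc (ip (u k - g) s) <= e / 2.
    apply: (@le_trans _ _ ((nc c + 1) * (e / 2 / (nc c + 1)))).
      by rewrite ler_pM ?nc_ge0// lerDl.
    by rewrite mulrC divfK// gt_eqF.
  lra.
have x0 : x = 0.
  have [[_ xO] _] := (bergP mD x).1 hx.
  apply/funext => w; have [Ow|/xO//] := pselect (O w).
  have [K hK KE] := evaluation Ow; rewrite KE// xS//; split => // e e0.
  have [N hN] := ug w Ow e e0; exists N => k /hN; rewrite subr0 -KE//.
have B0 : 0 <= B by apply: le_trans (uB 0%N); exact: (berg_ge0 mD).
pose Q := Num.sqrt B + hnorm ip g + 1.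
have Q0 : 0 < Q by rewrite ltr_wpDl ?addr_ge0 ?sqrtr_ge0.
have nug n : hnorm ip (u n - g) <= Q.
  apply: le_trans (nmD hil (uH n) (HN hil hg)) _; rewrite (nmN hil hg) /Q.
  have : hnorm ip (u n) <= Num.sqrt B by rewrite /hnorm ler_sqrt//; exact: uB.
  lra.
apply/eqP; rewrite -nc_eq0 eq_le nc_ge0 andbT; apply/ler_addgt0Pr => e e0; rewrite add0r.
have e2 : 0 < e / 2 by rewrite divr_gt0.
have [s [hs sC] sh] := xh _ (divr_gt0 e2 Q0); rewrite x0 subr0 in sh.
have [N hN] := sC _ e2; have := hN N (leqnn _); rewrite subr0 => h1.
have hhs := HB hil hh hs.
have -> : ip g h = - (ip (u N - g) s + ip (u N - g) (h - s)).
  rewrite -(ipDr hil)// (_ : s + (h - s) = h); last by rewrite addrC subrK.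
  by rewrite (ipBl hil)// u0 sub0r opprK.
rewrite ncN; apply: le_trans (ncD _ _) _.
have h2 := cauchy_schwarz hil (hug N) hhs.
have h3 : hnorm ip (u N - g) * hnorm ip (h - s) <= e / 2.
  apply: (@le_trans _ _ (Q * (e / 2 / Q))); first by rewrite ler_pM ?nm_ge0// ltW.
  by rewrite mulrC divfK// gt_eqF.
lra.
Qed.

Definition mono (al : 'I_m -> nat) : 'rV[C]_m -> C^o :=
  fun z => if `[< O z >] then \prod_j (z 0 j : C) ^+ al j else 0.

Lemma monoE al z : O z -> mono al z = \prod_j (z 0 j : C) ^+ al j.
Proof. by rewrite /mono; case: asboolP. Qed.

Lemma mono_hol al : hol O (mono al).
Proof.
split=> z; last by rewrite /mono; case: asboolP.
move=> Oz; have [d d0 hd] := Oopen Oz.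
apply: (hdiff_near d0 (f := fun z => \prod_j (z 0 j : C) ^+ al j : C^o)).
  by move=> h /hd; rewrite /mono; case: asboolP.
by apply: hdiff_prod => j; exact: hdiff_pow.
Qed.

Lemma mono_homog al j : homog j (al j) (mono al).
Proof.
move=> z Oz l l1; rewrite !monoE//; last exact: O_scale.
rewrite (bigD1 j)//= [in RHS](bigD1 j)//= mxE eqxx exprMn -!mulrA; congr (_ * (_ * _)).
by apply: eq_bigr => i /negbTE ij; rewrite mxE ij.
Qed.

Variable om : ('I_m -> nat) -> R.
Hypothesis om_gt0 : forall al, 0 < om al.
Hypothesis I2_mono : forall al, I2 O (mono al) = (om al)%:E.

Lemma mono_H al : H (mono al).
Proof. by apply/(bergP mD); split; [exact: mono_hol|rewrite I2_mono ltry]. Qed.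

Lemma ip_mono al : ip (mono al) (mono al) = ofR (om al).
Proof.
rewrite (ip_real hil (mono_H al)); congr (ofR _).
by apply: EFin_inj; rewrite -(I2E mD (mono_H al)) I2_mono.
Qed.

Lemma cj_unit l : nc l = 1 -> cj l = l^-1.
Proof.
move=> l1; have l0 : l != 0 by rewrite -nc_gt0 l1.
by apply: (mulIf l0); rewrite mulVf// cjMr l1 expr1n.
Qed.

Lemma mono_orth al be : al <> be -> ip (mono al) (mono be) = 0.
Proof.
move=> ab; have [j jab] : exists j, al j <> be j.
  by apply: contrapT => /forallNP h; apply: ab; apply/funext => j; apply: contrapT; exact: h.
(* The order exceeds both exponents, so the root of unity takes different powers at [al j] and
   [be j]. *)
pose N := (al j + be j).+1; pose l := zeta R N.
have l1 : nc l = 1 by exact: nc_zeta.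
have := ip_rotf j l1 (mono_H al) (mono_H be).
rewrite (homog_rotf (mono_hol al) (mono_homog al j) l1) (homog_rotf (mono_hol be) (mono_homog be j) l1).
have h1 := mono_H al; have h2 := mono_H be; have h3 := HZ hil (l ^+ be j) h2.
rewrite (ipZl hil)// (ipZr hil)// cj_unit ?ncX ?l1 ?expr1n// mulrA => /eqP.
rewrite -subr_eq0 -{2}[ip _ _]mul1r -mulrBl mulf_eq0 => /orP[|/eqP//].
have lb : l ^+ be j != 0 by rewrite -nc_gt0 ncX l1 expr1n.
have la : l ^+ al j != 0 by rewrite -nc_gt0 ncX l1 expr1n.
rewrite subr_eq0 => /eqP E; exfalso.
have {}E : l ^+ al j = l ^+ be j by rewrite -[RHS]mul1r -E divfK.
have K a b : (a < b <= al j + be j)%N -> l ^+ a != 0 -> l ^+ a = l ^+ b -> False.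
  move=> /andP[ab' bN] a0; rewrite -(subnKC (ltnW ab')) exprD -{1}[l ^+ a]mulr1.
  move=> /(mulfI a0)/esym/eqP; apply/negP; apply: zeta_prim; apply/andP; split; lia.
have [h|h|//] := ltngtP (al j) (be j).
- by apply: (K (al j) (be j)) => //; rewrite h leq_addl.
- by apply: (K (be j) (al j)) => //; rewrite h leq_addr.
Qed.

Lemma rotf_perp j l f be : nc l = 1 -> H f -> ip f (mono be) = 0 ->
  ip (rotf j l f) (mono be) = 0.
Proof.
move=> l1 hf f0; have h2 := mono_H be; have rf := rotf_H j l1 hf.
have lb : l ^+ be j != 0 by rewrite -nc_gt0 ncX l1 expr1n.
have := ip_rotf j l1 hf h2; rewrite f0 (homog_rotf (mono_hol be) (mono_homog be j) l1).
rewrite (ipZr hil)// => /eqP; rewrite mulf_eq0 => /orP[|/eqP//].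
by rewrite -nc_eq0 nc_cj nc_eq0 (negbTE lb).
Qed.

Lemma component_perp j n f (hf : H f) : (forall be, ip f (mono be) = 0) ->
  forall be, ip (component j n hf) (mono be) = 0.
Proof.
move=> f0 be; have hb := mono_H be.
have u0 N : ip (dmeanf j n f N.+1) (mono be) = 0.
  pose c (k : 'I_N.+1) := N.+1%:R^-1 * (zeta R N.+1 ^+ (n * k))^-1.
  have hr (k : 'I_N.+1) : H (rotf j (zeta R N.+1 ^+ k) f).
    by apply: rotf_H hf; exact: nc_zetaX.
  have hF (k : 'I_N.+1) : H (c k *: rotf j (zeta R N.+1 ^+ k) f) by exact: (HZ hil _ (hr k)).
  rewrite dmeanfE (ip_suml hil _ hF hb) big1// => k _.
  by rewrite (ipZl hil _ (hr k) hb) (rotf_perp j (nc_zetaX _ _ _) hf (f0 be)) mulr0.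
exact: (weak_limit (fun N => dmeanf_H j n hf N.+1) (fun N => dmeanf_le j n hf (ltn0Sn N))
  (component_H j n hf) (component_cvg j n hf) hb u0).
Qed.

Lemma homog_all f (al : 'I_m -> nat) (l : 'I_m -> C) z : (forall j, homog j (al j) f) ->
  (forall j, nc (l j) <= 1) -> O z ->
  f (\row_j (l j * z 0 j)) = (\prod_j l j ^+ al j) * f z.
Proof.
move=> hf l1 Oz.
pose sc (s : seq 'I_m) : 'rV[C]_m := \row_i (if i \in s then l i * z 0 i else z 0 i).
have H1 (s : seq 'I_m) : uniq s -> O (sc s) /\ f (sc s) = (\prod_(j <- s) l j ^+ al j) * f z.
  elim: s => [_|i s IH /= /andP[is_ us]].
    have -> : sc [::] = z by apply/rowP => i; rewrite mxE in_nil.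
    by rewrite big_nil mul1r.
  have [Os fs] := IH us.
  have -> : sc (i :: s) = scale i (l i) (sc s).
    apply/rowP => k; rewrite !mxE in_cons.
    by case: eqP => [->|_] //=; rewrite (negbTE is_).
  split; first exact: O_scale.
  by rewrite hf// fs big_cons mulrA.
have [_] := H1 _ (index_enum_uniq _ : uniq (index_enum 'I_m)).
by have -> : sc (index_enum 'I_m) = \row_j (l j * z 0 j)
  by apply/rowP => i; rewrite !mxE mem_index_enum.
Qed.

(** One point p with nonzero coordinates determines f: a small multiple t z of z is dominated by p
    in every coordinate, and homogeneity compares f (t z) both with f p and with f z. *)
Lemma homog_mono f al : H f -> (forall j, homog j (al j) f) -> exists c, f = c *: mono al.
Proof.
move=> hf hal; have [[_ f0] _] := (bergP mD f).1 hf.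
have [[z0 Oz0]|/forallNP On] := pselect (exists z, O z); last first.
  by exists 0; apply/funext => z; rewrite f0// scale0r.
have O0 : O 0 by apply: (Osolid Oz0) => j; rewrite mxE nc0 nc_ge0.
have [d d0 hd] := Oopen O0.
pose dl := d / (m%:R + 1); have m1 : 0 < m%:R + 1 :> R by rewrite ltr_wpDl.
have dl0 : 0 < dl by rewrite divr_gt0.
pose p : 'rV[C]_m := const_mx (ofR dl).
have Op : O p.
  rewrite -[p]add0r; apply: hd; apply: (@le_lt_trans _ _ (m%:R * dl)).
    by apply: N1_lt => j; rewrite mxE nc_ofR gtr0_norm.
  by rewrite mulrCA gtr_pMr// ltr_pdivrMr// mul1r ltrDl.
have dln : ofR dl != 0 :> C by rewrite ofR_eq0 gt_eqF.
exists (f p / \prod_j ofR dl ^+ al j); apply/funext => z.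
rewrite -[RHS]/(f p / _ * mono al z).
have [Oz|nO] := pselect (O z); last by rewrite f0// /mono; case: asboolP => //; rewrite mulr0.
pose t := dl / (dl + N1 z); have n0 := N1_ge0 z.
have t0 : 0 < t by rewrite divr_gt0// ltr_wpDr.
have t1 : t <= 1 by rewrite ler_pdivrMr ?mul1r ?lerDl// ltr_wpDr.
have tz j : t * nc (z 0 j) <= dl.
  rewrite /t mulrAC ler_pdivrMr ?ltr_wpDr// ler_pM2l//.
  by have := N1_ge z j; lra.
have nt : nc (ofR t) = t by rewrite nc_ofR gtr0_norm.
have nt1 (j : 'I_m) : nc (ofR t) <= 1 by rewrite nt.
have E1 := @homog_all f al (fun=> ofR t) z hal nt1 Oz.
have E2 := @homog_all f al (fun j => ofR t * z 0 j / ofR dl) p hal _ Op.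
have {}E2 : f (\row_j (ofR t * z 0 j)) = (\prod_j (ofR t * z 0 j / ofR dl) ^+ al j) * f p.
  rewrite -E2; last first.
    by move=> j; rewrite ncM ncM ncV nt nc_ofR gtr0_norm// ler_pdivrMr// mul1r.
  by congr f; apply/rowP => j; rewrite !mxE divfK.
rewrite E2 monoE// in E1 *.
have tn : \prod_(j < m) ofR t ^+ al j != 0 :> C.
  by apply/prodf_neq0 => j _; rewrite expf_neq0// ofR_eq0 gt_eqF.
apply: (mulfI tn); rewrite -E1.
have -> : \prod_j (ofR t * z 0 j / ofR dl) ^+ al j =
   (\prod_(j < m) ofR t ^+ al j) * (\prod_j z 0 j ^+ al j) / \prod_(j < m) ofR dl ^+ al j.
  rewrite -prodfV -!big_split; apply: eq_bigr => j _ /=.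
  by rewrite !exprMn exprVn.
by ring.
Qed.

(** Induction on the number of coordinates in which f is not yet homogeneous. The components of f in
    the next coordinate are again orthogonal to all monomials, hence zero; they are the Taylor
    coefficients along that coordinate, so f vanishes. With all coordinates done, f is a multiple of
    one monomial. *)
Lemma mono_total f : H f -> (forall al, ip f (mono al) = 0) -> f = 0.
Proof.
have P d : forall k f al, (k + d = m)%N -> H f -> (forall be, ip f (mono be) = 0) ->
   (forall i : 'I_m, (i < k)%N -> homog i (al i) f) -> f = 0.
  elim: d => [|d IH] k {}f al km hf fp fh.
    have [c fE] : exists c, f = c *: mono al.
      apply: homog_mono => // j; apply: fh; have := ltn_ord j; lia.
    have := fp al; rewrite fE (ipZl hil) ?ip_mono//; try exact: mono_H.
    move=> /eqP; rewrite mulf_eq0 => /orP[/eqP ->|]; first by rewrite scale0r.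
    by rewrite ofR_eq0 gt_eqF.
  have kltm : (k < m)%N by lia.
  pose j := Ordinal kltm.
  have comp0 n : component j n hf = 0.
    apply: (IH k.+1 _ (fun i => if i == j then n else al i)).
    - by lia.
    - exact: component_H.
    - exact: component_perp.
    move=> i ik; case: eqP => [->|ij]; first exact: component_homog.
    apply: component_homog_other; apply: fh.
    have : nat_of_ord i <> k by move=> E; apply: ij; apply/val_inj.
    lia.
  have [[_ f0] _] := (bergP mD f).1 hf; have holf := ((bergP mD f).1 hf).1.
  apply/funext => z; have [Oz|/f0//] := pselect (O z).
  have [R0 R01 hR] := scale_margin j Oz.
  have rr : 1 < (1 + R0) / 2 < R0 by apply/andP; split; lra.
  have rr0 : 0 < (1 + R0) / 2 < R0 by apply/andP; split; lra.
  have cd := scale_cdiff holf hR.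
  have T0 n : tcoef (fun l => f (scale j l z)) ((1 + R0) / 2) n = 0.
    by rewrite -(component_tcoef n hf Oz hR rr) comp0.
  set r := (1 + R0) / 2 in rr rr0 T0; have [r1 rR] := andP rr.
  have r0 : 0 < r by lra.
  have [B hB] : exists B, forall l, nc l = r -> nc (f (scale j l z)) <= B.
    by apply: (circle_boundC r0); apply: cdiff_circle (ltW r0) => l lr; apply: cd; rewrite lr.
  have w1 : nc (1 : C) < r by rewrite nc1.
  have H1 N : nc (f z) <= r^-1 ^+ N * (2 * (r / (r - 1) * (B + nc (f z)))).
    have := taylor_rem cd rr0 w1 N hB; rewrite scale1 nc1 mul1r big1 ?subr0// => i _.
    by rewrite T0 mul0r.
  set K := 2 * _ in H1.
  apply/eqP; rewrite -(nc_eq0 (f z : C)) eq_le nc_ge0 andbT.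
  apply/ler_addgt0Pr => e e0; rewrite add0r.
  have : (geometric K r^-1) k @[k --> \oo] --> (0 : R).
    by apply: cvg_geometric; rewrite ger0_norm ?invr_ge0 ?(ltW r0)// invf_lt1.
  move=> /cvgr0Pnorm_le/(_ _ e0)[N _ hN]; have := hN N (leqnn _); rewrite /= => hN'.
  by apply: le_trans (H1 N) _; rewrite mulrC; apply: le_trans hN'; exact: ler_norm.
by move=> hf fp; apply: (P m 0%N f (fun=> 0%N)).
Qed.

End reinhardt.

(** * Differences of consecutive weights *)

Section weight_differences.
Context (R : realType) (G : R -> R).
Hypothesis G_gt0 : forall s, 0 <= s -> 0 < G s.
Hypothesis G_rec : forall s, 0 <= s -> G (s + 1) = (s + 1) * G s.
Hypothesis G_convex : forall l s u : R, 0 < s -> 0 < u -> 0 <= l <= 1 ->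
  ln (G ((1 - l) * s + l * u)) <= (1 - l) * ln (G s) + l * ln (G u).
Implicit Types (b T : R) (n : nat).
Local Notation Q := (Qr G).
Local Notation U := (Ur G).

Let Q_gt0 b T : 0 <= T -> 0 < b -> 0 < Q b T. Proof. exact: Qr_gt0. Qed.

Lemma mul_ge_mid n : (n.+2 <= n.+1 * n.+3)%N. Proof. nia. Qed.

Lemma half_lt n : (n.+2 <= 2 * n.+1)%N. Proof. lia. Qed.

(** The functional equation carries the bound at T + 1 down to T; the factor lost, (T + b + 1) / (T
    + 1), is at most 1 + b. *)
Lemma Qr_lb2 b T : 0 < T -> 0 < b -> (T + 1) `^ b / (1 + b) <= Q b T.
Proof.
move=> T0 b0; have h := Qr_lb G_gt0 G_rec G_convex (T := T + 1) (b := b) ltac:(lra) b0.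
have E : Q b (T + 1) = Q b T * ((T + b + 1) / (T + 1)).
  have e1 : G (T + b + 1) = (T + b + 1) * G (T + b) by apply: G_rec; lra.
  have e2 : G (T + 1) = (T + 1) * G T by apply: G_rec; lra.
  have g0 : G T != 0 by rewrite gt_eqF// G_gt0// ltW.
  have T1 : T + 1 != 0 by rewrite gt_eqF//; lra.
  rewrite /Qr (_ : T + 1 + b = T + b + 1); last by ring.
  rewrite e1 e2; move: (G (T + b)) (G T) g0 => x y y0.
  by field; rewrite y0 T1.
have b1 : 0 < 1 + b by lra.
rewrite ler_pdivrMr//; apply: le_trans h _; rewrite E ler_pM2l ?Q_gt0 ?(ltW T0)//.
rewrite ler_pdivrMr; nra.
Qed.

(** T + b and S lie in [T, S + b] with complementary weights; the two convexity inequalities are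
    added. *)
Lemma Qr_mono b T S : 0 < b -> 0 < T -> T <= S -> Q b T <= Q b S.
Proof.
move=> b0 T0 TS; have d0 : 0 < S + b - T by lra.
have l01 : 0 <= b / (S + b - T) <= 1.
  by rewrite divr_ge0 ?(ltW b0) ?(ltW d0)//= ler_pdivrMr//; lra.
have l01' : 0 <= 1 - b / (S + b - T) <= 1 by move: l01 => /andP[]; lra.
have h1 := G_convex T0 (u := S + b) ltac:(lra) l01.
have h2 := G_convex T0 (u := S + b) ltac:(lra) l01'.
rewrite (_ : _ + _ * (S + b) = T + b) in h1; last by field; rewrite gt_eqF.
rewrite (_ : _ + _ * (S + b) = S) in h2; last by field; rewrite gt_eqF.
have p1 : 0 < G (T + b) by apply: G_gt0; lra.
have p2 : 0 < G S by apply: G_gt0; lra.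
have p3 : 0 < G T by apply: G_gt0; lra.
have p4 : 0 < G (S + b) by apply: G_gt0; lra.
rewrite /Qr ler_pdivrMr// mulrAC ler_pdivlMr//.
rewrite -ler_ln ?posrE ?mulr_gt0// !lnM ?posrE//.
move: h1 h2; move: (ln _) (ln (G S)) (ln (G T)) (ln (G (S + b))) => x y z w.
by move: (b / _) => l; lra.
Qed.

(** With e the larger of b and c, the inverse ratio is at most a value of [Ur e], which is 1 +
    O(1/T). Small T are absorbed by C, which makes the lower bound nonpositive. This is the source
    of the decay of the mixed commutators. *)
Lemma Qr_ratio b c : 0 < b -> 0 < c -> exists2 C : R, 0 < C &
  forall T, 0 < T -> 1 - C / T <= Q b T / Q b (T + c) <= 1.
Proof.
move=> b0 c0; pose e := Num.max b c.
have be : b <= e by rewrite le_max lexx.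
have ce : c <= e by rewrite le_max lexx orbT.
have e0 : 0 < e by lra.
pose T0 := 2 + 4 * e ^+ 2 + e; have e2 : 0 < e ^+ 2 by rewrite exprn_gt0.
exists (T0 + 2 * e ^+ 2); first by rewrite /T0; lra.
move=> S S0; have Sc : 0 < S + c by lra.
have q1 := Q_gt0 (ltW S0) b0; have q2 := Q_gt0 (ltW Sc) b0.
apply/andP; split; last by rewrite ler_pdivrMr// mul1r; apply: Qr_mono => //; lra.
have [ST|TS] := ltP S T0.
  apply: (@le_trans _ _ 0); last by rewrite divr_ge0 ?(ltW q1) ?(ltW q2).
  by rewrite subr_le0 ler_pdivlMr// mul1r; lra.
have h : Q b (S + c) / Q b S <= U e (S + e).
  have Se : 0 < S + e by lra.
  apply: (@le_trans _ _ (Q b (S + e) / Q b S)).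
    by rewrite ler_pM2r ?invr_gt0//; apply: Qr_mono => //; lra.
  (* The mixed second ratio of G is symmetric in its two increments. *)
  have -> : Q b (S + e) / Q b S = Q e (S + b) / Q e S.
    have g1 : G S != 0 by rewrite gt_eqF// G_gt0// ltW.
    have g2 : G (S + e) != 0 by rewrite gt_eqF// G_gt0// ltW.
    have g3 : G (S + b) != 0 by rewrite gt_eqF// G_gt0//; lra.
    rewrite /Qr (_ : S + e + b = S + b + e); last ring.
    by field; rewrite g1 g2 g3.
  rewrite UrE//; last lra.
  rewrite (_ : S + e - e = S); last ring.
  by rewrite ler_pM2r ?invr_gt0 ?Q_gt0 ?(ltW S0)//; apply: Qr_mono => //; lra.
have h2 := Ur_ub G_gt0 G_rec G_convex e0 (T := S + e) ltac:(rewrite /T0 in TS; lra).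
have h3 := le_trans h h2.
rewrite ler_pdivrMr// in h3; rewrite ler_pdivlMr//.
have h4 : 2 * e ^+ 2 / (S + e + 1) <= 2 * e ^+ 2 / S.
  by rewrite ler_pM2l ?mulr_gt0// lef_pV2 ?posrE//; lra.
have h5 : (T0 + 2 * e ^+ 2) / S = T0 / S + 2 * e ^+ 2 / S by rewrite mulrDl.
have h6 : 0 < T0 / S by rewrite divr_gt0 ?/T0//; lra.
rewrite h5; move: h4 h3 h6; move: (_ / S) (_ / S) (_ / (_ + 1)) (Q b S) (Q b (S + c)) q1 q2.
move=> y x z u v u0 v0 zx vu y0.
have x0 : v <= (1 + x) * u by apply: le_trans vu _; rewrite ler_pM2r// lerD2l.
have [x1|x1] := leP 1 (y + x).
  apply: (@le_trans _ _ 0); last exact: ltW.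
  by apply: mulr_le0_ge0; lra.
nra.
Qed.

(* With [b = 1 / p_j], [n = al_j] and [T = tdeg a al], multiplication by [z_j]
   has squared weight [weight_num b n / Q b T] at the normalized monomial
   [z^al], on which [M_j^* M_j - M_j M_j^*] has eigenvalue [weight_gap b n T]. *)
Definition weight_num b n := Q b (n.+1%:R * b) * (n.+1%:R / n.+2%:R).

Definition weight_gap b n T := weight_num b n / Q b T - (if n is k.+1 then weight_num b k / Q b (T - b) else 0).

Let tS b n : 0 < b -> 0 < n.+1%:R * b :> R. Proof. by move=> b0; rewrite mulr_gt0. Qed.

Lemma weight_num_gt0 b n : 0 < b -> 0 < weight_num b n.
Proof.
move=> b0; apply: mulr_gt0; last by rewrite divr_gt0.
by apply: Q_gt0 => //; rewrite ltW// tS.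
Qed.

Lemma weight_numS b n : 0 < b ->
  weight_num b n.+1 = weight_num b n * (U b (n.+2%:R * b) * (n.+2%:R ^+ 2 / (n.+1%:R * n.+3%:R))).
Proof.
move=> b0; have n1 : n.+2%:R * b - b = n.+1%:R * b by rewrite -[n.+2%:R]natr1; ring.
rewrite /weight_num UrE//; last by rewrite ler_peMl ?(ltW b0)// ler1n.
rewrite n1; have q0 : Q b (n.+1%:R * b) != 0 by rewrite gt_eqF// Q_gt0// ltW// tS.
have [m1 m2 m3] : [/\ n.+1%:R != 0 :> R, n.+2%:R != 0 :> R & n.+3%:R != 0 :> R].
  by rewrite !pnatr_eq0.
move: (Q b (n.+2%:R * b)) (Q b (n.+1%:R * b)) (n.+1%:R) (n.+2%:R) (n.+3%:R) q0 m1 m2 m3.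
by move=> y x p q r x0 p0 q0 r0; field; rewrite x0 p0 q0 r0.
Qed.

(** One weight times a difference of second ratios, each close to 1: at (n + 2) b, corrected by a
    rational factor, and at T. *)
Lemma weight_gapS b n T : 0 < b -> b < T ->
  weight_gap b n.+1 T = weight_num b n / Q b T *
    (U b (n.+2%:R * b) * (n.+2%:R ^+ 2 / (n.+1%:R * n.+3%:R)) - U b T).
Proof.
move=> b0 bT; rewrite /weight_gap weight_numS// (UrE G_gt0 b0 (ltW bT)).
have q1 : Q b T != 0 by rewrite gt_eqF// Q_gt0//; lra.
have q2 : Q b (T - b) != 0 by rewrite gt_eqF// Q_gt0//; lra.
by move: (weight_num _ _) (U _ _) (_ / _) => x y z; field; rewrite q1 q2.
Qed.

Let sq_ge1 n : 1 <= n.+2%:R ^+ 2 / (n.+1%:R * n.+3%:R) :> R.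
Proof.
rewrite ler_pdivlMr ?mulr_gt0// mul1r -natrM -natrX ler_nat; nia.
Qed.

(** [Ur] decreases and (n + 2) b <= T, while the rational factor is at least 1. *)
Lemma weight_gap_eq b n T : 0 < b -> n.+2%:R * b <= T ->
  0 <= U b (n.+2%:R * b) * (n.+2%:R ^+ 2 / (n.+1%:R * n.+3%:R)) - U b T.
Proof.
move=> b0 tT; have bt : b < n.+2%:R * b by rewrite ltr_pMl// ltr1n.
have := Ur_antitone G_gt0 G_rec G_convex b0 bt tT.
have := Ur_gt0 G_gt0 b0 (ltW bt); have := sq_ge1 n.
move: (U _ _) (U _ _) (_ / _) => x y z; nra.
Qed.

Lemma weight_gap_ge0 b n T : 0 < b -> n.+1%:R * b <= T -> 0 <= weight_gap b n T.
Proof.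
move=> b0; case: n => [|n] tT.
  by rewrite /weight_gap subr0 divr_ge0 ?(ltW (weight_num_gt0 _ _))// ltW// Q_gt0//; have := tS 0 b0; lra.
have bt : b < n.+2%:R * b by rewrite ltr_pMl// ltr1n.
rewrite weight_gapS//; last lra.
by rewrite mulr_ge0 ?weight_gap_eq// divr_ge0 ?(ltW (weight_num_gt0 _ _))// ltW// Q_gt0//; lra.
Qed.

(** Asymptotically [Ur_ub]; the finitely many small n are absorbed by the sum S. *)
Lemma Ur_natmul b : 0 < b -> exists2 D : R, 0 < D & forall n, U b (n.+2%:R * b) <= 1 + D / n.+2%:R.
Proof.
move=> b0; have [N hN] := exists_large 0 ((2 + 4 * b ^+ 2 + b) / b).
rewrite add0r in hN.
have Un n : 0 < U b (n.+2%:R * b).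
  by rewrite Ur_gt0// ler_peMl ?(ltW b0)// ler1n.
pose S := \sum_(k < N) U b (k.+2%:R * b) * k.+2%:R.
have S0 : 0 <= S by apply: sumr_ge0 => k _; rewrite mulr_ge0// ltW.
exists (2 * b + S); first by lra.
move=> n; have n2 : 0 < n.+2%:R :> R by [].
have [nN|Nn] := ltnP n N.
  apply: (@le_trans _ _ (S / n.+2%:R)).
    rewrite ler_pdivlMr// /S (bigD1 (Ordinal nN))//= lerDl; apply: sumr_ge0 => k _.
    by rewrite mulr_ge0// ltW.
  have h : 0 < 2 * b / n.+2%:R by rewrite divr_gt0 ?mulr_gt0.
  by rewrite (mulrDl (2 * b) S); move: (S / _) (_ / _) h => x y y0; lra.
have Nn' : N%:R <= n.+2%:R :> R by rewrite ler_nat; lia.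
apply: le_trans (Ur_ub G_gt0 G_rec G_convex b0 _) _.
  by rewrite ler_pdivrMr// in hN; apply: le_trans hN _; rewrite ler_pM2r.
rewrite lerD2l; apply: (@le_trans _ _ (2 * b ^+ 2 / (n.+2%:R * b))).
  by rewrite ler_pM2l ?mulr_gt0 ?exprn_gt0// lef_pV2 ?posrE ?lerDl ?addr_gt0 ?mulr_gt0.
rewrite (_ : 2 * b ^+ 2 / (n.+2%:R * b) = 2 * b / n.+2%:R); last first.
  by field; rewrite (gt_eqF b0) gt_eqF.
by rewrite ler_pM2r ?invr_gt0// lerDl.
Qed.

(** In the factored form the weight is bounded by a multiple of (n/T)^b and the difference of second
    ratios by a multiple of 1/n. *)
Lemma weight_gap_le b : 0 < b -> exists2 C : R, 0 < C & forall n T, n.+1%:R * b <= T ->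
  weight_gap b n T <= C * (n.+1%:R `^ b / T `^ b / n.+1%:R).
Proof.
move=> b0; have [D D0 hD] := Ur_natmul b0.
have b1 : 0 < b + 1 by lra.
pose C := weight_num b 0 * (1 + b) + (b + 1) `^ b * (1 + b) * (2 * D + 1).
have P0 := weight_num_gt0 0 b0; have B0 : 0 < (b + 1) `^ b by rewrite powR_gt0.
have C1 : 0 < weight_num b 0 * (1 + b) by apply: mulr_gt0 => //; lra.
have C2 : 0 < (b + 1) `^ b * (1 + b) * (2 * D + 1) by rewrite !mulr_gt0//; lra.
exists C; first by rewrite /C; lra.
have Qi T : 0 < T -> (Q b T)^-1 <= (1 + b) / T `^ b.
  move=> T0; have Tb : 0 < T `^ b by rewrite powR_gt0.
  have q0 := Q_gt0 (ltW T0) b0.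
  have r0 : 0 < T `^ b / (1 + b) by apply: divr_gt0 => //; lra.
  rewrite -[leRHS]invf_div lef_pV2 ?posrE//.
  apply: le_trans (Qr_lb2 T0 b0); rewrite ler_pM2r ?invr_gt0//; try lra.
  apply: ge0_ler_powR; rewrite ?nnegrE ?(ltW b0)//; lra.
case=> [|n] T tT.
  have T0 : 0 < T by have := tS 0 b0; lra.
  have Tb : 0 < T `^ b by rewrite powR_gt0.
  rewrite /weight_gap subr0 powR1 invr1 mulr1 mul1r.
  apply: (@le_trans _ _ (weight_num b 0 * ((1 + b) / T `^ b))); first by rewrite ler_pM2l// Qi.
  by rewrite mulrA ler_pM2r ?invr_gt0// lerDl ltW.
have bt : b < n.+2%:R * b by rewrite ltr_pMl// ltr1n.
have T0 : 0 < T by lra.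
have Tb : 0 < T `^ b by rewrite powR_gt0.
rewrite weight_gapS//; last lra.
have n2 : 0 < n.+2%:R :> R by [].
have nb : 0 < n.+2%:R `^ b :> R by rewrite powR_gt0.
have h1 : weight_num b n <= (b + 1) `^ b * n.+2%:R `^ b.
  rewrite -powRM ?(ltW b1)//.
  apply: (@le_trans _ _ (Q b (n.+1%:R * b))).
    rewrite /weight_num ger_pMr ?Q_gt0 ?(ltW (tS _ _))//.
    by rewrite ler_pdivrMr// mul1r ler_nat.
  apply: le_trans (Qr_ub G_gt0 G_rec G_convex (tS n b0) b0) _.
  apply: ge0_ler_powR; rewrite ?nnegrE ?(ltW b0)//; first by have := tS n b0; lra.
    by rewrite mulr_ge0// ltW.
  by rewrite -[n.+2%:R]natr1; have : 1 <= n.+1%:R :> R by [rewrite ler1n]; lra.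
have h2 : U b (n.+2%:R * b) * (n.+2%:R ^+ 2 / (n.+1%:R * n.+3%:R)) - U b T <= (2 * D + 1) / n.+2%:R.
  have := Ur_ge1 G_gt0 G_convex b0 (T := T) ltac:(lra).
  have := hD n; have := Ur_gt0 G_gt0 b0 (ltW bt).
  have -> : n.+2%:R ^+ 2 / (n.+1%:R * n.+3%:R) = 1 + (n.+1%:R * n.+3%:R)^-1 :> R.
    have -> : n.+3%:R = n.+1%:R + 2 :> R by rewrite -natrD addn2.
    have -> : n.+2%:R = n.+1%:R + 1 :> R by rewrite natr1.
    have : 0 < n.+1%:R :> R by [].
    by move: (n.+1%:R) => x x0; field; rewrite !gt_eqF//; lra.
  have : (n.+1%:R * n.+3%:R)^-1 <= n.+2%:R^-1 :> R.
    by rewrite lef_pV2 ?posrE ?mulr_gt0// -natrM ler_nat; exact: mul_ge_mid.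
  have : n.+2%:R^-1 <= 1 :> R by rewrite invf_le1// ler1n.
  have : 0 < n.+2%:R^-1 :> R by rewrite invr_gt0.
  have : 0 < (n.+1%:R * n.+3%:R)^-1 :> R by rewrite invr_gt0 mulr_gt0.
  move: (U b (n.+2%:R * b)) (U b T) (n.+1%:R * n.+3%:R)^-1 (n.+2%:R^-1) => x y z w z0 w0 w1 zw x0 xD y1.
  have : x * (1 + z) <= (1 + D * w) * (1 + w).
    by apply: ler_pM => //; lra.
  have : D * w * w <= D * w by rewrite ger_pMr// mulr_gt0.
  move: (x * _) => X; lra.
have h20 := weight_gap_eq b0 tT.
apply: (@le_trans _ _ ((b + 1) `^ b * n.+2%:R `^ b * ((1 + b) / T `^ b) * ((2 * D + 1) / n.+2%:R))).
  apply: ler_pM => //; first by rewrite divr_ge0 ?(ltW (weight_num_gt0 _ _))// ltW// Q_gt0// ltW.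
  by apply: ler_pM => //; rewrite ?(ltW (weight_num_gt0 _ _)) ?invr_ge0 ?Qi// ltW// Q_gt0// ltW.
rewrite (_ : _ * _ * _ = ((b + 1) `^ b * (1 + b) * (2 * D + 1)) * (n.+2%:R `^ b / T `^ b / n.+2%:R)); last first.
  by field; rewrite (gt_eqF Tb) gt_eqF.
by rewrite ler_pM2r ?divr_gt0// /C; lra.
Qed.

(** The last hypothesis makes the upper bound for the excess of [Ur] over 1 at T at most half of the
    lower bound at (n + 1) b, so their difference is still of order 1 / N; T <= K N keeps the weight
    itself bounded below. *)
Lemma weight_gap_lb b K : 0 < b -> 0 < K -> exists2 c : R, 0 < c & forall (N n : nat) T,
  (0 < N)%N -> (N <= n < 2 * N)%N -> T + b + 1 <= K * N%:R -> 2 + 4 * b ^+ 2 + b <= T ->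
  4 * (n.+1%:R * b + 1) <= T + 1 -> c / N%:R <= weight_gap b n T.
Proof.
move=> b0 K0; have b2 : 0 < b ^+ 2 by rewrite exprn_gt0.
have bb : 0 < b `^ b by rewrite powR_gt0.
have KK : 0 < K `^ b by rewrite powR_gt0.
exists (b `^ b / (1 + b) / 2 / K `^ b * (b ^+ 2 / (2 * (2 * b + 1)))).
  by rewrite !mulr_gt0 ?invr_gt0 ?mulr_gt0//; lra.
move=> N [|n] T N0 /andP[Nn nN] TK T0 tT; first by lia.
have N0' : 0 < N%:R :> R by rewrite ltr0n.
have bt : b < n.+2%:R * b by rewrite ltr_pMl// ltr1n.
have Tp : 0 < T by lra.
rewrite weight_gapS//; last lra.
have NR : N%:R <= n.+1%:R :> R by rewrite ler_nat.
have n2N : n.+2%:R <= 2 * N%:R :> R by rewrite -natrM ler_nat; exact: nN.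
have h1 : (N%:R * b) `^ b / (1 + b) / 2 <= weight_num b n.
  rewrite /weight_num; apply: ler_pM; rewrite ?invr_ge0//.
  - by rewrite divr_ge0 ?powR_ge0//; lra.
  - apply: le_trans (Qr_lb2 (tS n b0) b0); rewrite ler_pM2r ?invr_gt0//; try lra.
    apply: ge0_ler_powR; rewrite ?nnegrE ?(ltW b0) ?mulr_ge0 ?addr_ge0 ?(ltW b0)//.
    - by have := tS n b0; lra.
    - by apply: (@le_trans _ _ (n.+1%:R * b)); [rewrite ler_pM2r|rewrite lerDl].
  rewrite ler_pdivlMr// ler_pdivrMl// -natrM ler_nat.
  exact: (half_lt n).
have h2 : (Q b T)^-1 >= (K `^ b * N%:R `^ b)^-1.
  rewrite lef_pV2 ?posrE ?Q_gt0 ?(ltW Tp) ?mulr_gt0 ?powR_gt0//.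
  apply: le_trans (Qr_ub G_gt0 G_rec G_convex Tp b0) _.
  rewrite -powRM ?(ltW K0)//; apply: ge0_ler_powR; rewrite ?nnegrE ?(ltW b0) ?mulr_ge0 ?(ltW K0)//.
  lra.
have h3 : b ^+ 2 / (2 * (2 * b + 1)) / N%:R <=
   U b (n.+2%:R * b) * (n.+2%:R ^+ 2 / (n.+1%:R * n.+3%:R)) - U b T.
  have u1 := Ur_lb G_gt0 G_rec G_convex b0 bt.
  have u2 := Ur_ub G_gt0 G_rec G_convex b0 T0.
  have s1 := sq_ge1 n.
  have t1 : 0 < n.+2%:R * b + 1 by lra.
  have u3 : 2 * b ^+ 2 / (T + 1) <= b ^+ 2 / (2 * (n.+2%:R * b + 1)).
    rewrite ler_pdivrMr; last lra.
    rewrite mulrAC ler_pdivlMr; last lra.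
    have := ler_wpM2l (ltW b2) tT; lra.
  have u4 : b ^+ 2 / (2 * (2 * b + 1)) / N%:R <= b ^+ 2 / (2 * (n.+2%:R * b + 1)).
    rewrite -mulrA -invfM ler_pM2l// lef_pV2 ?posrE ?mulr_gt0//; try lra.
    have : 1 <= N%:R :> R by rewrite ler1n.
    have := ler_wpM2r (ltW b0) n2N; nra.
  have u5 : b ^+ 2 / (n.+2%:R * b + 1) = 2 * (b ^+ 2 / (2 * (n.+2%:R * b + 1))).
    by move: (n.+2%:R * b + 1) t1 => x x0; field; rewrite gt_eqF.
  have u6 : 0 < b ^+ 2 / (2 * (n.+2%:R * b + 1)) by rewrite divr_gt0// mulr_gt0.
  rewrite u5 in u1; move: u1 u2 s1 u3 u4 u6.
  move: (U _ _) (U _ _) (_ / (_ * _%:R)) (_ / (T + 1)) (_ / (2 * (_ * b + 1))) (_ / N%:R).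
  move=> x y z u v w; nra.
have h0 : 0 <= (N%:R * b) `^ b / (1 + b) / 2 by rewrite !divr_ge0 ?powR_ge0//; lra.
have i1 : 0 <= (K `^ b * N%:R `^ b)^-1 by rewrite invr_ge0 mulr_ge0 ?powR_ge0.
have i2 : 0 <= b ^+ 2 / (2 * (2 * b + 1)) / N%:R.
  by rewrite !divr_ge0 ?mulr_ge0 ?(ltW b2)//; lra.
have := ler_pM (mulr_ge0 h0 i1) i2 (ler_pM h0 i1 h1 h2) h3; apply: le_trans.
rewrite powRM ?(ltW b0)//.
have NN : N%:R `^ b != 0 :> R by rewrite gt_eqF// powR_gt0.
rewrite le_eqVlt; apply/orP; left; apply/eqP.
move: (N%:R `^ b) NN => x x0; field.
by rewrite x0 !gt_eqF//; lra.
Qed.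

Lemma weight_gap0_lb b K : 0 < b -> 0 < K -> exists2 c : R, 0 < c & forall (N : nat) T,
  (0 < N)%N -> 0 < T -> T + b + 1 <= K * N%:R -> c / N%:R `^ b <= weight_gap b 0 T.
Proof.
move=> b0 K0; have KK : 0 < K `^ b by rewrite powR_gt0.
have P0 := weight_num_gt0 0 b0.
exists (weight_num b 0 / K `^ b); first by rewrite divr_gt0.
move=> N T N0 T0 TK; rewrite /weight_gap subr0 -mulrA -invfM ler_pM2l//.
have N0' : 0 < N%:R :> R by rewrite ltr0n.
rewrite lef_pV2 ?posrE ?Q_gt0 ?(ltW T0) ?mulr_gt0 ?powR_gt0//.
apply: le_trans (Qr_ub G_gt0 G_rec G_convex T0 b0) _.
rewrite -powRM ?(ltW K0)//; apply: ge0_ler_powR; rewrite ?nnegrE ?(ltW b0) ?mulr_ge0 ?(ltW K0)//.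
lra.
Qed.

(** In one variable T is (n + 1) b, and the Gamma quotients in both weights cancel. *)
Lemma weight_gap_disc b n : 0 < b -> weight_gap b n (n.+1%:R * b) = (n.+1%:R * n.+2%:R)^-1.
Proof.
move=> b0; have h k : weight_num b k / Q b (k.+1%:R * b) = k.+1%:R / k.+2%:R.
  by rewrite /weight_num mulrAC mulfV ?mul1r// gt_eqF// Q_gt0// ltW// tS.
rewrite /weight_gap h; case: n => [|n]; first by rewrite subr0 mul1r mul1r.
have -> : n.+2%:R * b - b = n.+1%:R * b by rewrite -[n.+2%:R]natr1; ring.
rewrite h -[n.+3%:R]natr1 -[n.+2%:R]natr1 -[n.+1%:R]natr1.
by have : 0 <= n%:R :> R by []; move: (n%:R) => x x0; field; rewrite !gt_eqF//; lra.
Qed.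

End weight_differences.

(** * Series over multi-indices *)

Section series_boxes.
Context (R : realType).

(** Telescoping: each term is at most the decrease of n^(-d) / d, by the Bernoulli-type inequality
    (1 - 1/x)^(-d) >= 1 + d/x. *)
Lemma hsum_bound (d : R) : 0 < d -> forall N : nat,
  \sum_(n < N) n.+1%:R `^ (- (1 + d)) <= 1 + d^-1.
Proof.
move=> d0.
have step (N : nat) : (0 < N)%N ->
    N.+1%:R `^ (- (1 + d)) <= d^-1 * (N%:R `^ (- d) - N.+1%:R `^ (- d)) :> R.
  move=> N0; pose x : R := N.+1%:R; have x0 : 0 < x by rewrite ltr0n.
  have x1 : 1 < x by rewrite ltr1n.
  have u0 : 0 < x^-1 by rewrite invr_gt0.
  have u1 : x^-1 < 1 by rewrite invf_lt1.
  have NE : N%:R = x * (1 - x^-1) :> R.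
    by rewrite mulrBr mulr1 mulfV ?gt_eqF// /x -natr1 addrK.
  rewrite NE powRM ?(ltW x0)//; last by rewrite subr_ge0 ltW.
  have h : 1 + d * x^-1 <= (1 - x^-1) `^ (- d).
    rewrite /powR gt_eqF; last by rewrite subr_gt0.
    apply: le_trans (expR_ge1Dx _) _; rewrite ler_expR mulNr.
    have := @le_ln1Dx R (- x^-1); rewrite ltrN2 => /(_ u1) h.
    by rewrite -mulrN ler_pM2l// lerNr.
  have xd : 0 < x `^ (- d) by rewrite powR_gt0.
  have xE : x `^ (- (1 + d)) = x^-1 * x `^ (- d).
    rewrite opprD powRD; last by apply/implyP => _; rewrite gt_eqF.
    by rewrite (powRN x 1) powRr1// ltW.
  rewrite -/x xE ler_pdivlMl//; apply: (@le_trans _ _ (x `^ (- d) * (1 + d * x^-1) - x `^ (- d))).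
    by move: (x `^ _) (x^-1) => y w; rewrite le_eqVlt; apply/orP; left; apply/eqP; ring.
  by rewrite lerD2r ler_pM2l.
have H (N : nat) : \sum_(n < N.+1) n.+1%:R `^ (- (1 + d)) <= 1 + d^-1 - d^-1 * N.+1%:R `^ (- d).
  elim: N => [|N IH].
    by rewrite big_ord_recl big_ord0 !powR1 addr0 mulr1 addrK.
  rewrite big_ord_recr /=; apply: le_trans (lerD IH (step N.+1 isT)) _.
  by rewrite mulrBr; lra.
case=> [|N]; first by rewrite big_ord0 addr_ge0 ?invr_ge0 ?ltW.
apply: le_trans (H N) _; rewrite gerBl mulr_ge0 ?invr_ge0 ?powR_ge0 ?ltW//.
Qed.

Lemma ler_sum_sub (I : eqType) (r s : seq I) (F : I -> R) : uniq r -> uniq s ->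
  {subset r <= s} -> (forall i, 0 <= F i) -> \sum_(i <- r) F i <= \sum_(i <- s) F i.
Proof.
move=> ur us rs F0.
have pe : perm_eq r ([seq i <- s | i \in r]).
  apply: uniq_perm => //; first exact: filter_uniq.
  by move=> x; rewrite mem_filter; case: (boolP (x \in r)) => //= /rs ->.
rewrite (perm_big _ pe)/= big_filter big_mkcond/=; apply: ler_sum => i _.
by case: ifP.
Qed.

(** The finite family lies in a cube, over which the sum of products is a product of sums. *)
Lemma box_sum_bound m (d : R) (r : seq {ffun 'I_m -> nat}) : 0 < d -> uniq r ->
  \sum_(al <- r) \prod_i (al i).+1%:R `^ (- (1 + d)) <= (1 + d^-1) ^+ m.
Proof.
move=> d0 ur; pose N := \max_(al <- r) \max_i al i.
pose g (f : {ffun 'I_m -> 'I_N.+1}) : {ffun 'I_m -> nat} := [ffun i => f i : nat].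
have gi : injective g.
  by move=> f f' /ffunP E; apply/ffunP => i; apply/val_inj; have := E i; rewrite !ffunE.
pose F (al : {ffun 'I_m -> nat}) : R := \prod_i (al i).+1%:R `^ (- (1 + d)).
have F0 al : 0 <= F al by apply: prodr_ge0 => i _; exact: powR_ge0.
apply: le_trans (ler_sum_sub (s := [seq g f | f <- enum {ffun 'I_m -> 'I_N.+1}]) ur _ _ F0) _.
- by rewrite map_inj_uniq ?enum_uniq.
- move=> al alr; apply/mapP; exists [ffun i => inord (al i)]; first by rewrite mem_enum.
  apply/ffunP => i; rewrite !ffunE inordK// ltnS.
  apply: leq_trans (leq_bigmax_seq _ alr isT).
  by rewrite (leq_bigmax (F := fun i => al i)).
rewrite big_map big_enum /=.
rewrite (eq_bigr (fun f : {ffun 'I_m -> 'I_N.+1} => \prod_i (fun k : 'I_N.+1 => k.+1%:R `^ (- (1 + d)) : R) (f i))); last first.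
  by move=> f _; apply: eq_bigr => i _; rewrite ffunE.
rewrite -(bigA_distr_bigA (fun (i : 'I_m) (k : 'I_N.+1) => k.+1%:R `^ (- (1 + d)) : R)).
rewrite prodr_const card_ord lerXn2r ?nnegrE ?hsum_bound ?addr_ge0 ?invr_ge0 ?(ltW d0)//.
by apply: sumr_ge0 => k _; exact: powR_ge0.
Qed.

(** * Divergence along dyadic boxes *)

Section divergence.
Variables (m : nat) (d : {ffun 'I_m -> nat} -> R) (P : pred 'I_m) (Lc : 'I_m -> nat)
  (i0 : 'I_m) (c q p : R) (N0 : nat).
Hypotheses (Pi0 : P i0) (L0 : Lc i0 = 1%N) (c0 : 0 < c) (p0 : 0 < p).
Hypothesis d0 : forall al, 0 <= d al.

(** The coordinates in [P] are of order N, with individual multiples [Lc i]; the others are zero. *)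
Definition in_box N (al : {ffun 'I_m -> nat}) := forall i,
  (P i -> (Lc i * N <= al i < (Lc i).+1 * N)%N) /\ (~~ P i -> al i = 0%N).

Hypothesis dN : forall N al, (N0 <= N)%N -> (0 < N)%N -> in_box N al -> c / N%:R `^ q <= d al.
Hypothesis qp : q * p <= #|P|%:R.

Local Notation J := ({i : 'I_m | P i}).

Definition box_point N (f : {ffun J -> 'I_N}) : {ffun 'I_m -> nat} :=
  [ffun i => if insub i is Some u then (Lc i * N + f u)%N else 0%N].

Local Notation mk := box_point.

Lemma box_pointE N (f : {ffun J -> 'I_N}) (u : J) : mk f (val u) = (Lc (val u) * N + f u)%N.
Proof. by rewrite ffunE valK. Qed.

Lemma box_point_inj N : injective (@mk N).
Proof.
move=> f f' E; apply/ffunP => u; apply/val_inj.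
by have := congr1 (fun g : {ffun 'I_m -> nat} => g (val u)) E; rewrite !box_pointE => /addnI.
Qed.

Lemma box_point_in N (f : {ffun J -> 'I_N}) : in_box N (mk f).
Proof.
move=> i; split => [Pi|nPi]; last by rewrite ffunE insubN.
have := box_pointE f (Sub i Pi : J); rewrite SubK => ->.
by rewrite leq_addr /= mulSn addnC ltn_add2r.
Qed.

(** N^#|P| points, each contributing at least c^p N^(-q p): the assumption on q p makes the total at
    least c^p. *)
Let box_sum N : (N0 <= N)%N -> (0 < N)%N ->
  c `^ p <= \sum_(al <- [seq mk f | f <- enum {ffun J -> 'I_N}]) d al `^ p.
Proof.
move=> NN Np; have N1 : 1 <= N%:R :> R by rewrite ler1n.
have Nq : 0 < N%:R :> R by rewrite ltr0n.
rewrite big_map big_enum/=.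
apply: (@le_trans _ _ (\sum_(f : {ffun J -> 'I_N}) c `^ p * N%:R `^ (- (q * p)))).
  rewrite sumr_const -[X in _ <= X]mulr_natr -mulrA ler_peMr ?powR_ge0//.
  rewrite card_ffun card_ord card_sig natrX -powR_mulrn ?ler0n// -powRD; last first.
    by apply/implyP => _; rewrite gt_eqF.
  apply: (@le_trans _ _ (N%:R `^ 0)); first by rewrite powRr0.
  by apply: ler_powR => //; rewrite addrC subr_ge0.
apply: ler_sum => f _.
have -> : c `^ p * N%:R `^ (- (q * p)) = (c / N%:R `^ q) `^ p.
  by rewrite -powRN powRM ?powR_ge0 ?(ltW c0)// -powRrM mulNr.
apply: ge0_ler_powR; rewrite ?nnegrE ?(ltW p0) ?divr_ge0 ?powR_ge0 ?(ltW c0)//.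
by apply: dN => //; exact: box_point_in.
Qed.

Lemma box_diverge : ~ exists M, forall r : seq {ffun 'I_m -> nat}, uniq r -> \sum_(al <- r) d al `^ p <= M.
Proof.
move=> [M hM]; pose e := c `^ p; have e0 : 0 < e by rewrite powR_gt0.
(* The boxes for N = 2^(K + N0) are disjoint, because coordinate i0, with [Lc i0 = 1], ranges over
   [N, 2N). *)
have H K : exists r : seq {ffun 'I_m -> nat}, [/\ uniq r,
    (forall al, al \in r -> (al i0 < 2 ^ (K + N0))%N) & K%:R * e <= \sum_(al <- r) d al `^ p].
  elim: K => [|K [r [ur rK hr]]]; first by exists [::]; rewrite big_nil mul0r.
  pose N := (2 ^ (K + N0))%N.
  pose s := [seq mk f | f <- enum {ffun J -> 'I_N}].
  have sE al : al \in s -> (N <= al i0 < 2 * N)%N.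
    move=> /mapP[f _ ->]; have [+ _] := box_point_in f i0.
    by rewrite L0 mul1n; apply.
  exists (r ++ s); split.
  - rewrite cat_uniq ur map_inj_uniq ?enum_uniq ?andbT//=; last exact: box_point_inj.
    apply/hasPn => al /sE /andP[h _]; apply/negP => /rK; rewrite -/N ltnNge h.
    by [].
  - move=> al; rewrite mem_cat addSn expnS => /orP[/rK h|/sE /andP[_ //]].
    by apply: leq_trans h _; rewrite leq_pmull.
  rewrite big_cat/= -natr1 mulrDl mul1r lerD// box_sum// ?expn_gt0//.
  by apply: leq_trans (ltnW (ltn_expl _ (ltnSn 1))) ; rewrite leq_addl.
have [K hK] := exists_large 0 ((M + 1) / e).
have [r [ur _ hr]] := H K; have := hM r ur.
rewrite add0r ler_pdivrMr// in hK; lra.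
Qed.

End divergence.

End series_boxes.

(** * The commutators on the Bergman space of an ellipsoid *)

Section ellipsoid_domain.
Context (R : realType) (m : nat) (a : 'I_m -> R).
Hypothesis a0 : forall j, 0 < a j.
Local Notation C := (Cplx R).
Local Notation L := (measurableTypeR R).
Local Notation pt := (m.-tuple (L * L)).
Local Notation O := (ellipsoid a : set 'rV[C]_m).
Local Notation D := (@cp R m @^-1` O).
Implicit Types (z w h : 'rV[C]_m) (j : 'I_m).

Let a20 j : 0 < 2 * a j. Proof. by rewrite mulr_gt0. Qed.

Lemma ellipsoidE z : O z <-> \sum_j nc (z 0 j) `^ (2 * a j) < 1.
Proof. by []. Qed.

Lemma ellipsoid_cp (x : pt) : O (cp x) <-> \sum_j sqn (tnth x j) `^ a j < 1.
Proof.
rewrite ellipsoidE (eq_bigr (fun j => sqn (tnth x j) `^ a j)) // => j _.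
by rewrite powRrM powR_mulrn ?nc_ge0// sqr_nc cpE.
Qed.

Lemma ellipsoid_measurable : measurable D.
Proof.
rewrite (_ : D = (fun x : pt => \sum_j sqn (tnth x j) `^ a j : L) @^-1` `]-oo, 1[).
  rewrite -[X in measurable X]setTI; apply: measurable_sum => // j.
  exact: (measurableT_comp (measurable_pow (a j)) (measurable_sqn_tnth j)).
by apply/seteqP; split => x; rewrite /= in_itv/= ellipsoid_cp.
Qed.

Lemma ellipsoid_solid z w : O z -> (forall j, nc (w 0 j) <= nc (z 0 j)) -> O w.
Proof.
rewrite !ellipsoidE => Oz wz; apply: le_lt_trans Oz; apply: ler_sum => j _.
by apply: ge0_ler_powR; rewrite ?nnegrE ?nc_ge0 ?(ltW (a20 j)).
Qed.

Lemma ellipsoid_le1 z j : O z -> nc (z 0 j) <= 1.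
Proof.
rewrite ellipsoidE => Oz; rewrite leNgt; apply/negP => z1.
have : 1 `^ (2 * a j) <= nc (z 0 j) `^ (2 * a j).
  by apply: ge0_ler_powR; rewrite ?nnegrE ?nc_ge0 ?(ltW (a20 j))// ltW.
rewrite powR1 leNgt => /negP; apply; apply: le_lt_trans Oz.
by rewrite (bigD1 j)//= lerDl; apply: sumr_ge0 => i _; exact: powR_ge0.
Qed.

Lemma ellipsoid_open z : O z -> exists2 d : R, 0 < d & forall h, N1 h < d -> O (z + h).
Proof.
move=> /ellipsoidE; set s := \sum_j _ => s1.
(* The slack 1 - s is shared among the coordinates; y j is the radius at which the j-th term has
   grown by e. *)
pose e := (1 - s) / (m%:R + 1); have m1 : 0 < m%:R + 1 :> R by rewrite ltr_wpDl.
have e0 : 0 < e by apply: divr_gt0 => //; lra.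
pose y j := (nc (z 0 j) `^ (2 * a j) + e) `^ (2 * a j)^-1.
have yE j : y j `^ (2 * a j) = nc (z 0 j) `^ (2 * a j) + e.
  by rewrite -powRrM mulVf ?gt_eqF// powRr1// addr_ge0 ?powR_ge0 ?(ltW e0).
have yz j : 0 < y j - nc (z 0 j).
  rewrite subr_gt0 ltNge; apply/negP => h.
  have : y j `^ (2 * a j) <= nc (z 0 j) `^ (2 * a j).
    by apply: ge0_ler_powR; rewrite ?nnegrE ?nc_ge0 ?powR_ge0 ?(ltW (a20 j)).
  by rewrite yE; lra.
exists (\big[Num.min/1]_j (y j - nc (z 0 j))).
  by elim/big_rec: _ => // j x _ x0; rewrite lt_min yz.
move=> h hd; apply/ellipsoidE.
apply: (@le_lt_trans _ _ (\sum_j (nc (z 0 j) `^ (2 * a j) + e))).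
  apply: ler_sum => j _; rewrite -yE; apply: ge0_ler_powR; rewrite ?nnegrE ?nc_ge0 ?powR_ge0 ?(ltW (a20 j))//.
  rewrite mxE; apply: le_trans (ncD _ _) _.
  have h1 : N1 h < y j - nc (z 0 j) by apply: lt_le_trans hd _; exact: bigmin_le_cond.
  by have := N1_ge h j; lra.
rewrite big_split/= sumr_const card_ord -/s -mulr_natl.
have : m%:R * e < 1 - s.
  by rewrite /e mulrCA gtr_pMr ?ltr_pdivrMr ?mul1r ?ltrDl//; lra.
lra.
Qed.

Lemma mono_weight_gt0 al : 0 < mono_weight a al.
Proof.
rewrite divr_gt0 ?Pi_gt0 ?tdeg_ge0//; apply: prodr_gt0 => j _.
by rewrite mulr_gt0 ?discA_gt0// divr_gt0// Pi_gt0// divr_ge0// ltW.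
Qed.

Lemma I2_mono_ellipsoid al : I2 O (mono O al) = (mono_weight a al)%:E.
Proof.
rewrite (I2T (mono_hol ellipsoid_open al)).
have := integral_monof al 1 a0; rewrite /psi ltr01 powR1 mulr1 => <-.
apply: eq_integral => x _; rewrite /monof.
case: ifPn => [/ellipsoid_cp Ox|/negP nO].
  rewrite monoE//; congr (_%:E).
  rewrite (big_morph _ (@ncM R) (@nc1 R)) -prodrXl; apply: eq_bigr => j _.
  by rewrite ncX -exprM mulnC exprM sqr_nc cpE.
by rewrite (mono_hol ellipsoid_open al).2 ?nc0 ?expr0n// => /ellipsoid_cp.
Qed.

End ellipsoid_domain.

(** * Coordinate multiplications as weighted shifts *)

Section weighted_shifts.
Context (R : realType) (m : nat).
Local Notation C := (Cplx R).
Local Notation I := {ffun 'I_m -> nat}.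
Variable O : set 'rV[C]_m.
Hypothesis mD : measurable (@cp R m @^-1` O).
Hypothesis Oopen : forall z, O z -> exists2 d : R, 0 < d & forall h, N1 h < d -> O (z + h).
Hypothesis Osolid : forall z w : 'rV[C]_m, O z -> (forall j, nc (w 0 j) <= nc (z 0 j)) -> O w.
Hypothesis O_le1 : forall z j, O z -> nc (z 0 j) <= 1.
Variable om : ('I_m -> nat) -> R.
Hypothesis om_gt0 : forall al, 0 < om al.
Hypothesis I2_mono : forall al, I2 O (mono O al) = (om al)%:E.
Local Notation H := (bergman_space O).
Local Notation ip := (bergman_ip O).
Local Notation V := ('rV[C]_m -> C^o).
Implicit Types (j k : 'I_m) (al be ga : I).

Let hil := bergman_hilbert mD Oopen.
Local Notation M := (@coord_mul R m).
Local Notation A j := (adjoint H ip (M j)).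

Definition inc j al : I := [ffun i => (al i + (i == j))%N].
(** Truncated subtraction leaves al unchanged when [al j] is 0; the coefficients below treat that
    case separately. *)
Definition dec j al : I := [ffun i => (al i - (i == j))%N].

Lemma incK j : cancel (inc j) (dec j).
Proof. by move=> al; apply/ffunP => i; rewrite !ffunE addnK. Qed.

Lemma decK j al : (0 < al j)%N -> inc j (dec j al) = al.
Proof.
by move=> h; apply/ffunP => i; rewrite !ffunE; case: eqP => [->|_]; [rewrite subnK|rewrite subn0 addn0].
Qed.

Lemma inc_gt0 j al : (0 < inc j al j)%N. Proof. by rewrite ffunE eqxx addn1. Qed.

Lemma dec_inc j k al : j != k -> dec k (inc j al) = inc j (dec k al).
Proof.
move=> jk; apply/ffunP => i; rewrite !ffunE; case: (eqVneq i j) => [->|_].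
  by rewrite (negbTE jk) !subn0.
by rewrite !addn0.
Qed.

Lemma inc_other j k al : j != k -> inc j al k = al k.
Proof. by move=> jk; rewrite ffunE eq_sym (negbTE jk) addn0. Qed.

Definition wt j al : R := Num.sqrt (om (inc j al) / om al).

Lemma sqr_wt j al : wt j al ^+ 2 = om (inc j al) / om al.
Proof. by rewrite sqr_sqrtr// divr_ge0 ?ltW. Qed.

Lemma coord_mul_H j f : H f -> H (M j f).
Proof.
move=> hf; have [[df f0] fi] := (bergP mD f).1 hf.
have hM : hol O (M j f).
  split=> z; last by move=> nO; rewrite /coord_mul f0// mulr0.
  by move=> Oz; apply: hdiff_mul; [exact: hdiff_coord|exact: df].
apply/(bergP mD); split => //; apply: le_lt_trans fi; apply: ge0_le_integral => //.
- by move=> x _; rewrite lee_fin sqr_ge0.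
- by apply/measurable_EFinP; exact: (measurable_nc2 hM.1).
- by apply/measurable_EFinP; exact: (measurable_nc2 df).
move=> x Dx; rewrite lee_fin /coord_mul ncM exprMn ler_piMl ?sqr_ge0//.
by rewrite expr_le1 ?nc_ge0// O_le1.
Qed.

Lemma coord_mul_bounded j : bounded_operator H ip (M j).
Proof.
split; first exact: coord_mul_H.
  move=> c f g _ _; apply/funext => z.
  rewrite -[LHS]/(z 0 j * (c * f z + g z)) -[RHS]/(c * (z 0 j * f z) + z 0 j * g z).
  by rewrite mulrDr mulrCA.
exists 1 => f hf; rewrite mul1r ler_sqrt; last exact: (berg_ge0 mD).
have hM := coord_mul_H j hf.
rewrite -lee_fin -[leLHS](I2E mD hM) -[leRHS](I2E mD hf).
have [[df f0] _] := (bergP mD f).1 hf; have [[dM _] _] := (bergP mD _).1 hM.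
apply: ge0_le_integral => //.
- by move=> x _; rewrite lee_fin sqr_ge0.
- by apply/measurable_EFinP; exact: (measurable_nc2 dM).
- by apply/measurable_EFinP; exact: (measurable_nc2 df).
move=> x Dx; rewrite lee_fin /coord_mul ncM exprMn ler_piMl ?sqr_ge0//.
by rewrite expr_le1 ?nc_ge0// O_le1.
Qed.

Definition nmono al : V := (ofR (Num.sqrt (om al)))^-1 *: mono O al.

Let sq0 al : ofR (Num.sqrt (om al)) != 0 :> C.
Proof. by rewrite ofR_eq0 gt_eqF// sqrtr_gt0. Qed.

Lemma nmono_H al : H (nmono al).
Proof. by apply: (HZ hil); exact: (mono_H mD Oopen I2_mono). Qed.

Lemma nmono_ip al be : ip (nmono al) (nmono be) = (al == be)%:R.
Proof.
have ha := mono_H mD Oopen I2_mono al; have hb := mono_H mD Oopen I2_mono be.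
rewrite (ipZl hil _ ha (HZ hil _ hb)) (ipZr hil _ ha hb).
case: eqP => [->|ab].
  rewrite (ip_mono mD Oopen I2_mono) -ofRV cj_ofR -!ofRM mulrA -invfM -expr2 sqr_sqrtr ?(ltW (om_gt0 _))//.
  by rewrite mulVf// gt_eqF.
rewrite (mono_orth mD Oopen Osolid I2_mono) ?mulr0// => h; apply: ab.
by apply/ffunP => i; rewrite h.
Qed.

Lemma nmono_total f : H f -> (forall al, ip f (nmono al) = 0) -> f = 0.
Proof.
move=> hf f0; apply: (mono_total mD Oopen Osolid om_gt0 I2_mono hf) => al.
have := f0 [ffun i => al i]; rewrite /nmono (_ : mono O [ffun i => al i] = mono O al); last first.
  by congr mono; apply/funext => i; rewrite ffunE.
rewrite (ipZr hil)//; last exact: (mono_H mD Oopen I2_mono).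
by move=> /eqP; rewrite mulf_eq0 -nc_eq0 nc_cj nc_eq0 invr_eq0 (negbTE (sq0 _)) => /eqP.
Qed.

Lemma nmono_basis : orthonormal_basis H ip nmono.
Proof. exact: (basis_of_total hil nmono_H nmono_ip nmono_total). Qed.

Lemma coord_mul_nmono j al : M j (nmono al) = ofR (wt j al) *: nmono (inc j al).
Proof.
apply/funext => z.
rewrite -[LHS]/(z 0 j * ((ofR (Num.sqrt (om al)))^-1 * mono O al z)).
rewrite -[RHS]/(ofR (wt j al) * ((ofR (Num.sqrt (om (inc j al))))^-1 * mono O (inc j al) z)).
have E : z 0 j * mono O al z = mono O (inc j al) z.
  rewrite /mono; case: asboolP => _; last by rewrite mulr0.
  rewrite (bigD1 j)//= [RHS](bigD1 j)//= mulrA -exprS ffunE eqxx addn1; congr (_ * _).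
  by apply: eq_bigr => i /negbTE ij; rewrite ffunE ij addn0.
rewrite -E mulrCA; have -> : ofR (wt j al) = ofR (Num.sqrt (om (inc j al))) / ofR (Num.sqrt (om al)) :> C.
  by rewrite /wt sqrtrM ?(ltW (om_gt0 _))// sqrtrV ?(ltW (om_gt0 _))// ofRM ofRV.
by have := sq0 al; have := sq0 (inc j al); move: (ofR _) (ofR _) (z 0 j) (mono O al z) => x y u v x0 y0; field; rewrite x0 y0.
Qed.

Lemma adjoint_nmono j al : A j (nmono al) =
  if al j == 0%N then 0 else ofR (wt j (dec j al)) *: nmono (dec j al).
Proof.
have bM := coord_mul_bounded j; have hal := nmono_H al.
have [hA AE] := adjointP hil bM hal.
set h := (if _ then _ else _); have hh : H h.
  by rewrite /h; case: ifP => _; [exact: (hil0 hil)|apply: (HZ hil); exact: nmono_H].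
apply/eqP; rewrite -subr_eq0; apply/eqP; have hd := HB hil hA hh.
apply: nmono_total => // be; have hbe := nmono_H be.
suff E : ip (nmono be) (A j (nmono al)) = ip (nmono be) h.
  by rewrite (hil_cj hil hbe hd) (ipBr hil)// E subrr cj0.
rewrite -(AE _ hbe) coord_mul_nmono (ipZl hil _ (nmono_H _) hal).
rewrite nmono_ip /h; case: ifPn => [/eqP a0|a0].
  rewrite (ip0r hil hbe); case: eqP => [E|_]; last by rewrite mulr0.
  by have := inc_gt0 j be; rewrite E a0.
have hde := nmono_H (dec j al).
rewrite (ipZr hil _ hbe hde) cj_ofR nmono_ip; case: (eqVneq be (dec j al)) => [->|nb].
  by rewrite decK ?lt0n// eqxx.
case: eqP => [E|_]; last by rewrite !mulr0.
by case/eqP: nb; rewrite -E incK.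
Qed.

Definition wdiff j al : R := wt j al ^+ 2 - (if al j == 0%N then 0 else wt j (dec j al) ^+ 2).

Local Notation K j k := (commutator (M j) (A k)).

Lemma comm_bounded j k : bounded_operator H ip (K j k).
Proof.
apply: (commutator_bounded hil); first exact: coord_mul_bounded.
exact: (adjoint_bounded hil (coord_mul_bounded k)).
Qed.

Lemma adjoint_comm j k f : H f -> adjoint H ip (K j k) f = K k j f.
Proof.
move=> hf; exact: (adjoint_commutator hil (coord_mul_bounded j) (coord_mul_bounded k) hf).
Qed.

Let lin0 T : bounded_operator H ip T -> T 0 = 0.
Proof.
move=> bT; have := bop_lin bT 1 (hil0 hil) (hil0 hil).
by rewrite !scale1r addr0 => /eqP; rewrite -subr_eq0 opprD addrA subrr sub0r oppr_eq0 => /eqP.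
Qed.

Let linZ T c f : bounded_operator H ip T -> H f -> T (c *: f) = c *: T f.
Proof.
move=> bT hf; have := bop_lin bT c hf (hil0 hil).
by rewrite addr0 (lin0 bT) addr0.
Qed.

Let sZ (x y : R) al : ofR x *: (ofR y *: nmono al) = ofR (x * y) *: nmono al.
Proof. by rewrite [LHS]scalerA -ofRM. Qed.

Let sB (x y : R) al : ofR x *: nmono al - ofR y *: nmono al = ofR (x - y) *: nmono al.
Proof.
rewrite -scalerBl; congr (_ *: nmono al).
by apply: complex_eq; rewrite ?reB ?imB /= ?subr0.
Qed.

Lemma comm_diag j al : K j j (nmono al) = ofR (- wdiff j al) *: nmono al.
Proof.
have bM := coord_mul_bounded j; have bA := adjoint_bounded hil bM.
rewrite /commutator [coord_mul j (nmono al)]coord_mul_nmono (linZ _ bA (nmono_H _)).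
rewrite !adjoint_nmono (gtn_eqF (inc_gt0 _ _)) incK sZ -expr2 /wdiff.
case: ifPn => [a0|a0].
  rewrite (lin0 bM) subr0 -[0](scale0r (nmono al)) -[0]/(ofR 0 : C) sB.
  by rewrite sub0r.
rewrite (linZ _ bM (nmono_H _)) coord_mul_nmono decK ?lt0n// sZ -expr2 sB.
by rewrite opprB.
Qed.

Lemma comm_diag_sq j al :
  K j j (adjoint H ip (K j j) (nmono al)) = ofR (`|wdiff j al| ^+ 2) *: nmono al.
Proof.
have hal := nmono_H al; rewrite adjoint_comm// comm_diag.
rewrite (linZ _ (comm_bounded j j) hal) comm_diag sZ; congr (ofR _ *: _).
by rewrite -expr2 sqrrN real_normK ?num_real.
Qed.

(** Indexed by the common lower multi-index: for j != k the commutator sends the basis vector at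
    [inc k ga] to [kap j k ga] times the one at [inc j ga]. *)
Definition kap j k ga : R := wt j ga * wt k ga - wt k (inc j ga) * wt j (inc k ga).

Lemma comm_off j k al : j != k -> K j k (nmono al) =
  if al k == 0%N then 0 else ofR (kap j k (dec k al)) *: nmono (inc j (dec k al)).
Proof.
move=> jk; have bM := coord_mul_bounded j.
have bA := adjoint_bounded hil (coord_mul_bounded k).
rewrite /commutator [coord_mul j (nmono al)]coord_mul_nmono (linZ _ bA (nmono_H _)).
rewrite !adjoint_nmono inc_other//; case: ifPn => [a0|a0].
  by rewrite (lin0 bM) scaler0 subr0.
rewrite (linZ _ bM (nmono_H _)) coord_mul_nmono dec_inc// sZ sZ sB; congr (ofR _ *: _).
have E : al = inc k (dec k al) by rewrite decK// lt0n.
rewrite /kap [X in wt j X * wt k (inc _ _)]E; congr (_ - _); exact: mulrC.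
Qed.

(** The singular value at al up to sign. It lowers coordinate j, not k, because the adjoint acts
    first. *)
Definition koff j k al : R := if al j == 0%N then 0 else kap j k (dec j al).

Lemma kap_sym j k ga : kap j k ga = kap k j ga.
Proof. by rewrite /kap; congr (_ - _); exact: mulrC. Qed.

Lemma comm_off_sq j k al : j != k ->
  K j k (adjoint H ip (K j k) (nmono al)) = ofR (`|koff j k al| ^+ 2) *: nmono al.
Proof.
move=> jk; have hal := nmono_H al; have kj : k != j by rewrite eq_sym.
rewrite adjoint_comm// comm_off// /koff; case: ifPn => a0.
  by rewrite (lin0 (comm_bounded j k)) normr0 expr0n scale0r.
rewrite (linZ _ (comm_bounded j k) (nmono_H _)).
rewrite comm_off// gtn_eqF ?inc_gt0// incK decK ?lt0n// sZ kap_sym.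
by rewrite -expr2 real_normK ?num_real.
Qed.

End weighted_shifts.

(** * Ratios of monomial norms *)

Section ellipsoid_weights.
Context (R : realType) (m : nat) (a : 'I_m -> R).
Hypothesis a0 : forall j, 0 < a j.
Local Notation I := {ffun 'I_m -> nat}.
Implicit Types (j k : 'I_m) (al ga : I).
Local Notation T := (tdeg a).
Local Notation om := (mono_weight a).
Local Notation Q := (Qr (@Pi R)).
Local Notation P := (weight_num (@Pi R)).

Let b0 j : 0 < (a j)^-1. Proof. by rewrite invr_gt0. Qed.

Lemma tdeg_inc j al : T (inc j al) = T al + (a j)^-1.
Proof.
rewrite /tdeg (bigD1 j)//= [in RHS](bigD1 j)//= ffunE eqxx addn1 -natr1 mulrDl mul1r -!addrA; congr (_ + _).
rewrite addrC; congr (_ + _); apply: eq_bigr => i /negbTE ij.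
by rewrite ffunE ij addn0.
Qed.

Lemma tdeg_ge j al : (al j).+1%:R * (a j)^-1 <= T al.
Proof.
by rewrite /tdeg (bigD1 j)//= lerDl; apply: sumr_ge0 => i _; rewrite divr_ge0// ltW.
Qed.

Lemma tdeg_gt0 j al : 0 < T al.
Proof. by apply: lt_le_trans (tdeg_ge j al); rewrite mulr_gt0. Qed.

(** The area of the disc and all factors but the j-th cancel, leaving one Gamma quotient in [al j]
    and one in the total degree. *)
Lemma mono_weight_inc j al :
  om (inc j al) / om al = P (a j)^-1 (al j) / Q (a j)^-1 (T al).
Proof.
rewrite /mono_weight (bigD1 j)//= [X in _ / (X / _)](bigD1 j)//= tdeg_inc.
rewrite (eq_bigr (fun i => discA R * (Pi ((al i).+1%:R / a i) / (al i).+1%:R))); last first.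
  by move=> i /negbTE ij; rewrite ffunE ij addn0.
rewrite ffunE eqxx addn1 /weight_num /Qr.
set F := \prod_(i | _) _; set n := al j.
have F0 : 0 < F by apply: prodr_gt0 => i _; rewrite mulr_gt0 ?discA_gt0// divr_gt0// Pi_gt0// divr_ge0// ltW.
rewrite (_ : n.+2%:R / a j = n.+1%:R / a j + (a j)^-1); last first.
  by rewrite -[n.+2%:R]natr1 mulrDl mul1r.
have p1 : 0 < Pi (n.+1%:R / a j) by rewrite Pi_gt0// divr_ge0// ltW.
have p2 : 0 < Pi (n.+1%:R / a j + (a j)^-1) by rewrite Pi_gt0// addr_ge0 ?divr_ge0// ltW.
have p3 : 0 < Pi (T al) by rewrite Pi_gt0// ltW// (tdeg_gt0 j).
have p4 : 0 < Pi (T al + (a j)^-1) by rewrite Pi_gt0// addr_ge0 ?(ltW (tdeg_gt0 j al)) ?(ltW (b0 j)).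
have d0 := discA_gt0 R; have n1 : n.+1%:R != 0 :> R by [].
have n2 : n.+2%:R != 0 :> R by [].
move: (Pi _) p1 => u u0; move: (Pi (_ / _ + _)) p2 => v v0.
move: (Pi (T al)) p3 => w w0; move: (Pi (T al + _)) p4 => x x0.
move: F F0 (discA R) d0 n.+1%:R n1 n.+2%:R n2 => F F0 A d0 x1 n1 x2 n2.
by field; rewrite ?n1 ?n2 !gt_eqF.
Qed.

End ellipsoid_weights.

(** * Commutator coefficients in terms of Gamma quotients *)

Section general_weights.
Context (R : realType) (m : nat) (G : R -> R) (b : 'I_m -> R).
Local Notation I := {ffun 'I_m -> nat}.
Variables (om : ('I_m -> nat) -> R) (T : I -> R).
Implicit Types (j k : 'I_m) (al ga : I).
Local Notation Q := (Qr G).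
Local Notation P := (weight_num G).
Hypothesis G_gt0 : forall s, 0 <= s -> 0 < G s.
Hypothesis G_rec : forall s, 0 <= s -> G (s + 1) = (s + 1) * G s.
Hypothesis G_convex : forall l s u : R, 0 < s -> 0 < u -> 0 <= l <= 1 ->
  ln (G ((1 - l) * s + l * u)) <= (1 - l) * ln (G s) + l * ln (G u).
Hypothesis b0 : forall j, 0 < b j.
Hypothesis T_inc : forall j al, T (inc j al) = T al + b j.
Hypothesis T_ge : forall j al, (al j).+1%:R * b j <= T al.
Hypothesis om_gt0 : forall be : 'I_m -> nat, 0 < om be.
Hypothesis om_inc : forall j al, om (inc j al) / om al = P (b j) (al j) / Q (b j) (T al).

Let T_gt0 j al : 0 < T al.
Proof. by apply: lt_le_trans (T_ge j al); rewrite mulr_gt0. Qed.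

Lemma sqr_wtE j al : wt om j al ^+ 2 = P (b j) (al j) / Q (b j) (T al).
Proof. by rewrite (sqr_wt om_gt0) om_inc. Qed.

Lemma wdiffE j al : wdiff om j al = weight_gap G (b j) (al j) (T al).
Proof.
rewrite /wdiff /weight_gap sqr_wtE; case E : (al j) => [|n] /=; first by [].
have a1 : (0 < al j)%N by rewrite E.
have E1 : dec j al j = n by rewrite ffunE eqxx E subn1.
have E2 : T (dec j al) = T al - b j by rewrite -[in RHS](decK a1) T_inc addrK.
by rewrite sqr_wtE E1 E2.
Qed.

Lemma wdiff_ge0 j al : 0 <= wdiff om j al.
Proof.
by rewrite wdiffE; apply: (weight_gap_ge0 G_gt0 G_rec G_convex (b0 j)); exact: T_ge.
Qed.

Lemma wt_le1 j al : wt om j al <= 1.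
Proof.
rewrite -[leRHS]sqrtr1; apply: ler_wsqrtr; rewrite om_inc ler_pdivrMr ?mul1r; last first.
  by apply: (Qr_gt0 G_gt0); rewrite ?(ltW (T_gt0 j al)).
have n0 : 0 < (al j).+1%:R * b j by rewrite mulr_gt0.
have h := Qr_mono G_gt0 G_convex (b0 j) n0 (T_ge j al).
apply: le_trans h; rewrite /weight_num ler_piMr//; last by rewrite ler_pdivrMr// mul1r ler_nat.
by apply: ltW; apply: (Qr_gt0 G_gt0); rewrite ?(ltW n0).
Qed.

Lemma wt_ge0 j al : 0 <= wt om j al. Proof. exact: sqrtr_ge0. Qed.

Let Q_gt0 j al : 0 < Q (b j) (T al).
Proof. by apply: (Qr_gt0 G_gt0); rewrite ?(ltW (T_gt0 j al)). Qed.

(** Both sides equal G(T + b_j) G(T + b_k) / (G(T) G(T + b_j + b_k)). *)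
Lemma Qr_ratio_sym j k al :
  Q (b j) (T al) / Q (b j) (T al + b k) = Q (b k) (T al) / Q (b k) (T al + b j).
Proof.
rewrite /Qr [T al + b j + _]addrAC !invf_div.
by move: (G _) (G _) (G _) (G _) => x y z u; ring.
Qed.

(** A step in direction k changes the j-th weight only through T. By the symmetry of the ratio both
    weights acquire the same square-root factor. *)
Lemma kapE j k ga : j != k -> kap om j k ga =
  wt om j ga * wt om k ga * (1 - Q (b j) (T ga) / Q (b j) (T ga + b k)).
Proof.
move=> jk; set r := _ / Q _ (T ga + _).
have r0 : 0 <= r by rewrite /r -T_inc ltW// divr_gt0.
have E (j' k' : 'I_m) : j' != k' -> wt om j' (inc k' ga) =
    wt om j' ga * Num.sqrt (Q (b j') (T ga) / Q (b j') (T ga + b k')).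
  move=> jk'; have Pj : 0 < P (b j') (ga j') by apply: (weight_num_gt0 G_gt0).
  rewrite -[LHS](ger0_norm (wt_ge0 _ _)) -sqrtr_sqr -[wt om j' ga](ger0_norm (wt_ge0 _ _)) -sqrtr_sqr.
  rewrite -sqrtrM ?sqr_ge0// !sqr_wtE inc_other 1?eq_sym// -T_inc; congr Num.sqrt.
  have := Q_gt0 j' ga; have := Q_gt0 j' (inc k' ga).
  move: (Q _ _) (Q _ _) (P _ _) => x y z x1 y1; field.
  by rewrite ?gt_eqF.
rewrite /kap (E k j) 1?eq_sym// (E j k)// -Qr_ratio_sym -/r.
rewrite mulrBr mulr1; congr (_ - _).
by rewrite mulrACA -[X in _ * X]expr2 sqr_sqrtr// [wt om k ga * _]mulrC.
Qed.

Lemma koff_le j k : j != k -> exists2 c : R, 0 < c & forall al, `|koff om j k al| <= c / T al.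
Proof.
move=> jk.
have [c c0 hc] := Qr_ratio G_gt0 G_rec G_convex (b0 j) (b0 k).
(* The estimate holds at ga = [dec j al], and T al = T ga + b j is at most 2 T ga. *)
exists (2 * c); first by rewrite mulr_gt0.
move=> al; rewrite /koff; case: ifPn => [_|nz].
  by rewrite normr0 divr_ge0 ?mulr_ge0 ?(ltW c0)// ltW// (T_gt0 j).
rewrite kapE//; set ga := dec j al; have T1 := T_gt0 j ga.
have /andP[h1 h2] := hc _ T1.
have Tal : T al = T ga + b j by rewrite -T_inc decK ?lt0n.
have Tga : b j <= T ga.
  by apply: le_trans (T_ge j ga); rewrite ler_peMl ?(ltW (b0 j))// ler1n.
rewrite normrM normrM !(ger0_norm (wt_ge0 _ _)).
apply: (@le_trans _ _ (1 * (c / T ga))).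
  apply: ler_pM => //; first by rewrite mulr_ge0 ?wt_ge0.
    by rewrite mulr_ile1 ?wt_ge0 ?wt_le1.
  by rewrite ger0_norm; lra.
have T2 := T_gt0 j al.
rewrite mul1r ler_pdivlMr// mulrAC ler_pdivrMr// [2 * c]mulrC -mulrA ler_pM2l//; lra.
Qed.

End general_weights.

(** * Convergence of the sums of p-th powers *)

Section degree_series.
Context (R : realType) (m : nat) (b : 'I_m -> R).
Local Notation I := {ffun 'I_m -> nat}.
Variables (T : I -> R) (d : I -> R) (C p : R).
Hypothesis b0 : forall j, 0 < b j.
Hypothesis TE : forall al, T al = \sum_i (al i).+1%:R * b i.
Hypothesis d0 : forall al, 0 <= d al.
Hypotheses (C0 : 0 < C) (p0 : 0 < p).
Implicit Types (al : I) (i j : 'I_m).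

Let K := \sum_i (b i)^-1.

Let K_gt0 j : 0 < K.
Proof.
rewrite /K (bigD1 j)//= ltr_pwDl ?invr_gt0//; apply: sumr_ge0 => i _.
by rewrite invr_ge0 ltW.
Qed.

Let T_gt0 j al : 0 < T al.
Proof.
rewrite TE (bigD1 j)//= ltr_pwDl ?mulr_gt0//; apply: sumr_ge0 => i _.
by rewrite mulr_ge0// ltW.
Qed.

Let ln_le j al : ln (al j).+1%:R <= ln K + ln (T al).
Proof.
have Tj : (al j).+1%:R * b j <= T al.
  by rewrite TE (bigD1 j)//= lerDl; apply: sumr_ge0 => i _; rewrite mulr_ge0// ltW.
have Kj : (b j)^-1 <= K.
  by rewrite /K (bigD1 j)//= lerDl; apply: sumr_ge0 => i _; rewrite invr_ge0 ltW.
have Tp := T_gt0 j al; have Kp := K_gt0 j.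
rewrite -lnM ?posrE// ler_ln ?posrE ?mulr_gt0//.
apply: le_trans (_ : (b j)^-1 * T al <= _); last by rewrite ler_pM2r.
by rewrite -ler_pdivrMl ?invr_gt0// invrK mulrC.
Qed.

Let summable_of_le M e : 0 <= M -> 0 < e ->
  (forall al, d al `^ p <= M * \prod_i (al i).+1%:R `^ (- (1 + e))) ->
  exists M', forall r : seq I, uniq r -> \sum_(al <- r) d al `^ p <= M'.
Proof.
move=> M0 e0 h; exists (M * (1 + e^-1) ^+ m) => r ur.
apply: (@le_trans _ _ (\sum_(al <- r) M * \prod_i (al i).+1%:R `^ (- (1 + e)))).
  by apply: ler_sum => al _; exact: h.
by rewrite -mulr_sumr ler_wpM2l//; exact: box_sum_bound.
Qed.

Let prod_expR e al :
  \prod_i ((al i).+1%:R : R) `^ (- (1 + e)) = expR (- (1 + e) * \sum_i ln (al i).+1%:R).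
Proof.
rewrite mulr_sumr expR_sum; apply: eq_bigr => i _.
by rewrite /powR pnatr_eq0.
Qed.

(** Every al_i + 1 is at most K T, so T^(-p) with p = m (1 + e) is dominated by the product of the
    (al_i + 1)^(-(1 + e)). *)
Lemma summable_degree_inv : m%:R < p -> (0 < m)%N ->
  (forall al, d al <= C / T al) ->
  exists M, forall r : seq I, uniq r -> \sum_(al <- r) d al `^ p <= M.
Proof.
move=> mp m0 h; have mR : 0 < m%:R :> R by rewrite ltr0n.
pose j0 := Ordinal m0.
pose e := p / m%:R - 1; have e0 : 0 < e by rewrite /e subr_gt0 ltr_pdivlMr ?mul1r.
apply: (summable_of_le (M := C `^ p * expR (p * ln K)) (e := e)) => //.
  by rewrite mulr_ge0 ?powR_ge0 ?expR_ge0.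
move=> al; have Tp := T_gt0 j0 al.
apply: (@le_trans _ _ ((C / T al) `^ p)).
  by apply: ge0_ler_powR; rewrite ?nnegrE ?(ltW p0)// divr_ge0// ltW.
rewrite powRM ?invr_ge0 ?(ltW C0) ?(ltW Tp)// -mulrA ler_wpM2l ?powR_ge0//.
rewrite prod_expR -expRD /powR gt_eqF ?invr_gt0// lnV ?posrE// ler_expR.
have s : \sum_i ln (al i).+1%:R <= m%:R * (ln K + ln (T al)).
  apply: le_trans (_ : \sum_(i < m) (ln K + ln (T al)) <= _).
    by apply: ler_sum => i _; exact: ln_le.
  by rewrite sumr_const card_ord mulr_natl.
have pe : p = m%:R * (1 + e) by rewrite /e addrC subrK mulrC divfK// gt_eqF.
have := ler_wpM2l (_ : 0 <= 1 + e) s; move=> /(_ ltac:(lra)).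
rewrite mulrA [(1 + e) * m%:R]mulrC -pe; lra.
Qed.

Lemma summable_degree_diag j : m%:R < p -> (1 < m)%N -> m%:R - 1 < p * b j ->
  (forall al, d al <= C * ((al j).+1%:R `^ b j / T al `^ b j / (al j).+1%:R)) ->
  exists M, forall r : seq I, uniq r -> \sum_(al <- r) d al `^ p <= M.
Proof.
move=> mp m1 pb h; have mR : 1 < m%:R :> R by rewrite ltr1n.
have m10 : 0 < m%:R - 1 :> R by lra.
have m0 : 0 < m%:R :> R by lra.
(* The largest e with (1 + e) m <= p and (1 + e)(m - 1) <= p b_j; the two strict assumptions make it
   positive. *)
pose e := Num.min (p / m%:R) (p * b j / (m%:R - 1)) - 1.
have e0 : 0 < e.
  by rewrite /e subr_gt0 lt_min !ltr_pdivlMr// !mul1r mp pb.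
have e1 : (1 + e) * m%:R <= p.
  by rewrite /e addrC subrK -ler_pdivlMr// ge_min lexx.
have e2 : (1 + e) * (m%:R - 1) <= p * b j.
  by rewrite /e addrC subrK -ler_pdivlMr// ge_min lexx orbT.
apply: (summable_of_le (M := C `^ p * expR (p * b j * ln K)) (e := e)) => //.
  by rewrite mulr_ge0 ?powR_ge0 ?expR_ge0.
move=> al; have Tp := T_gt0 j al.
pose l i : R := ln (al i).+1%:R.
have XE : (al j).+1%:R `^ b j / T al `^ b j / (al j).+1%:R =
    expR (b j * l j - b j * ln (T al) - l j).
  rewrite !expRD !expRN lnK ?posrE// /powR pnatr_eq0 /= gt_eqF//.
apply: (@le_trans _ _ ((C * expR (b j * l j - b j * ln (T al) - l j)) `^ p)).
  apply: ge0_ler_powR; rewrite ?nnegrE ?(ltW p0)//.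
    by rewrite mulr_ge0 ?expR_ge0 ?(ltW C0).
  by rewrite -XE.
rewrite powRM ?expR_ge0 ?(ltW C0)// -[leRHS]mulrA ler_wpM2l ?powR_ge0//.
rewrite prod_expR -expRD -expRM ler_expR -/(l _).
have s : \sum_i l i <= l j + (m%:R - 1) * (ln K + ln (T al)).
  rewrite (bigD1 j)//= lerD2l.
  apply: le_trans (_ : \sum_(i < m | i != j) (ln K + ln (T al)) <= _).
    by apply: ler_sum => i _; exact: ln_le.
  have -> : m%:R - 1 = m.-1%:R :> R by rewrite -subn1 natrB// ltnW.
  by rewrite sumr_const cardC1 card_ord mulr_natl.
have l0 : 0 <= l j by rewrite ln_ge0// ler1n.
have lj := ln_le j al; rewrite -/(l j) in lj.
have s' : (1 + e) * \sum_i l i <= (1 + e) * (l j + (m%:R - 1) * (ln K + ln (T al))).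
  by apply: ler_wpM2l => //; lra.
set y := ln K + ln (T al) in s' lj *.
(* In logarithms the claim is linear; it is the sum of s', h1 and h2, the two conditions on e
   weighted by the nonnegative y - l j and l j. *)
have h1 : (p * b j - (1 + e) * (m%:R - 1)) * (y - l j) >= 0 by rewrite mulr_ge0; lra.
have h2 : (p - (1 + e) * m%:R) * l j >= 0 by rewrite mulr_ge0; lra.
have -> : ln (T al) = y - ln K by rewrite /y; ring.
move: s' h1 h2; move: (\sum_i l i) (ln K) => S k; nra.
Qed.

End degree_series.

Section degree_series1.
Context (R : realType) (d : {ffun 'I_1 -> nat} -> R) (p : R).

Lemma summable_degree1 : 1 / 2 < p ->
  (forall al, d al = ((al ord0).+1%:R * (al ord0).+2%:R)^-1) ->
  exists M, forall r : seq {ffun 'I_1 -> nat}, uniq r -> \sum_(al <- r) d al `^ p <= M.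
Proof.
move=> p1 h; pose e := 2 * p - 1; have e0 : 0 < e by rewrite /e; lra.
exists ((1 + e^-1) ^+ 1) => r ur; apply: le_trans (box_sum_bound e0 ur).
apply: ler_sum => al _; rewrite big_ord1 h (_ : 1 + e = 2 * p); last by rewrite /e; ring.
set n := al ord0; rewrite -mulrN powRrM powR_mulrn// -[leRHS]/(_ `^ (- p)).
rewrite powRN -powR_inv1 ?mulr_ge0// -powRrM mulN1r powRN.
rewrite lef_pV2 ?posrE ?powR_gt0 ?exprn_gt0 ?mulr_gt0//.
apply: ge0_ler_powR; rewrite ?nnegrE ?sqr_ge0 ?mulr_ge0//; first by lra.
by rewrite expr2 ler_pM2l// ler_nat.
Qed.

End degree_series1.

(** * Divergence outside the stated range *)

Section degree_divergence.
Context (R : realType) (m : nat) (G : R -> R) (b : 'I_m -> R).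
Local Notation I := {ffun 'I_m -> nat}.
Hypothesis G_gt0 : forall s, 0 <= s -> 0 < G s.
Hypothesis G_rec : forall s, 0 <= s -> G (s + 1) = (s + 1) * G s.
Hypothesis G_convex : forall l s u : R, 0 < s -> 0 < u -> 0 <= l <= 1 ->
  ln (G ((1 - l) * s + l * u)) <= (1 - l) * ln (G s) + l * ln (G u).
Variables (T d : I -> R) (p : R) (j : 'I_m).
Hypothesis b0 : forall i, 0 < b i.
Hypothesis TE : forall al, T al = \sum_i (al i).+1%:R * b i.
Hypothesis d0 : forall al, 0 <= d al.
Hypothesis dE : forall al, d al = weight_gap G (b j) (al j) (T al).
Hypothesis p0 : 0 < p.
Implicit Types (al : I) (i : 'I_m).

Local Notation bounded_sums :=
  (exists M, forall r : seq I, uniq r -> \sum_(al <- r) d al `^ p <= M).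

Let T_ge i al : (al i).+1%:R * b i <= T al.
Proof.
by rewrite TE (bigD1 i)//= lerDl; apply: sumr_ge0 => k _; rewrite mulr_ge0// ltW.
Qed.

Let T_box P Lc N al : (0 < N)%N -> in_box P Lc N al ->
  T al <= N%:R * \sum_i (Lc i).+1%:R * b i.
Proof.
move=> N0 hal; rewrite TE mulr_sumr; apply: ler_sum => i _.
rewrite mulrA ler_pM2r// -natrM ler_nat.
have [h1 h2] := hal i; case: (boolP (P i)) => [/h1/andP[_]|/h2 ->].
  by rewrite mulnC.
by rewrite muln_gt0 N0.
Qed.

Let ex_neq : (1 < m)%N -> exists i, i != j.
Proof.
move=> m1; have /fintype.card_gt0P[i ij] : (0 < #|predC1 j|)%N by rewrite cardC1 card_ord; lia.
by exists i.
Qed.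

Lemma unbounded_diag : (1 < m)%N -> p <= m%:R -> ~ bounded_sums.
Proof.
move=> m1 pm.
have [i ij] := ex_neq m1.
(* The other coordinates are taken about L times larger than the j-th; coordinate i alone then makes
   T large enough for [weight_gap_lb], at the price of a constant factor only. *)
pose L := (Num.truncn (4 * (2 * b j + 1) * (b i)^-1)).+1.
have hL : 4 * (2 * b j + 1) * (b i)^-1 <= L%:R by rewrite ltW// truncnS_gt.
pose Lc k : nat := if k == j then 1%N else L.
pose K := \sum_k (Lc k).+1%:R * b k + b j + 1.
have S0 : 0 <= \sum_k (Lc k).+1%:R * b k.
  by apply: sumr_ge0 => k _; rewrite mulr_ge0// ltW.
have K0 : 0 < K by rewrite /K; have := b0 j; lra.
have [c c0 hc] := weight_gap_lb G_gt0 G_rec G_convex (b0 j) K0.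
pose N0 := (Num.truncn ((2 + 4 * b j ^+ 2 + b j) / b j)).+1.
have hN0 : (2 + 4 * b j ^+ 2 + b j) / b j <= N0%:R by rewrite ltW// truncnS_gt.
apply: (@box_diverge _ _ _ predT Lc j c 1 p N0) => //.
- by rewrite /Lc eqxx.
- move=> N al NN N1 hal; rewrite powRr1// dE.
  have NR : 1 <= N%:R :> R by rewrite ler1n.
  have [hj _] := hal j; have {}hj := hj isT; rewrite /Lc eqxx mul1n in hj.
  have [hi _] := hal i; have {}hi := hi isT; rewrite /Lc (negbTE ij) in hi.
  have /andP[hj1 hj2] := hj; have /andP[hi1 _] := hi.
  have bj := b0 j; have bi := b0 i.
  apply: hc => //.
  + have := T_box N1 hal; rewrite /K; nra.
  + apply: le_trans (T_ge j al); rewrite -ler_pdivrMr//.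
    by apply: le_trans hN0 _; rewrite ler_nat (leq_trans NN)// ltnW.
  + have h1 : L%:R * N%:R * b i <= T al.
      by apply: le_trans (T_ge i al); rewrite ler_pM2r// -natrM ler_nat ltnW.
    have h2 : (al j).+1%:R <= 2 * N%:R :> R by rewrite -natrM ler_nat.
    have h3 : 4 * (2 * b j + 1) <= L%:R * b i by rewrite -ler_pdivrMr.
    have h4 : 4 * (2 * b j + 1) * N%:R <= T al.
      by apply: le_trans h1; rewrite [leRHS]mulrAC ler_pM2r//; lra.
    have h5 : (al j).+1%:R * b j <= 2 * N%:R * b j by rewrite ler_pM2r.
    by move: h4 h5; move: ((al j).+1%:R * b j) => x; nra.
- by rewrite mul1r cardT size_enum_ord.
Qed.

(** With [al j = 0] the gap is a single weight of order N^(- b_j), and N^(m - 1) indices remain in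
    the box. *)
Lemma unbounded_face : (1 < m)%N -> b j * p <= m%:R - 1 -> ~ bounded_sums.
Proof.
move=> m1 pm.
have [i ij] := ex_neq m1.
pose K := \sum_k 2 * b k + b j + 1.
have S0 : 0 <= \sum_k 2 * b k by apply: sumr_ge0 => k _; rewrite mulr_ge0// ltW.
have K0 : 0 < K by rewrite /K; have := b0 j; lra.
have [c c0 hc] := weight_gap0_lb G_gt0 G_rec G_convex (b0 j) K0.
apply: (@box_diverge _ _ _ (predC1 j) (fun=> 1%N) i c (b j) p 0) => //.
- move=> N al _ N1 hal; rewrite dE.
  have NR : 1 <= N%:R :> R by rewrite ler1n.
  have [_ hj] := hal j; have -> : al j = 0%N by apply: hj; rewrite /= eqxx.
  apply: hc => //.
    by apply: lt_le_trans (T_ge j al); rewrite mulr_gt0.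
  have := T_box N1 hal; have := b0 j; rewrite /K.
  by move: (\sum_k _) S0 => S S0; nra.
- by rewrite cardC1 card_ord -subn1 natrB// ltnW.
Qed.

End degree_divergence.

Lemma unbounded1 (R : realType) (d : {ffun 'I_1 -> nat} -> R) (p : R) :
  0 < p -> p <= 1 / 2 ->
  (forall al, d al = ((al ord0).+1%:R * (al ord0).+2%:R)^-1) ->
  ~ exists M, forall r : seq {ffun 'I_1 -> nat}, uniq r -> \sum_(al <- r) d al `^ p <= M.
Proof.
move=> p0 p1 dE.
(* For N <= n < 2N one has (n + 1)(n + 2) <= 2N * 3N, hence the constant 1/6 and the exponent 2. *)
apply: (@box_diverge _ _ _ predT (fun=> 1%N) ord0 6^-1 2 p 0) => //.
- by move=> al; rewrite dE invr_ge0 mulr_ge0.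
- move=> N al _ N0 /(_ ord0)[/(_ isT)/andP[_ h] _]; rewrite dE powR_mulrn// -invfM.
  rewrite lef_pV2 ?posrE ?mulr_gt0 ?exprn_gt0 ?ltr0n//.
  rewrite -natrM -natrX -natrM ler_nat; nia.
- by rewrite cardT size_enum_ord; lra.
Qed.

(** * Summability of the commutators on an ellipsoid *)

Section ellipsoid_summability.
Context (R : realType) (m : nat) (a : 'I_m -> R).
Hypothesis a0 : forall j, 0 < a j.
Variable p : R.
Hypothesis p0 : 0 < p.
Local Notation C := (Cplx R).
Local Notation I := {ffun 'I_m -> nat}.
Local Notation O := (ellipsoid a : set 'rV[C]_m).
Local Notation H := (bergman_space O).
Local Notation ip := (bergman_ip O).
Local Notation om := (mono_weight a).
Local Notation G := (@Pi R).
Local Notation K j k := (commutator (coord_mul j) (adjoint H ip (coord_mul k))).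
Local Notation bounded_sums d :=
  (exists M, forall r : seq I, uniq r -> \sum_(al <- r) d al `^ p <= M).
Implicit Types (j k : 'I_m) (al : I).

Let b j := (a j)^-1.
Let T al := tdeg a al.
Let b0 j : 0 < b j. Proof. by rewrite invr_gt0. Qed.
Let TE al : T al = \sum_i (al i).+1%:R * b i. Proof. by []. Qed.
Let G0 := @Pi_gt0 R.
Let Gr := @Pi_rec R.
Let Gc := @ln_Pi_convex R.
Let T_inc j al : T (inc j al) = T al + b j := tdeg_inc a j al.
Let T_ge j al : (al j).+1%:R * b j <= T al := tdeg_ge a0 j al.
Let om_inc j al : om (inc j al) / om al = weight_num G (b j) (al j) / Qr G (b j) (T al) :=
  mono_weight_inc a0 j al.

Lemma diag_commutator_summable j :
  summable_operator H ip p (K j j) <-> bounded_sums (wdiff om j).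
Proof.
have mD := ellipsoid_measurable a; have Oo := @ellipsoid_open R m a a0.
have Os := @ellipsoid_solid R m a a0; have O1 := @ellipsoid_le1 R m a a0.
have og := mono_weight_gt0 a0; have I2m := I2_mono_ellipsoid a0.
have hb := nmono_basis mD Oo Os og I2m.
have bK := comm_bounded mD Oo O1 j j.
have w0 al := wdiff_ge0 G0 Gr Gc b0 T_inc T_ge og om_inc j al.
have sq al := comm_diag_sq mD Oo Os O1 og I2m j al.
have sq' al : K j j (adjoint H ip (K j j) (nmono O om al)) = ofR (wdiff om j al ^+ 2) *: nmono O om al.
  by rewrite sq ger0_norm.
split=> [|[M hM]].
  exact: (diag_summable (bergman_hilbert mD Oo) hb bK w0 sq' p0).
exact: (summable_diag hb bK w0 sq' hM).
Qed.

Lemma off_commutator_summable j k : j != k -> (m%:R < p) ->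
  summable_operator H ip p (K j k).
Proof.
move=> jk mp.
have mD := ellipsoid_measurable a; have Oo := @ellipsoid_open R m a a0.
have Os := @ellipsoid_solid R m a a0; have O1 := @ellipsoid_le1 R m a a0.
have og := mono_weight_gt0 a0; have I2m := I2_mono_ellipsoid a0.
have hb := nmono_basis mD Oo Os og I2m.
have bK := comm_bounded mD Oo O1 j k.
have sq al := comm_off_sq mD Oo Os O1 og I2m al jk.
have [c c0 hc] := koff_le G0 Gr Gc b0 T_inc T_ge og om_inc jk.
have m0 : (0 < m)%N by case: (j) => i; exact: leq_trans.
have d0 al : 0 <= `|koff om j k al| by [].
have [M hM] := summable_degree_inv b0 TE d0 c0 p0 mp m0 hc.
exact: (summable_diag hb bK d0 sq hM).
Qed.

Lemma diag_commutator_summable_gt j : (1 < m)%N ->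
  summable_operator H ip p (K j j) <-> m%:R < p /\ a j * (m%:R - 1) < p.
Proof.
move=> m1; have og := mono_weight_gt0 a0.
have w0 al := wdiff_ge0 G0 Gr Gc b0 T_inc T_ge og om_inc j al.
have wE al := wdiffE T_inc og om_inc j al.
have pb : (m%:R - 1 < p * b j) = (a j * (m%:R - 1) < p).
  by rewrite /b ltr_pdivlMr// mulrC.
rewrite diag_commutator_summable; split=> [bs|[mp pa]].
  split; rewrite ltNge; apply/negP => h.
    exact: (unbounded_diag G0 Gr Gc b0 TE w0 wE p0 m1 h bs).
  apply: (unbounded_face G0 Gr Gc b0 TE w0 wE p0 m1 _ bs).
  by rewrite mulrC /b ler_pdivrMr// mulrC.
have [c c0 hc] := weight_gap_le G0 Gr Gc (b0 j).
apply: (summable_degree_diag b0 TE w0 c0 p0 mp m1 (j := j)) => [|al]; first by rewrite pb.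
by rewrite wE; apply: hc; exact: T_ge.
Qed.

End ellipsoid_summability.

Lemma diag_commutator_summable1 (R : realType) (a : 'I_1 -> R) (p : R) :
  (forall j, 0 < a j) -> 0 < p ->
  summable_operator (bergman_space (ellipsoid a)) (bergman_ip (ellipsoid a)) p
    (commutator (coord_mul ord0)
      (adjoint (bergman_space (ellipsoid a)) (bergman_ip (ellipsoid a)) (coord_mul ord0)))
  <-> 1 / 2 < p.
Proof.
move=> a0 p0.
have wE al : wdiff (mono_weight a) ord0 al = ((al ord0).+1%:R * (al ord0).+2%:R)^-1.
  have w := wdiffE (tdeg_inc a) (mono_weight_gt0 a0) (mono_weight_inc a0) ord0 al.
  rewrite w /tdeg big_ord1; apply: (weight_gap_disc (@Pi_gt0 R)).
  by rewrite invr_gt0.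
rewrite (diag_commutator_summable a0 p0); split=> [bs|hp].
  by rewrite ltNge; apply/negP => h; exact: (unbounded1 p0 h wE bs).
exact: summable_degree1 hp wE.
Qed.

Theorem theorem1 (R : realType) (m : nat) (hm : (1 <= m)%N)
    (a : 'I_m -> R) (ha : forall j : 'I_m, 0 < a j) (p : R) (hp : 0 < p) :
  essentially_normal p (ellipsoid a) <->
  (if m == 1%N then 1 / 2 else \big[Num.max/m%:R]_(j < m) (a j * (m%:R - 1)))
    < p.
Proof.
case: eqP => [m1|/eqP m1].
  subst m; rewrite -(diag_commutator_summable1 ha hp); split=> [h|h]; first exact: h.
  by move=> j k; rewrite !ord1.
have {}m1 : (1 < m)%N by rewrite ltn_neqAle eq_sym m1.
split=> [h|/bigmax_ltP[mp ap]]; last move=> j k.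
  (* The diagonal commutators alone give every condition: each j yields its own bound on a_j, and
     any one of them yields m < p. *)
  have d j := (diag_commutator_summable_gt ha hp j m1).1 (h j j).
  apply/bigmax_ltP; split=> [|j _]; last exact: (d j).2.
  exact: (d (Ordinal hm)).1.
case: (eqVneq j k) => [->|jk]; last exact: off_commutator_summable.
apply/(diag_commutator_summable_gt ha hp k m1); split=> //.
exact: ap.
Qed.
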